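(* Let $\alpha>0$, $\beta>0$, and let $\gamma_0,\gamma_1$ be constants with $\gamma_0\sqrt{\alpha}\neq\gamma_1$. Assume that $u_0\in\mathcal{S}([0,\infty))$, $\zeta\in C^\infty([0,\infty))$, and $f\in C^\infty(\overline{\mathbb{R}^+\times\mathbb{R}^+})$ is such that for every $T>0$ and all nonnegative integers $n,m,\ell$, $$\sup\left\{x^\ell\left|\frac{\partial^{n+m}f(x,t)}{\partial x^n\partial t^m}\right| : x>0,\ 0\le t\le T\right\}<\infty .$$ For $x>0$ and $t>0$ define $$\begin{aligned}u(x,t)=&\ \frac{1}{2\pi}\int_{-\infty}^{\infty}\hat{u}_0(\lambda)e^{i\lambda x-\omega(\lambda)t}\,d\lambda-\frac{1}{2\pi}\int_{\mathcal{K}}\hat{u}_0(-\lambda)\frac{\gamma_0-i\gamma_1\lambda}{\gamma_0+i\gamma_1\lambda}e^{i\lambda x-\omega(\lambda)t}\,d\lambda\\&-\frac{i}{\pi}\int_{\mathcal{K}}\frac{e^{i\lambda x-\omega(\lambda)t}}{(1+\alpha\lambda^2)(i\gamma_1\lambda+\gamma_0)}\lambda\,\tilde{\zeta}(\lambda,t)\,d\lambda\\&+\frac{1}{2\pi}\int_{-\infty}^{\infty}\frac{e^{i\lambda x-\omega(\lambda)t}}{1+\alpha\lambda^2}F(\lambda,t)\,d\lambda-\frac{1}{2\pi}\int_{\mathcal{K}}\frac{e^{i\lambda x-\omega(\lambda)t}}{1+\alpha\lambda^2}\frac{\gamma_0-i\gamma_1\lambda}{\gamma_0+i\gamma_1\lambda}F(-\lambda,t)\,d\lambda,\end{aligned}$$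 where $\omega,\hat u_0,\tilde\zeta,F,\mathcal{K}$ are as defined in the context. Then $u$ satisfies the following. (1) The limits $$U_{n,m}(x):=\lim_{t\to0^+}\frac{\partial^{n+m}u(x,t)}{\partial x^n\partial t^m},\quad n,m=0,1,2,\dots,$$ exist and are uniform for $x>0$. Moreover the functions $U_{n,m}(x)$ are $C^\infty$ for $x\in\mathbb{R}^+$. (2) The limits $$H_{n,m}(t):=\lim_{x\to0^+}\frac{\partial^{n+m}u(x,t)}{\partial x^n\partial t^m},\quad n,m=0,1,2,\dots,$$ exist and are uniform for $0<t\le T$ (for every $T>0$). Moreover the functions $H_{n,m}(t)$ are $C^\infty$ for $t\in\mathbb{R}^+$. (3) For every $n=0,1,2,\dots$, $$\lim_{t\to0^+}\frac{\partial^n u(x,t)}{\partial x^n}=\frac{d^n u_0(x)}{dx^n},\quad\text{uniformly for } x>0.$$ (4) For every $m=0,1,2,\dots$ and every $T>0$, $$\lim_{x\to0^+}\left\{\gamma_0\left[\alpha\frac{\partial^{m+1}u(x,t)}{\partial t^{m+1}}+\beta\frac{\partial^m u(x,t)}{\partial t^m}\right]+\gamma_1\left[\alpha\frac{\partial^{m+2}u(x,t)}{\partial t^{m+1}\partial x}+\beta\frac{\partial^{m+1}u(x,t)}{\partial t^m\partial x}\right]\right\}=\frac{d^m\zeta(t)}{dt^m},$$ uniformly for $0<t\le T$.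
   Context: $\mathbb{R}^+=(0,\infty)$. $\mathcal{S}([0,\infty))$ is the space of functions $g\in C^\infty([0,\infty))$ with $\sup_{x\ge0}x^\ell|g^{(n)}(x)|<\infty$ for all nonnegative integers $n,\ell$. $C^\infty(\overline{\mathbb{R}^+\times\mathbb{R}^+})$ denotes functions smooth up to the boundary on $[0,\infty)\times[0,\infty)$. Notation: $$\omega(\lambda)=\frac{\beta\lambda^2}{1+\alpha\lambda^2},\qquad \hat u_0(\lambda)=\int_0^\infty e^{-i\lambda x}u_0(x)\,dx\quad(\operatorname{Im}\lambda\le0),$$ $$\tilde\zeta(\lambda,t)=\int_0^t e^{\omega(\lambda)\tau}\zeta(\tau)\,d\tau,\qquad \hat f(\lambda,t)=\int_0^\infty e^{-i\lambda x}f(x,t)\,dx\quad(\operatorname{Im}\lambda\le0),$$ $$F(\lambda,t)=\int_0^t e^{\omega(\lambda)\tau}\hat f(\lambda,\tau)\,d\tau\quad(\operatorname{Im}\lambda\le0).$$ Note that $\omega(-\lambda)=\omega(\lambda)$. $\mathcal{K}$ is a sufficiently small simple closed curve surrounding the point $i/\sqrt{\alpha}$, traversed counterclockwise: it lies, together with its interior, in $\{\operatorname{Im}\lambda>0\}$, and, if $\gamma_1\ne0$, the point $i\gamma_0/\gamma_1$ lies neither on $\mathcal{K}$ nor inside it. The integral $\int_{-\infty}^\infty\hat u_0(\lambda)e^{i\lambda x-\omega(\lambda)t}d\lambda$ is in general only conditionally convergent and is understood as an improper integral. *)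

(* Defs.v *)
From Stdlib Require Export Reals.
From Coquelicot Require Export Coquelicot.
Open Scope R_scope.

Definition Cexp (z : C) : C := (exp (Re z) * cos (Im z), exp (Re z) * sin (Im z)).

Definition CRInt (g : R -> C) (a b : R) : C :=
  RInt (V := C_R_CompleteNormedModule) g a b.

(* Improper integral over the line: the two endpoints go to infinity
   independently of one another. *)
Definition CRInt_line (g : R -> C) : C :=
  RInt_gen (V := C_R_CompleteNormedModule) g (Rbar_locally m_infty) (Rbar_locally p_infty).

Definition CRInt_halfline (g : R -> C) : C :=
  RInt_gen (V := C_R_CompleteNormedModule) g (at_point 0) (Rbar_locally p_infty).

Definition has_deriv (g : R -> C) (x : R) (l : C) : Prop :=
  is_derive (K := R_AbsRing) (V := C_R_NormedModule) g x l.

(* [g] is smooth on the open set [O], its derivatives extend continuously to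
   [D] (where [O] is contained in [D], and [D] in the closure of [O]), and
   [dg n] is the n-th derivative of [g] on [D].  The values of [g] and [dg]
   outside [D] are irrelevant. *)
Definition derivs1 (O D : R -> Prop) (g : R -> C) (dg : nat -> R -> C) : Prop :=
  (forall x, D x -> dg 0%nat x = g x) /\
  (forall n, continuous_on (T := R_UniformSpace) (U := C_UniformSpace) D (dg n)) /\
  (forall n x, O x -> has_deriv (dg n) x (dg (S n) x)).

(* The same in two variables: [dg n m] is the partial derivative of order [n]
   in the first variable and [m] in the second one. *)
Definition derivs2 (O D : R * R -> Prop) (g : R -> R -> C)
    (dg : nat -> nat -> R -> R -> C) : Prop :=
  (forall x t, D (x, t) -> dg 0%nat 0%nat x t = g x t) /\
  (forall n m, continuous_on (T := prod_UniformSpace R_UniformSpace R_UniformSpace)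
                 (U := C_UniformSpace) D (fun p => dg n m (fst p) (snd p))) /\
  (forall n m x t, O (x, t) ->
     has_deriv (fun y => dg n m y t) x (dg (S n) m x t) /\
     has_deriv (fun s => dg n m x s) t (dg n (S m) x t)).

Definition pos (x : R) : Prop := 0 < x.
Definition nonneg (x : R) : Prop := 0 <= x.
Definition open_quadrant (p : R * R) : Prop := 0 < fst p /\ 0 < snd p.
Definition closed_quadrant (p : R * R) : Prop := 0 <= fst p /\ 0 <= snd p.

Definition smooth_on_pos (g : R -> C) : Prop := exists dg, derivs1 pos pos g dg.

(* [g] belongs to S([0,oo)), with derivatives [dg]. *)
Definition Schwartz_halfline (g : R -> C) (dg : nat -> R -> C) : Prop :=
  derivs1 pos nonneg g dg /\
  forall n l : nat, exists M : R, forall x, 0 <= x -> x ^ l * Cmod (dg n x) <= M.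

(* g(s, y) -> l(y) as s -> 0+, uniformly for y in A. *)
Definition unif_lim_0plus (g : R -> R -> C) (A : R -> Prop) (l : R -> C) : Prop :=
  forall eps : posreal,
    at_right 0 (fun s => forall y, A y -> Cmod (g s y - l y)%C < eps).

Definition on_curve (K : R -> C) (z : C) : Prop := exists s, 0 <= s <= 1 /\ K s = z.

(* On each closed piece the curve is the restriction of a C^1 function. *)
Definition piecewise_C1 (K : R -> C) : Prop :=
  exists (n : nat) (s : nat -> R),
    s 0%nat = 0 /\ s n = 1 /\
    forall i, (i < n)%nat ->
      s i < s (S i) /\
      exists g dg : R -> C,
        (forall r, has_deriv g r (dg r) /\
                   continuous (T := R_UniformSpace) (U := C_UniformSpace) dg r) /\
        (forall r, s i <= r <= s (S i) -> K r = g r).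

Definition simple_closed_curve (K : R -> C) : Prop :=
  piecewise_C1 K /\ K 0 = K 1 /\
  forall r s, 0 <= r -> r < s -> s <= 1 -> K r = K s -> r = 0 /\ s = 1.

(* For a piecewise C^1 curve, the value of [Derive] at the finitely many
   corners and at the endpoints is irrelevant to the integral. *)
Definition contour_int (K : R -> C) (g : C -> C) : C :=
  CRInt (fun s => (g (K s) *
                   (Derive (fun r => Re (K r)) s, Derive (fun r => Im (K r)) s))%C) 0 1.

(* [z] and [w] are in the same component of the complement of the curve. *)
Definition joined_off (K : R -> C) (z w : C) : Prop :=
  exists p : R -> C,
    continuous_on (T := R_UniformSpace) (U := C_UniformSpace) (fun s => 0 <= s <= 1) p /\
    p 0 = z /\ p 1 = w /\ forall s, 0 <= s <= 1 -> ~ on_curve K (p s).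

(* [z] is in a bounded component of the complement of the curve. *)
Definition inside (K : R -> C) (z : C) : Prop :=
  ~ on_curve K z /\ exists M : R, forall w, joined_off K z w -> Cmod w <= M.

Definition winding_number (K : R -> C) (z : C) : C :=
  (/ (2 * PI * Ci) * contour_int K (fun w => / (w - z)))%C.

Definition counterclockwise (K : R -> C) : Prop :=
  forall z, inside K z -> winding_number K z = RtoC 1.

Definition admissible_contour (alpha : R) (gamma0 gamma1 : C) (K : R -> C) : Prop :=
  simple_closed_curve K /\ counterclockwise K /\
  inside K (Ci / sqrt alpha)%C /\
  (forall z, on_curve K z \/ inside K z -> 0 < Im z) /\
  (gamma1 <> RtoC 0 ->
     ~ on_curve K (Ci * gamma0 / gamma1)%C /\ ~ inside K (Ci * gamma0 / gamma1)%C).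

Definition omega (alpha beta : R) (lam : C) : C :=
  (beta * (lam * lam) / (1 + alpha * (lam * lam)))%C.

(* \hat g, to be used for Im lam <= 0. *)
Definition hat (g : R -> C) (lam : C) : C :=
  CRInt_halfline (fun x => (Cexp (- (Ci * lam * x)) * g x)%C).

Definition zeta_tilde (alpha beta : R) (zeta : R -> C) (lam : C) (t : R) : C :=
  CRInt (fun tau => (Cexp (omega alpha beta lam * tau) * zeta tau)%C) 0 t.

Definition Fhat (alpha beta : R) (f : R -> R -> C) (lam : C) (t : R) : C :=
  CRInt (fun tau => (Cexp (omega alpha beta lam * tau) * hat (fun x => f x tau) lam)%C) 0 t.

Definition sol (alpha beta : R) (gamma0 gamma1 : C) (u0 zeta : R -> C)
    (f : R -> R -> C) (K : R -> C) (x t : R) : C :=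
  let E (lam : C) : C := Cexp (Ci * lam * x - omega alpha beta lam * t)%C in
  let d (lam : C) : C := (1 + alpha * (lam * lam))%C in
  let q (lam : C) : C :=
    ((gamma0 - Ci * gamma1 * lam) / (gamma0 + Ci * gamma1 * lam))%C in
  (/ (2 * PI) * CRInt_line (fun lam => hat u0 lam * E lam)
   - / (2 * PI) * contour_int K (fun lam => hat u0 (- lam) * q lam * E lam)
   - Ci / PI * contour_int K (fun lam =>
       E lam / (d lam * (Ci * gamma1 * lam + gamma0))
       * lam * zeta_tilde alpha beta zeta lam t)
   + / (2 * PI) * CRInt_line (fun lam => E lam / d lam * Fhat alpha beta f lam t)
   - / (2 * PI) * contour_int K (fun lam =>
       E lam / d lam * q lam * Fhat alpha beta f (- lam) t))%C.

(* Main.v *)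
From Stdlib Require Import Lra Lia Psatz Classical FunctionalExtensionality.
Require Import Defs.

(** Write [b = beta / alpha] and [den z = 1 + alpha z^2], so that [omega = b - b / den].  The solution is first put in the form
<<
  u(x,t) = e^{-bt} u0(x) + (integral over K of a density in z depending on x and t),
>>
    and everything is read off from the density, because the contour is compact, stays away from the real axis and from all the
    poles, and so makes every estimate uniform up to [x = 0] and [t = 0].

    From the line to the contour.  On the real axis [e^{-omega t}] tends to [e^{-bt}] at infinity; this constant is what makes the
    first line integral only conditionally convergent, and Fourier inversion ([inversion]) turns it into [e^{-bt} u0(x)].  The
    difference is a contour integral by residues ([L_multiplier]):
<<
  e^{-omega(mu) t} - e^{-bt} = 1/(2 pi) . int_K e^{-omega(z) t} 2iz / (z^2 - mu^2) dz,
>>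
    and as a Fourier multiplier [2iz / (z^2 - mu^2)] is convolution with [e^{iz|x|}], so that the line integral against the datum
    becomes an integral over [K] of [e^{-omega(z) t}] times the resolvent [int g(y) e^{iz|x-y|} dy] ([line_to_contour]).  The
    forcing term is treated in the same way at each time ([line_forcing]).  The other integrals over [K] add the reflection of that
    resolvent at the wall and the wave sent by the boundary datum; this is [sol_is_jet].

    Smoothness.  Cutting the resolvent at [y = x] leaves an integral of Duhamel type over [(0,x)] and a Laplace type integral over
    [(x,infinity)]; the time integral of the density is again of Duhamel type.  Such operations preserve the families of functions
    [G n m] in which [G (n+1) m] and [G n (m+1)] are first-order Taylor coefficients of [G n m], uniformly on the closed quadrant
    ([tame]), and so does integration over the contour.  Applied to the density this gives a whole jet [sol_jet] of the solution
    ([tame_sol_jet]), and the uniform limits at [t = 0] and [x = 0], with their smoothness, are its values there.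

    The data.  At [t = 0] the density is a superposition of [e^{izs}] and of the reflection coefficient times [e^{izs}], with
    [s >= 0], which are holomorphic inside [K], so the integral vanishes and [u = u0] ([sol_jet_initial]).  At the wall, the
    reflected waves are annihilated by the Robin operator, [alpha d/dt + beta] acts on the density as multiplication by
    [beta / den] plus [alpha] times its source, and only terms in the boundary datum remain: [z / den], whose residue reproduces
    [zeta(t)], and [z / den^2 e^{-omega (t - r)}], whose integral is zero ([wall_0]).  The statements on derivatives follow since
    two sequences of successive derivatives agree as soon as their first terms do ([jets_unique]).

    Residues without Cauchy's theorem.  All the integrands are combinations of [e^{r psi} psi' / psi] and [e^{r psi} psi'], with [psi]
    affine or affine in [1 / den].  The second is exact, hence the first does not depend on [r] ([exp_log_deriv]), and [r = 0]
    leaves winding numbers.  These are locally constant because [1 / (w - z)^2] has a primitive, and vanish outside the curve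
    because there the point can be moved arbitrarily far away ([wind_outside]). *)

Open Scope R_scope.

Notation cont := (continuous (T := R_UniformSpace) (U := C_UniformSpace)).

(** * Complex-valued functions of a real variable *)

Lemma has_deriv_pair : forall g x l, has_deriv g x l <->
  is_derive (fun y => Re (g y)) x (Re l) /\ is_derive (fun y => Im (g y)) x (Im l).
Proof.
intros g x l; split.
- intros H; split.
  + apply (filterdiff_comp' g (fun z : prod_NormedModule R_AbsRing R_NormedModule R_NormedModule => fst z) x _ (fun z => fst z)) in H.
    2: apply filterdiff_linear, is_linear_fst.
    exact H.
  + apply (filterdiff_comp' g (fun z : prod_NormedModule R_AbsRing R_NormedModule R_NormedModule => snd z) x _ (fun z => snd z)) in H.
    2: apply filterdiff_linear, is_linear_snd.
    exact H.
- intros [H1 H2].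
  assert (H := filterdiff_comp'_2 (fun y => Re (g y)) (fun y => Im (g y))
    (fun a b => (a, b)) x _ _ (fun a b => (a, b)) H1 H2).
  unfold has_deriv, is_derive.
  eapply filterdiff_ext_lin.
  + eapply filterdiff_ext.
    2: { apply H. eapply filterdiff_ext_lin.
         - eapply filterdiff_ext. 2: apply filterdiff_id. intros [a b]; reflexivity.
         - intros [a b]; reflexivity. }
    intros y; simpl; now destruct (g y).
  + intros y; simpl; reflexivity.
Qed.

Lemma norm_Cmod : forall z : C, norm (V := C_R_NormedModule) z = Cmod z.
Proof.
intros z. change (sqrt (Rabs (fst z) ^ 2 + Rabs (snd z) ^ 2) = Cmod z).
unfold Cmod. rewrite !pow2_abs. reflexivity.
Qed.

Lemma scal_C : forall (a : R) (z : C), scal (V := C_R_NormedModule) a z = (a * z)%C.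
Proof. intros a [x y]. apply injective_projections; simpl; unfold scal; simpl; unfold mult; simpl; ring. Qed.

Lemma im_le_Cmod : forall z : C, Rabs (Im z) <= Cmod z.
Proof.
intros z. generalize (Rmax_Cmod z); intros H.
eapply Rle_trans; [ apply (Rmax_r (Rabs (fst z))) | exact H ].
Qed.

Lemma Cmod_le_sum : forall z : C, Cmod z <= Rabs (Re z) + Rabs (Im z).
Proof.
intros [a b].
assert (E : ((a, b) : C) = (RtoC a + Ci * RtoC b)%C) by (apply injective_projections; simpl; ring).
change (Cmod (a, b) <= Rabs a + Rabs b). rewrite E.
eapply Rle_trans; [apply Cmod_triangle|].
rewrite Cmod_mult, Cmod_Ci, !Cmod_R, Rmult_1_l. apply Rle_refl.
Qed.

Lemma cont_eps : forall g x, cont g x <->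
  forall eps, 0 < eps -> exists d, 0 < d /\ forall y, Rabs (y - x) < d -> Cmod (g y - g x) < eps.
Proof.
intros g x; split.
- intros H eps He.
  assert (H1 : locally x (fun y => ball_norm (V := C_R_NormedModule) (g x) (mkposreal eps He) (g y))).
  { apply H. apply (locally_ball_norm (V := C_R_NormedModule)). }
  destruct H1 as [d Hd]. exists d. split; [apply cond_pos|].
  intros y Hy. specialize (Hd y Hy). unfold ball_norm in Hd.
  rewrite norm_Cmod in Hd. exact Hd.
- intros H P HP.
  apply (locally_norm_le_locally (V := C_R_NormedModule) (g x) P) in HP.
  destruct HP as [e He]. destruct (H e (cond_pos e)) as (d & Hd & Hy).
  exists (mkposreal d Hd). intros y By. apply He.
  unfold ball_norm. rewrite norm_Cmod. apply Hy. exact By.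
Qed.

Lemma cont_pair : forall g x, cont g x <->
  continuous (fun y => Re (g y)) x /\ continuous (fun y => Im (g y)) x.
Proof.
intros g x; split.
- intros H. split.
  + apply (continuous_comp g (fun z : C_UniformSpace => fst z)); [exact H|].
    destruct (g x) as [a b]. apply continuous_fst.
  + apply (continuous_comp g (fun z : C_UniformSpace => snd z)); [exact H|].
    destruct (g x) as [a b]. apply continuous_snd.
- intros [H1 H2]. apply cont_eps. intros eps He.
  assert (He2 : 0 < eps / 2) by lra.
  destruct (H1 _ (locally_ball (Re (g x)) (mkposreal _ He2))) as [d1 Hd1].
  destruct (H2 _ (locally_ball (Im (g x)) (mkposreal _ He2))) as [d2 Hd2].
  exists (Rmin d1 d2). split; [apply Rmin_glb_lt; apply cond_pos|].
  intros y Hy.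
  assert (B1 := Hd1 y (Rlt_le_trans _ _ _ Hy (Rmin_l _ _))).
  assert (B2 := Hd2 y (Rlt_le_trans _ _ _ Hy (Rmin_r _ _))).
  change (Rabs (Re (g y) - Re (g x)) < eps / 2) in B1.
  change (Rabs (Im (g y) - Im (g x)) < eps / 2) in B2.
  eapply Rle_lt_trans; [apply Cmod_le_sum|].
  change (Rabs (Re (g y) - Re (g x)) + Rabs (Im (g y) - Im (g x)) < eps). lra.
Qed.

Lemma cont_const : forall (c : C) x, cont (fun _ => c) x.
Proof. intros; apply continuous_const. Qed.

Lemma cont_plus : forall (f g : R -> C) x, cont f x -> cont g x -> cont (fun y => f y + g y)%C x.
Proof. intros f g x Hf Hg. apply (continuous_plus (V := C_R_NormedModule) f g x Hf Hg). Qed.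

Lemma cont_opp : forall (f : R -> C) x, cont f x -> cont (fun y => - f y)%C x.
Proof. intros f x Hf. apply (continuous_opp (V := C_R_NormedModule) f x Hf). Qed.

Lemma cont_minus : forall (f g : R -> C) x, cont f x -> cont g x -> cont (fun y => f y - g y)%C x.
Proof. intros f g x Hf Hg. apply cont_plus; [exact Hf | apply cont_opp, Hg]. Qed.

Lemma cont_mult : forall (f g : R -> C) x, cont f x -> cont g x -> cont (fun y => f y * g y)%C x.
Proof.
intros f g x Hf Hg. apply cont_pair in Hf. apply cont_pair in Hg.
destruct Hf as [f1 f2], Hg as [g1 g2]. apply cont_pair; simpl. split.
- apply (continuous_minus (V := R_NormedModule)); apply (continuous_mult (K := R_AbsRing)); assumption.
- apply (continuous_plus (V := R_NormedModule)); apply (continuous_mult (K := R_AbsRing)); assumption.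
Qed.

Lemma cont_RtoC : forall (f : R -> R) x, continuous f x -> cont (fun y => RtoC (f y)) x.
Proof. intros f x H. apply cont_pair. simpl. split; [exact H | apply continuous_const]. Qed.

Lemma continuousR_ext : forall (f g : R -> R) (x : R), (forall y, f y = g y) -> continuous f x -> continuous g x.
Proof. intros f g x H Hf. apply (continuous_ext f g x H Hf). Qed.

Lemma Cnz_sq : forall z : C, z <> 0%C -> Re z * Re z + Im z * Im z <> 0.
Proof.
intros [a b] Hz H. simpl in H. apply Hz.
assert (a = 0) by nra. assert (b = 0) by nra. subst. reflexivity.
Qed.

Lemma cont_inv : forall (f : R -> C) x, cont f x -> f x <> 0%C -> cont (fun y => / f y)%C x.
Proof.
intros f x Hf Hz. apply cont_pair in Hf. destruct Hf as [f1 f2].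
assert (Hs := Cnz_sq _ Hz).
assert (Hd : continuous (fun y => fst (f y) ^ 2 + snd (f y) ^ 2) x).
{ apply (continuous_plus (V := R_NormedModule)).
  - apply (continuousR_ext (fun y => Re (f y) * Re (f y))); [intros; unfold Re; ring|].
    apply (continuous_mult (K := R_AbsRing)); exact f1.
  - apply (continuousR_ext (fun y => Im (f y) * Im (f y))); [intros; unfold Im; ring|].
    apply (continuous_mult (K := R_AbsRing)); exact f2. }
assert (Hn : fst (f x) ^ 2 + snd (f x) ^ 2 <> 0) by (unfold Re, Im in Hs; simpl; lra).
assert (Hi := continuous_Rinv_comp _ _ Hd Hn).
apply cont_pair; simpl. split.
- apply (continuous_mult (K := R_AbsRing)); [exact f1|exact Hi].
- apply (continuous_mult (K := R_AbsRing)); [|exact Hi].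
  apply (continuous_opp (V := R_NormedModule)). exact f2.
Qed.

Lemma cont_div : forall (f g : R -> C) x, cont f x -> cont g x -> g x <> 0%C -> cont (fun y => f y / g y)%C x.
Proof. intros. apply cont_mult; [|apply cont_inv]; assumption. Qed.

Lemma cont_Cexp : forall (f : R -> C) x, cont f x -> cont (fun y => Cexp (f y)) x.
Proof.
intros f x Hf. apply cont_pair in Hf. destruct Hf as [f1 f2]. apply cont_pair. unfold Cexp; simpl. split;
apply (continuous_mult (K := R_AbsRing)).
- apply (continuous_comp _ exp); [exact f1 | apply continuous_exp].
- apply (continuous_comp _ cos); [exact f2 | apply continuous_cos].
- apply (continuous_comp _ exp); [exact f1 | apply continuous_exp].
- apply (continuous_comp _ sin); [exact f2 | apply continuous_sin].
Qed.

Lemma cont_Cmod : forall (f : R -> C) x, cont f x -> continuous (fun y => Cmod (f y)) x.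
Proof.
intros f x Hf.
apply (continuousR_ext (fun y => norm (V := C_R_NormedModule) (f y))); [intros; apply norm_Cmod|].
apply (continuous_comp f (norm (V := C_R_NormedModule))); [exact Hf|].
apply (filterlim_norm (V := C_R_NormedModule)).
Qed.

Lemma cont_ext : forall (f g : R -> C) x, (forall y, f y = g y) -> cont f x -> cont g x.
Proof. intros f g x H Hf. apply (continuous_ext f g x H Hf). Qed.

(** ** Derivatives *)

Lemma has_deriv_ext : forall f g x l, (forall y, f y = g y) -> has_deriv f x l -> has_deriv g x l.
Proof. intros f g x l H Hf. apply (is_derive_ext f g x l H Hf). Qed.

Lemma has_deriv_ext_loc : forall f g x l, locally x (fun y => f y = g y) -> has_deriv f x l -> has_deriv g x l.
Proof. intros f g x l H Hf. apply (is_derive_ext_loc f g x l H Hf). Qed.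

Lemma has_deriv_const : forall c x, has_deriv (fun _ => c) x 0%C.
Proof. intros c x. apply (is_derive_const (K := R_AbsRing) (V := C_R_NormedModule)). Qed.

Lemma has_deriv_plus : forall f g x l m, has_deriv f x l -> has_deriv g x m -> has_deriv (fun y => f y + g y)%C x (l + m)%C.
Proof. intros. apply (is_derive_plus (V := C_R_NormedModule)); assumption. Qed.

Lemma has_deriv_opp : forall f x l, has_deriv f x l -> has_deriv (fun y => - f y)%C x (- l)%C.
Proof. intros. apply (is_derive_opp (V := C_R_NormedModule)); assumption. Qed.

Lemma has_deriv_minus : forall f g x l m, has_deriv f x l -> has_deriv g x m -> has_deriv (fun y => f y - g y)%C x (l - m)%C.
Proof. intros. apply has_deriv_plus; [|apply has_deriv_opp]; assumption. Qed.

Lemma has_deriv_mult : forall f g x l m, has_deriv f x l -> has_deriv g x m ->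
  has_deriv (fun y => f y * g y)%C x (l * g x + f x * m)%C.
Proof.
intros f g x l m Hf Hg. apply has_deriv_pair in Hf. apply has_deriv_pair in Hg.
destruct Hf as [f1 f2], Hg as [g1 g2]. apply has_deriv_pair.
assert (P := fun a b da db (Ha : is_derive a x da) (Hb : is_derive b x db) =>
  is_derive_mult (K := R_AbsRing) a b x da db Ha Hb Rmult_comm).
split.
- assert (Q := is_derive_minus (V := R_NormedModule) _ _ _ _ _ (P _ _ _ _ f1 g1) (P _ _ _ _ f2 g2)).
  evar_last; [exact Q|]. unfold minus, plus, opp, mult; simpl. unfold plus, opp, mult; simpl. unfold Re, Im. ring.
- assert (Q := is_derive_plus (V := R_NormedModule) _ _ _ _ _ (P _ _ _ _ f1 g2) (P _ _ _ _ f2 g1)).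
  evar_last; [exact Q|]. unfold minus, plus, opp, mult; simpl. unfold plus, opp, mult; simpl. unfold Re, Im. ring.
Qed.

Lemma has_deriv_eq : forall f x l m, has_deriv f x l -> l = m -> has_deriv f x m.
Proof. intros; subst; assumption. Qed.

Lemma has_deriv_scal : forall c f x l, has_deriv f x l -> has_deriv (fun y => c * f y)%C x (c * l)%C.
Proof.
intros. eapply has_deriv_eq; [apply has_deriv_mult; [apply has_deriv_const|exact H]|cbv beta; ring].
Qed.

Lemma has_deriv_RtoC : forall (f : R -> R) x l, is_derive f x l -> has_deriv (fun y => RtoC (f y)) x (RtoC l).
Proof. intros f x l H. apply has_deriv_pair. simpl. split; [exact H | apply (is_derive_const (V := R_NormedModule))]. Qed.

Lemma has_deriv_id : forall x, has_deriv (fun y => RtoC y) x 1%C.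
Proof. intros x. apply (has_deriv_RtoC (fun y => y)). apply (is_derive_id (K := R_AbsRing)). Qed.

Lemma has_deriv_Cexp : forall f x l, has_deriv f x l -> has_deriv (fun y => Cexp (f y)) x (l * Cexp (f x))%C.
Proof.
intros f x l Hf. apply has_deriv_pair in Hf. destruct Hf as [f1 f2]. apply has_deriv_pair. unfold Cexp; simpl.
assert (P := fun a b da db (Ha : is_derive a x da) (Hb : is_derive b x db) =>
  is_derive_mult (K := R_AbsRing) a b x da db Ha Hb Rmult_comm).
assert (E := is_derive_comp exp _ _ _ _ (is_derive_exp _) f1).
split.
- assert (Q := P _ _ _ _ E (is_derive_comp cos _ _ _ _ (is_derive_cos _) f2)).
  evar_last; [exact Q|]. unfold plus, mult, scal; simpl. unfold plus, mult; simpl. unfold Re, Im, mult; simpl. ring.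
- assert (Q := P _ _ _ _ E (is_derive_comp sin _ _ _ _ (is_derive_sin _) f2)).
  evar_last; [exact Q|]. unfold plus, mult, scal; simpl. unfold plus, mult; simpl. unfold Re, Im, mult; simpl. ring.
Qed.

Lemma has_deriv_inv : forall f x l, has_deriv f x l -> f x <> 0%C -> has_deriv (fun y => / f y)%C x (- l / (f x * f x))%C.
Proof.
intros f x l Hf Hz. apply has_deriv_pair in Hf. destruct Hf as [f1 f2].
assert (Hs := Cnz_sq _ Hz).
assert (P := fun a b da db (Ha : is_derive a x da) (Hb : is_derive b x db) =>
  is_derive_mult (K := R_AbsRing) a b x da db Ha Hb Rmult_comm).
assert (Q := is_derive_plus (V := R_NormedModule) _ _ _ _ _ (P _ _ _ _ f1 f1) (P _ _ _ _ f2 f2)).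
assert (I := is_derive_inv _ _ _ Q Hs).
assert (Hn : fst (f x) ^ 2 + snd (f x) ^ 2 <> 0) by (unfold Re, Im in Hs; simpl; lra).
apply has_deriv_pair. split.
- apply (is_derive_ext (fun y => Re (f y) * / (Re (f y) * Re (f y) + Im (f y) * Im (f y)))).
  { intros y. unfold Cinv, Re, Im, Rdiv. cbn [fst snd].
    apply f_equal. apply f_equal. simpl; ring. }
  evar_last; [apply (P _ _ _ _ f1 I)|].
  destruct (f x) as [a b], l as [c d]. unfold plus, mult; simpl in *. unfold plus, mult; simpl in *. field.
  split; [|lra]. intro H; apply Hs. nra.
- apply (is_derive_ext (fun y => (- Im (f y)) * / (Re (f y) * Re (f y) + Im (f y) * Im (f y)))).
  { intros y. unfold Cinv, Re, Im, Rdiv. cbn [fst snd].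
    apply f_equal. apply f_equal. simpl; ring. }
  evar_last; [apply (P _ _ _ _ (is_derive_opp (V := R_NormedModule) _ _ _ f2) I)|].
  destruct (f x) as [a b], l as [c d]. unfold plus, mult, opp; simpl in *. unfold plus, mult, opp; simpl in *. field.
  split; [|lra]. intro H; apply Hs. nra.
Qed.

Lemma has_deriv_cont : forall f x l, has_deriv f x l -> cont f x.
Proof.
intros f x l H. apply (ex_derive_continuous (V := C_R_NormedModule)). exists l. exact H.
Qed.

(** The mean value theorem is applied to the component of [G] in the direction [w = G b - G a], which reduces the claim to
    the monotonicity of a real function. *)
Lemma deriv_dom : forall (G g : R -> C) (N n : R -> R) a b, a <= b ->
  (forall r, a <= r <= b -> has_deriv G r (g r)) ->
  (forall r, a <= r <= b -> is_derive N r (n r)) ->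
  (forall r, a <= r <= b -> Cmod (g r) <= n r) ->
  Cmod (G b - G a)%C <= N b - N a.
Proof.
intros G g N n a b Hab HG HN Hle.
set (w := (G b - G a)%C).
destruct (Req_dec (Cmod w) 0) as [H0|H0].
{ rewrite H0.
  destruct (MVT_gen N a b n) as (c & Hc & E).
  - intros x Hx. apply HN. rewrite Rmin_left, Rmax_right in Hx; lra.
  - intros x Hx. rewrite Rmin_left, Rmax_right in Hx by lra.
    apply continuity_pt_filterlim, (ex_derive_continuous (V := R_NormedModule)). eexists; apply HN; exact Hx.
  - rewrite Rmin_left, Rmax_right in Hc by lra. rewrite E.
    apply Rmult_le_pos; [|lra]. eapply Rle_trans; [apply Cmod_ge_0|apply Hle, Hc]. }
assert (Hw : 0 < Cmod w) by (generalize (Cmod_ge_0 w); lra).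
(* Nondecreasing by the Cauchy-Schwarz inequality for the real inner product of the plane. *)
pose (phi := fun r => Cmod w * N r - (Re w * Re (G r) + Im w * Im (G r))).
pose (dphi := fun r => Cmod w * n r - (Re w * Re (g r) + Im w * Im (g r))).
assert (Hphi : forall r, a <= r <= b -> is_derive phi r (dphi r)).
{ intros r Hr. destruct (proj1 (has_deriv_pair _ _ _) (HG r Hr)) as [H1 H2].
  apply (is_derive_minus (V := R_NormedModule)).
  - apply (is_derive_scal N r (Cmod w) (n r)). apply HN, Hr.
  - apply (is_derive_plus (V := R_NormedModule)).
    + apply (is_derive_scal (fun r => Re (G r)) r (Re w)). exact H1.
    + apply (is_derive_scal (fun r => Im (G r)) r (Im w)). exact H2. }
assert (CS : forall z, Re w * Re z + Im w * Im z <= Cmod w * Cmod z).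
{ intros z. rewrite <- Cmod_conj, <- Cmod_mult.
  eapply Rle_trans; [|apply re_le_Cmod]. eapply Rle_trans; [|apply Rle_abs].
  right. simpl. unfold Re, Im. ring. }
assert (Hmono : phi a <= phi b).
{ destruct (MVT_gen phi a b dphi) as (c & Hc & E).
  - intros x Hx. apply Hphi. rewrite Rmin_left, Rmax_right in Hx; lra.
  - intros x Hx. rewrite Rmin_left, Rmax_right in Hx by lra.
    apply continuity_pt_filterlim, (ex_derive_continuous (V := R_NormedModule)). eexists; apply Hphi; exact Hx.
  - rewrite Rmin_left, Rmax_right in Hc by lra.
    assert (0 <= dphi c).
    { unfold dphi. specialize (CS (g c)). specialize (Hle c Hc).
      assert (Cmod w * Cmod (g c) <= Cmod w * n c) by (apply Rmult_le_compat_l; lra). lra. }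
    assert (0 <= dphi c * (b - a)) by (apply Rmult_le_pos; lra). lra. }
unfold phi in Hmono.
assert (Hw2 : Cmod w * Cmod w = Re w * (Re (G b) - Re (G a)) + Im w * (Im (G b) - Im (G a))).
{ replace (Cmod w * Cmod w) with (Cmod w ^ 2) by ring. rewrite Cmod2_alt. unfold w; simpl. unfold Re, Im. ring. }
apply Rmult_le_reg_l with (Cmod w); [exact Hw|]. lra.
Qed.

Lemma deriv_lip : forall (G g : R -> C) M a b, a <= b ->
  (forall r, a <= r <= b -> has_deriv G r (g r)) ->
  (forall r, a <= r <= b -> Cmod (g r) <= M) ->
  Cmod (G b - G a)%C <= M * (b - a).
Proof.
intros G g M a b Hab HG HM.
replace (M * (b - a)) with (M * b - M * a) by ring.
apply (deriv_dom G g (fun r => M * r) (fun _ => M)); auto.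
intros r _. auto_derive; [exact I|ring].
Qed.

Lemma Cmod_minus_sym : forall a b : C, Cmod (a - b)%C = Cmod (b - a)%C.
Proof. intros. rewrite <- Cmod_opp. f_equal. ring. Qed.

Lemma deriv_lip_abs : forall (G g : R -> C) M a b,
  (forall r, Rmin a b <= r <= Rmax a b -> has_deriv G r (g r)) ->
  (forall r, Rmin a b <= r <= Rmax a b -> Cmod (g r) <= M) ->
  Cmod (G b - G a)%C <= M * Rabs (b - a).
Proof.
intros G g M a b HG HM. destruct (Rle_dec a b) as [H|H].
- rewrite Rmin_left, Rmax_right in HG, HM by lra. rewrite Rabs_pos_eq by lra.
  apply (deriv_lip G g); auto.
- rewrite Rmin_right, Rmax_left in HG, HM by lra. rewrite Cmod_minus_sym, Rabs_minus_sym, Rabs_pos_eq by lra.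
  apply (deriv_lip G g); auto; lra.
Qed.

Lemma has_deriv_quad : forall (g : R -> C) x l M d, 0 < d ->
  (forall y, Rabs (y - x) < d -> Cmod (g y - g x - (y - x)%R * l)%C <= M * (y - x) ^ 2) ->
  has_deriv g x l.
Proof.
intros g x l M d Hd H. split.
- apply (is_linear_scal_l (K := R_AbsRing) (V := C_R_NormedModule)).
- intros z Hz. apply (is_filter_lim_locally_unique (V := AbsRing_NormedModule R_AbsRing)) in Hz. subst z.
  intros eps. set (M' := Rmax M 1).
  assert (HM' : 1 <= M') by apply Rmax_r.
  assert (Hd' : 0 < Rmin d (eps / M')).
  { apply Rmin_glb_lt; [exact Hd|]. apply Rdiv_lt_0_compat; [apply cond_pos|lra]. }
  exists (mkposreal _ Hd'). refine (fun (y : R) Hy => _).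
  change (Rabs (y - x) < Rmin d (eps / M')) in Hy.
  assert (H1 := Rlt_le_trans _ _ _ Hy (Rmin_l _ _)).
  assert (H2 := Rlt_le_trans _ _ _ Hy (Rmin_r _ _)).
  rewrite norm_Cmod.
  change (Cmod (g y - g x - scal (V := C_R_NormedModule) (y - x)%R l)%C <= eps * Rabs (y - x)).
  rewrite scal_C.
  eapply Rle_trans; [apply H, H1|].
  rewrite <- (pow2_abs (y - x)).
  replace (M * Rabs (y - x) ^ 2) with (M * Rabs (y - x) * Rabs (y - x)) by ring. apply Rmult_le_compat_r; [apply Rabs_pos|].
  assert (M * Rabs (y - x) <= M' * Rabs (y - x)) by (apply Rmult_le_compat_r; [apply Rabs_pos|apply Rmax_l]).
  assert (M' * Rabs (y - x) <= M' * (eps / M')) by (apply Rmult_le_compat_l; lra).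
  assert (E : M' * (eps / M') = eps) by (field; lra).
  change (M * Rabs (y - x) <= eps). lra.
Qed.

(** * The exponential *)

Lemma Cexp_add : forall z w, Cexp (z + w)%C = (Cexp z * Cexp w)%C.
Proof.
intros [a b] [c d]. unfold Cexp; simpl. apply injective_projections; simpl;
rewrite exp_plus, ?cos_plus, ?sin_plus; ring.
Qed.

Lemma Cexp_0 : Cexp 0%C = 1%C.
Proof. unfold Cexp; simpl. rewrite exp_0, cos_0, sin_0. apply injective_projections; simpl; ring. Qed.

Lemma Cexp_R : forall a : R, Cexp (RtoC a) = RtoC (exp a).
Proof. intros. unfold Cexp; simpl. rewrite cos_0, sin_0. apply injective_projections; simpl; ring. Qed.

Lemma Cmod_Cexp : forall z, Cmod (Cexp z) = exp (Re z).
Proof.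
intros [a b]. unfold Cexp, Cmod; simpl.
replace (_ + _) with (Rsqr (exp a) * (Rsqr (sin b) + Rsqr (cos b))) by (unfold Rsqr; ring).
rewrite sin2_cos2, Rmult_1_r. apply sqrt_Rsqr. left; apply exp_pos.
Qed.

Lemma has_deriv_Cexp_lin : forall a t, has_deriv (fun t : R => Cexp (a * t)%C) t (a * Cexp (a * t))%C.
Proof.
intros a t. eapply has_deriv_eq; [apply has_deriv_Cexp, has_deriv_scal, has_deriv_id|].
cbv beta. ring.
Qed.

Lemma cont_Cexp_lin : forall a t, cont (fun t : R => Cexp (a * t)%C) t.
Proof. intros. eapply has_deriv_cont, has_deriv_Cexp_lin. Qed.

Lemma exp_le_1 : forall a, a <= 0 -> exp a <= 1.
Proof. intros a [H| ->]; [|rewrite exp_0; lra]. left. rewrite <- exp_0. apply exp_increasing, H. Qed.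

Lemma exp_le : forall a b, a <= b -> exp a <= exp b.
Proof. intros a b [H| ->]; [|lra]. left. apply exp_increasing, H. Qed.

(** * Integrals of complex-valued functions *)

Notation isC g a b l := (is_RInt (V := C_R_NormedModule) g a b l).
Notation exC g a b := (ex_RInt (V := C_R_NormedModule) g a b).

Lemma exC_cont : forall (g : R -> C) a b, (forall z, cont g z) -> exC g a b.
Proof. intros g a b H. apply (ex_RInt_continuous (V := C_R_CompleteNormedModule)). intros; apply H. Qed.

Lemma isC_CRInt : forall (g : R -> C) a b, exC g a b -> isC g a b (CRInt g a b).
Proof. intros g a b H. apply (RInt_correct (V := C_R_CompleteNormedModule)), H. Qed.

Lemma CRInt_unique : forall (g : R -> C) a b l, isC g a b l -> CRInt g a b = l.
Proof. intros g a b l H. apply (is_RInt_unique (V := C_R_CompleteNormedModule)), H. Qed.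

Lemma isC_scal : forall (c : C) (g : R -> C) a b l, isC g a b l -> isC (fun x => c * g x)%C a b (c * l)%C.
Proof.
intros c g a b l H.
assert (H1 := is_RInt_fct_extend_fst (U := R_NormedModule) (V := R_NormedModule) g a b l H).
assert (H2 := is_RInt_fct_extend_snd (U := R_NormedModule) (V := R_NormedModule) g a b l H).
apply (is_RInt_fct_extend_pair (U := R_NormedModule) (V := R_NormedModule) (fun x => c * g x)%C).
- apply (is_RInt_minus (V := R_NormedModule)); apply (is_RInt_scal (V := R_NormedModule)); assumption.
- apply (is_RInt_plus (V := R_NormedModule)); apply (is_RInt_scal (V := R_NormedModule)); assumption.
Qed.

Lemma exC_scal : forall (c : C) (g : R -> C) a b, exC g a b -> exC (fun x => c * g x)%C a b.
Proof. intros c g a b [l H]. eexists; apply isC_scal, H. Qed.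

Lemma CRInt_scal : forall (c : C) (g : R -> C) a b, exC g a b -> CRInt (fun x => c * g x)%C a b = (c * CRInt g a b)%C.
Proof. intros. apply CRInt_unique, isC_scal, isC_CRInt, H. Qed.

Lemma CRInt_plus : forall (f g : R -> C) a b, exC f a b -> exC g a b ->
  CRInt (fun x => f x + g x)%C a b = (CRInt f a b + CRInt g a b)%C.
Proof. intros. apply CRInt_unique, (is_RInt_plus (V := C_R_NormedModule)); apply isC_CRInt; assumption. Qed.

Lemma exC_plus : forall (f g : R -> C) a b, exC f a b -> exC g a b -> exC (fun x => f x + g x)%C a b.
Proof. intros. apply (ex_RInt_plus (V := C_R_NormedModule)); assumption. Qed.

Lemma CRInt_minus : forall (f g : R -> C) a b, exC f a b -> exC g a b ->
  CRInt (fun x => f x - g x)%C a b = (CRInt f a b - CRInt g a b)%C.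
Proof. intros. apply CRInt_unique, (is_RInt_minus (V := C_R_NormedModule)); apply isC_CRInt; assumption. Qed.

Lemma CRInt_ext : forall (f g : R -> C) a b, a <= b -> (forall x, a < x < b -> f x = g x) -> CRInt f a b = CRInt g a b.
Proof.
intros f g a b Hab H. apply (RInt_ext (V := C_R_CompleteNormedModule)).
rewrite Rmin_left, Rmax_right by lra. exact H.
Qed.

Lemma exC_ext : forall (f g : R -> C) a b, a <= b -> (forall x, a < x < b -> f x = g x) -> exC f a b -> exC g a b.
Proof.
intros f g a b Hab H. apply (ex_RInt_ext (V := C_R_NormedModule)).
rewrite Rmin_left, Rmax_right by lra. exact H.
Qed.

Lemma CRInt_Chasles : forall (f : R -> C) a b c, exC f a b -> exC f b c -> CRInt f a c = (CRInt f a b + CRInt f b c)%C.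
Proof. intros. symmetry. apply (RInt_Chasles (V := C_R_CompleteNormedModule)); assumption. Qed.

Lemma CRInt_point : forall f a, CRInt f a a = 0%C.
Proof. intros. apply CRInt_unique, (is_RInt_point (V := C_R_NormedModule)). Qed.

Lemma CRInt_const : forall c a b, CRInt (fun _ => c) a b = ((b - a)%R * c)%C.
Proof.
intros. apply CRInt_unique. rewrite <- scal_C. apply (is_RInt_const (V := C_R_NormedModule)).
Qed.

Lemma CRInt_bound : forall (f : R -> C) a b M, a <= b -> exC f a b -> (forall x, a <= x <= b -> Cmod (f x) <= M) ->
  Cmod (CRInt f a b) <= M * (b - a).
Proof.
intros f a b M Hab Hex HM. rewrite <- norm_Cmod.
eapply (norm_RInt_le (V := C_R_NormedModule) f (fun _ => M) a b); [exact Hab| |apply isC_CRInt, Hex|].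
- intros x Hx. rewrite norm_Cmod. apply HM, Hx.
- evar_last; [apply (is_RInt_const (V := R_NormedModule))|]. unfold scal; simpl; unfold mult; simpl; ring.
Qed.

Lemma CRInt_deriv : forall (g : R -> C) a b, (forall z, cont g z) -> has_deriv (fun b => CRInt g a b) b (g b).
Proof.
intros g a b H. apply (is_derive_RInt (V := C_R_NormedModule) g (fun b => CRInt g a b) a b).
- apply filter_forall. intros y. apply isC_CRInt, exC_cont, H.
- apply H.
Qed.

Lemma CRInt_FTC : forall (G g : R -> C) a b, a <= b ->
  (forall x, a <= x <= b -> has_deriv G x (g x)) -> (forall x, a <= x <= b -> cont g x) ->
  isC g a b (G b - G a)%C.
Proof.
intros G g a b Hab HG Hg.
apply (is_RInt_derive (V := C_R_CompleteNormedModule) G g a b); rewrite Rmin_left, Rmax_right by lra; assumption.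
Qed.

Lemma CRInt_dom : forall (g : R -> C) (N n : R -> R) a b, a <= b -> (forall z, cont g z) ->
  (forall r, a <= r <= b -> is_derive N r (n r)) ->
  (forall r, a <= r <= b -> Cmod (g r) <= n r) ->
  Cmod (CRInt g a b) <= N b - N a.
Proof.
intros g N n a b Hab Hg HN Hle.
assert (H := deriv_dom (fun r => CRInt g a r) g N n a b Hab (fun r _ => CRInt_deriv g a r Hg) HN Hle).
cbv beta in H. rewrite CRInt_point in H. replace (CRInt g a b) with (CRInt g a b - 0)%C by ring. exact H.
Qed.

Lemma CRInt_comp_opp : forall (g : R -> C) a b, (forall z, cont g z) -> CRInt g a b = CRInt (fun x => g (- x)) (- b) (- a).
Proof.
intros g a b Hg. symmetry. apply CRInt_unique.
assert (H := is_RInt_comp (V := C_R_CompleteNormedModule) g (fun x => - x) (fun _ => - 1) (-a) (-b)).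
rewrite !Ropp_involutive in H.
assert (H' : isC (fun y => scal (V := C_R_NormedModule) (-1) (g (- y))) (-a) (-b) (CRInt g a b)).
{ apply H; [intros; apply Hg|].
  intros x _. split; [|apply continuous_const]. auto_derive; [exact I|ring]. }
apply (is_RInt_swap (V := C_R_NormedModule)) in H'.
apply (is_RInt_opp (V := C_R_NormedModule)) in H'.
rewrite opp_opp in H'.
eapply (is_RInt_ext (V := C_R_NormedModule)); [|exact H'].
intros x _. cbv beta. rewrite scal_C. change (- (RtoC (-1) * g (- x)%R) = g (- x)%R)%C.
apply injective_projections; simpl; ring.
Qed.

Lemma CRInt_shift : forall (g : R -> C) a b c, (forall z, cont g z) -> CRInt g (a + c) (b + c) = CRInt (fun x => g (x + c)) a b.
Proof.
intros g a b c Hg. symmetry. apply CRInt_unique.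
assert (H := is_RInt_comp (V := C_R_CompleteNormedModule) g (fun x => x + c) (fun _ => 1) a b).
eapply (is_RInt_ext (V := C_R_NormedModule)); [|apply H].
- intros x _. cbv beta. rewrite scal_C. apply injective_projections; simpl; ring.
- intros; apply Hg.
- intros x _. split; [|apply continuous_const]. auto_derive; [exact I|ring].
Qed.

(** * Bounded linear functionals and uniform limits *)

Lemma le_of_eps : forall x y : R, (forall eps, 0 < eps -> x <= y + eps) -> x <= y.
Proof. intros x y H. destruct (Rle_dec x y) as [h|h]; [exact h|]. specialize (H ((x - y) / 2)). lra. Qed.

Lemma Ceq_of_eps : forall z w : C, (forall eps, 0 < eps -> Cmod (z - w)%C <= eps) -> z = w.
Proof.
intros z w H. assert (Cmod (z - w)%C <= 0) by (apply le_of_eps; intros; rewrite Rplus_0_l; auto).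
assert (E : (z - w)%C = 0%C) by (apply Cmod_eq_0; generalize (Cmod_ge_0 (z - w)%C); lra).
replace z with (z - w + w)%C by ring. rewrite E. ring.
Qed.

(** A bounded linear functional [L], of norm at most [Lam].  [D] is the class of admissible integrands, [P] the set on which
    their size is measured.  Contour integrals, integrals over segments and weighted integrals over the half line are all of this
    kind.  Closure of [D] under uniform limits is what lets derivatives and integrals with respect to a parameter stay admissible
    without any joint continuity. *)
Record BLF {S : Type} (P : S -> Prop) (D : (S -> C) -> Prop) (L : (S -> C) -> C) (Lam : R) : Prop := {
  blf_pos : 0 <= Lam;
  blf_plus_D : forall g h, D g -> D h -> D (fun s => g s + h s)%C;
  blf_plus : forall g h, D g -> D h -> L (fun s => g s + h s)%C = (L g + L h)%C;
  blf_scal_D : forall c g, D g -> D (fun s => c * g s)%C;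
  blf_scal : forall c g, D g -> L (fun s => c * g s)%C = (c * L g)%C;
  blf_lim : forall g, (forall eps, 0 < eps -> exists h, D h /\ forall s, P s -> Cmod (g s - h s)%C <= eps) -> D g;
  blf_bound : forall g M, D g -> (forall s, P s -> Cmod (g s) <= M) -> Cmod (L g) <= Lam * M }.

Fixpoint csum (n : nat) (f : nat -> C) : C :=
  match n with O => 0%C | Datatypes.S k => (csum k f + f k)%C end.

Section BLF_theory.
Context {S : Type} {P : S -> Prop} {D : (S -> C) -> Prop} {L : (S -> C) -> C} {Lam : R}.
Hypothesis HL : BLF P D L Lam.

Lemma blf_D_ext : forall g h, D g -> (forall s, P s -> g s = h s) -> D h.
Proof.
intros g h Hg H. apply (blf_lim _ _ _ _ HL). intros eps He. exists g. split; [exact Hg|].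
intros s Hs. rewrite H by exact Hs. replace (h s - h s)%C with (RtoC 0) by ring. rewrite Cmod_0; lra.
Qed.

Lemma blf_minus_D : forall g h, D g -> D h -> D (fun s => g s - h s)%C.
Proof.
intros g h Hg Hh. apply (blf_D_ext (fun s => g s + (- (1)) * h s)%C).
- apply (blf_plus_D _ _ _ _ HL); [exact Hg|]. apply (blf_scal_D _ _ _ _ HL), Hh.
- intros; ring.
Qed.

Lemma blf_minus_bound : forall g h M, D g -> D h -> (forall s, P s -> Cmod (g s - h s)%C <= M) ->
  Cmod (L g - L h)%C <= Lam * M.
Proof.
intros g h M Hg Hh H.
assert (Hm : D (fun s => - (1) * h s)%C) by apply (blf_scal_D _ _ _ _ HL), Hh.
replace (L g - L h)%C with (L (fun s => g s + (- (1)) * h s)%C).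
- apply (blf_bound _ _ _ _ HL).
  + apply (blf_plus_D _ _ _ _ HL); assumption.
  + intros s Hs. replace (g s + - (1) * h s)%C with (g s - h s)%C by ring. apply H, Hs.
- rewrite (blf_plus _ _ _ _ HL), (blf_scal _ _ _ _ HL) by assumption. ring.
Qed.

Lemma blf_ext : forall g h, D g -> (forall s, P s -> g s = h s) -> L g = L h.
Proof.
intros g h Hg H. apply Ceq_of_eps. intros eps He.
assert (B : Cmod (L g - L h)%C <= Lam * 0).
{ apply blf_minus_bound; [exact Hg|apply (blf_D_ext g); assumption|].
  intros s Hs. rewrite H by exact Hs. replace (h s - h s)%C with (RtoC 0) by ring. rewrite Cmod_0; lra. }
lra.
Qed.

Lemma blf_minus : forall g h, D g -> D h -> L (fun s => g s - h s)%C = (L g - L h)%C.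
Proof.
intros g h Hg Hh.
assert (Hm : D (fun s => - (1) * h s)%C) by apply (blf_scal_D _ _ _ _ HL), Hh.
rewrite <- (blf_ext (fun s => g s + (- (1)) * h s)%C).
- rewrite (blf_plus _ _ _ _ HL), (blf_scal _ _ _ _ HL) by assumption. ring.
- apply (blf_plus_D _ _ _ _ HL); assumption.
- intros; ring.
Qed.

(** Used with [g], [h], [k] the two values and the derivative of a family of integrands: Taylor expansions pass through [L]. *)
Lemma blf_lin_bound : forall g h k c M, D g -> D h -> D k -> (forall s, P s -> Cmod (g s - h s - c * k s)%C <= M) ->
  Cmod (L g - L h - c * L k)%C <= Lam * M.
Proof.
intros g h k c M Hg Hh Hk H.
assert (Hck := blf_scal_D _ _ _ _ HL c k Hk). assert (Hgh := blf_minus_D g h Hg Hh).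
rewrite <- (blf_scal _ _ _ _ HL c k Hk), <- (blf_minus g h Hg Hh), <- (blf_minus _ _ Hgh Hck).
apply (blf_bound _ _ _ _ HL); [apply blf_minus_D; assumption|exact H].
Qed.

Lemma blf_zero : forall g, D g -> (forall s, P s -> g s = 0%C) -> L g = 0%C.
Proof.
intros g Hg H. apply Ceq_of_eps. intros eps He.
assert (Cmod (L g) <= Lam * 0).
{ apply (blf_bound _ _ _ _ HL); [exact Hg|]. intros s Hs. rewrite H, Cmod_0 by exact Hs. lra. }
replace (L g - 0)%C with (L g) by ring. lra.
Qed.

Lemma blf_csum : forall n (g : nat -> S -> C), (exists g0, D g0) -> (forall i, (i < n)%nat -> D (g i)) ->
  D (fun s => csum n (fun i => g i s)) /\ L (fun s => csum n (fun i => g i s)) = csum n (fun i => L (g i)).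
Proof.
intros n g [g0 Hg0]. induction n as [|n IH]; intros H.
- assert (D0 : D (fun _ => 0%C)).
  { apply (blf_D_ext (fun s => 0 * g0 s)%C); [apply (blf_scal_D _ _ _ _ HL), Hg0|intros; ring]. }
  simpl. split; [exact D0|]. apply blf_zero; auto.
- destruct IH as [IH1 IH2]; [intros; apply H; lia|]. simpl. split.
  + apply (blf_plus_D _ _ _ _ HL); [exact IH1|apply H; lia].
  + rewrite (blf_plus _ _ _ _ HL), IH2; [reflexivity|exact IH1|apply H; lia].
Qed.
End BLF_theory.

Lemma csum_ext : forall n f g, (forall i, (i < n)%nat -> f i = g i) -> csum n f = csum n g.
Proof.
induction n as [|n IH]; intros f g H; simpl; [reflexivity|].
rewrite (IH f g), H by (intros; try apply H; lia). reflexivity.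
Qed.

(** * Clamping, and the class of functions continuous along a parametrization *)

Definition clamp (a b r : R) : R := Rmax a (Rmin b r).

Lemma clamp_in : forall a b r, a <= b -> a <= clamp a b r <= b.
Proof. intros. unfold clamp, Rmax, Rmin. repeat destruct Rle_dec; lra. Qed.

Lemma clamp_id : forall a b r, a <= r <= b -> clamp a b r = r.
Proof. intros. unfold clamp, Rmax, Rmin. repeat destruct Rle_dec; lra. Qed.

Lemma clamp_lip : forall a b r r', Rabs (clamp a b r - clamp a b r') <= Rabs (r - r').
Proof. intros. unfold clamp, Rmax, Rmin. repeat destruct Rle_dec; unfold Rabs; repeat destruct Rcase_abs; lra. Qed.

Lemma Rmax0_lip : forall r r', Rabs (Rmax 0 r - Rmax 0 r') <= Rabs (r - r').
Proof. intros. unfold Rmax. repeat destruct Rle_dec; unfold Rabs; repeat destruct Rcase_abs; lra. Qed.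

(** Continuity along [rho] only: with [rho] the projection of the line to a segment or a half line this is continuity on that
    set, with [rho] a closed curve it is continuity on the curve. *)
Definition Dc {S : Type} (rho : R -> S) (g : S -> C) : Prop := forall r, cont (fun r => g (rho r)) r.

Lemma Dc_lim : forall {S} (rho : R -> S) (P : S -> Prop) g, (forall r, P (rho r)) ->
  (forall eps, 0 < eps -> exists h, Dc rho h /\ forall s, P s -> Cmod (g s - h s)%C <= eps) -> Dc rho g.
Proof.
intros S rho P g HP H r. apply cont_eps. intros eps He.
destruct (H (eps / 4)) as (h & Hh & Hgh); [lra|].
destruct (proj1 (cont_eps _ r) (Hh r) (eps / 4)) as (d & Hd & Hy); [lra|].
exists d; split; [exact Hd|]. intros y Hyr.
replace (g (rho y) - g (rho r))%C
  with ((g (rho y) - h (rho y)) + (h (rho y) - h (rho r)) - (g (rho r) - h (rho r)))%C by ring.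
unfold Cminus at 1.
eapply Rle_lt_trans; [apply Cmod_triangle|]. rewrite Cmod_opp.
eapply Rle_lt_trans; [apply Rplus_le_compat_r, Cmod_triangle|].
generalize (Hgh _ (HP y)) (Hgh _ (HP r)) (Hy y Hyr). lra.
Qed.

Lemma cont_lip : forall (g : R -> C) M x, (forall y, Cmod (g y - g x)%C <= M * Rabs (y - x)) -> cont g x.
Proof.
intros g M x H. apply cont_eps. intros eps He.
exists (eps / (Rabs M + 1)). assert (HM := Rabs_pos M). split; [apply Rdiv_lt_0_compat; lra|].
intros y Hy. eapply Rle_lt_trans; [apply H|].
apply Rle_lt_trans with ((Rabs M + 1) * Rabs (y - x)).
- apply Rmult_le_compat_r; [apply Rabs_pos|]. generalize (Rle_abs M); lra.
- apply Rlt_le_trans with ((Rabs M + 1) * (eps / (Rabs M + 1))).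
  + apply Rmult_lt_compat_l; lra.
  + right; field; lra.
Qed.

Lemma Dc_lip : forall (rho : R -> R) g M, (forall r r', Rabs (rho r - rho r') <= Rabs (r - r')) ->
  (forall r r', Cmod (g (rho r) - g (rho r'))%C <= M * Rabs (rho r - rho r')) -> Dc rho g.
Proof.
intros rho g M Hr Hg r. apply cont_lip with (Rabs M). intros y.
eapply Rle_trans; [apply Hg|]. eapply Rle_trans; [|apply Rmult_le_compat_l; [apply Rabs_pos|apply Hr]].
apply Rmult_le_compat_r; [apply Rabs_pos|apply Rle_abs].
Qed.

Lemma cont_comp_lip : forall (g : R -> C) (rho : R -> R) r,
  (forall r r', Rabs (rho r - rho r') <= Rabs (r - r')) -> cont g (rho r) -> cont (fun r => g (rho r)) r.
Proof.
intros g rho r Hr Hg. apply cont_eps. intros eps He.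
destruct (proj1 (cont_eps _ _) Hg eps He) as (d & Hd & H). exists d; split; [exact Hd|].
intros y Hy. apply H. eapply Rle_lt_trans; [apply Hr|exact Hy].
Qed.

Lemma Dc_of_cont : forall (g : R -> C) (rho : R -> R),
  (forall r r', Rabs (rho r - rho r') <= Rabs (r - r')) -> (forall r, cont g r) -> Dc rho g.
Proof. intros g rho Hr Hg r. apply cont_comp_lip; [exact Hr|apply Hg]. Qed.

(** ** The integral over a segment *)

Lemma exC_Dc : forall (g : R -> C) a b, a <= b -> Dc (clamp a b) g -> exC g a b.
Proof.
intros g a b Hab Hg. apply (exC_ext (fun r => g (clamp a b r))); [exact Hab| |].
- intros x Hx. rewrite clamp_id by lra. reflexivity.
- apply exC_cont, Hg.
Qed.

Lemma CRInt_clamp : forall (g : R -> C) a b, a <= b -> CRInt g a b = CRInt (fun r => g (clamp a b r)) a b.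
Proof. intros. apply CRInt_ext; [assumption|]. intros; rewrite clamp_id by lra; reflexivity. Qed.

Lemma BLF_RInt : forall a b, a <= b ->
  BLF (fun r => a <= r <= b) (Dc (clamp a b)) (fun g => CRInt g a b) (b - a).
Proof.
intros a b Hab. constructor.
- lra.
- intros g h Hg Hh r. apply cont_plus; auto.
- intros g h Hg Hh. apply CRInt_plus; apply exC_Dc; assumption.
- intros c g Hg r. apply cont_mult; [apply cont_const|auto].
- intros c g Hg. apply CRInt_scal, exC_Dc; assumption.
- intros g H. apply (Dc_lim _ (fun r => a <= r <= b)); [intros; apply clamp_in, Hab|exact H].
- intros g M Hg HM. rewrite Rmult_comm. apply CRInt_bound; [exact Hab|apply exC_Dc; assumption|exact HM].
Qed.

Lemma Dc_clamp_lip : forall g M a b, a <= b ->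
  (forall y y', a <= y <= b -> a <= y' <= b -> Cmod (g y - g y')%C <= M * Rabs (y - y')) -> Dc (clamp a b) g.
Proof.
intros g M a b Hab H. apply Dc_lip with M; [apply clamp_lip|].
intros; apply H; apply clamp_in, Hab.
Qed.

Lemma riemann_sum : forall h M a b N, a <= b -> (0 < N)%nat ->
  (forall y y', a <= y <= b -> a <= y' <= b -> Cmod (h y - h y')%C <= M * Rabs (y - y')) ->
  Cmod (CRInt h a b - csum N (fun i => RtoC ((b - a) / INR N) * h (a + INR i * ((b - a) / INR N))%R))%C
    <= M * (b - a) ^ 2 / INR N.
Proof.
intros h M a b N Hab HN Hh.
assert (HNR : 0 < INR N) by (apply lt_0_INR, HN).
set (dl := (b - a) / INR N).
assert (Hdl : 0 <= dl) by (apply Rdiv_le_0_compat; lra).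
assert (Hb : a + INR N * dl = b) by (unfold dl; field; lra).
assert (Hcl : forall z, cont (fun r => h (clamp a b r)) z) by (apply Dc_clamp_lip with M; assumption).
rewrite (CRInt_clamp h) by exact Hab.
assert (Hin : forall k, (k <= N)%nat -> a <= a + INR k * dl <= b).
{ intros k Hk. split.
  - assert (0 <= INR k * dl) by (apply Rmult_le_pos; [apply pos_INR|exact Hdl]). lra.
  - rewrite <- Hb. apply Rplus_le_compat_l, Rmult_le_compat_r; [exact Hdl|apply le_INR, Hk]. }
assert (K : forall k, (k <= N)%nat ->
  Cmod (CRInt (fun r => h (clamp a b r)) a (a + INR k * dl) - csum k (fun i => RtoC dl * h (a + INR i * dl)%R))%C
   <= INR k * (M * dl ^ 2)).
{ induction k as [|k IH]; intros Hk.
  - replace (a + INR 0 * dl) with a by (simpl; ring). rewrite CRInt_point. simpl.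
    replace (0 - 0)%C with (RtoC 0) by ring. rewrite Cmod_0. lra.
  - specialize (IH ltac:(lia)).
    rewrite (CRInt_Chasles _ a (a + INR k * dl)) by (apply exC_cont, Hcl).
    cbn [csum].
    match goal with |- Cmod (?A + ?B - (?E + ?F))%C <= _ =>
      replace (A + B - (E + F))%C with ((A - E) + (B - F))%C by ring end.
    eapply Rle_trans; [apply Cmod_triangle|]. rewrite S_INR.
    replace ((INR k + 1) * (M * dl ^ 2)) with (INR k * (M * dl ^ 2) + (M * dl) * dl) by ring.
    apply Rplus_le_compat; [exact IH|].
    assert (Hk1 := Hin k ltac:(lia)). assert (Hk2 := Hin (Datatypes.S k) Hk). rewrite S_INR in Hk2.
    replace (RtoC dl * h (a + INR k * dl)%R)%C
      with (CRInt (fun _ => h (a + INR k * dl)%R) (a + INR k * dl) (a + (INR k + 1) * dl))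
      by (rewrite CRInt_const; f_equal; f_equal; ring).
    rewrite <- CRInt_minus by (apply exC_cont; first [exact Hcl | intros; apply cont_const]).
    replace (M * dl * dl) with (M * dl * (a + (INR k + 1) * dl - (a + INR k * dl))) by ring.
    apply CRInt_bound.
    + lra.
    + apply exC_cont. intros z. apply cont_minus; [apply Hcl|apply cont_const].
    + intros x Hx. rewrite clamp_id by lra.
      destruct (Req_dec dl 0) as [Hd0|Hd0].
      * replace x with (a + INR k * dl) by (rewrite Hd0 in *; lra).
        replace (h (a + INR k * dl)%R - h (a + INR k * dl)%R)%C with (RtoC 0) by ring.
        rewrite Cmod_0, Hd0. lra.
      * eapply Rle_trans; [apply Hh; lra|]. rewrite Rabs_pos_eq by lra.
        destruct (Rle_dec 0 M) as [HM|HM].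
        -- apply Rmult_le_compat_l; lra.
        -- exfalso. assert (B := Hh (a + INR k * dl) (a + (INR k + 1) * dl) Hk1 Hk2).
           rewrite Rabs_minus_sym, Rabs_pos_eq in B by lra.
           generalize (Cmod_ge_0 (h (a + INR k * dl)%R - h (a + (INR k + 1) * dl)%R)%C). intros.
           assert (M * (a + (INR k + 1) * dl - (a + INR k * dl)) < 0); [|lra].
           replace (a + (INR k + 1) * dl - (a + INR k * dl)) with dl by ring. nra. }
specialize (K N (le_n N)). rewrite Hb in K.
replace (M * (b - a) ^ 2 / INR N) with (INR N * (M * dl ^ 2)) by (unfold dl; field; lra).
exact K.
Qed.

Lemma nat_large : forall C0 eps, 0 < eps -> exists N, (0 < N)%nat /\ C0 / INR N <= eps.
Proof.
intros C0 eps He. destruct (nfloor_ex (Rabs C0 / eps)) as [n Hn].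
{ apply Rdiv_le_0_compat; [apply Rabs_pos|exact He]. }
exists (Datatypes.S n). split; [lia|].
assert (0 < INR (Datatypes.S n)) by (apply lt_0_INR; lia).
apply Rmult_le_reg_r with (INR (Datatypes.S n)); [assumption|].
replace (C0 / INR (Datatypes.S n) * INR (Datatypes.S n)) with C0 by (field; lra).
rewrite S_INR in *. destruct Hn as [_ Hn].
apply Rmult_lt_compat_l with (r := eps) in Hn; [|exact He].
replace (eps * (Rabs C0 / eps)) with (Rabs C0) in Hn by (field; lra).
generalize (Rle_abs C0). lra.
Qed.

(** Fubini for a bounded linear functional against an integral over a segment:
    both are limits of the same Riemann sums. *)
Lemma blf_int : forall {S} {P : S -> Prop} {D L Lam} (HL : BLF P D L Lam) (g : S -> R -> C) M a b, a <= b ->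
  (forall s, P s -> forall y y', a <= y <= b -> a <= y' <= b -> Cmod (g s y - g s y')%C <= M * Rabs (y - y')) ->
  (forall y, a <= y <= b -> D (fun s => g s y)) ->
  D (fun s => CRInt (g s) a b) /\ L (fun s => CRInt (g s) a b) = CRInt (fun y => L (fun s => g s y)) a b.
Proof.
intros S P D L Lam HL g M a b Hab Hg HD.
pose (RS := fun N (h : R -> C) => csum N (fun i => RtoC ((b - a) / INR N) * h (a + INR i * ((b - a) / INR N))%R)%C).
assert (Hin : forall N i, (0 < N)%nat -> (i < N)%nat -> a <= a + INR i * ((b - a) / INR N) <= b).
{ intros N i HN Hi. assert (0 < INR N) by (apply lt_0_INR, HN).
  assert (0 <= (b - a) / INR N) by (apply Rdiv_le_0_compat; lra).
  assert (INR i <= INR N) by (apply le_INR; lia). assert (0 <= INR i) by apply pos_INR.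
  split; [nra|]. replace b with (a + INR N * ((b - a) / INR N)) at 2 by (field; lra). nra. }
assert (HDs : forall N, (0 < N)%nat -> D (fun s => RS N (g s)) /\
  L (fun s => RS N (g s)) = RS N (fun y => L (fun s => g s y))).
{ intros N HN.
  destruct (blf_csum HL N (fun i s => RtoC ((b - a) / INR N) * g s (a + INR i * ((b - a) / INR N))%R)%C) as [H1 H2].
  - exists (fun s => g s a). apply HD. lra.
  - intros i Hi. apply (blf_scal_D _ _ _ _ HL). apply HD, Hin; assumption.
  - split; [exact H1|]. unfold RS. rewrite H2. apply csum_ext. intros i Hi.
    apply (blf_scal _ _ _ _ HL (RtoC ((b - a) / INR N)) (fun s => g s _)). apply HD, Hin; assumption. }
assert (HDi : D (fun s => CRInt (g s) a b)).
{ apply (blf_lim _ _ _ _ HL). intros eps He.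
  destruct (nat_large (M * (b - a) ^ 2) eps He) as (N & HN & HNe).
  exists (fun s => RS N (g s)). split; [apply HDs, HN|].
  intros s Hs. eapply Rle_trans; [|exact HNe].
  apply riemann_sum; [exact Hab|exact HN|apply Hg, Hs]. }
split; [exact HDi|].
apply Ceq_of_eps. intros eps He.
destruct (nat_large (2 * (Lam * M * (b - a) ^ 2)) eps He) as (N & HN & HNe).
destruct (HDs N HN) as [D1 E1].
replace (L (fun s => CRInt (g s) a b) - CRInt (fun y => L (fun s => g s y)) a b)%C with
  ((L (fun s => CRInt (g s) a b) - L (fun s => RS N (g s))) +
   - (CRInt (fun y => L (fun s => g s y)) a b - RS N (fun y => L (fun s => g s y))))%C by (rewrite E1; ring).
eapply Rle_trans; [apply Cmod_triangle|]. rewrite Cmod_opp.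
assert (B1 : Cmod (L (fun s => CRInt (g s) a b) - L (fun s => RS N (g s)))%C <= Lam * (M * (b - a) ^ 2 / INR N)).
{ apply (blf_minus_bound HL); [exact HDi|exact D1|]. intros s Hs.
  apply riemann_sum; [exact Hab|exact HN|apply Hg, Hs]. }
assert (B2 : Cmod (CRInt (fun y => L (fun s => g s y)) a b - RS N (fun y => L (fun s => g s y)))%C
   <= (Lam * M) * (b - a) ^ 2 / INR N).
{ apply riemann_sum; [exact Hab|exact HN|]. intros y y' Hy Hy'. rewrite Rmult_assoc.
  apply (blf_minus_bound HL); [apply HD, Hy|apply HD, Hy'|]. intros s Hs. apply Hg; assumption. }
eapply Rle_trans; [apply Rplus_le_compat; [exact B1|exact B2]|].
eapply Rle_trans; [|exact HNe]. right. field. apply Rgt_not_eq, lt_0_INR, HN.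
Qed.

(** * Improper integrals *)

Lemma CRInt_halfline_intro : forall (h : R -> C) l,
  (forall N, 0 < N -> exC h 0 N) ->
  (forall eps, 0 < eps -> exists N0, 0 < N0 /\ forall N, N0 <= N -> Cmod (CRInt h 0 N - l)%C < eps) ->
  CRInt_halfline h = l.
Proof.
intros h l Hex Hl. unfold CRInt_halfline.
apply (is_RInt_gen_unique (V := C_R_CompleteNormedModule)).
intros Q HQ.
apply (locally_norm_le_locally (V := C_R_NormedModule) l Q) in HQ.
destruct HQ as [e He]. destruct (Hl e (cond_pos e)) as (N0 & HN0 & H).
exists (fun a => a = 0) (fun b => N0 < b).
- reflexivity.
- exists N0. auto.
- intros a b -> Hb. exists (CRInt h 0 b). split.
  + apply isC_CRInt, Hex. simpl. lra.
  + apply He. unfold ball_norm. rewrite norm_Cmod. apply H. lra.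
Qed.

Lemma CRInt_line_intro : forall (h : R -> C) l,
  (forall A B, A <= B -> exC h A B) ->
  (forall eps, 0 < eps -> exists N0, 0 < N0 /\ forall A B, A <= - N0 -> N0 <= B -> Cmod (CRInt h A B - l)%C < eps) ->
  CRInt_line h = l.
Proof.
intros h l Hex Hl. unfold CRInt_line.
apply (is_RInt_gen_unique (V := C_R_CompleteNormedModule)).
intros Q HQ.
apply (locally_norm_le_locally (V := C_R_NormedModule) l Q) in HQ.
destruct HQ as [e He]. destruct (Hl e (cond_pos e)) as (N0 & HN0 & H).
exists (fun a => a < - N0) (fun b => N0 < b).
- exists (- N0). auto.
- exists N0. auto.
- intros a b Ha Hb. exists (CRInt h a b). split.
  + apply isC_CRInt, Hex. simpl. lra.
  + apply He. unfold ball_norm. rewrite norm_Cmod. apply H; lra.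
Qed.

(** The integrability class of the half line; the majorant is the derivative of [- Cst / (1 + y)], which gives explicit tails. *)
Definition dec (Cst : R) (h : R -> C) : Prop := forall y, 0 <= y -> Cmod (h y) <= Cst / (1 + y) ^ 2.

Notation Dh := (Dc (Rmax 0)).

Lemma dec_pos : forall c h, dec c h -> 0 <= c.
Proof. intros c h H. specialize (H 0 (Rle_refl 0)). generalize (Cmod_ge_0 (h 0)). replace (c / (1 + 0) ^ 2) with c in H by field. lra. Qed.

Lemma exC_half : forall h a b, 0 <= a -> a <= b -> Dh h -> exC h a b.
Proof.
intros h a b Ha Hab Hh. apply (exC_ext (fun r => h (Rmax 0 r))); [exact Hab| |].
- intros x Hx. rewrite Rmax_right by lra. reflexivity.
- apply exC_cont, Hh.
Qed.

Lemma dec_tail : forall c h a b, Dh h -> dec c h -> 0 <= a -> a <= b ->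
  Cmod (CRInt h a b) <= c / (1 + a) - c / (1 + b).
Proof.
intros c h a b Hh Hd Ha Hab.
rewrite (CRInt_ext h (fun r => h (Rmax 0 r))) by (try assumption; intros; rewrite Rmax_right by lra; reflexivity).
replace (c / (1 + a) - c / (1 + b)) with (- (c / (1 + b)) - - (c / (1 + a))) by ring.
apply (CRInt_dom _ (fun r => - (c / (1 + r))) (fun r => c / (1 + r) ^ 2)); [exact Hab|exact Hh| |].
- intros r Hr. auto_derive; [lra|field; lra].
- intros r Hr. rewrite Rmax_right by lra. apply Hd. lra.
Qed.

Lemma half_ex : forall c h, Dh h -> dec c h ->
  forall N, 0 <= N -> Cmod (CRInt_halfline h - CRInt h 0 N)%C <= c / (1 + N).
Proof.
intros c h Hh Hd.
assert (Hc := dec_pos _ _ Hd).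
assert (Hch : forall a b, 0 <= a -> a <= b -> Cmod (CRInt h 0 b - CRInt h 0 a)%C <= c / (1 + a)).
{ intros a b Ha Hab. rewrite (CRInt_Chasles h 0 a b) by (apply exC_half; auto; lra).
  replace (CRInt h 0 a + CRInt h a b - CRInt h 0 a)%C with (CRInt h a b) by ring.
  eapply Rle_trans; [apply (dec_tail c); assumption|].
  assert (0 <= c / (1 + b)) by (apply Rdiv_le_0_compat; lra). lra. }
destruct (proj1 (filterlim_locally_cauchy (U := C_R_CompleteNormedModule) (F := Rbar_locally p_infty) (fun N => CRInt h 0 N))) as [l Hl].
{ intros eps. exists (fun N => (2 * c) / eps < N /\ 0 < N). split.
  - apply filter_and; [exists (2 * c / eps); auto | exists 0; auto].
  - intros u v [Hu Hu0] [Hv Hv0].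
    assert (K : forall a b, 2 * c / eps < a -> 0 < a -> a <= b -> Cmod (CRInt h 0 b - CRInt h 0 a)%C < eps).
    { intros a b Ha Ha0 Hab. eapply Rle_lt_trans; [apply Hch; lra|].
      assert (He := cond_pos eps).
      apply Rmult_lt_reg_r with (1 + a); [lra|].
      replace (c / (1 + a) * (1 + a)) with c by (field; lra).
      apply Rmult_lt_compat_r with (r := eps) in Ha; [|exact He].
      replace (2 * c / eps * eps) with (2 * c) in Ha by (field; lra). nra. }
    apply (norm_compat1 (V := C_R_NormedModule)). rewrite norm_Cmod.
    change (Cmod (CRInt h 0 v - CRInt h 0 u)%C < eps).
    destruct (Rle_dec u v).
    + apply K; assumption.
    + rewrite Cmod_minus_sym. apply K; lra. }
assert (Hlim : forall eps, 0 < eps -> exists N0, 0 < N0 /\ forall N, N0 <= N -> Cmod (CRInt h 0 N - l)%C < eps).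
{ intros eps He.
  assert (HB := Hl _ (locally_ball_norm (V := C_R_NormedModule) l (mkposreal eps He))).
  destruct HB as [M HM]. exists (Rmax 0 M + 1).
  assert (0 <= Rmax 0 M) by apply Rmax_l. assert (M <= Rmax 0 M) by apply Rmax_r.
  split; [lra|]. intros N HN. specialize (HM N ltac:(lra)). unfold ball_norm in HM.
  rewrite norm_Cmod in HM. exact HM. }
assert (E : CRInt_halfline h = l).
{ apply CRInt_halfline_intro; [|exact Hlim]. intros N HN. apply exC_half; auto; lra. }
intros N HN. rewrite E. apply le_of_eps. intros eps He.
destruct (Hlim eps He) as (N0 & HN0 & H).
assert (H1 := H (Rmax N N0) (Rmax_r _ _)). assert (H2 := Hch N (Rmax N N0) HN (Rmax_l _ _)).
replace (l - CRInt h 0 N)%C with ((CRInt h 0 (Rmax N N0) - CRInt h 0 N) + - (CRInt h 0 (Rmax N N0) - l))%C by ring.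
eapply Rle_trans; [apply Cmod_triangle|]. rewrite Cmod_opp. lra.
Qed.

(** Convenient for evaluating an improper integral: no limit has to be taken, only a finite integral compared with [l]. *)
Lemma half_unique : forall c h (l : C), Dh h -> dec c h ->
  (exists c', forall N, 0 <= N -> Cmod (CRInt h 0 N - l)%C <= c' / (1 + N)) -> CRInt_halfline h = l.
Proof.
intros c h l Hh Hd [c' H]. apply Ceq_of_eps. intros eps He.
destruct (nat_large (c + c') eps He) as (N & HN & HNe).
assert (HNR : 0 < INR N) by (apply lt_0_INR, HN).
replace (CRInt_halfline h - l)%C with ((CRInt_halfline h - CRInt h 0 (INR N)) + (CRInt h 0 (INR N) - l))%C by ring.
eapply Rle_trans; [apply Cmod_triangle|].
generalize (half_ex c h Hh Hd (INR N) (Rlt_le _ _ HNR)) (H (INR N) (Rlt_le _ _ HNR)). intros H1 H2.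
assert (0 <= c + c').
{ specialize (H 0 (Rle_refl 0)). generalize (Cmod_ge_0 (CRInt h 0 0 - l)%C) (dec_pos _ _ Hd).
  replace (c' / (1 + 0)) with c' in H by field. lra. }
assert ((c + c') / (1 + INR N) <= (c + c') / INR N).
{ apply Rmult_le_compat_l; [assumption|]. apply Rinv_le_contravar; lra. }
replace ((c + c') / (1 + INR N)) with (c / (1 + INR N) + c' / (1 + INR N)) in * by (field; lra). lra.
Qed.

Lemma half_bound : forall c h, Dh h -> dec c h -> Cmod (CRInt_halfline h) <= c.
Proof.
intros c h Hh Hd. assert (H := half_ex c h Hh Hd 0 (Rle_refl 0)).
rewrite CRInt_point in H. replace (CRInt_halfline h - 0)%C with (CRInt_halfline h) in H by ring.
replace (c / (1 + 0)) with c in H by field. exact H.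
Qed.

Lemma half_plus : forall c c' f g, Dh f -> Dh g -> dec c f -> dec c' g ->
  CRInt_halfline (fun y => f y + g y)%C = (CRInt_halfline f + CRInt_halfline g)%C.
Proof.
intros c c' f g Hf Hg Df Dg. apply (half_unique (c + c')).
- intros r. apply cont_plus; auto.
- intros y Hy. eapply Rle_trans; [apply Cmod_triangle|].
  replace ((c + c') / (1 + y) ^ 2) with (c / (1 + y) ^ 2 + c' / (1 + y) ^ 2) by (field; lra).
  apply Rplus_le_compat; auto.
- exists (c + c'). intros N HN. rewrite CRInt_plus by (apply exC_half; auto; lra).
  match goal with |- Cmod (?A + ?B - (?E + ?F))%C <= _ =>
      replace (A + B - (E + F))%C with (- (E - A) + - (F - B))%C by ring end.
  eapply Rle_trans; [apply Cmod_triangle|]. rewrite !Cmod_opp.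
  replace ((c + c') / (1 + N)) with (c / (1 + N) + c' / (1 + N)) by (field; lra).
  apply Rplus_le_compat; apply half_ex; assumption.
Qed.

Lemma half_scal : forall c k f, Dh f -> dec c f ->
  CRInt_halfline (fun y => k * f y)%C = (k * CRInt_halfline f)%C.
Proof.
intros c k f Hf Df. apply (half_unique (Cmod k * c)).
- intros r. apply cont_mult; [apply cont_const|auto].
- intros y Hy. rewrite Cmod_mult. unfold Rdiv. rewrite Rmult_assoc.
  apply Rmult_le_compat_l; [apply Cmod_ge_0|]. apply Df, Hy.
- exists (Cmod k * c). intros N HN. rewrite CRInt_scal by (apply exC_half; auto; lra).
  match goal with |- Cmod (?A * ?B - ?A * ?F)%C <= _ =>
      replace (A * B - A * F)%C with (- (A * (F - B)))%C by ring end.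
  rewrite Cmod_opp, Cmod_mult. unfold Rdiv. rewrite Rmult_assoc.
  apply Rmult_le_compat_l; [apply Cmod_ge_0|]. apply half_ex; assumption.
Qed.

Lemma half_ext : forall c f g, Dh f -> dec c f -> (forall y, 0 < y -> f y = g y) -> CRInt_halfline g = CRInt_halfline f.
Proof.
intros c f g Hf Df H. apply CRInt_halfline_intro.
- intros N HN. apply (exC_ext f); [lra|intros; apply H; lra|apply exC_half; auto; lra].
- intros eps He. destruct (nat_large c (eps / 2)) as (N0 & HN0 & HNe); [lra|].
  assert (HNR : 0 < INR N0) by (apply lt_0_INR, HN0). assert (Hc := dec_pos _ _ Df).
  exists (INR N0). split; [exact HNR|]. intros N HN.
  rewrite (CRInt_ext g f) by (try lra; intros; symmetry; apply H; lra).
  rewrite Cmod_minus_sym. eapply Rle_lt_trans; [apply (half_ex c); auto; lra|].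
  assert (c / (1 + N) <= c / INR N0); [|lra].
  apply Rmult_le_compat_l; [exact Hc|]. apply Rinv_le_contravar; lra.
Qed.

Definition bddh (g : R -> C) : Prop := exists M, forall y, 0 <= y -> Cmod (g y) <= M.

Lemma dec_mult : forall c M w g, dec c w -> (forall y, 0 <= y -> Cmod (g y) <= M) -> dec (c * M) (fun y => w y * g y)%C.
Proof.
intros c M w g Hw Hg y Hy. rewrite Cmod_mult.
replace (c * M / (1 + y) ^ 2) with (c / (1 + y) ^ 2 * M) by (field; lra).
apply Rmult_le_compat; try apply Cmod_ge_0; auto.
Qed.

(** A fixed weight of quadratic decay makes the improper integral a bounded functional of the other factor. *)
Lemma BLF_half : forall w c, Dh w -> dec c w ->
  BLF (fun y => 0 <= y) (fun g => Dh g /\ bddh g) (fun g => CRInt_halfline (fun y => w y * g y)%C) c.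
Proof.
intros w c Hw Hd.
assert (Hm : forall g, Dh g -> Dh (fun y => w y * g y)%C) by (intros g Hg r; apply cont_mult; auto).
constructor.
- apply (dec_pos _ _ Hd).
- intros g h [Hg [Mg Bg]] [Hh [Mh Bh]]. split.
  + intros r; apply cont_plus; auto.
  + exists (Mg + Mh). intros y Hy. eapply Rle_trans; [apply Cmod_triangle|]. apply Rplus_le_compat; auto.
- intros g h [Hg [Mg Bg]] [Hh [Mh Bh]].
  rewrite <- (half_plus (c * Mg) (c * Mh)) by (auto; apply dec_mult; auto).
  f_equal. apply functional_extensionality. intros y. ring.
- intros k g [Hg [Mg Bg]]. split.
  + intros r; apply cont_mult; [apply cont_const|auto].
  + exists (Cmod k * Mg). intros y Hy. rewrite Cmod_mult. apply Rmult_le_compat_l; [apply Cmod_ge_0|auto].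
- intros k g [Hg [Mg Bg]]. rewrite <- (half_scal (c * Mg)) by (auto; apply dec_mult; auto).
  f_equal. apply functional_extensionality. intros y. ring.
- intros g H. split.
  + apply (Dc_lim (Rmax 0) (fun y => 0 <= y)); [apply Rmax_l|].
    intros eps He. destruct (H eps He) as (h & [Hh _] & B). exists h; auto.
  + destruct (H 1 Rlt_0_1) as (h & [_ [M HM]] & B). exists (1 + M). intros y Hy.
    replace (g y) with ((g y - h y) + h y)%C by ring.
    eapply Rle_trans; [apply Cmod_triangle|]. apply Rplus_le_compat; auto.
- intros g M [Hg _] HM. apply half_bound; [auto|]. apply dec_mult; auto.
Qed.

Lemma exp_dec : forall dl y, 0 < dl -> 0 <= y -> exp (- (dl * y)) <= (Rmax 1 (2 / dl)) ^ 2 / (1 + y) ^ 2.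
Proof.
intros dl y Hd Hy. set (k := Rmax 1 (2 / dl)).
assert (Hk1 : 1 <= k) by apply Rmax_l. assert (Hk2 : 2 / dl <= k) by apply Rmax_r.
assert (He : 1 + y <= k * exp (dl * y / 2)).
{ assert (H := exp_ineq1_le (dl * y / 2)).
  assert (Hkd : 1 <= k * (dl / 2)).
  { replace 1 with (2 / dl * (dl / 2)) by (field; lra). apply Rmult_le_compat_r; lra. }
  apply Rle_trans with (k * (1 + dl * y / 2)); [|apply Rmult_le_compat_l; lra].
  replace (k * (1 + dl * y / 2)) with (k + (k * (dl / 2)) * y) by field. nra. }
assert (Hs : (1 + y) ^ 2 <= k ^ 2 * exp (dl * y)).
{ replace (exp (dl * y)) with (exp (dl * y / 2) ^ 2).
  - rewrite <- Rpow_mult_distr. apply pow_incr. lra.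
  - simpl. rewrite Rmult_1_r, <- exp_plus. f_equal. field. }
rewrite exp_Ropp. assert (0 < exp (dl * y)) by apply exp_pos. assert (0 < (1 + y) ^ 2) by (apply pow_lt; lra).
apply Rmult_le_reg_r with (exp (dl * y) * (1 + y) ^ 2); [apply Rmult_lt_0_compat; assumption|].
replace (/ exp (dl * y) * (exp (dl * y) * (1 + y) ^ 2)) with ((1 + y) ^ 2) by (field; lra).
replace (k ^ 2 / (1 + y) ^ 2 * (exp (dl * y) * (1 + y) ^ 2)) with (k ^ 2 * exp (dl * y)) by (field; lra).
exact Hs.
Qed.

(** * Families with uniform first-order Taylor expansions *)

Definition bdd {S} (P : S -> Prop) (I : R -> Prop) (g : S -> R -> C) : Prop :=
  exists M, 0 <= M /\ forall s y, P s -> I y -> Cmod (g s y) <= M.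

(** Asking for a quadratic remainder on the closed set [I] encodes differentiability, uniform in the parameter and including
    the end points of [I]. *)
Definition tay {S} (P : S -> Prop) (I : R -> Prop) (g g1 : S -> R -> C) : Prop :=
  exists M, 0 <= M /\ forall s y y', P s -> I y -> I y' ->
    Cmod (g s y' - g s y - (y' - y)%R * g1 s y)%C <= M * (y' - y) ^ 2.

Definition lip {S} (P : S -> Prop) (I : R -> Prop) (g : S -> R -> C) : Prop :=
  exists M, 0 <= M /\ forall s y y', P s -> I y -> I y' -> Cmod (g s y - g s y')%C <= M * Rabs (y - y').

Definition coef {S} (P : S -> Prop) (k : S -> C) : Prop := exists M, 0 <= M /\ forall s, P s -> Cmod (k s) <= M.

Section OneVar.
Context {S : Type} (P : S -> Prop) (I : R -> Prop).

Lemma bdd_plus : forall g h, bdd P I g -> bdd P I h -> bdd P I (fun s y => g s y + h s y)%C.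
Proof.
intros g h (M & HM & Hg) (M' & HM' & Hh). exists (M + M'). split; [lra|]. intros s y Hs Hy.
eapply Rle_trans; [apply Cmod_triangle|]. apply Rplus_le_compat; auto.
Qed.

Lemma bdd_scal : forall k g, coef P k -> bdd P I g -> bdd P I (fun s y => k s * g s y)%C.
Proof.
intros k g (M & HM & Hk) (M' & HM' & Hg). exists (M * M'). split; [apply Rmult_le_pos; assumption|]. intros s y Hs Hy.
rewrite Cmod_mult. apply Rmult_le_compat; auto; apply Cmod_ge_0.
Qed.

Lemma tay_plus : forall g g1 h h1, tay P I g g1 -> tay P I h h1 ->
  tay P I (fun s y => g s y + h s y)%C (fun s y => g1 s y + h1 s y)%C.
Proof.
intros g g1 h h1 (M & HM & Hg) (M' & HM' & Hh). exists (M + M'). split; [lra|]. intros s y y' Hs Hy Hy'.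
replace (g s y' + h s y' - (g s y + h s y) - (y' - y)%R * (g1 s y + h1 s y))%C with
 ((g s y' - g s y - (y' - y)%R * g1 s y) + (h s y' - h s y - (y' - y)%R * h1 s y))%C by ring.
eapply Rle_trans; [apply Cmod_triangle|]. rewrite Rmult_plus_distr_r. apply Rplus_le_compat; auto.
Qed.

Lemma tay_scal : forall k g g1, coef P k -> tay P I g g1 -> tay P I (fun s y => k s * g s y)%C (fun s y => k s * g1 s y)%C.
Proof.
intros k g g1 (M & HM & Hk) (M' & HM' & Hg). exists (M * M'). split; [apply Rmult_le_pos; assumption|].
intros s y y' Hs Hy Hy'.
replace (k s * g s y' - k s * g s y - (y' - y)%R * (k s * g1 s y))%C with
 (k s * (g s y' - g s y - (y' - y)%R * g1 s y))%C by ring.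
rewrite Cmod_mult, Rmult_assoc. apply Rmult_le_compat; auto; apply Cmod_ge_0.
Qed.

Lemma tay_lip : forall g g1, bdd P I g -> bdd P I g1 -> tay P I g g1 -> lip P I g.
Proof.
intros g g1 (M0 & H0 & B0) (M1 & H1 & B1) (M & H & B). exists (2 * M0 + M1 + M). split; [lra|].
intros s y' y Hs Hy' Hy. destruct (Rle_dec (Rabs (y' - y)) 1) as [Hd|Hd].
- replace (g s y' - g s y)%C with ((g s y' - g s y - (y' - y)%R * g1 s y) + (y' - y)%R * g1 s y)%C by ring.
  eapply Rle_trans; [apply Cmod_triangle|]. rewrite Cmod_mult, Cmod_R.
  assert (C1 := B s y y' Hs Hy Hy'). assert (C2 := B1 s y Hs Hy).
  rewrite <- (pow2_abs (y' - y)) in C1. assert (0 <= Rabs (y' - y)) by apply Rabs_pos.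
  assert (M * Rabs (y' - y) ^ 2 <= M * Rabs (y' - y)) by (apply Rmult_le_compat_l; [lra|nra]).
  assert (Rabs (y' - y) * Cmod (g1 s y) <= Rabs (y' - y) * M1) by (apply Rmult_le_compat_l; lra). nra.
- unfold Cminus. eapply Rle_trans; [apply Cmod_triangle|]. rewrite Cmod_opp.
  generalize (B0 s y Hs Hy) (B0 s y' Hs Hy'). intros. nra.
Qed.

Lemma tay_ext : forall g g1 h h1, (forall s y, P s -> I y -> g s y = h s y) -> (forall s y, P s -> I y -> g1 s y = h1 s y) ->
  tay P I g g1 -> tay P I h h1.
Proof.
intros g g1 h h1 E E1 (M & HM & H). exists M; split; [exact HM|]. intros s y y' Hs Hy Hy'.
rewrite <- !E, <- E1 by assumption. apply H; assumption.
Qed.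

End OneVar.

Lemma bdd_sub : forall {S S'} (P : S -> Prop) (P' : S' -> Prop) (phi : S' -> S) I g, (forall s, P' s -> P (phi s)) ->
  bdd P I g -> bdd P' I (fun s y => g (phi s) y).
Proof. intros S S' P P' phi I g Hp (M & HM & H). exists M; split; auto. Qed.

Lemma tay_sub : forall {S S'} (P : S -> Prop) (P' : S' -> Prop) (phi : S' -> S) I g g1, (forall s, P' s -> P (phi s)) ->
  tay P I g g1 -> tay P' I (fun s y => g (phi s) y) (fun s y => g1 (phi s) y).
Proof. intros S S' P P' phi I g g1 Hp (M & HM & H). exists M; split; auto. Qed.

Lemma coef_sub : forall {S S'} (P : S -> Prop) (P' : S' -> Prop) (phi : S' -> S) k, (forall s, P' s -> P (phi s)) ->
  coef P k -> coef P' (fun s => k (phi s)).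
Proof. intros S S' P P' phi k Hp (M & HM & H). exists M; split; auto. Qed.

Lemma coef_const : forall {S} (P : S -> Prop) (c : C), coef P (fun _ => c).
Proof. intros. exists (Cmod c). split; [apply Cmod_ge_0|intros; lra]. Qed.

Lemma coef_opp : forall {S} (P : S -> Prop) k, coef P k -> coef P (fun s => - k s)%C.
Proof. intros S P k (M & HM & H). exists M; split; [exact HM|]. intros. rewrite Cmod_opp. auto. Qed.

Lemma taylor_of_lip : forall (p p1 : R -> C) M y y', 0 <= M ->
  (forall r, Rmin y y' <= r <= Rmax y y' -> has_deriv p r (p1 r)) ->
  (forall r, Rmin y y' <= r <= Rmax y y' -> Cmod (p1 r - p1 y)%C <= M * Rabs (r - y)) ->
  Cmod (p y' - p y - (y' - y)%R * p1 y)%C <= M * (y' - y) ^ 2.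
Proof.
intros p p1 M y y' HM Hp Hl.
assert (H := deriv_lip_abs (fun r => p r - RtoC r * p1 y)%C (fun r => p1 r - p1 y)%C (M * Rabs (y' - y)) y y').
replace (p y' - p y - (y' - y)%R * p1 y)%C with (p y' - y' * p1 y - (p y - y * p1 y))%C
  by (rewrite RtoC_minus; ring).
rewrite <- (pow2_abs (y' - y)). replace (M * Rabs (y' - y) ^ 2) with (M * Rabs (y' - y) * Rabs (y' - y)) by ring.
apply H.
- intros r Hr. apply has_deriv_minus; [apply Hp, Hr|].
  eapply has_deriv_eq; [apply has_deriv_mult; [apply has_deriv_id|apply has_deriv_const]|]. cbv beta. ring.
- intros r Hr. eapply Rle_trans; [apply Hl, Hr|]. apply Rmult_le_compat_l; [exact HM|].
  revert Hr. unfold Rmin, Rmax. destruct Rle_dec; unfold Rabs; repeat destruct Rcase_abs; lra.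
Qed.

Definition interval0 (I : R -> Prop) : Prop := I 0 /\ (forall y, I y -> 0 <= y) /\ (forall y r, I y -> 0 <= r <= y -> I r).

Lemma interval0_nonneg : interval0 (fun y => 0 <= y).
Proof. split; [lra|split]; intros; lra. Qed.

Lemma interval0_seg : forall T, 0 <= T -> interval0 (fun y => 0 <= y <= T).
Proof. intros. split; [lra|split]; intros; lra. Qed.

Lemma interval0_between : forall I a b r, interval0 I -> I a -> I b -> Rmin a b <= r <= Rmax a b -> I r.
Proof.
intros I a b r (H0 & Hp & Hc) Ha Hb Hr. generalize (Hp _ Ha) (Hp _ Hb). intros.
unfold Rmin, Rmax in Hr. destruct (Rle_dec a b); [apply (Hc b)|apply (Hc a)]; auto; lra.
Qed.

Lemma tay_of_deriv2 : forall {S} (P : S -> Prop) I (g g1 g2 : S -> R -> C), interval0 I ->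
  (forall s y, P s -> I y -> has_deriv (g s) y (g1 s y)) -> (forall s y, P s -> I y -> has_deriv (g1 s) y (g2 s y)) ->
  bdd P I g2 -> tay P I g g1.
Proof.
intros S P I g g1 g2 HI Hg Hg1 (M & HM & H2). exists M. split; [exact HM|]. intros s y y' Hs Hy Hy'.
apply taylor_of_lip; [exact HM| |].
- intros r Hr. apply Hg; [exact Hs|]. apply (interval0_between I y y'); assumption.
- intros r Hr. apply (deriv_lip_abs (g1 s) (g2 s)).
  + intros q Hq. apply Hg1; [exact Hs|]. apply (interval0_between I y r); auto. apply (interval0_between I y y'); assumption.
  + intros q Hq. apply H2; [exact Hs|]. apply (interval0_between I y r); auto. apply (interval0_between I y y'); assumption.
Qed.

(** ** Bounded linear functionals applied to families *)

Section BLF_density.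
Context {S1 S2 : Type} (P1 : S2 -> S1 -> Prop) (P2 : S2 -> Prop) (D : S2 -> (S1 -> C) -> Prop) (L : S2 -> (S1 -> C) -> C) (Lam : R).
Hypothesis HL : forall s2, P2 s2 -> BLF (P1 s2) (D s2) (L s2) Lam.
Variable I : R -> Prop.

Lemma bdd_blf : forall g : S2 -> R -> S1 -> C,
  bdd (fun s : S2 * S1 => P2 (fst s) /\ P1 (fst s) (snd s)) I (fun s y => g (fst s) y (snd s)) ->
  (forall s y, P2 s -> I y -> D s (g s y)) ->
  bdd P2 I (fun s y => L s (g s y)).
Proof.
intros g (M & HM & H) HD. exists (Rabs Lam * M). split; [apply Rmult_le_pos; [apply Rabs_pos|exact HM]|].
intros s y Hs Hy.
eapply Rle_trans; [apply (blf_bound _ _ _ _ (HL s Hs)) with (M := M)|].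
- apply HD; assumption.
- intros s1 Hs1. apply (H (s, s1)); auto.
- apply Rmult_le_compat_r; [exact HM|apply Rle_abs].
Qed.

Lemma tay_blf : forall g g1 : S2 -> R -> S1 -> C,
  tay (fun s : S2 * S1 => P2 (fst s) /\ P1 (fst s) (snd s)) I (fun s y => g (fst s) y (snd s)) (fun s y => g1 (fst s) y (snd s)) ->
  (forall s y, P2 s -> I y -> D s (g s y)) -> (forall s y, P2 s -> I y -> D s (g1 s y)) ->
  tay P2 I (fun s y => L s (g s y)) (fun s y => L s (g1 s y)).
Proof.
intros g g1 (M & HM & H) HD HD1. exists (Rabs Lam * M). split; [apply Rmult_le_pos; [apply Rabs_pos|exact HM]|].
intros s y y' Hs Hy Hy'. assert (HLs := HL s Hs).
assert (DA := HD s y Hs Hy). assert (DA' := HD s y' Hs Hy'). assert (DB := HD1 s y Hs Hy).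
eapply Rle_trans; [apply (blf_lin_bound HLs) with (M := M * (y' - y) ^ 2); try assumption|].
- intros s1 Hs1. apply (H (s, s1)); auto.
- rewrite <- Rmult_assoc. apply Rmult_le_compat_r; [apply pow2_ge_0|].
  apply Rmult_le_compat_r; [exact HM|apply Rle_abs].
Qed.

(** [g1 s y] is a uniform limit of difference quotients, hence stays admissible. *)
Lemma tay_D : forall g g1 : S2 -> R -> S1 -> C,
  tay (fun s : S2 * S1 => P2 (fst s) /\ P1 (fst s) (snd s)) I (fun s y => g (fst s) y (snd s)) (fun s y => g1 (fst s) y (snd s)) ->
  (forall y eps, I y -> 0 < eps -> exists y', I y' /\ y' <> y /\ Rabs (y' - y) < eps) ->
  (forall s y, P2 s -> I y -> D s (g s y)) ->
  forall s y, P2 s -> I y -> D s (g1 s y).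
Proof.
intros g g1 (M & HM & H) HI HD s y Hs Hy. assert (HLs := HL s Hs).
apply (blf_lim _ _ _ _ HLs). intros eps He.
destruct (HI y (eps / (M + 1)) Hy) as (y' & Hy' & Hne & Hd); [apply Rdiv_lt_0_compat; lra|].
exists (fun s1 => / (y' - y)%R * (g s y' s1 - g s y s1))%C. split.
- apply (blf_scal_D _ _ _ _ HLs), (blf_minus_D HLs); apply HD; assumption.
- intros s1 Hs1. assert (B := H (s, s1) y y' (conj Hs Hs1) Hy Hy'). cbn [fst snd] in B.
  assert (Hn : RtoC (y' - y) <> 0%C) by (intros E; apply RtoC_inj in E; lra).
  replace (g1 s y s1 - / (y' - y)%R * (g s y' s1 - g s y s1))%C with
    (- (/ (y' - y)%R * (g s y' s1 - g s y s1 - (y' - y)%R * g1 s y s1)))%C by (field; exact Hn).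
  rewrite Cmod_opp, Cmod_mult, Cmod_inv, Cmod_R by exact Hn.
  assert (Hp : 0 < Rabs (y' - y)) by (apply Rabs_pos_lt; lra).
  rewrite <- (pow2_abs (y' - y)) in B.
  apply Rmult_le_reg_l with (Rabs (y' - y)); [exact Hp|]. rewrite <- Rmult_assoc, Rinv_r, Rmult_1_l by lra.
  eapply Rle_trans; [exact B|].
  assert (M * Rabs (y' - y) <= eps).
  { apply Rle_trans with ((M + 1) * Rabs (y' - y)); [nra|].
    replace eps with ((M + 1) * (eps / (M + 1))) by (field; lra). apply Rmult_le_compat_l; lra. }
  nra.
Qed.
End BLF_density.

(** ** The Duhamel integral *)

(** The solution of [p' = a p + g], [p 0 = 0]. *)
Definition duh (a : C) (g : R -> C) (y : R) : C := CRInt (fun r => Cexp (a * (y - r)%R) * g r)%C 0 y.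

Lemma cont_duh_weight : forall a y r, cont (fun r => Cexp (a * (y - r)%R))%C r.
Proof.
intros a y r. apply cont_Cexp, cont_mult; [apply cont_const|]. apply cont_RtoC.
apply (continuous_minus (V := R_NormedModule)); [apply continuous_const|apply continuous_id].
Qed.

(** It suffices to bound the functional on everywhere continuous integrands, since [g] can be composed with the projection to
    the segment. *)
Lemma BLF_duh : forall a y kap, 0 <= y -> 0 <= kap ->
  (forall g M, (forall r, cont g r) -> (forall r, 0 <= r <= y -> Cmod (g r) <= M) -> Cmod (duh a g y) <= kap * M) ->
  BLF (fun r => 0 <= r <= y) (Dc (clamp 0 y)) (fun g => duh a g y) kap.
Proof.
intros a y kap Hy Hk Hb.
assert (HB := BLF_RInt 0 y Hy).
assert (Hw : forall g, Dc (clamp 0 y) g -> Dc (clamp 0 y) (fun r => Cexp (a * (y - r)%R) * g r)%C).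
{ intros g Hg r. apply cont_mult; [|apply Hg].
  apply (cont_comp_lip (fun r => Cexp (a * (y - r)%R))%C); [apply clamp_lip|apply cont_duh_weight]. }
constructor.
- exact Hk.
- apply (blf_plus_D _ _ _ _ HB).
- intros g h Hg Hh. unfold duh. rewrite <- (blf_plus _ _ _ _ HB) by auto. f_equal.
  apply functional_extensionality; intros r; ring.
- apply (blf_scal_D _ _ _ _ HB).
- intros c g Hg. unfold duh. rewrite <- (blf_scal _ _ _ _ HB) by auto. f_equal.
  apply functional_extensionality; intros r; ring.
- apply (blf_lim _ _ _ _ HB).
- intros g M Hg HM. replace (duh a g y) with (duh a (fun r => g (clamp 0 y r)) y).
  + apply Hb; [exact Hg|]. intros r Hr. apply HM, clamp_in, Hy.
  + apply CRInt_ext; [exact Hy|]. intros r Hr. rewrite clamp_id by lra. reflexivity.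
Qed.

(** Uniform in [y] thanks to the decay of the weight. *)
Lemma BLF_duh_dec : forall a y dl, 0 <= y -> 0 < dl -> Re a <= - dl ->
  BLF (fun r => 0 <= r <= y) (Dc (clamp 0 y)) (fun g => duh a g y) (/ dl).
Proof.
intros a y dl Hy Hd Ha. assert (Hdi : 0 < / dl) by (apply Rinv_0_lt_compat, Hd).
apply BLF_duh; [exact Hy|lra|]. intros g M Hg HM.
assert (HM0 : 0 <= M) by (eapply Rle_trans; [apply Cmod_ge_0|apply (HM 0); lra]).
apply Rle_trans with (M / dl * exp (- dl * (y - y)) - M / dl * exp (- dl * (y - 0))).
- apply (CRInt_dom _ (fun r => M / dl * exp (- dl * (y - r))) (fun r => M * exp (- dl * (y - r)))); [exact Hy| | |].
  + intros z. apply cont_mult; [apply cont_duh_weight|apply Hg].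
  + intros r _. auto_derive; [exact I|unfold Rminus; field; lra].
  + intros r Hr. rewrite Cmod_mult, Cmod_Cexp, Rmult_comm. apply Rmult_le_compat; try apply Cmod_ge_0.
    * left; apply exp_pos.
    * apply HM, Hr.
    * apply exp_le. simpl. unfold Re in Ha. nra.
- replace (- dl * (y - y)) with 0 by ring. rewrite exp_0.
  assert (0 < exp (- dl * (y - 0))) by apply exp_pos.
  assert (0 <= M / dl) by (apply Rdiv_le_0_compat; lra). unfold Rdiv in *. nra.
Qed.

Lemma BLF_duh_seg : forall a y A T, 0 <= y <= T -> Cmod a <= A ->
  BLF (fun r => 0 <= r <= y) (Dc (clamp 0 y)) (fun g => duh a g y) (T * exp (A * T)).
Proof.
intros a y A T Hy HA. assert (0 <= A) by (eapply Rle_trans; [apply Cmod_ge_0|exact HA]).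
assert (He : 0 < exp (A * T)) by apply exp_pos.
apply BLF_duh; [lra|apply Rmult_le_pos; lra|]. intros g M Hg HM.
assert (HM0 : 0 <= M) by (eapply Rle_trans; [apply Cmod_ge_0|apply (HM 0); lra]).
eapply Rle_trans; [apply (CRInt_bound _ 0 y (exp (A * T) * M)); [lra| |]|].
- apply exC_cont. intros z. apply cont_mult; [apply cont_duh_weight|apply Hg].
- intros r Hr. rewrite Cmod_mult, Cmod_Cexp. apply Rmult_le_compat; try apply Cmod_ge_0.
  + left; apply exp_pos.
  + apply exp_le. eapply Rle_trans; [apply Rle_abs|]. eapply Rle_trans; [apply re_le_Cmod|].
    rewrite Cmod_mult, Cmod_R, Rabs_pos_eq by lra. apply Rmult_le_compat; try lra; apply Cmod_ge_0.
  + apply HM, Hr.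
- assert (0 <= exp (A * T) * M) by (apply Rmult_le_pos; lra). nra.
Qed.

Section Duhamel.
Context {S : Type} (P : S -> Prop) (I : R -> Prop) (HI : interval0 I) (a : S -> C) (kap : R) (g : S -> R -> C).
Hypothesis Ha : coef P a.
Hypothesis HB : forall s y, P s -> I y -> BLF (fun r => 0 <= r <= y) (Dc (clamp 0 y)) (fun g => duh (a s) g y) kap.
Hypothesis Hgb : bdd P I g.
Hypothesis Hgl : lip P I g.

Lemma lip_Dc_clamp : forall s y, P s -> I y -> Dc (clamp 0 y) (g s).
Proof.
intros s y Hs Hy. destruct HI as (_ & Hp & Hc). destruct Hgl as (M & HM & H).
apply Dc_clamp_lip with M; [apply Hp, Hy|]. intros; apply H; auto; apply (Hc y); auto.
Qed.

Lemma duh_bdd : bdd P I (fun s y => duh (a s) (g s) y).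
Proof.
destruct Hgb as (M & HM & H). exists (Rabs kap * M). split; [apply Rmult_le_pos; [apply Rabs_pos|exact HM]|].
intros s y Hs Hy. destruct HI as (_ & Hp & Hc).
eapply Rle_trans; [apply (blf_bound _ _ _ _ (HB s y Hs Hy)) with (M := M)|].
- apply lip_Dc_clamp; assumption.
- intros r Hr. apply H; [exact Hs|]. apply (Hc y); auto.
- apply Rmult_le_compat_r; [exact HM|apply Rle_abs].
Qed.

(** Beyond [Y] the integrand is frozen, so that [p] is differentiable on the whole line and one-sided derivatives are
    avoided. *)
Lemma duh_deriv : forall s Y, P s -> I Y ->
  exists p, (forall y, 0 <= y <= Y -> p y = duh (a s) (g s) y) /\
    (forall y, has_deriv p y (a s * p y + g s (clamp 0 Y y))%C).
Proof.
intros s Y Hs HY. destruct HI as (_ & Hp & Hc). assert (HY0 := Hp Y HY).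
exists (fun y : R => Cexp (a s * y)%C * CRInt (fun r : R => Cexp (- a s * r) * g s (clamp 0 Y r))%C 0 y)%C.
assert (Hcont : forall z, cont (fun r : R => Cexp (- a s * r) * g s (clamp 0 Y r))%C z).
{ intros z. apply cont_mult; [apply cont_Cexp_lin|apply lip_Dc_clamp; assumption]. }
split.
- intros y Hy. rewrite <- CRInt_scal by (apply exC_cont, Hcont). apply CRInt_ext; [lra|].
  intros r Hr. rewrite clamp_id by lra. rewrite Cmult_assoc, <- Cexp_add. f_equal. f_equal.
  rewrite RtoC_minus. ring.
- intros y. eapply has_deriv_eq.
  + apply has_deriv_mult; [apply has_deriv_Cexp_lin|]. apply CRInt_deriv, Hcont.
  + cbv beta. rewrite <- (Cmult_assoc (a s)). f_equal. rewrite Cmult_assoc, <- Cexp_add.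
    replace (a s * y + - a s * y)%C with (RtoC 0) by ring. rewrite Cexp_0. ring.
Qed.

Lemma duh_lip : lip P I (fun s y => duh (a s) (g s) y).
Proof.
destruct duh_bdd as (Mp & HMp & Hpb). destruct Hgb as (Mg & HMg & Hgb'). destruct Ha as (A & HA & Ha').
exists (A * Mp + Mg). split; [generalize (Rmult_le_pos _ _ HA HMp); lra|].
assert (K : forall s y y', P s -> I y -> I y' -> y <= y' -> Cmod (duh (a s) (g s) y' - duh (a s) (g s) y)%C <= (A * Mp + Mg) * (y' - y)).
{ intros s y y' Hs Hy Hy' Hyy. destruct HI as (_ & Hp & Hc). assert (H0 := Hp _ Hy).
  destruct (duh_deriv s y' Hs Hy') as (p & Ep & Dp).
  rewrite <- !Ep by lra. apply (deriv_lip p (fun r => a s * p r + g s (clamp 0 y' r))%C); [exact Hyy|intros; apply Dp|].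
  intros r Hr. assert (Ir : I r) by (apply (Hc y'); auto; lra).
  eapply Rle_trans; [apply Cmod_triangle|]. rewrite Cmod_mult, clamp_id by lra.
  apply Rplus_le_compat; [|apply Hgb'; assumption].
  apply Rmult_le_compat; try apply Cmod_ge_0; [apply Ha', Hs|]. rewrite Ep by lra. apply Hpb; assumption. }
intros s y y' Hs Hy Hy'. destruct (Rle_dec y y').
- rewrite Cmod_minus_sym, Rabs_minus_sym, Rabs_pos_eq by lra. apply K; auto.
- rewrite Rabs_pos_eq by lra. apply K; auto; lra.
Qed.

Lemma duh_tay : tay P I (fun s y => duh (a s) (g s) y) (fun s y => a s * duh (a s) (g s) y + g s y)%C.
Proof.
destruct duh_lip as (Mp & HMp & Hpl). destruct Hgl as (Mg & HMg & Hgl'). destruct Ha as (A & HA & Ha').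
exists (A * Mp + Mg). assert (HM : 0 <= A * Mp + Mg) by (generalize (Rmult_le_pos _ _ HA HMp); lra).
split; [exact HM|]. intros s y y' Hs Hy Hy'.
set (Y := Rmax y y'). assert (HY : I Y) by (unfold Y, Rmax; destruct Rle_dec; assumption).
destruct (duh_deriv s Y Hs HY) as (p & Ep & Dp).
assert (H0 : 0 <= y) by (apply HI, Hy). assert (H0' : 0 <= y') by (apply HI, Hy').
assert (HyY : y <= Y) by apply Rmax_l. assert (HyY' : y' <= Y) by apply Rmax_r.
rewrite <- !Ep by lra. replace (g s y) with (g s (clamp 0 Y y)) by (rewrite clamp_id by lra; reflexivity).
apply (taylor_of_lip p (fun r => a s * p r + g s (clamp 0 Y r))%C); [exact HM|intros; apply Dp|].
intros r Hr. assert (Ir : I r) by (apply (interval0_between I y y'); assumption).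
assert (Hr0 : 0 <= r) by (apply HI, Ir). assert (r <= Y) by apply Hr.
rewrite !clamp_id by lra. rewrite !Ep by lra.
match goal with |- Cmod (?A * ?B + ?E - (?A * ?B' + ?E'))%C <= _ =>
  replace (A * B + E - (A * B' + E'))%C with (A * (B - B') + (E - E'))%C by ring end.
eapply Rle_trans; [apply Cmod_triangle|]. rewrite Cmod_mult, Rmult_plus_distr_r, (Rmult_assoc A).
apply Rplus_le_compat; [|apply Hgl'; assumption].
apply Rmult_le_compat; try apply Cmod_ge_0; [apply Ha', Hs|]. apply Hpl; assumption.
Qed.
End Duhamel.

(** * Tame families on the closed quadrant *)

Notation halfR := (fun y : R => 0 <= y).
Notation segR T := (fun t : R => 0 <= t <= T).

Definition parT {S} (P : S -> Prop) (T : R) (st : S * R) : Prop := P (fst st) /\ 0 <= snd st <= T.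
Definition parX {S} (P : S -> Prop) (sx : S * R) : Prop := P (fst sx) /\ 0 <= snd sx.

(** [G n m] plays the partial derivative of order [n] in [x] and [m] in [t]; the bounds are uniform in the parameter, in
    [x >= 0] and in [0 <= t <= T].  The expansions hold up to the boundary, so that no one-sided derivative has to be mentioned. *)
Definition tame {S} (P : S -> Prop) (G : nat -> nat -> S -> R -> R -> C) : Prop :=
  forall T, 0 < T -> forall n m,
    bdd (parT P T) halfR (fun st x => G n m (fst st) x (snd st)) /\
    tay (parT P T) halfR (fun st x => G n m (fst st) x (snd st)) (fun st x => G (Datatypes.S n) m (fst st) x (snd st)) /\
    tay (parX P) (segR T) (fun sx t => G n m (fst sx) (snd sx) t) (fun sx t => G n (Datatypes.S m) (fst sx) (snd sx) t).

Section Tame.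
Context {S : Type} {P : S -> Prop}.
Implicit Types G H : nat -> nat -> S -> R -> R -> C.

Lemma tame_bt : forall G, tame P G -> forall T, 0 < T -> forall n m,
  bdd (parX P) (segR T) (fun sx t => G n m (fst sx) (snd sx) t).
Proof.
intros G HG T HT n m. destruct (HG T HT n m) as ((M & HM & B) & _). exists M; split; [exact HM|].
intros [s x] t [Hs Hx] Ht. apply (B (s, t) x); [split|]; assumption.
Qed.

Lemma tame_lipx : forall G, tame P G -> forall T, 0 < T -> forall n m,
  lip (parT P T) halfR (fun st x => G n m (fst st) x (snd st)).
Proof.
intros G HG T HT n m. eapply tay_lip; [apply HG; exact HT| |apply HG; exact HT].
apply (HG T HT (Datatypes.S n) m).
Qed.

Lemma tame_lipt : forall G, tame P G -> forall T, 0 < T -> forall n m,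
  lip (parX P) (segR T) (fun sx t => G n m (fst sx) (snd sx) t).
Proof.
intros G HG T HT n m. eapply tay_lip; [apply tame_bt; assumption| |apply HG; exact HT].
apply (tame_bt G HG T HT n (Datatypes.S m)).
Qed.

Lemma tame_plus : forall G H, tame P G -> tame P H -> tame P (fun n m s x t => G n m s x t + H n m s x t)%C.
Proof.
intros G H HG HH T HT n m. destruct (HG T HT n m) as (a & b & c). destruct (HH T HT n m) as (a' & b' & c').
split; [|split].
- exact (bdd_plus _ _ _ _ a a').
- exact (tay_plus _ _ _ _ _ _ b b').
- exact (tay_plus _ _ _ _ _ _ c c').
Qed.

Lemma tame_scal : forall k G, coef P k -> tame P G -> tame P (fun n m s x t => k s * G n m s x t)%C.
Proof.
intros k G Hk HG T HT n m. destruct (HG T HT n m) as (a & b & c).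
assert (k1 : coef (parT P T) (fun st => k (fst st))) by (apply (coef_sub P); [intros s Hs; apply Hs|exact Hk]).
assert (k2 : coef (parX P) (fun st => k (fst st))) by (apply (coef_sub P); [intros s Hs; apply Hs|exact Hk]).
split; [|split].
- exact (bdd_scal _ _ _ _ k1 a).
- exact (tay_scal _ _ _ _ _ k1 b).
- exact (tay_scal _ _ _ _ _ k2 c).
Qed.

Lemma tame_sep : forall (X H : nat -> S -> R -> C),
  (forall n, bdd P halfR (X n) /\ tay P halfR (X n) (X (Datatypes.S n))) ->
  (forall T, 0 < T -> forall m, bdd P (segR T) (H m) /\ tay P (segR T) (H m) (H (Datatypes.S m))) ->
  tame P (fun n m s x t => H m s t * X n s x)%C.
Proof.
intros X H HX HH T HT n m. destruct (HX n) as (a & b). destruct (HH T HT m) as (c & d).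
assert (k1 : coef (parT P T) (fun st => H m (fst st) (snd st))).
{ destruct c as (M & HM & B). exists M; split; [exact HM|]. intros [s t] [Hs Ht]. apply B; assumption. }
assert (k2 : coef (parX P) (fun sx => X n (fst sx) (snd sx))).
{ destruct a as (M & HM & B). exists M; split; [exact HM|]. intros [s t] [Hs Ht]. apply B; assumption. }
split; [|split].
- exact (bdd_scal _ _ _ (fun st x => X n (fst st) x) k1 (bdd_sub P _ fst _ (X n) (fun st Hs => proj1 Hs) a)).
- exact (tay_scal _ _ _ (fun st x => X n (fst st) x) (fun st x => X (Datatypes.S n) (fst st) x) k1
    (tay_sub P _ fst _ (X n) (X (Datatypes.S n)) (fun st Hs => proj1 Hs) b)).
- eapply tay_ext; [| |exact (tay_scal _ _ _ (fun sx t => H m (fst sx) t) (fun sx t => H (Datatypes.S m) (fst sx) t) k2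
    (tay_sub P _ fst _ (H m) (H (Datatypes.S m)) (fun st Hs => proj1 Hs) d))]; intros; cbv beta; ring.
Qed.

(** The Duhamel integral in [x] with its jet, which is forced by [p_x = a p + g]. *)
Fixpoint duhx (a : S -> C) G (n m : nat) (s : S) (x t : R) : C :=
  match n with
  | O => duh (a s) (fun y => G 0%nat m s y t) x
  | Datatypes.S k => (a s * duhx a G k m s x t + G k m s x t)%C
  end.

(** The weight decays, so the estimates hold for all [x >= 0]; the expansion in [t] is the one of [G] under the integral. *)
Lemma tame_duhx : forall a G dl, 0 < dl -> coef P a -> (forall s, P s -> Re (a s) <= - dl) ->
  tame P G -> tame P (duhx a G).
Proof.
intros a G dl Hdl Ha Hre HG T HT n m.
assert (k1 : coef (parT P T) (fun st => a (fst st))) by (apply (coef_sub P); [intros s Hs; apply Hs|exact Ha]).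
assert (k2 : coef (parX P) (fun st => a (fst st))) by (apply (coef_sub P); [intros s Hs; apply Hs|exact Ha]).
induction n as [|n (IHa & IHb & IHc)].
- assert (B1 : forall s y, parT P T s -> 0 <= y ->
    BLF (fun r => 0 <= r <= y) (Dc (clamp 0 y)) (fun g => duh (a (fst s)) g y) (/ dl)).
  { intros [s t] y [Hs Ht] Hy. apply BLF_duh_dec; auto. }
  assert (L := tame_lipx G HG T HT 0 m). destruct (HG T HT 0%nat m) as (b & _ & d).
  split; [|split].
  + apply (duh_bdd (parT P T) halfR interval0_nonneg _ _ (fun st x => G 0%nat m (fst st) x (snd st)) B1 b L).
  + apply (duh_tay (parT P T) halfR interval0_nonneg _ _ (fun st x => G 0%nat m (fst st) x (snd st)) k1 B1 b L).
  + apply (tay_blf (S1 := R) (S2 := S * R) (fun sx y => 0 <= y <= snd sx) (parX P) (fun sx => Dc (clamp 0 (snd sx)))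
      (fun sx g => duh (a (fst sx)) g (snd sx)) (/ dl)) with
      (g := fun sx t y => G 0%nat m (fst sx) y t) (g1 := fun sx t y => G 0%nat (Datatypes.S m) (fst sx) y t).
    * intros [s x] [Hs Hx]. apply BLF_duh_dec; auto.
    * apply (tay_sub (parX P) _ (fun s : (S * R) * R => (fst (fst s), snd s)) _ (fun sx t => G 0%nat m (fst sx) (snd sx) t)
        (fun sx t => G 0%nat (Datatypes.S m) (fst sx) (snd sx) t)); [|exact d].
      intros [[s x] y] [[Hs Hx] Hy]. split; simpl in *; [assumption|lra].
    * intros [s x] t [Hs Hx] Ht. apply (lip_Dc_clamp (parT P T) halfR interval0_nonneg (fun st x => G 0%nat m (fst st) x (snd st)) L (s, t)); [split|]; assumption.
    * intros [s x] t [Hs Hx] Ht. apply (lip_Dc_clamp (parT P T) halfR interval0_nonneg (fun st x => G 0%nat (Datatypes.S m) (fst st) x (snd st))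
        (tame_lipx G HG T HT 0 (Datatypes.S m)) (s, t)); [split|]; assumption.
- destruct (HG T HT n m) as (b & c & d). split; [|split].
  + exact (bdd_plus _ _ _ _ (bdd_scal _ _ _ _ k1 IHa) b).
  + exact (tay_plus _ _ _ _ _ _ (tay_scal _ _ _ _ _ k1 IHb) c).
  + exact (tay_plus _ _ _ _ _ _ (tay_scal _ _ _ _ _ k2 IHc) d).
Qed.

(** The Duhamel integral in [t]; the roles of the variables are exchanged and only bounded times are controlled. *)
Fixpoint duht (a : S -> C) G (n m : nat) (s : S) (x t : R) : C :=
  match m with
  | O => duh (a s) (fun r => G n 0%nat s x r) t
  | Datatypes.S k => (a s * duht a G n k s x t + G n k s x t)%C
  end.

Lemma tame_duht : forall a G, coef P a -> tame P G -> tame P (duht a G).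
Proof.
intros a G Ha HG T HT n m. revert n.
assert (k1 : coef (parT P T) (fun st => a (fst st))) by (apply (coef_sub P); [intros s Hs; apply Hs|exact Ha]).
assert (k2 : coef (parX P) (fun st => a (fst st))) by (apply (coef_sub P); [intros s Hs; apply Hs|exact Ha]).
destruct Ha as (A & HA & Ha').
assert (HT0 : 0 <= T) by lra. assert (HI := interval0_seg T HT0).
assert (B1 : forall s y, parX P s -> 0 <= y <= T ->
    BLF (fun r => 0 <= r <= y) (Dc (clamp 0 y)) (fun g => duh (a (fst s)) g y) (T * exp (A * T))).
{ intros [s x] y [Hs Hx] Hy. apply BLF_duh_seg; auto. }
assert (DD : forall n s x t, P s -> 0 <= x -> 0 <= t <= T -> Dc (clamp 0 t) (fun r => G n 0%nat s x r)).
{ intros n s x t Hs Hx Ht. apply (lip_Dc_clamp (parX P) (segR T) HI (fun sx t => G n 0%nat (fst sx) (snd sx) t)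
    (tame_lipt G HG T HT n 0) (s, x)); [split|]; assumption. }
induction m as [|m IH]; intros n.
- assert (L := tame_lipt G HG T HT n 0). destruct (HG T HT n 0%nat) as (b & c & d).
  assert (bt := tame_bt G HG T HT n 0).
  assert (E := duh_bdd (parX P) (segR T) HI _ _ (fun sx t => G n 0%nat (fst sx) (snd sx) t) B1 bt L).
  split; [|split].
  + destruct E as (M & HM & E). exists M. split; [exact HM|].
    intros [s t] x [Hs Ht] Hx. apply (E (s, x) t); [split|]; assumption.
  + apply (tay_blf (S1 := R) (S2 := S * R) (fun st y => 0 <= y <= snd st) (parT P T) (fun st => Dc (clamp 0 (snd st)))
      (fun st g => duh (a (fst st)) g (snd st)) (T * exp (A * T))) with
      (g := fun st x r => G n 0%nat (fst st) x r) (g1 := fun st x r => G (Datatypes.S n) 0%nat (fst st) x r).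
    * intros [s t] [Hs Ht]. apply BLF_duh_seg; auto.
    * apply (tay_sub (parT P T) _ (fun s : (S * R) * R => (fst (fst s), snd s)) _ (fun st x => G n 0%nat (fst st) x (snd st))
        (fun st x => G (Datatypes.S n) 0%nat (fst st) x (snd st))); [|exact c].
      intros [[s t] y] [[Hs Ht] Hy]. split; simpl in *; [assumption|lra].
    * intros [s t] x [Hs Ht] Hx. apply DD; assumption.
    * intros [s t] x [Hs Ht] Hx. apply DD; assumption.
  + apply (duh_tay (parX P) (segR T) HI _ _ (fun sx t => G n 0%nat (fst sx) (snd sx) t) k2 B1 bt L).
- destruct (HG T HT n m) as (b & c & d). destruct (IH n) as (IHa & IHb & IHc). split; [|split].
  + exact (bdd_plus _ _ _ _ (bdd_scal _ _ _ _ k1 IHa) b).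
  + exact (tay_plus _ _ _ _ _ _ (tay_scal _ _ _ _ _ k1 IHb) c).
  + exact (tay_plus _ _ _ _ _ _ (tay_scal _ _ _ _ _ k2 IHc) d).
Qed.

(** Translating the variable keeps the domain of integration fixed, so that derivatives fall on [G] alone. *)
Definition lap (a : S -> C) G (n m : nat) (s : S) (x t : R) : C :=
  CRInt_halfline (fun y => Cexp (a s * y) * G n m s (x + y)%R t)%C.

Lemma Dh_exp : forall a : C, Dh (fun y : R => Cexp (a * y)).
Proof. intros a. apply Dc_of_cont; [apply Rmax0_lip|]. intros; apply cont_Cexp_lin. Qed.

Lemma dec_exp : forall (a : C) dl, 0 < dl -> Re a <= - dl -> dec ((Rmax 1 (2 / dl)) ^ 2) (fun y : R => Cexp (a * y)).
Proof.
intros a dl Hd Ha y Hy. rewrite Cmod_Cexp. eapply Rle_trans; [|apply (exp_dec dl y Hd Hy)].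
apply exp_le. simpl. unfold Re in Ha. nra.
Qed.

Lemma tame_Dh : forall G, tame P G -> forall n m s x t, P s -> 0 <= x -> 0 <= t ->
  Dh (fun y => G n m s (x + y)%R t) /\ bddh (fun y => G n m s (x + y)%R t).
Proof.
intros G HG n m s x t Hs Hx Ht. assert (HT : 0 < t + 1) by lra.
destruct (tame_lipx G HG (t + 1) HT n m) as (M & HM & L).
destruct (HG (t + 1) HT n m) as ((M' & HM' & B) & _).
assert (Ht' : parT P (t + 1) (s, t)) by (split; simpl; [assumption|lra]).
split.
- apply Dc_lip with M; [apply Rmax0_lip|]. intros r r'.
  assert (0 <= Rmax 0 r) by apply Rmax_l. assert (0 <= Rmax 0 r') by apply Rmax_l.
  replace (Rmax 0 r - Rmax 0 r') with ((x + Rmax 0 r) - (x + Rmax 0 r')) by ring.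
  apply (L (s, t)); [exact Ht'|lra|lra].
- exists M'. intros y Hy. apply (B (s, t) (x + y)); [exact Ht'|lra].
Qed.

Lemma tame_lap : forall a G dl, 0 < dl -> (forall s, P s -> Re (a s) <= - dl) ->
  tame P G -> tame P (lap a G).
Proof.
intros a G dl Hdl Hre HG T HT n m.
pose (cst := (Rmax 1 (2 / dl)) ^ 2).
assert (HB : forall s, P s -> BLF halfR (fun g => Dh g /\ bddh g) (fun g => CRInt_halfline (fun y => Cexp (a s * y) * g y)%C) cst).
{ intros s Hs. apply BLF_half; [apply Dh_exp|]. apply dec_exp; auto. }
assert (HBT : forall st, parT P T st -> BLF halfR (fun g => Dh g /\ bddh g) (fun g => CRInt_halfline (fun y => Cexp (a (fst st) * y) * g y)%C) cst)
  by (intros [s t] [Hs Ht]; apply HB, Hs).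
assert (HBX : forall st, parX P st -> BLF halfR (fun g => Dh g /\ bddh g) (fun g => CRInt_halfline (fun y => Cexp (a (fst st) * y) * g y)%C) cst)
  by (intros [s t] [Hs Ht]; apply HB, Hs).
destruct (HG T HT n m) as (b & c & d). split; [|split].
- apply (bdd_blf (S1 := R) (S2 := S * R) (fun _ => halfR) (parT P T) (fun _ g => Dh g /\ bddh g)
    (fun st g => CRInt_halfline (fun y => Cexp (a (fst st) * y) * g y)%C) cst HBT) with
    (g := fun st x y => G n m (fst st) (x + y)%R (snd st)).
  + destruct b as (M & HM & B). exists M; split; [exact HM|]. intros [[s t] y] x [Hs Hy] Hx. apply (B (s, t)); [exact Hs|]. simpl in *; lra.
  + intros [s t] x [Hs Ht] Hx. apply (tame_Dh G HG); simpl in *; [assumption|assumption|lra].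
- apply (tay_blf (S1 := R) (S2 := S * R) (fun _ => halfR) (parT P T) (fun _ g => Dh g /\ bddh g)
    (fun st g => CRInt_halfline (fun y => Cexp (a (fst st) * y) * g y)%C) cst HBT) with
    (g := fun st x y => G n m (fst st) (x + y)%R (snd st)) (g1 := fun st x y => G (Datatypes.S n) m (fst st) (x + y)%R (snd st)).
  + destruct c as (M & HM & B). exists M; split; [exact HM|]. intros [[s t] y] x x' [Hs Hy] Hx Hx'. cbn [fst snd] in *.
    replace (x' - x) with ((x' + y) - (x + y)) by ring. apply (B (s, t)); [exact Hs|lra|lra].
  + intros [s t] x [Hs Ht] Hx. apply (tame_Dh G HG); simpl in *; [assumption|assumption|lra].
  + intros [s t] x [Hs Ht] Hx. apply (tame_Dh G HG); simpl in *; [assumption|assumption|lra].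
- apply (tay_blf (S1 := R) (S2 := S * R) (fun _ => halfR) (parX P) (fun _ g => Dh g /\ bddh g)
    (fun st g => CRInt_halfline (fun y => Cexp (a (fst st) * y) * g y)%C) cst HBX) with
    (g := fun sx t y => G n m (fst sx) (snd sx + y)%R t) (g1 := fun sx t y => G n (Datatypes.S m) (fst sx) (snd sx + y)%R t).
  + destruct d as (M & HM & B). exists M; split; [exact HM|]. intros [[s x] y] t t' [[Hs Hx] Hy] Ht Ht'. cbn [fst snd] in *.
    apply (B (s, x + y)); [split; simpl; [assumption|lra]|assumption|assumption].
  + intros [s x] t [Hs Hx] Ht. apply (tame_Dh G HG); simpl in *; [assumption|assumption|lra].
  + intros [s x] t [Hs Hx] Ht. apply (tame_Dh G HG); simpl in *; [assumption|assumption|lra].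
Qed.

(** Admissibility is only asked for the lowest order: the higher ones are limits of difference quotients. *)
Lemma tame_blf_D : forall (D : (S -> C) -> Prop) L Lam, BLF P D L Lam -> forall G, tame P G ->
  (forall x t, 0 <= x -> 0 <= t -> D (fun s => G 0%nat 0%nat s x t)) ->
  forall n m x t, 0 <= x -> 0 <= t -> D (fun s => G n m s x t).
Proof.
intros D L Lam HL G HG H0.
assert (Hn : forall n x t, 0 <= x -> 0 <= t -> D (fun s => G n 0%nat s x t)).
{ induction n as [|n IH]; [exact H0|]. intros x t Hx Ht.
  assert (HT : 0 < t + 1) by lra. destruct (HG (t + 1) HT n 0%nat) as (_ & c & _).
  refine (tay_D (S1 := S) (S2 := unit) (fun _ => P) (fun _ => True) (fun _ => D) (fun _ => L) Lam (fun _ _ => HL) halfR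
   (fun _ x s => G n 0%nat s x t) (fun _ x s => G (Datatypes.S n) 0%nat s x t) _ _ _ tt x Logic.I Hx); auto.
  - apply (tay_sub (parT P (t + 1)) _ (fun s : unit * S => (snd s, t)) _ (fun st x => G n 0%nat (fst st) x (snd st))
      (fun st x => G (Datatypes.S n) 0%nat (fst st) x (snd st))); [|exact c].
    intros [u s] [_ Hs]. split; simpl in *; [assumption|lra].
  - intros y eps Hy He. exists (y + eps / 2). split; [lra|split; [lra|]]. rewrite Rabs_pos_eq; lra. }
intros n m. induction m as [|m IH]; [apply Hn|]. intros x t Hx Ht.
assert (HT : 0 < t + 1) by lra. destruct (HG (t + 1) HT n m) as (_ & _ & d).
refine (tay_D (S1 := S) (S2 := unit) (fun _ => P) (fun _ => True) (fun _ => D) (fun _ => L) Lam (fun _ _ => HL) (segR (t + 1))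
   (fun _ t s => G n m s x t) (fun _ t s => G n (Datatypes.S m) s x t) _ _ _ tt t Logic.I _); auto.
- apply (tay_sub (parX P) _ (fun s : unit * S => (snd s, x)) _ (fun sx t => G n m (fst sx) (snd sx) t)
      (fun sx t => G n (Datatypes.S m) (fst sx) (snd sx) t)); [|exact d].
  intros [u s] [_ Hs]. split; simpl in *; [assumption|lra].
- intros y eps Hy He. destruct (Req_dec y (t + 1)) as [->|Hne].
  + exists (t + 1 - Rmin (eps / 2) (t + 1)). assert (0 < Rmin (eps / 2) (t + 1)) by (apply Rmin_glb_lt; lra).
    generalize (Rmin_l (eps / 2) (t + 1)) (Rmin_r (eps / 2) (t + 1)). intros.
    split; [lra|split; [lra|]]. rewrite Rabs_left1; lra.
  + exists (y + Rmin (eps / 2) (t + 1 - y)). assert (0 < Rmin (eps / 2) (t + 1 - y)) by (apply Rmin_glb_lt; lra).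
    generalize (Rmin_l (eps / 2) (t + 1 - y)) (Rmin_r (eps / 2) (t + 1 - y)). intros.
    split; [lra|split; [lra|]]. rewrite Rabs_pos_eq; lra.
- intros [] y _ [Hy _]. apply IH; assumption.
- simpl; lra.
Qed.
End Tame.

Lemma tame_sub : forall {S S'} (P : S -> Prop) (P' : S' -> Prop) (phi : S' -> S) G, (forall s, P' s -> P (phi s)) ->
  tame P G -> tame P' (fun n m s x t => G n m (phi s) x t).
Proof.
intros S S' P P' phi G Hp HG T HT n m. destruct (HG T HT n m) as (b & c & d). split; [|split].
- apply (bdd_sub (parT P T) (parT P' T) (fun s => (phi (fst s), snd s)) _ (fun st x => G n m (fst st) x (snd st))); [|exact b].
  intros [s t] [Hs Ht]; split; [apply Hp, Hs|exact Ht].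
- apply (tay_sub (parT P T) (parT P' T) (fun s => (phi (fst s), snd s)) _ (fun st x => G n m (fst st) x (snd st))
   (fun st x => G (Datatypes.S n) m (fst st) x (snd st))); [|exact c].
  intros [s t] [Hs Ht]; split; [apply Hp, Hs|exact Ht].
- apply (tay_sub (parX P) (parX P') (fun s => (phi (fst s), snd s)) _ (fun st x => G n m (fst st) (snd st) x)
   (fun st x => G n (Datatypes.S m) (fst st) (snd st) x)); [|exact d].
  intros [s t] [Hs Ht]; split; [apply Hp, Hs|exact Ht].
Qed.

Definition plain (_ : unit) : Prop := True.

Lemma tame_blf : forall {S} {P : S -> Prop} (D : (S -> C) -> Prop) L Lam, BLF P D L Lam -> forall G, tame P G ->
  (forall x t, 0 <= x -> 0 <= t -> D (fun s => G 0%nat 0%nat s x t)) ->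
  tame plain (fun n m _ x t => L (fun s => G n m s x t)).
Proof.
intros S P D L Lam HL G HG H0.
assert (HD := tame_blf_D D L Lam HL G HG H0).
intros T HT n m. destruct (HG T HT n m) as (b & c & d). split; [|split].
- apply (bdd_blf (S1 := S) (S2 := unit * R) (fun _ => P) (parT plain T) (fun _ => D) (fun _ => L) Lam (fun _ _ => HL) halfR
    (fun st x s => G n m s x (snd st))).
  + destruct b as (M & HM & B). exists M; split; [exact HM|]. intros [[u t] s] x [[_ Ht] Hs] Hx. apply (B (s, t)); [split|]; assumption.
  + intros [u t] x [_ Ht] Hx. apply HD; simpl in *; lra.
- apply (tay_blf (S1 := S) (S2 := unit * R) (fun _ => P) (parT plain T) (fun _ => D) (fun _ => L) Lam (fun _ _ => HL) halfR
    (fun st x s => G n m s x (snd st)) (fun st x s => G (Datatypes.S n) m s x (snd st))).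
  + destruct c as (M & HM & B). exists M; split; [exact HM|]. intros [[u t] s] x x' [[_ Ht] Hs] Hx Hx'. apply (B (s, t)); [split| |]; assumption.
  + intros [u t] x [_ Ht] Hx. apply HD; simpl in *; lra.
  + intros [u t] x [_ Ht] Hx. apply HD; simpl in *; lra.
- apply (tay_blf (S1 := S) (S2 := unit * R) (fun _ => P) (parX plain) (fun _ => D) (fun _ => L) Lam (fun _ _ => HL) (segR T)
    (fun sx t s => G n m s (snd sx) t) (fun sx t s => G n (Datatypes.S m) s (snd sx) t)).
  + destruct d as (M & HM & B). exists M; split; [exact HM|]. intros [[u x] s] t t' [[_ Hx] Hs] Ht Ht'. apply (B (s, x)); [split| |]; assumption.
  + intros [u x] t [_ Hx] Ht. apply HD; simpl in *; lra.
  + intros [u x] t [_ Hx] Ht. apply HD; simpl in *; lra.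
Qed.

(** ** What tameness gives *)

Lemma at_right_intro : forall (Q : R -> Prop) d, 0 < d -> (forall s, 0 < s < d -> Q s) -> at_right 0 Q.
Proof.
intros Q d Hd H. exists (mkposreal d Hd). intros y Hy Hy0. apply H. split; [exact Hy0|].
change (Rabs (y - 0) < d) in Hy. rewrite Rminus_0_r, Rabs_pos_eq in Hy; lra.
Qed.

Lemma unif_lim_lip : forall (g : R -> R -> C) (A : R -> Prop) l M, 0 <= M ->
  (forall s y, 0 < s <= 1 -> A y -> Cmod (g s y - l y)%C <= M * s) -> unif_lim_0plus g A l.
Proof.
intros g A l M HM H eps. assert (He := cond_pos eps).
apply (at_right_intro _ (Rmin 1 (eps / (M + 1)))).
- apply Rmin_glb_lt; [lra|]. apply Rdiv_lt_0_compat; lra.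
- intros s [Hs0 Hs] y Hy. assert (H1 := Rlt_le_trans _ _ _ Hs (Rmin_l _ _)). assert (H2 := Rlt_le_trans _ _ _ Hs (Rmin_r _ _)).
  eapply Rle_lt_trans; [apply H; [lra|exact Hy]|].
  apply Rle_lt_trans with ((M + 1) * s); [nra|].
  apply Rlt_le_trans with ((M + 1) * (eps / (M + 1))); [apply Rmult_lt_compat_l; lra|]. right; field; lra.
Qed.

Section Out.
Variable G : nat -> nat -> unit -> R -> R -> C.
Hypothesis HG : tame plain G.

Lemma tame_has_deriv_x : forall n m x t, 0 < x -> 0 <= t -> has_deriv (fun y => G n m tt y t) x (G (S n) m tt x t).
Proof.
intros n m x t Hx Ht. destruct (HG (t + 1) ltac:(lra) n m) as (_ & (M & HM & B) & _).
apply (has_deriv_quad _ _ _ M x); [exact Hx|]. intros y Hy. apply (B (tt, t)); [split; simpl; [exact I|lra]|lra|].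
apply Rabs_def2 in Hy. lra.
Qed.

Lemma tame_has_deriv_t : forall n m x t, 0 <= x -> 0 < t -> has_deriv (fun s => G n m tt x s) t (G n (S m) tt x t).
Proof.
intros n m x t Hx Ht. destruct (HG (2 * t) ltac:(lra) n m) as (_ & _ & (M & HM & B)).
apply (has_deriv_quad _ _ _ M t); [exact Ht|]. intros y Hy. apply Rabs_def2 in Hy.
apply (B (tt, x)); [split; simpl; [exact I|lra]|lra|lra].
Qed.

(** Bounded first derivatives give a joint Lipschitz bound. *)
Lemma tame_cont2 : forall n m, continuous_on (T := prod_UniformSpace R_UniformSpace R_UniformSpace)
  (U := C_UniformSpace) open_quadrant (fun p => G n m tt (fst p) (snd p)).
Proof.
intros n m [x t] [Hx Ht]. cbn [fst snd] in *.
destruct (tame_lipx G HG (2 * t) ltac:(lra) n m) as (M1 & H1 & B1).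
destruct (tame_lipt G HG (2 * t) ltac:(lra) n m) as (M2 & H2 & B2).
intros Q HQ. apply (locally_norm_le_locally (V := C_R_NormedModule)) in HQ. destruct HQ as [e He].
assert (Hd : 0 < Rmin t (e / (M1 + M2 + 1))).
{ apply Rmin_glb_lt; [exact Ht|]. apply Rdiv_lt_0_compat; [apply cond_pos|lra]. }
exists (mkposreal _ Hd). intros [x' t'] [Bx Bt] [Hx' Ht']. cbn [fst snd] in *.
change (Rabs (x' - x) < Rmin t (e / (M1 + M2 + 1))) in Bx.
change (Rabs (t' - t) < Rmin t (e / (M1 + M2 + 1))) in Bt.
apply He. unfold ball_norm. rewrite norm_Cmod.
change (Cmod (G n m tt x' t' - G n m tt x t)%C < e).
assert (Bt' := Rlt_le_trans _ _ _ Bt (Rmin_l _ _)). apply Rabs_def2 in Bt'.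
replace (G n m tt x' t' - G n m tt x t)%C with ((G n m tt x' t' - G n m tt x t') + (G n m tt x t' - G n m tt x t))%C by ring.
eapply Rle_lt_trans; [apply Cmod_triangle|].
assert (C1 : Cmod (G n m tt x' t' - G n m tt x t')%C <= M1 * Rabs (x' - x)).
{ apply (B1 (tt, t')); [split; simpl; [exact I|lra]|lra|lra]. }
assert (C2 : Cmod (G n m tt x t' - G n m tt x t)%C <= M2 * Rabs (t' - t)).
{ apply (B2 (tt, x)); [split; simpl; [exact I|lra]|lra|lra]. }
assert (E1 := Rlt_le_trans _ _ _ Bx (Rmin_r _ _)). assert (E2 := Rlt_le_trans _ _ _ Bt (Rmin_r _ _)).
assert (He0 := cond_pos e).
set (q := e / (M1 + M2 + 1)) in *.
assert (Eq : (M1 + M2 + 1) * q = e) by (unfold q; field; lra).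
assert (0 < q) by (unfold q; apply Rdiv_lt_0_compat; lra).
assert (M1 * Rabs (x' - x) <= M1 * q) by (apply Rmult_le_compat_l; lra).
assert (M2 * Rabs (t' - t) <= M2 * q) by (apply Rmult_le_compat_l; lra). lra.
Qed.

Lemma tame_derivs2 : forall g : R -> R -> C, (forall x t, 0 < x -> 0 < t -> G 0%nat 0%nat tt x t = g x t) ->
  derivs2 open_quadrant open_quadrant g (fun n m x t => G n m tt x t).
Proof.
intros g Hg. split; [|split].
- intros x t [Hx Ht]. apply Hg; assumption.
- apply tame_cont2.
- intros n m x t [Hx Ht]. cbn [fst snd] in *. split; [apply tame_has_deriv_x|apply tame_has_deriv_t]; lra.
Qed.

Lemma tame_lim_t : forall n m, unif_lim_0plus (fun t x => G n m tt x t) pos (fun x => G n m tt x 0).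
Proof.
intros n m. destruct (tame_lipt G HG 1 Rlt_0_1 n m) as (M & HM & B).
apply (unif_lim_lip _ _ _ M HM). intros s y Hs Hy.
replace (M * s) with (M * Rabs (s - 0)) by (rewrite Rminus_0_r, Rabs_pos_eq; lra).
apply (B (tt, y)); [split; simpl; [exact I|unfold pos in Hy; lra]|lra|lra].
Qed.

Lemma tame_lim_x : forall n m T, 0 < T -> unif_lim_0plus (fun x t => G n m tt x t) (fun t => 0 < t <= T) (fun t => G n m tt 0 t).
Proof.
intros n m T HT. destruct (tame_lipx G HG T HT n m) as (M & HM & B).
apply (unif_lim_lip _ _ _ M HM). intros s y Hs Hy.
replace (M * s) with (M * Rabs (s - 0)) by (rewrite Rminus_0_r, Rabs_pos_eq; lra).
apply (B (tt, y)); [split; simpl; [exact I|lra]|lra|lra].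
Qed.

Lemma tame_smooth_x : forall n m, smooth_on_pos (fun x => G n m tt x 0).
Proof.
intros n m. exists (fun k x => G (k + n)%nat m tt x 0). split; [|split].
- reflexivity.
- intros k. apply continuous_on_forall. intros x Hx. eapply has_deriv_cont, tame_has_deriv_x; [exact Hx|lra].
- intros k x Hx. apply tame_has_deriv_x; [exact Hx|lra].
Qed.

Lemma tame_smooth_t : forall n m, smooth_on_pos (fun t => G n m tt 0 t).
Proof.
intros n m. exists (fun k t => G n (k + m)%nat tt 0 t). split; [|split].
- reflexivity.
- intros k. apply continuous_on_forall. intros x Hx. eapply has_deriv_cont, tame_has_deriv_t; [lra|exact Hx].
- intros k x Hx. apply tame_has_deriv_t; [lra|exact Hx].
Qed.
End Out.

Lemma has_deriv_unique : forall g x l l', has_deriv g x l -> has_deriv g x l' -> l = l'.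
Proof.
intros g x l l' H H'. apply has_deriv_pair in H. apply has_deriv_pair in H'. destruct H as [a b], H' as [a' b'].
apply injective_projections.
- change (Re l = Re l'). rewrite <- (is_derive_unique _ _ _ a). apply is_derive_unique, a'.
- change (Im l = Im l'). rewrite <- (is_derive_unique _ _ _ b). apply is_derive_unique, b'.
Qed.

Lemma jets_unique : forall g h : nat -> R -> C,
  (forall n x, 0 < x -> has_deriv (g n) x (g (S n) x)) -> (forall n x, 0 < x -> has_deriv (h n) x (h (S n) x)) ->
  (forall x, 0 < x -> g 0%nat x = h 0%nat x) -> forall n x, 0 < x -> g n x = h n x.
Proof.
intros g h Hg Hh H0. induction n as [|n IH]; [exact H0|]. intros x Hx.
apply (has_deriv_unique (g n) x); [apply Hg, Hx|].
apply (has_deriv_ext_loc (h n)); [|apply Hh, Hx].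
exists (mkposreal x Hx). intros y Hy. change (Rabs (y - x) < x) in Hy. apply Rabs_def2 in Hy. symmetry; apply IH; lra.
Qed.

(** ** Tameness of the data *)

(** Used at boundary points approached along the diagonal, where data known in the interior reach their boundary values. *)
Definition rlim (F : R -> C) (l : C) : Prop :=
  forall eta, 0 < eta -> exists d, 0 < d /\ forall e, 0 < e < d -> Cmod (F e - l)%C < eta.

Lemma rlim_bound : forall F l K, rlim F l -> (forall e, 0 < e < 1 -> Cmod (F e) <= K) -> Cmod l <= K.
Proof.
intros F l K HF HK. apply le_of_eps. intros eta He. destruct (HF eta He) as (d & Hd & H).
assert (0 < Rmin d 1) by (apply Rmin_glb_lt; lra). generalize (Rmin_l d 1) (Rmin_r d 1). intros.
pose (e := Rmin d 1 / 2). assert (B := H e ltac:(unfold e; lra)). assert (B' := HK e ltac:(unfold e; lra)).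
replace l with (F e + - (F e - l))%C by ring. eapply Rle_trans; [apply Cmod_triangle|]. rewrite Cmod_opp. lra.
Qed.

Lemma rlim_plus : forall F l F' l', rlim F l -> rlim F' l' -> rlim (fun e => F e + F' e)%C (l + l')%C.
Proof.
intros F l F' l' H H' eta He. destruct (H (eta / 2)) as (d & Hd & B); [lra|]. destruct (H' (eta / 2)) as (d' & Hd' & B'); [lra|].
exists (Rmin d d'). split; [apply Rmin_glb_lt; assumption|]. intros e [He0 He1].
replace (F e + F' e - (l + l'))%C with ((F e - l) + (F' e - l'))%C by ring.
eapply Rle_lt_trans; [apply Cmod_triangle|].
assert (C1 := B e (conj He0 (Rlt_le_trans _ _ _ He1 (Rmin_l _ _)))).
assert (C2 := B' e (conj He0 (Rlt_le_trans _ _ _ He1 (Rmin_r _ _)))). lra.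
Qed.

Lemma rlim_scal : forall c F l, rlim F l -> rlim (fun e => c * F e)%C (c * l)%C.
Proof.
intros c F l H eta He. assert (Hc := Cmod_ge_0 c). destruct (H (eta / (Cmod c + 1))) as (d & Hd & B); [apply Rdiv_lt_0_compat; lra|].
exists d; split; [exact Hd|]. intros e Hed. replace (c * F e - c * l)%C with (c * (F e - l))%C by ring. rewrite Cmod_mult.
specialize (B e Hed). assert (Hp := Cmod_ge_0 (F e - l)%C).
apply Rle_lt_trans with ((Cmod c + 1) * Cmod (F e - l)%C); [nra|].
replace eta with ((Cmod c + 1) * (eta / (Cmod c + 1))) by (field; lra). apply Rmult_lt_compat_l; lra.
Qed.

Lemma rlim_taylor : forall A B E a b c (dl : R), rlim A a -> rlim B b -> rlim E c -> forall K,
  (forall e, 0 < e < 1 -> Cmod (A e - B e - dl * E e)%C <= K) -> Cmod (a - b - dl * c)%C <= K.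
Proof.
intros A B E a b c dl HA HB HE K HK.
apply (rlim_bound (fun e => A e + - (1) * B e + (- dl) * E e)%C).
- replace (a - b - dl * c)%C with (a + - (1) * b + (- dl) * c)%C by ring.
  apply rlim_plus; [apply rlim_plus; [exact HA|]|]; apply rlim_scal; assumption.
- intros e He. replace (A e + - (1) * B e + (- dl) * E e)%C with (A e - B e - dl * E e)%C by ring. apply HK, He.
Qed.

Lemma rlim_on1 : forall (g : R -> C) x, continuous_on (T := R_UniformSpace) (U := C_UniformSpace) nonneg g -> 0 <= x ->
  rlim (fun e => g (x + e)%R) (g x).
Proof.
intros g x Hg Hx eta He.
assert (H := Hg x Hx _ (locally_ball_norm (V := C_R_NormedModule) (g x) (mkposreal eta He))).
destruct H as [d Hd]. exists d. split; [apply cond_pos|]. intros e Hed.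
rewrite <- norm_Cmod. apply Hd.
- change (Rabs (x + e - x) < d). replace (x + e - x) with e by ring. rewrite Rabs_pos_eq; lra.
- unfold nonneg; lra.
Qed.

Lemma rlim_on2 : forall (g : R -> R -> C) x t, continuous_on (T := prod_UniformSpace R_UniformSpace R_UniformSpace)
  (U := C_UniformSpace) closed_quadrant (fun p => g (fst p) (snd p)) -> 0 <= x -> 0 <= t ->
  rlim (fun e => g (x + e)%R (t + e)%R) (g x t).
Proof.
intros g x t Hg Hx Ht eta He.
assert (H := Hg (x, t) (conj Hx Ht) _ (locally_ball_norm (V := C_R_NormedModule) (g x t) (mkposreal eta He))).
destruct H as [d Hd]. exists d. split; [apply cond_pos|]. intros e Hed.
rewrite <- norm_Cmod. apply (Hd (x + e, t + e)).
- split; simpl; [change (Rabs (x + e - x) < d); replace (x + e - x) with e by ring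
                |change (Rabs (t + e - t) < d); replace (t + e - t) with e by ring]; rewrite Rabs_pos_eq; lra.
- split; simpl; lra.
Qed.

Lemma Dh_on : forall (g : R -> C), continuous_on (T := R_UniformSpace) (U := C_UniformSpace) nonneg g -> Dh g.
Proof.
intros g Hg r. apply cont_eps. intros eps He.
assert (H := Hg (Rmax 0 r) (Rmax_l 0 r) _ (locally_ball_norm (V := C_R_NormedModule) (g (Rmax 0 r)) (mkposreal eps He))).
destruct H as [d Hd]. exists d. split; [apply cond_pos|]. intros y Hy.
rewrite <- norm_Cmod. apply Hd.
- change (Rabs (Rmax 0 y - Rmax 0 r) < d). eapply Rle_lt_trans; [apply Rmax0_lip|exact Hy].
- apply Rmax_l.
Qed.

Lemma interior_taylor : forall (p p1 p2 : R -> C) M y y', 0 <= M -> 0 < y -> 0 < y' ->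
  (forall r, Rmin y y' <= r <= Rmax y y' -> has_deriv p r (p1 r)) ->
  (forall r, Rmin y y' <= r <= Rmax y y' -> has_deriv p1 r (p2 r)) ->
  (forall r, Rmin y y' <= r <= Rmax y y' -> Cmod (p2 r) <= M) ->
  Cmod (p y' - p y - (y' - y)%R * p1 y)%C <= M * (y' - y) ^ 2.
Proof.
intros p p1 p2 M y y' HM Hy Hy' H H1 H2. apply taylor_of_lip; [exact HM|exact H|].
intros r Hr. assert (K : forall q, Rmin y r <= q <= Rmax y r -> Rmin y y' <= q <= Rmax y y').
{ intros q. revert Hr. unfold Rmin, Rmax. repeat destruct Rle_dec; lra. }
apply (deriv_lip_abs p1 p2); intros q Hq; [apply H1, K, Hq|apply H2, K, Hq].
Qed.

(** The second derivative bounds the remainder inside; continuity carries the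
    inequality to the boundary. *)
Lemma tay_of_derivs1 : forall g dg (I J : R -> Prop), derivs1 pos nonneg g dg -> interval0 I -> interval0 J ->
  (forall y e, I y -> 0 < e < 1 -> J (y + e)) -> (forall n, bdd plain J (fun _ => dg n)) ->
  forall n, tay plain I (fun _ => dg n) (fun _ => dg (S n)).
Proof.
intros g dg I J (_ & Hc & Hd) HI HJ HIJ Hb n. destruct (Hb (S (S n))) as (M & HM & B).
exists M. split; [exact HM|]. intros _ y y' _ Hy Hy'.
assert (H0 : 0 <= y) by (apply HI, Hy). assert (H0' : 0 <= y') by (apply HI, Hy').
apply (rlim_taylor _ _ _ _ _ _ (y' - y) (rlim_on1 _ _ (Hc n) H0') (rlim_on1 _ _ (Hc n) H0) (rlim_on1 _ _ (Hc (S n)) H0)).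
intros e He. replace (y' - y) with ((y' + e) - (y + e)) by ring.
assert (Hpos : forall r, Rmin (y + e) (y' + e) <= r <= Rmax (y + e) (y' + e) -> 0 < r).
{ intros r. unfold Rmin, Rmax. destruct Rle_dec; lra. }
apply (interior_taylor (dg n) (dg (S n)) (dg (S (S n)))); try assumption; try lra.
- intros r Hr. apply Hd, Hpos, Hr.
- intros r Hr. apply Hd, Hpos, Hr.
- intros r Hr. apply (B tt); [exact Logic.I|].
  apply (interval0_between J (y + e) (y' + e)); auto.
Qed.

Lemma bounded_seg : forall (g : R -> C) a b, a <= b -> (forall r, cont g r) -> exists M, 0 <= M /\ forall r, a <= r <= b -> Cmod (g r) <= M.
Proof.
intros g a b Hab Hg.
destruct (continuity_ab_maj (fun r => Cmod (g r)) a b Hab) as (Mx & H & _).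
- intros c _. apply continuity_pt_filterlim. apply cont_Cmod, Hg.
- exists (Cmod (g Mx)). split; [apply Cmod_ge_0|exact H].
Qed.

Lemma derivs1_jets_seg : forall g dg, derivs1 pos nonneg g dg -> forall T, 0 < T -> forall n,
  bdd plain (segR T) (fun _ => dg n) /\ tay plain (segR T) (fun _ => dg n) (fun _ => dg (S n)).
Proof.
intros g dg H.
assert (Hb : forall T, 0 < T -> forall n, bdd plain (segR T) (fun _ => dg n)).
{ intros T HT n. destruct H as (_ & Hc & _).
  destruct (bounded_seg (fun r => dg n (Rmax 0 r)) 0 T) as (M & HM & B); [lra|apply Dh_on, Hc|].
  exists M. split; [exact HM|]. intros _ y _ Hy. rewrite <- (Rmax_right 0 y) by lra. apply B; lra. }
intros T HT n. split; [apply Hb, HT|].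
apply (tay_of_derivs1 g dg (segR T) (segR (T + 1)) H).
- apply interval0_seg; lra.
- apply interval0_seg; lra.
- intros; lra.
- apply Hb; lra.
Qed.

Lemma Schwartz_jets : forall g dg, Schwartz_halfline g dg -> forall n,
  bdd plain halfR (fun _ => dg n) /\ tay plain halfR (fun _ => dg n) (fun _ => dg (S n)).
Proof.
intros g dg (H & B).
assert (Hb : forall n, bdd plain halfR (fun _ => dg n)).
{ intros n. destruct (B n 0%nat) as (M & HM). exists (Rabs M). split; [apply Rabs_pos|]. intros _ y _ Hy.
  specialize (HM y Hy). simpl in HM. generalize (Rle_abs M). lra. }
intros n. split; [apply Hb|].
apply (tay_of_derivs1 g dg halfR halfR H); auto using interval0_nonneg. intros; lra.
Qed.

Lemma tame_derivs2_data : forall f df, derivs2 open_quadrant closed_quadrant f df ->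
  (forall T, 0 < T -> forall n m l : nat, exists M, forall x t, 0 < x -> 0 <= t <= T -> x ^ l * Cmod (df n m x t) <= M) ->
  tame plain (fun n m _ x t => df n m x t).
Proof.
intros f df (_ & Hc & Hd) HB.
assert (Hb : forall T, 0 < T -> forall n m, exists M, 0 <= M /\ forall x t, 0 <= x -> 0 <= t <= T -> Cmod (df n m x t) <= M).
{ intros T HT n m. destruct (HB (T + 1) ltac:(lra) n m 0%nat) as (M & HM). exists (Rabs M). split; [apply Rabs_pos|].
  intros x t Hx Ht. apply (rlim_bound _ _ _ (rlim_on2 (df n m) x t (Hc n m) Hx (proj1 Ht))).
  intros e He. specialize (HM (x + e) (t + e) ltac:(lra) ltac:(lra)). simpl in HM. generalize (Rle_abs M). lra. }
intros T HT n m. split; [|split].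
- destruct (Hb T HT n m) as (M & HM & B). exists M. split; [exact HM|]. intros [u t] x [_ Ht] Hx. apply B; assumption.
- destruct (Hb (T + 1) ltac:(lra) (S (S n)) m) as (M & HM & B). exists M. split; [exact HM|].
  intros [u t] y y' [_ Ht] Hy Hy'. cbn [fst snd] in *.
  apply (rlim_taylor _ _ _ _ _ _ (y' - y) (rlim_on2 _ _ t (Hc n m) Hy' (proj1 Ht)) (rlim_on2 _ _ t (Hc n m) Hy (proj1 Ht))
    (rlim_on2 _ _ t (Hc (S n) m) Hy (proj1 Ht))).
  intros e He. replace (y' - y) with ((y' + e) - (y + e)) by ring.
  assert (Hpos : forall r, Rmin (y + e) (y' + e) <= r <= Rmax (y + e) (y' + e) -> 0 < r).
  { intros r. unfold Rmin, Rmax. destruct Rle_dec; lra. }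
  apply (interior_taylor (fun r => df n m r (t + e)%R) (fun r => df (S n) m r (t + e)%R) (fun r => df (S (S n)) m r (t + e)%R)); try assumption; try lra.
  + intros r Hr. apply Hd. split; simpl; [apply Hpos, Hr|lra].
  + intros r Hr. apply Hd. split; simpl; [apply Hpos, Hr|lra].
  + intros r Hr. apply B; [left; apply Hpos, Hr|lra].
- destruct (Hb (T + 1) ltac:(lra) n (S (S m))) as (M & HM & B). exists M. split; [exact HM|].
  intros [u x] y y' [_ Hx] Hy Hy'. cbn [fst snd] in *.
  apply (rlim_taylor _ _ _ _ _ _ (y' - y) (rlim_on2 _ x _ (Hc n m) Hx (proj1 Hy')) (rlim_on2 _ x _ (Hc n m) Hx (proj1 Hy))
    (rlim_on2 _ x _ (Hc n (S m)) Hx (proj1 Hy))).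
  intros e He. replace (y' - y) with ((y' + e) - (y + e)) by ring.
  assert (Hpos : forall r, Rmin (y + e) (y' + e) <= r <= Rmax (y + e) (y' + e) -> 0 < r <= T + 1).
  { intros r. unfold Rmin, Rmax. destruct Rle_dec; lra. }
  apply (interior_taylor (fun r => df n m (x + e)%R r) (fun r => df n (S m) (x + e)%R r) (fun r => df n (S (S m)) (x + e)%R r)); try assumption; try lra.
  + intros r Hr. apply Hd. split; simpl; [lra|apply Hpos, Hr].
  + intros r Hr. apply Hd. split; simpl; [lra|apply Hpos, Hr].
  + intros r Hr. apply B; [lra|]. specialize (Hpos r Hr). lra.
Qed.

(** * Integrals along a closed curve *)

(** Differentiability along every path; this is all that the fundamental theorem of calculus needs, and it composes without any
    complex analysis. *)
Definition pder (Phi : C -> C) (l z : C) : Prop :=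
  forall (c : R -> C) r dc, has_deriv c r dc -> c r = z -> has_deriv (fun q => Phi (c q)) r (l * dc)%C.

Lemma Dc_const : forall {S} (rho : R -> S) (k : C), Dc rho (fun _ => k).
Proof. intros S rho k r. apply cont_const. Qed.

Lemma Dc_plus : forall {S} (rho : R -> S) f g, Dc rho f -> Dc rho g -> Dc rho (fun s => f s + g s)%C.
Proof. intros S rho f g Hf Hg r. apply cont_plus; auto. Qed.

Lemma Dc_opp : forall {S} (rho : R -> S) f, Dc rho f -> Dc rho (fun s => - f s)%C.
Proof. intros S rho f Hf r. apply cont_opp; auto. Qed.

Lemma Dc_minus : forall {S} (rho : R -> S) f g, Dc rho f -> Dc rho g -> Dc rho (fun s => f s - g s)%C.
Proof. intros S rho f g Hf Hg r. apply cont_minus; auto. Qed.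

Lemma Dc_mult : forall {S} (rho : R -> S) f g, Dc rho f -> Dc rho g -> Dc rho (fun s => f s * g s)%C.
Proof. intros S rho f g Hf Hg r. apply cont_mult; auto. Qed.

Lemma Dc_div : forall {S} (rho : R -> S) f g, Dc rho f -> Dc rho g -> (forall r, g (rho r) <> 0%C) -> Dc rho (fun s => f s / g s)%C.
Proof. intros S rho f g Hf Hg Hn r. apply cont_div; [apply Hf|apply Hg|apply Hn]. Qed.

Lemma Dc_inv : forall {S} (rho : R -> S) g, Dc rho g -> (forall r, g (rho r) <> 0%C) -> Dc rho (fun s => / g s)%C.
Proof. intros S rho g Hg Hn r. apply cont_inv; [apply Hg|apply Hn]. Qed.

Lemma Dc_Cexp : forall {S} (rho : R -> S) f, Dc rho f -> Dc rho (fun s => Cexp (f s)).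
Proof. intros S rho f Hf r. apply cont_Cexp; auto. Qed.

(** Such a function has zero derivative. *)
Lemma const_of_quad : forall (q : R -> C) M T, 0 <= T -> 0 <= M ->
  (forall r r', 0 <= r <= T -> 0 <= r' <= T -> Cmod (q r' - q r)%C <= M * (r' - r) ^ 2) -> q T = q 0.
Proof.
intros q M T HT HM H. apply Ceq_of_eps. intros eps He.
assert (E : Cmod (q (clamp 0 T T) - q (clamp 0 T 0))%C <= 0 * (T - 0)).
{ apply (deriv_lip (fun r => q (clamp 0 T r)) (fun _ => 0%C)); [exact HT| |intros; rewrite Cmod_0; lra].
  intros r _. apply (has_deriv_quad _ r _ M 1 Rlt_0_1). intros y _.
  replace (q (clamp 0 T y) - q (clamp 0 T r) - (y - r)%R * 0)%C with (q (clamp 0 T y) - q (clamp 0 T r))%C by ring.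
  eapply Rle_trans; [apply H; apply clamp_in, HT|]. apply Rmult_le_compat_l; [exact HM|].
  rewrite <- (pow2_abs (y - r)), <- (pow2_abs (_ - _)). apply pow_incr. split; [apply Rabs_pos|apply clamp_lip]. }
rewrite !clamp_id in E by lra. lra.
Qed.

Section Curve.
Variable K : R -> C.
Hypothesis HK : simple_closed_curve K.

(** The curve extended to the whole line by freezing it at the end points. *)
Definition Kc (r : R) : C := K (clamp 0 1 r).

Definition integrand (g : C -> C) (s : R) : C :=
  (g (K s) * (Derive (fun r => Re (K r)) s, Derive (fun r => Im (K r)) s))%C.

Lemma Kc_on : forall r, on_curve K (Kc r).
Proof. intros r. exists (clamp 0 1 r). split; [apply clamp_in; lra|reflexivity]. Qed.

Lemma on_Kc : forall z, on_curve K z -> exists r, 0 <= r <= 1 /\ Kc r = z.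
Proof. intros z (s & Hs & E). exists s. split; [exact Hs|]. unfold Kc. rewrite clamp_id; assumption. Qed.

(** On a smooth piece the parametrization may be replaced by the [C^1] function that it restricts, for which the integrand is
    continuous. *)
Lemma piece : forall a b (G dG : R -> C), 0 <= a -> a < b -> b <= 1 ->
  (forall r, has_deriv G r (dG r) /\ cont dG r) -> (forall r, a <= r <= b -> K r = G r) ->
  (forall g, Dc Kc g -> exC (integrand g) a b) /\
  (exists Lam, 0 <= Lam /\ forall g M, Dc Kc g -> (forall z, on_curve K z -> Cmod (g z) <= M) ->
     Cmod (CRInt (integrand g) a b) <= Lam * M) /\
  (forall Phi Phi', Dc Kc Phi' -> (forall z, on_curve K z -> pder Phi (Phi' z) z) ->
     CRInt (integrand Phi') a b = (Phi (K b) - Phi (K a))%C).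
Proof.
intros a b G dG Ha Hab Hb HG HKG.
assert (Hab' : a <= b) by lra.
pose (h := fun (g : C -> C) r => (g (K (clamp a b r)) * dG r)%C).
assert (Hh : forall g, Dc Kc g -> forall r, cont (h g) r).
{ intros g Hg r. apply cont_mult; [|apply HG].
  apply (cont_ext (fun r => g (Kc (clamp a b r)))).
  - intros y. unfold Kc. rewrite (clamp_id 0 1); [reflexivity|]. generalize (clamp_in a b y Hab'). lra.
  - apply (cont_comp_lip (fun r => g (Kc r))); [apply clamp_lip|apply Hg]. }
assert (Hi : forall g r, a < r < b -> h g r = integrand g r).
{ intros g r Hr. unfold h, integrand. rewrite clamp_id by lra. f_equal.
  destruct (proj1 (has_deriv_pair _ _ _) (proj1 (HG r))) as [D1 D2].
  assert (HL : locally r (fun y => K y = G y)).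
  { assert (Hm : 0 < Rmin (r - a) (b - r)) by (apply Rmin_glb_lt; lra).
    exists (mkposreal _ Hm). intros y Hy. change (Rabs (y - r) < Rmin (r - a) (b - r)) in Hy.
    generalize (Rmin_l (r - a) (b - r)) (Rmin_r (r - a) (b - r)). apply Rabs_def2 in Hy. intros. apply HKG. lra. }
  rewrite (Derive_ext_loc (fun r => Re (K r)) (fun r => Re (G r))), (Derive_ext_loc (fun r => Im (K r)) (fun r => Im (G r))).
  - apply is_derive_unique in D1. apply is_derive_unique in D2.
    apply injective_projections; symmetry; [exact D1|exact D2].
  - revert HL. apply filter_imp. intros y ->. reflexivity.
  - revert HL. apply filter_imp. intros y ->. reflexivity. }
split; [|split].
- intros g Hg. apply (exC_ext (h g)); [exact Hab'|intros; apply Hi; assumption|]. apply exC_cont, Hh, Hg.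
- destruct (bounded_seg dG a b Hab' (fun r => proj2 (HG r))) as (B & HB & HdG).
  exists (B * (b - a)). split; [apply Rmult_le_pos; lra|]. intros g M Hg HM.
  rewrite <- (CRInt_ext (h g)) by (try exact Hab'; intros; apply Hi; assumption).
  replace (B * (b - a) * M) with (M * B * (b - a)) by ring.
  apply CRInt_bound; [exact Hab'|apply exC_cont, Hh, Hg|].
  intros x Hx. unfold h. rewrite Cmod_mult. apply Rmult_le_compat; try apply Cmod_ge_0; [|apply HdG, Hx].
  apply HM. exists (clamp a b x). split; [|reflexivity]. generalize (clamp_in a b x Hab'). lra.
- intros Phi Phi' HPhi' HPhi.
  rewrite <- (CRInt_ext (h Phi')) by (try exact Hab'; intros; apply Hi; assumption).
  rewrite !HKG by lra. apply CRInt_unique, (CRInt_FTC (fun r => Phi (G r))); [exact Hab'| |intros; apply Hh, HPhi'].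
  intros x Hx. unfold h. rewrite clamp_id by lra.
  apply (HPhi (K x)); [exists x; split; [lra|reflexivity]|apply HG|symmetry; apply HKG, Hx].
Qed.

(** By induction on the number of pieces already traversed; the last item is the fundamental theorem of calculus, closed up
    by [K 0 = K 1]. *)
Lemma Kc_cont_and_integral :
  (forall r, cont Kc r) /\
  (forall g, Dc Kc g -> exC (integrand g) 0 1) /\
  (exists Lam, 0 <= Lam /\ forall g M, Dc Kc g -> (forall z, on_curve K z -> Cmod (g z) <= M) ->
     Cmod (CRInt (integrand g) 0 1) <= Lam * M) /\
  (forall Phi Phi', Dc Kc Phi' -> (forall z, on_curve K z -> pder Phi (Phi' z) z) ->
     CRInt (integrand Phi') 0 1 = 0%C).
Proof.
destruct HK as ((n & s & Hs0 & Hsn & Hp) & Hcl & _).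
assert (Hmon : forall i j, (i <= j <= n)%nat -> s i <= s j).
{ intros i j [Hij Hj]. induction Hij as [|j Hij IH]; [lra|]. destruct (Hp j ltac:(lia)) as [Hlt _].
  specialize (IH ltac:(lia)). lra. }
assert (Main : forall k, (k <= n)%nat ->
  (forall r, cont (fun r => K (clamp 0 (s k) r)) r) /\
  (forall g, Dc Kc g -> exC (integrand g) 0 (s k)) /\
  (exists Lam, 0 <= Lam /\ forall g M, Dc Kc g -> (forall z, on_curve K z -> Cmod (g z) <= M) ->
     Cmod (CRInt (integrand g) 0 (s k)) <= Lam * M) /\
  (forall Phi Phi', Dc Kc Phi' -> (forall z, on_curve K z -> pder Phi (Phi' z) z) ->
     CRInt (integrand Phi') 0 (s k) = (Phi (K (s k)) - Phi (K 0))%C)).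
{ induction k as [|k IH]; intros Hk.
  - rewrite Hs0. split; [|split; [|split]].
    + intros r. apply (cont_ext (fun _ => K 0)); [|apply cont_const].
      intros y. f_equal. unfold clamp, Rmax, Rmin. repeat destruct Rle_dec; lra.
    + intros g _. apply (ex_RInt_point (V := C_R_NormedModule)).
    + exists 0. split; [lra|]. intros g M _ _. rewrite CRInt_point, Cmod_0. lra.
    + intros Phi Phi' _ _. rewrite CRInt_point. ring.
  - destruct (IH ltac:(lia)) as (IHc & IHe & (Lam & HLam & IHb) & IHx).
    destruct (Hp k ltac:(lia)) as (Hlt & G & dG & HG & HKG).
    assert (H0 := Hmon 0%nat k ltac:(lia)). rewrite Hs0 in H0.
    assert (H1 := Hmon (S k) n ltac:(lia)). rewrite Hsn in H1.
    destruct (piece (s k) (s (S k)) G dG H0 Hlt H1 HG HKG) as (Pe & (Lam' & HLam' & Pb) & Px).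
    split; [|split; [|split]].
    + intros r.
      apply (cont_ext (fun r => K (clamp 0 (s k) r) + (G (clamp (s k) (s (S k)) r) - K (s k)))%C).
      * intros y. destruct (Rle_dec y (s k)) as [Hy|Hy].
        -- replace (clamp (s k) (s (S k)) y) with (s k) by (unfold clamp, Rmax, Rmin; repeat destruct Rle_dec; lra).
           rewrite <- HKG by lra.
           replace (clamp 0 (s (S k)) y) with (clamp 0 (s k) y) by (unfold clamp, Rmax, Rmin; repeat destruct Rle_dec; lra).
           ring.
        -- replace (clamp 0 (s k) y) with (s k) by (unfold clamp, Rmax, Rmin; repeat destruct Rle_dec; lra).
           replace (clamp 0 (s (S k)) y) with (clamp (s k) (s (S k)) y) by (unfold clamp, Rmax, Rmin; repeat destruct Rle_dec; lra).
           rewrite (HKG (clamp _ _ _)) by (apply clamp_in; lra). ring.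
      * apply cont_plus; [apply IHc|]. apply cont_minus; [|apply cont_const].
        apply cont_comp_lip; [apply clamp_lip|]. eapply has_deriv_cont, HG.
    + intros g Hg. apply (ex_RInt_Chasles (V := C_R_NormedModule) _ 0 (s k)); auto.
    + exists (Lam + Lam'). split; [lra|]. intros g M Hg HM. rewrite (CRInt_Chasles _ 0 (s k)) by auto.
      eapply Rle_trans; [apply Cmod_triangle|]. rewrite Rmult_plus_distr_r. apply Rplus_le_compat; auto.
    + intros Phi Phi' HPhi' HPhi. rewrite (CRInt_Chasles _ 0 (s k)) by auto. rewrite (IHx Phi Phi'), (Px Phi Phi') by auto. ring. }
destruct (Main n (le_n n)) as (A & B & E & F). rewrite Hsn in *. split; [exact A|split; [exact B|split; [exact E|]]].
intros Phi Phi' H1 H2. rewrite (F Phi Phi' H1 H2), Hcl. ring.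
Qed.

Lemma Kc_cont : forall r, cont Kc r.
Proof. apply Kc_cont_and_integral. Qed.

Lemma Dc_id : Dc Kc (fun z => z).
Proof. exact Kc_cont. Qed.

Lemma BLF_contour : exists Lam, BLF (on_curve K) (Dc Kc) (contour_int K) Lam.
Proof.
destruct Kc_cont_and_integral as (_ & He & (Lam & HLam & Hb) & _). exists Lam.
constructor.
- exact HLam.
- intros g h; apply Dc_plus.
- intros g h Hg Hh. transitivity (CRInt (fun s => integrand g s + integrand h s)%C 0 1).
  + apply CRInt_ext; [lra|]. intros; unfold integrand; ring.
  + apply CRInt_plus; auto.
- intros c g Hg. apply Dc_mult; [apply Dc_const|exact Hg].
- intros c g Hg. transitivity (CRInt (fun s => c * integrand g s)%C 0 1).
  + apply CRInt_ext; [lra|]. intros; unfold integrand; ring.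
  + apply CRInt_scal; auto.
- intros g H. apply (Dc_lim Kc (on_curve K)); [apply Kc_on|exact H].
- exact Hb.
Qed.

Lemma contour_exact : forall Phi Phi', Dc Kc Phi' -> (forall z, on_curve K z -> pder Phi (Phi' z) z) -> contour_int K Phi' = 0%C.
Proof. apply Kc_cont_and_integral. Qed.

Lemma Dc_coef : forall g, Dc Kc g -> coef (on_curve K) g.
Proof.
intros g Hg. destruct (bounded_seg (fun r => g (Kc r)) 0 1) as (M & HM & B); [lra|exact Hg|].
exists M. split; [exact HM|]. intros z Hz. destruct (on_Kc z Hz) as (r & Hr & <-). apply B, Hr.
Qed.

Lemma curve_dist : forall z, ~ on_curve K z -> exists dl, 0 < dl /\ forall w, on_curve K w -> dl <= Cmod (w - z)%C.
Proof.
intros z Hz. destruct (continuity_ab_min (fun r => Cmod (Kc r - z)%C) 0 1) as (m & Hm & Hm01); [lra| |].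
- intros c _. apply continuity_pt_filterlim. apply (cont_Cmod (fun r => Kc r - z)%C). apply cont_minus; [apply Kc_cont|apply cont_const].
- exists (Cmod (Kc m - z)%C). split.
  + apply Cmod_gt_0. intros E. apply Hz. replace z with (Kc m); [apply Kc_on|].
    replace (Kc m) with (Kc m - z + z)%C by ring. rewrite E. ring.
  + intros w Hw. destruct (on_Kc w Hw) as (r & Hr & <-). apply Hm, Hr.
Qed.

Lemma off_neq : forall z, ~ on_curve K z -> forall w, on_curve K w -> (w - z)%C <> 0%C.
Proof. intros z Hz w Hw E. apply Hz. replace z with w; [exact Hw|]. replace w with (w - z + z)%C by ring. rewrite E. ring. Qed.

(** ** The winding number *)

(** [2 i pi] times the winding number. *)
Definition wind (z : C) : C := contour_int K (fun w => / (w - z))%C.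

Lemma Dc_wind : forall z, ~ on_curve K z -> Dc Kc (fun w => / (w - z))%C.
Proof.
intros z Hz. apply Dc_inv; [apply Dc_minus; [apply Dc_id|apply Dc_const]|].
intros r. apply (off_neq z Hz), Kc_on.
Qed.

Lemma pder_inv_shift : forall a z, (z - a)%C <> 0%C -> pder (fun w => - / (w - a))%C (/ ((z - a) * (z - a)))%C z.
Proof.
intros a z Hz c r dc Hc E. subst z. eapply has_deriv_eq.
- apply has_deriv_opp, has_deriv_inv; [apply has_deriv_minus; [exact Hc|apply has_deriv_const]|exact Hz].
- cbv beta. field. exact Hz.
Qed.

(** Since [1/(w-a)^2] has a primitive, moving the pole changes the winding
    integral only to second order. *)
Lemma wind_quad : exists Lam, 0 <= Lam /\ forall a b dl, 0 < dl ->
  (forall w, on_curve K w -> dl <= Cmod (w - a)%C) -> (forall w, on_curve K w -> dl <= Cmod (w - b)%C) ->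
  Cmod (wind b - wind a)%C <= Lam / dl ^ 3 * Cmod (b - a)%C ^ 2.
Proof.
destruct BLF_contour as (Lam & HL). exists Lam. split; [apply (blf_pos _ _ _ _ HL)|].
intros a b dl Hdl Ha Hb.
assert (Hna : ~ on_curve K a).
{ intros H. specialize (Ha a H). replace (a - a)%C with (RtoC 0) in Ha by ring. rewrite Cmod_0 in Ha. lra. }
assert (Hnb : ~ on_curve K b).
{ intros H. specialize (Hb b H). replace (b - b)%C with (RtoC 0) in Hb by ring. rewrite Cmod_0 in Hb. lra. }
assert (Dsq : Dc Kc (fun w => / ((w - a) * (w - a)))%C).
{ apply Dc_inv; [apply Dc_mult; (apply Dc_minus; [apply Dc_id|apply Dc_const])|].
  intros r. apply Cmult_neq_0; apply (off_neq a Hna), Kc_on. }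
assert (E0 : contour_int K (fun w => / ((w - a) * (w - a)))%C = 0%C).
{ apply (contour_exact (fun w => - / (w - a))%C); [exact Dsq|]. intros z Hz. apply pder_inv_shift, (off_neq a Hna), Hz. }
replace (wind b - wind a)%C with (wind b - wind a - (b - a) * contour_int K (fun w => / ((w - a) * (w - a)))%C)%C by (rewrite E0; ring).
replace (Lam / dl ^ 3 * Cmod (b - a) ^ 2) with (Lam * (Cmod (b - a)%C ^ 2 / dl ^ 3)) by (field; lra).
apply (blf_lin_bound HL (fun w => / (w - b))%C (fun w => / (w - a))%C (fun w => / ((w - a) * (w - a)))%C).
- apply Dc_wind, Hnb.
- apply Dc_wind, Hna.
- exact Dsq.
- intros w Hw. assert (Na := off_neq a Hna w Hw). assert (Nb := off_neq b Hnb w Hw).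
  replace (/ (w - b) - / (w - a) - (b - a) * / ((w - a) * (w - a)))%C with
    ((b - a) * (b - a) * / ((w - b) * ((w - a) * (w - a))))%C by (field; split; assumption).
  rewrite !Cmod_mult, Cmod_inv, !Cmod_mult by (repeat apply Cmult_neq_0; assumption).
  specialize (Ha w Hw). specialize (Hb w Hw).
  replace (Cmod (b - a) ^ 2 / dl ^ 3) with (Cmod (b - a) * Cmod (b - a) * / (dl * (dl * dl))) by (field; lra).
  apply Rmult_le_compat_l; [apply Rmult_le_pos; apply Cmod_ge_0|].
  apply Rinv_le_contravar; [repeat apply Rmult_lt_0_compat; lra|].
  repeat apply Rmult_le_compat; try lra; apply Rmult_le_pos; lra.
Qed.

(** By [wind_quad] the winding integral has zero derivative along the segment from [z] to [z']. *)
Lemma wind_loc : forall z, ~ on_curve K z -> exists dl, 0 < dl /\ forall z', Cmod (z' - z)%C < dl -> wind z' = wind z.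
Proof.
intros z Hz. destruct (curve_dist z Hz) as (dl & Hdl & Hd). destruct wind_quad as (Lam & HLam & HQ).
exists (dl / 4). split; [lra|]. intros z' Hz'.
assert (Hfar : forall th w, Rabs th <= 2 -> on_curve K w -> dl / 2 <= Cmod (w - (z + th * (z' - z)))%C).
{ intros th w Hth Hw. specialize (Hd w Hw).
  assert (Hsmall : Cmod (th * (z' - z))%C <= dl / 2).
  { rewrite Cmod_mult, Cmod_R. generalize (Cmod_ge_0 (z' - z)%C). nra. }
  replace (w - z)%C with ((w - (z + th * (z' - z))) + th * (z' - z))%C in Hd by ring.
  generalize (Cmod_triangle (w - (z + th * (z' - z)))%C (th * (z' - z))%C). lra. }
assert (E : wind (z + 1%R * (z' - z))%C = wind (z + 0%R * (z' - z))%C).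
{ apply (const_of_quad (fun th => wind (z + th * (z' - z))%C) (Lam / (dl / 2) ^ 3 * Cmod (z' - z)%C ^ 2)); [lra| |].
  - apply Rmult_le_pos; [apply Rdiv_le_0_compat; [exact HLam|apply pow_lt; lra]|apply pow2_ge_0].
  - intros r r' Hr Hr'. eapply Rle_trans; [apply (HQ _ _ (dl / 2)); [lra| |]|].
    + intros w Hw. apply Hfar; [rewrite Rabs_pos_eq; lra|exact Hw].
    + intros w Hw. apply Hfar; [rewrite Rabs_pos_eq; lra|exact Hw].
    + replace (z + r' * (z' - z) - (z + r * (z' - z)))%C with ((r' - r)%R * (z' - z))%C by (rewrite RtoC_minus; ring).
      rewrite Cmod_mult, Cmod_R, Rpow_mult_distr, pow2_abs. right; ring. }
replace (z + 1%R * (z' - z))%C with z' in E by ring. replace (z + 0%R * (z' - z))%C with z in E by ring. exact E.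
Qed.

Lemma wind_joined : forall z w, joined_off K z w -> wind w = wind z.
Proof.
intros z w (p & Hc & H0 & H1 & Hoff).
assert (Hcp : Dc (clamp 0 1) p).
{ intros r. apply cont_eps. intros eps He.
  assert (H := Hc (clamp 0 1 r) (clamp_in 0 1 r Rle_0_1) _ (locally_ball_norm (V := C_R_NormedModule) (p (clamp 0 1 r)) (mkposreal eps He))).
  destruct H as [d Hd]. exists d. split; [apply cond_pos|]. intros y Hy. rewrite <- norm_Cmod. apply Hd.
  - change (Rabs (clamp 0 1 y - clamp 0 1 r) < d). eapply Rle_lt_trans; [apply clamp_lip|exact Hy].
  - apply clamp_in; lra. }
assert (E : Cmod (wind (p (clamp 0 1 1)) - wind (p (clamp 0 1 0)))%C <= 0 * (1 - 0)).
{ apply (deriv_lip (fun r => wind (p (clamp 0 1 r))) (fun _ => 0%C)); [lra| |intros; rewrite Cmod_0; lra].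
  intros r _. destruct (wind_loc (p (clamp 0 1 r))) as (dl & Hdl & HW); [apply Hoff, clamp_in; lra|].
  destruct (proj1 (cont_eps _ _) (Hcp r) dl Hdl) as (d & Hd & Hy).
  apply (has_deriv_quad _ r _ 0 d Hd). intros y Hyr. rewrite (HW _ (Hy y Hyr)).
  replace (wind (p (clamp 0 1 r)) - wind (p (clamp 0 1 r)) - (y - r)%R * 0)%C with (RtoC 0) by ring.
  rewrite Cmod_0. lra. }
rewrite !clamp_id, H0, H1 in E by lra. apply Ceq_of_eps. intros. lra.
Qed.

(** A point that is not inside can be joined to points arbitrarily far away, where the integrand is arbitrarily small. *)
Lemma wind_outside : forall z, ~ on_curve K z -> ~ inside K z -> wind z = 0%C.
Proof.
intros z Hz Hin. destruct BLF_contour as (Lam & HL). assert (HLam := blf_pos _ _ _ _ HL).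
destruct (Dc_coef _ Dc_id) as (B & HB & HKB).
apply Ceq_of_eps. intros eps He.
assert (Hex : exists w, joined_off K z w /\ B + Lam / eps + 1 < Cmod w).
{ apply NNPP. intros Hn. apply Hin. split; [exact Hz|]. exists (B + Lam / eps + 1). intros w Hw.
  apply Rnot_lt_le. intros Hlt. apply Hn. exists w; split; assumption. }
destruct Hex as (w & Hj & Hw). rewrite <- (wind_joined z w Hj).
assert (Hle : 0 <= Lam / eps) by (apply Rdiv_le_0_compat; lra).
assert (Hd : forall v, on_curve K v -> Lam / eps + 1 <= Cmod (v - w)%C).
{ intros v Hv. specialize (HKB v Hv). rewrite Cmod_minus_sym.
  generalize (Cmod_triangle (w - v)%C v). replace (w - v + v)%C with w by ring. lra. }
assert (Hnw : ~ on_curve K w).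
{ intros H. specialize (Hd w H). replace (w - w)%C with (RtoC 0) in Hd by ring. rewrite Cmod_0 in Hd. lra. }
replace (wind w - 0)%C with (wind w) by ring.
eapply Rle_trans; [apply (blf_bound _ _ _ _ HL) with (M := / (Lam / eps + 1)); [apply Dc_wind, Hnw|]|].
- intros v Hv. rewrite Cmod_inv by (apply (off_neq w Hnw v Hv)). apply Rinv_le_contravar; [lra|]. apply Hd, Hv.
- apply Rmult_le_reg_r with (Lam / eps + 1); [lra|]. rewrite Rmult_assoc, Rinv_l by lra.
  replace (eps * (Lam / eps + 1)) with (Lam + eps) by (field; lra). lra.
Qed.

(** ** Logarithmic derivatives *)

(** The derivative in [r] of the first integral is the second one, whose integrand is the [z]-derivative of [e^{r psi} / r]; so the
    exponential factor can be removed. *)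
Lemma exp_log_deriv : forall psi dpsi, Dc Kc psi -> Dc Kc dpsi -> (forall z, on_curve K z -> pder psi (dpsi z) z) ->
  (forall z, on_curve K z -> psi z <> 0%C) -> forall r, 0 <= r ->
  contour_int K (fun z => Cexp (r * psi z) * (dpsi z / psi z))%C = contour_int K (fun z => dpsi z / psi z)%C /\
  contour_int K (fun z => Cexp (r * psi z) * dpsi z)%C = 0%C.
Proof.
intros psi dpsi Hpsi Hdpsi Hder Hnz. destruct BLF_contour as (Lam & HL).
assert (Hnz' : forall r, psi (Kc r) <> 0%C) by (intros r; apply Hnz, Kc_on).
assert (De : forall r : R, Dc Kc (fun z => Cexp (r * psi z))%C) by (intros r; apply Dc_Cexp, Dc_mult; [apply Dc_const|exact Hpsi]).
assert (Dq : Dc Kc (fun z => dpsi z / psi z)%C) by (apply Dc_div; assumption).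
assert (D0 : forall r : R, Dc Kc (fun z => Cexp (r * psi z) * (dpsi z / psi z))%C) by (intros r; apply Dc_mult; auto).
assert (D1 : forall r : R, Dc Kc (fun z => Cexp (r * psi z) * dpsi z)%C) by (intros r; apply Dc_mult; auto).
assert (Z : forall r, 0 <= r -> contour_int K (fun z => Cexp (r * psi z) * dpsi z)%C = 0%C).
{ intros r [Hr|<-].
  - apply (contour_exact (fun z => / r * Cexp (r * psi z))%C); [apply D1|].
    intros z Hz c q dc Hc E. subst z. eapply has_deriv_eq.
    + apply has_deriv_scal, has_deriv_Cexp, has_deriv_scal, (Hder _ Hz); [exact Hc|reflexivity].
    + cbv beta. field. intros E. apply RtoC_inj in E. lra.
  - apply (contour_exact psi); [apply D1|]. intros z Hz c q dc Hc E.
    eapply has_deriv_eq; [apply (Hder z Hz c q dc Hc E)|].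
    replace (0%R * psi z)%C with (RtoC 0) by ring. rewrite Cexp_0. ring. }
intros r Hr. split; [|apply Z, Hr].
assert (T : tay (on_curve K) (segR r) (fun z y => Cexp (y * psi z) * (dpsi z / psi z))%C (fun z y => Cexp (y * psi z) * dpsi z)%C).
{ assert (Hd : forall z (y : R), has_deriv (fun y : R => Cexp (y * psi z))%C y (psi z * Cexp (y * psi z))%C).
  { intros z y. eapply has_deriv_eq; [apply has_deriv_Cexp, has_deriv_mult; [apply has_deriv_id|apply has_deriv_const]|]. cbv beta. ring. }
  apply (tay_of_deriv2 _ _ _ _ (fun z y => Cexp (y * psi z) * (psi z * dpsi z))%C).
  - apply interval0_seg, Hr.
  - intros z y Hz Hy. eapply has_deriv_eq; [apply has_deriv_mult; [apply Hd|apply has_deriv_const]|]. cbv beta. field. apply Hnz, Hz.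
  - intros z y Hz Hy. eapply has_deriv_eq; [apply has_deriv_mult; [apply Hd|apply has_deriv_const]|]. cbv beta. ring.
  - destruct (Dc_coef _ Hpsi) as (M & HM & B). destruct (Dc_coef _ (Dc_mult _ _ _ Hpsi Hdpsi)) as (M' & HM' & B').
    exists (exp (r * M) * M'). assert (Hp := exp_pos (r * M)). split; [apply Rmult_le_pos; lra|].
    intros z y Hz Hy. rewrite Cmod_mult, Cmod_Cexp. apply Rmult_le_compat; try apply Cmod_ge_0; [left; apply exp_pos| |apply B', Hz].
    apply exp_le. eapply Rle_trans; [apply Rle_abs|]. eapply Rle_trans; [apply re_le_Cmod|].
    rewrite Cmod_mult, Cmod_R, Rabs_pos_eq by lra. apply Rmult_le_compat; try lra; [apply Cmod_ge_0|apply B, Hz]. }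
destruct T as (M & HM & T).
assert (E := const_of_quad (fun y => contour_int K (fun z => Cexp (y * psi z) * (dpsi z / psi z))%C) (Lam * M) r Hr
  (Rmult_le_pos _ _ (blf_pos _ _ _ _ HL) HM)). cbv beta in E. rewrite E.
- apply (blf_ext HL); [apply D0|]. intros z Hz. replace (0%R * psi z)%C with (RtoC 0) by ring. rewrite Cexp_0. ring.
- intros y y' Hy Hy'.
  replace (contour_int K (fun z => Cexp (y' * psi z) * (dpsi z / psi z)) - contour_int K (fun z => Cexp (y * psi z) * (dpsi z / psi z)))%C
   with (contour_int K (fun z => Cexp (y' * psi z) * (dpsi z / psi z)) - contour_int K (fun z => Cexp (y * psi z) * (dpsi z / psi z))
    - (y' - y)%R * contour_int K (fun z => Cexp (y * psi z) * dpsi z))%C by (rewrite Z by lra; ring).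
  rewrite Rmult_assoc.
  apply (blf_lin_bound HL (fun z => Cexp (y' * psi z) * (dpsi z / psi z))%C (fun z => Cexp (y * psi z) * (dpsi z / psi z))%C
    (fun z => Cexp (y * psi z) * dpsi z)%C); auto.
Qed.
End Curve.

(** * The integrals over the contour *)

Definition den (alpha : R) (lam : C) : C := (1 + alpha * (lam * lam))%C.
(** The Fourier transform of [e^{i lam |y|}] when [Im lam > 0]; see [kern_hat]. *)
Definition kern (lam mu : C) : C := (2 * Ci * lam / (lam * lam - mu * mu))%C.
(** Amplitude of the wave [e^{i lam x}] which, subtracted from [e^{- i lam x}], cancels the Robin operator at [x = 0]. *)
Definition refl (gamma0 gamma1 lam : C) : C := ((gamma0 - Ci * gamma1 * lam) / (gamma0 + Ci * gamma1 * lam))%C.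

Lemma Ci2 : (Ci * Ci = - (1))%C.
Proof. apply injective_projections; simpl; ring. Qed.

Lemma Ci_neq_0 : Ci <> 0%C.
Proof. intros H. injection H. lra. Qed.

Lemma RtoC_neq_0 : forall r : R, r <> 0 -> RtoC r <> 0%C.
Proof. intros r H E. apply RtoC_inj in E. contradiction. Qed.

Lemma Cinv_neq_0 : forall z : C, z <> 0%C -> (/ z)%C <> 0%C.
Proof.
intros z Hz E. assert (H := Cinv_r z Hz). rewrite E, Cmult_0_r in H. apply RtoC_inj in H. lra.
Qed.

Ltac cnz := repeat split; first [assumption | apply Ci_neq_0 | apply RtoC_neq_0; first [assumption | apply PI_neq0 | lra]].

Lemma omega_den : forall (alpha beta : R) lam, alpha <> 0 -> den alpha lam <> 0%C ->
  omega alpha beta lam = (beta / alpha - beta / alpha / den alpha lam)%C.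
Proof. intros alpha beta lam Ha Hd. unfold omega, den in *. field. cnz. Qed.

Lemma den_real : forall (alpha mu : R), 0 < alpha -> den alpha mu <> 0%C.
Proof.
intros alpha mu Ha E. unfold den in E. rewrite <- !RtoC_mult, <- RtoC_plus in E. apply RtoC_inj in E. nra.
Qed.

Section Adm.
Variables (alpha beta : R) (gamma0 gamma1 : C) (K : R -> C).
Hypothesis Ha : 0 < alpha.
Hypothesis Hb : 0 < beta.
Hypothesis Hg : (gamma0 * sqrt alpha)%C <> gamma1.
Hypothesis HK : admissible_contour alpha gamma0 gamma1 K.

Let L := contour_int K.
Let D := Dc (Kc K).
Let b : R := beta / alpha.
Let sa : R := sqrt alpha.

Lemma adm_simple : simple_closed_curve K.
Proof. apply HK. Qed.

Lemma on_Im_pos : forall z, on_curve K z -> 0 < Im z.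
Proof. intros z Hz. apply HK. left; exact Hz. Qed.

Lemma lower_outside : forall z, Im z <= 0 -> ~ on_curve K z /\ ~ inside K z.
Proof. intros z Hz. destruct HK as (_ & _ & _ & H & _). split; intros H1; assert (0 < Im z) by (apply H; auto); lra. Qed.

Lemma wind_lower : forall z, Im z <= 0 -> wind K z = 0%C.
Proof. intros z Hz. apply (wind_outside K adm_simple); apply lower_outside, Hz. Qed.

Lemma sa_pos : 0 < sa.
Proof. apply sqrt_lt_R0, Ha. Qed.

Lemma sa_sq : (RtoC sa * RtoC sa)%C = RtoC alpha.
Proof. rewrite <- RtoC_mult. unfold sa. rewrite sqrt_sqrt; [reflexivity|lra]. Qed.

Lemma sa_neq : RtoC sa <> 0%C.
Proof. apply RtoC_neq_0. generalize sa_pos; lra. Qed.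

Lemma wind_pole : wind K (Ci / sa)%C = (2 * PI * Ci)%C.
Proof.
destruct HK as (_ & Hcc & Hin & _). assert (H := Hcc _ Hin). unfold winding_number in H. fold (wind K (Ci / sqrt alpha)%C) in H.
fold sa in H. assert (Hpi : (2 * PI * Ci)%C <> 0%C).
{ apply Cmult_neq_0; [apply Cmult_neq_0; apply RtoC_neq_0; [lra|apply PI_neq0]|apply Ci_neq_0]. }
replace (wind K (Ci / sa)) with ((2 * PI * Ci) * (/ (2 * PI * Ci) * wind K (Ci / sa)))%C by (field; cnz).
rewrite H. ring.
Qed.

Lemma Im_nCisa : Im (- (Ci / sa))%C <= 0.
Proof.
assert (H := sa_pos). simpl. unfold Im; simpl.
assert (0 < / (sa * (sa * 1) + 0 * (0 * 1))) by (apply Rinv_0_lt_compat; nra). unfold Rdiv. nra.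
Qed.

Lemma den_factor : forall z, den alpha z = (alpha * ((z - Ci / sa) * (z - - (Ci / sa))))%C.
Proof.
intros z. unfold den. rewrite <- sa_sq.
replace (sa * sa * ((z - Ci / sa) * (z - - (Ci / sa))))%C with (sa * sa * (z * z) - Ci * Ci)%C by (field; apply sa_neq).
rewrite Ci2. ring.
Qed.

Lemma pole_off : ~ on_curve K (Ci / sa)%C.
Proof. destruct HK as (_ & _ & Hin & _). apply Hin. Qed.

Lemma on_den : forall z, on_curve K z -> den alpha z <> 0%C.
Proof.
intros z Hz. rewrite den_factor. apply Cmult_neq_0; [apply RtoC_neq_0; lra|].
apply Cmult_neq_0; apply off_neq with K; try exact Hz; [apply pole_off|apply (lower_outside _ Im_nCisa)].
Qed.

Lemma on_robin : forall z, on_curve K z -> (gamma0 + Ci * gamma1 * z)%C <> 0%C.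
Proof.
intros z Hz. destruct (classic (gamma1 = 0%C)) as [E|E].
- subst gamma1. replace (gamma0 + Ci * 0 * z)%C with gamma0 by ring. intros E. apply Hg. rewrite E. ring.
- destruct HK as (_ & _ & _ & _ & H). destruct (H E) as [H1 _].
  replace (gamma0 + Ci * gamma1 * z)%C with (Ci * gamma1 * (z - Ci * gamma0 / gamma1))%C.
  + apply Cmult_neq_0; [apply Cmult_neq_0; [apply Ci_neq_0|exact E]|]. apply off_neq with K; assumption.
  + replace (Ci * gamma1 * (z - Ci * gamma0 / gamma1))%C with (Ci * gamma1 * z - (Ci * Ci) * gamma0)%C by (field; exact E).
    rewrite Ci2. ring.
Qed.

Lemma on_real : forall z (mu : R), on_curve K z -> (z - mu)%C <> 0%C.
Proof. intros z mu Hz. apply off_neq with K; [|exact Hz]. apply lower_outside. simpl. lra. Qed.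

Lemma on_kern : forall z (mu : R), on_curve K z -> (z * z - mu * mu)%C <> 0%C.
Proof.
intros z mu Hz. replace (z * z - mu * mu)%C with ((z - mu) * (z - (- mu)%R))%C by (rewrite RtoC_opp; ring).
apply Cmult_neq_0; apply on_real, Hz.
Qed.

Lemma D_id : D (fun z => z).
Proof. apply Dc_id, adm_simple. Qed.

Lemma D_den : D (den alpha).
Proof. apply Dc_plus; [apply Dc_const|]. apply Dc_mult; [apply Dc_const|apply Dc_mult; apply D_id]. Qed.

Lemma D_dinv : D (fun z => / den alpha z)%C.
Proof. apply Dc_inv; [apply D_den|]. intros r. apply on_den, Kc_on. Qed.

Lemma D_omega : D (omega alpha beta).
Proof. apply Dc_div; [|apply D_den|intros r; apply on_den, Kc_on]. apply Dc_mult; [apply Dc_const|apply Dc_mult; apply D_id]. Qed.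

Lemma D_refl : D (refl gamma0 gamma1).
Proof.
apply Dc_div; [apply Dc_minus; [apply Dc_const|apply Dc_mult; [apply Dc_const|apply D_id]]
 |apply Dc_plus; [apply Dc_const|apply Dc_mult; [apply Dc_const|apply D_id]]|].
intros r. apply on_robin, Kc_on.
Qed.

Lemma D_kern : forall mu : R, D (fun z => kern z mu).
Proof.
intros mu. apply Dc_div; [apply Dc_mult; [apply Dc_const|apply D_id]
  |apply Dc_minus; [apply Dc_mult; apply D_id|apply Dc_const]|].
intros r. apply on_kern, Kc_on.
Qed.

Lemma curve_Im : exists dl, 0 < dl /\ forall z, on_curve K z -> dl <= Im z.
Proof.
destruct (continuity_ab_min (fun r => Im (Kc K r)) 0 1) as (m & Hm & Hm01); [lra| |].
- intros c _. apply continuity_pt_filterlim. apply (proj1 (cont_pair _ _) (Kc_cont K adm_simple c)).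
- exists (Im (Kc K m)). split; [apply on_Im_pos, Kc_on|].
  intros w Hw. destruct (on_Kc K w Hw) as (r & Hr & <-). apply Hm, Hr.
Qed.

(** ** Exponentials along the contour *)

Lemma L_exp : forall r, 0 <= r -> L (fun z => Cexp (Ci * z * r))%C = 0%C.
Proof.
intros r Hr.
destruct (BLF_contour K adm_simple) as (Lam & HL).
assert (HD : D (fun z => Cexp (Ci * z * r))%C) by (apply Dc_Cexp, Dc_mult; [apply Dc_mult; [apply Dc_const|apply D_id]|apply Dc_const]).
destruct (exp_log_deriv K adm_simple (fun z => Ci * z)%C (fun _ => Ci)) with (r := r) as [_ H]; try assumption.
- apply Dc_mult; [apply Dc_const|apply D_id].
- apply Dc_const.
- intros z Hz c q dc Hc E. apply has_deriv_scal, Hc.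
- intros z Hz. apply Cmult_neq_0; [apply Ci_neq_0|]. replace z with (z - 0%R)%C by ring. apply on_real, Hz.
- assert (H' : (Ci * L (fun z => Cexp (Ci * z * r)))%C = 0%C).
  { rewrite <- H. unfold L. rewrite <- (blf_scal _ _ _ _ HL Ci) by exact HD. f_equal. apply functional_extensionality. intros z.
    rewrite Cmult_comm. do 2 f_equal. ring. }
  replace (L (fun z => Cexp (Ci * z * r))%C) with (/ Ci * (Ci * L (fun z => Cexp (Ci * z * r))))%C by (field; apply Ci_neq_0).
  rewrite H'. ring.
Qed.

(** Either the reflection coefficient is constant, or it is a constant plus a multiple of [1 / (z - p)] with [p] outside the
    contour. *)
Lemma L_refl_exp : forall r, 0 <= r -> L (fun z => refl gamma0 gamma1 z * Cexp (Ci * z * r))%C = 0%C.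
Proof.
intros r Hr.
destruct (BLF_contour K adm_simple) as (Lam & HL).
assert (HD : D (fun z => Cexp (Ci * z * r))%C) by (apply Dc_Cexp, Dc_mult; [apply Dc_mult; [apply Dc_const|apply D_id]|apply Dc_const]).
destruct (classic (gamma1 = 0%C)) as [E|E].
- rewrite <- (L_exp r Hr). apply (blf_ext HL); [apply Dc_mult; [apply D_refl|exact HD]|].
  intros z Hz. assert (H := on_robin z Hz). unfold refl. rewrite E in *.
  replace ((gamma0 - Ci * 0 * z) / (gamma0 + Ci * 0 * z))%C with (RtoC 1); [ring|]. field.
  intros E0. apply H. rewrite E0. ring.
- destruct HK as (_ & _ & _ & _ & Hp). destruct (Hp E) as [Hon Hin].
  set (p := (Ci * gamma0 / gamma1)%C) in *.
  destruct (exp_log_deriv K adm_simple (fun z => Ci * (z - p))%C (fun _ => Ci)) with (r := r) as [H _]; try assumption.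
  + apply Dc_mult; [apply Dc_const|]. apply Dc_minus; [apply D_id|apply Dc_const].
  + apply Dc_const.
  + intros z Hz c q dc Hc Ez. eapply has_deriv_eq; [apply has_deriv_scal, has_deriv_minus; [exact Hc|apply has_deriv_const]|ring].
  + intros z Hz. apply Cmult_neq_0; [apply Ci_neq_0|]. apply off_neq with K; assumption.
  + assert (Hw : L (fun z => Ci / (Ci * (z - p)))%C = 0%C).
    { rewrite <- (wind_outside K adm_simple p Hon Hin). unfold wind, L. apply (blf_ext HL).
      - apply Dc_div; [apply Dc_const|apply Dc_mult; [apply Dc_const|apply Dc_minus; [apply D_id|apply Dc_const]]|].
        intros q. apply Cmult_neq_0; [apply Ci_neq_0|]. apply off_neq with K; [exact Hon|apply Kc_on].
      - intros z Hz. field. split; [apply off_neq with K; assumption|apply Ci_neq_0]. }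
    fold L in H. rewrite Hw in H.
    assert (D1 : D (fun z => Cexp (r * (Ci * (z - p))) * (Ci / (Ci * (z - p))))%C).
    { apply Dc_mult; [apply Dc_Cexp, Dc_mult; [apply Dc_const|apply Dc_mult; [apply Dc_const|apply Dc_minus; [apply D_id|apply Dc_const]]]|].
      apply Dc_div; [apply Dc_const|apply Dc_mult; [apply Dc_const|apply Dc_minus; [apply D_id|apply Dc_const]]|].
      intros q. apply Cmult_neq_0; [apply Ci_neq_0|]. apply off_neq with K; [exact Hon|apply Kc_on]. }
    (* [refl = - 1 + 2 gamma0 / (i gamma1 (z - p))], because [gamma0 + i gamma1 z = i gamma1 (z - p)]. *)
    assert (E2 : L (fun z => refl gamma0 gamma1 z * Cexp (Ci * z * r))%C =
      L (fun z => - (1) * Cexp (Ci * z * r) + (2 * gamma0 / (Ci * gamma1) * Cexp (r * (Ci * p))) *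
          (Cexp (r * (Ci * (z - p))) * (Ci / (Ci * (z - p)))))%C).
    { apply (blf_ext HL); [apply Dc_mult; [apply D_refl|exact HD]|]. intros z Hz.
      assert (Hz1 := on_robin z Hz). assert (Hz2 : (z - p)%C <> 0%C) by (apply off_neq with K; assumption).
      replace (Cexp (Ci * z * r)) with (Cexp (r * (Ci * p)) * Cexp (r * (Ci * (z - p))))%C by (rewrite <- Cexp_add; f_equal; ring).
      unfold refl.
      assert (Er : (gamma0 + Ci * gamma1 * z)%C = (Ci * gamma1 * (z - p))%C).
      { unfold p. replace (Ci * gamma1 * (z - Ci * gamma0 / gamma1))%C with (Ci * gamma1 * z - (Ci * Ci) * gamma0)%C by (field; exact E).
        rewrite Ci2. ring. }
      replace (gamma0 - Ci * gamma1 * z)%C with (2 * gamma0 - (gamma0 + Ci * gamma1 * z))%C by ring.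
      rewrite !Er. field. repeat split; auto using Ci_neq_0. }
    rewrite E2. unfold L.
    rewrite (blf_plus _ _ _ _ HL) by (apply Dc_mult; [apply Dc_const|]; assumption).
    rewrite (blf_scal _ _ _ _ HL), (blf_scal _ _ _ _ HL) by assumption.
    fold L. rewrite H, (L_exp r Hr). ring.
Qed.

(** ** The variable [s = 1/den], in which the essential singularity becomes entire *)

Let dden (z : C) : C := (- (2 * alpha * z) / (den alpha z * den alpha z))%C.

Lemma pder_dinv : forall sg z, on_curve K z -> pder (fun z => / den alpha z - sg)%C (dden z) z.
Proof.
intros sg z Hz c q dc Hc E. subst z. assert (Hd := on_den _ Hz). eapply has_deriv_eq.
- apply has_deriv_minus; [apply has_deriv_inv; [|exact Hd]|apply has_deriv_const].
  apply has_deriv_plus; [apply has_deriv_const|]. apply has_deriv_scal. apply has_deriv_mult; exact Hc.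
- cbv beta. unfold dden. field. exact Hd.
Qed.

Lemma D_dden : D dden.
Proof.
apply Dc_div; [apply Dc_opp, Dc_mult; [apply Dc_const|apply D_id]|apply Dc_mult; apply D_den|].
intros r. apply Cmult_neq_0; apply on_den, Kc_on.
Qed.

Lemma D_dsg : forall sg, D (fun z => / den alpha z - sg)%C.
Proof. intros sg. apply Dc_minus; [apply D_dinv|apply Dc_const]. Qed.

Lemma D_exps : forall r : R, D (fun z => Cexp (r * / den alpha z))%C.
Proof. intros r. apply Dc_Cexp, Dc_mult; [apply Dc_const|apply D_dinv]. Qed.

Lemma D_zd : D (fun z => z / den alpha z)%C.
Proof. apply Dc_div; [apply D_id|apply D_den|]. intros r. apply on_den, Kc_on. Qed.

Lemma L_z_den : L (fun z => z / den alpha z)%C = (PI * Ci / alpha)%C.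
Proof.
destruct (BLF_contour K adm_simple) as (Lam & HL).
assert (Hn := proj1 (lower_outside _ Im_nCisa)).
assert (D1 := Dc_wind K adm_simple _ pole_off). assert (D2 := Dc_wind K adm_simple _ Hn).
transitivity (L (fun z => / (2 * alpha) * (/ (z - Ci / sa) + / (z - - (Ci / sa))))%C).
- apply (blf_ext HL); [apply D_zd|]. intros z Hz. rewrite den_factor.
  assert (N1 := off_neq K _ pole_off z Hz). assert (N2 := off_neq K _ Hn z Hz).
  set (u := (Ci / sa)%C) in *. field. cnz.
- unfold L. rewrite (blf_scal _ _ _ _ HL), (blf_plus _ _ _ _ HL); try assumption; [|apply Dc_plus; assumption].
  change (/ (2 * alpha) * (wind K (Ci / sa) + wind K (- (Ci / sa))) = PI * Ci / alpha)%C.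
  rewrite wind_pole, (wind_lower _ Im_nCisa). field. cnz.
Qed.

Lemma L_exps_zd : forall r, 0 <= r -> L (fun z => Cexp (r * / den alpha z) * (z / den alpha z))%C = (PI * Ci / alpha)%C.
Proof.
intros r Hr. destruct (BLF_contour K adm_simple) as (Lam & HL).
destruct (exp_log_deriv K adm_simple (fun z => / den alpha z - 0%R)%C dden (D_dsg 0%R) D_dden) with (r := r) as [H _]; try assumption.
- intros z Hz. apply pder_dinv, Hz.
- intros z Hz. assert (Hd := on_den z Hz). replace (/ den alpha z - 0%R)%C with (/ den alpha z)%C by ring. apply Cinv_neq_0; exact Hd.
- assert (A2 : (2 * alpha)%C <> 0%C) by (apply Cmult_neq_0; apply RtoC_neq_0; lra).
  assert (E : forall z, on_curve K z -> (dden z / (/ den alpha z - 0%R))%C = ((- (2 * alpha)) * (z / den alpha z))%C).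
  { intros z Hz. assert (Hd := on_den z Hz). unfold dden. replace (/ den alpha z - 0%R)%C with (/ den alpha z)%C by ring.
    field. exact Hd. }
  assert (D1 : D (fun z => dden z / (/ den alpha z - 0%R))%C).
  { apply Dc_div; [apply D_dden|apply D_dsg|]. intros q. assert (Hd := on_den _ (Kc_on K q)).
    replace (/ den alpha (Kc K q) - 0%R)%C with (/ den alpha (Kc K q))%C by ring. apply Cinv_neq_0; exact Hd. }
  assert (D2 : D (fun z => Cexp (r * / den alpha z) * (z / den alpha z))%C) by (apply Dc_mult; [apply D_exps|apply D_zd]).
  assert (H1 : (- (2 * alpha) * L (fun z => Cexp (r * / den alpha z) * (z / den alpha z)))%C =
    (- (2 * alpha) * L (fun z => z / den alpha z))%C).
  { unfold L. rewrite <- !(blf_scal _ _ _ _ HL) by (try apply D_zd; exact D2).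
    transitivity (contour_int K (fun z => Cexp (r * (/ den alpha z - 0%R)) * (dden z / (/ den alpha z - 0%R)))%C).
    - apply (blf_ext HL); [apply Dc_mult; [apply Dc_const|exact D2]|]. intros z Hz. rewrite (E z Hz).
      replace (/ den alpha z - 0%R)%C with (/ den alpha z)%C by ring. ring.
    - rewrite H. apply (blf_ext HL); [exact D1|]. exact E. }
  rewrite L_z_den in H1.
  replace (L (fun z => Cexp (r * / den alpha z) * (z / den alpha z))%C) with
   (/ (- (2 * alpha)) * (- (2 * alpha) * L (fun z => Cexp (r * / den alpha z) * (z / den alpha z))))%C.
  + rewrite H1. field. cnz.
  + field. cnz.
Qed.

Lemma L_exps_zdd : forall r, 0 <= r -> L (fun z => Cexp (r * / den alpha z) * dden z)%C = 0%C.
Proof.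
intros r Hr.
destruct (exp_log_deriv K adm_simple (fun z => / den alpha z - 0%R)%C dden (D_dsg 0%R) D_dden) with (r := r) as [_ H]; try assumption.
- intros z Hz. apply pder_dinv, Hz.
- intros z Hz. assert (Hd := on_den z Hz). replace (/ den alpha z - 0%R)%C with (/ den alpha z)%C by ring. apply Cinv_neq_0; exact Hd.
- rewrite <- H. unfold L. f_equal. apply functional_extensionality. intros z.
  replace (/ den alpha z - 0%R)%C with (/ den alpha z)%C by ring. reflexivity.
Qed.

Lemma kern_split : forall z (mu : R), on_curve K z ->
  (2 * z / (z * z - mu * mu))%C = (/ (z - mu) + / (z - (- mu)%R))%C.
Proof.
intros z mu Hz. assert (H1 := on_real z mu Hz). assert (H2 := on_real z (- mu) Hz).
rewrite RtoC_opp in *.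
replace (z * z - mu * mu)%C with ((z - mu) * (z - - mu))%C by ring.
field. split; assumption.
Qed.

Lemma L_kern0 : forall mu : R, L (fun z => 2 * z / (z * z - mu * mu))%C = 0%C.
Proof.
intros mu. destruct (BLF_contour K adm_simple) as (Lam & HL).
assert (O1 : ~ on_curve K mu) by (apply lower_outside; simpl; lra).
assert (O2 : ~ on_curve K (- mu)%R) by (apply lower_outside; simpl; lra).
transitivity (L (fun z => / (z - mu) + / (z - (- mu)%R))%C).
- symmetry. apply (blf_ext HL); [apply Dc_plus; apply Dc_wind; try exact adm_simple; assumption|].
  intros z Hz. symmetry. apply kern_split, Hz.
- unfold L. rewrite (blf_plus _ _ _ _ HL) by (apply Dc_wind; try exact adm_simple; assumption).
  change (wind K mu + wind K (- mu)%R = 0)%C. rewrite !wind_lower by (simpl; lra). ring.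
Qed.

Lemma dsg_eq : forall z (mu : R), on_curve K z ->
  (/ den alpha z - / den alpha mu)%C = (- alpha * (z * z - mu * mu) / (den alpha z * den alpha mu))%C.
Proof.
intros z mu Hz. assert (H1 := on_den z Hz). assert (H2 := den_real alpha mu Ha).
replace (alpha * (z * z - mu * mu))%C with (den alpha z - den alpha mu)%C by (unfold den; ring).
replace (- alpha * (z * z - mu * mu))%C with (den alpha mu - den alpha z)%C by (unfold den; ring).
field. split; assumption.
Qed.

Lemma dsg_log : forall z (mu : R), on_curve K z ->
  (dden z / (/ den alpha z - / den alpha mu))%C = (2 * z / (z * z - mu * mu) + (- (2 * alpha)) * (z / den alpha z))%C.
Proof.
intros z mu Hz. rewrite dsg_eq by exact Hz. assert (H1 := on_den z Hz). assert (H2 := den_real alpha mu Ha).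
assert (H3 := on_kern z mu Hz). unfold dden.
replace (2 * z / (z * z - mu * mu) + (- (2 * alpha)) * (z / den alpha z))%C
  with (2 * z * (den alpha z - alpha * (z * z - mu * mu)) / ((z * z - mu * mu) * den alpha z))%C by (field; split; assumption).
replace (den alpha z - alpha * (z * z - mu * mu))%C with (den alpha mu) by (unfold den; ring).
field. cnz.
Qed.

Lemma D_k2 : forall mu : R, D (fun z => 2 * z / (z * z - mu * mu))%C.
Proof.
intros mu. apply Dc_div; [apply Dc_mult; [apply Dc_const|apply D_id]
  |apply Dc_minus; [apply Dc_mult; apply D_id|apply Dc_const]|].
intros r. apply on_kern, Kc_on.
Qed.

(** The logarithmic derivative of [psi = 1 / den - 1 / den mu]: at the zeros of [psi], which are [mu] and [- mu], the winding
    numbers vanish, and the pole of [1 / den] contributes [- 2 i pi].  The factor on the right comes from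
    shifting the exponent by [1 / den mu]. *)
Lemma L_exps_log : forall r (mu : R), 0 <= r ->
  L (fun z => Cexp (r * / den alpha z) * (2 * z / (z * z - mu * mu) + (- (2 * alpha)) * (z / den alpha z)))%C
   = (- (2 * PI * Ci) * Cexp (r * / den alpha mu))%C.
Proof.
intros r mu Hr. destruct (BLF_contour K adm_simple) as (Lam & HL).
assert (H2 := den_real alpha mu Ha).
assert (Hnz : forall z, on_curve K z -> (/ den alpha z - / den alpha mu)%C <> 0%C).
{ intros z Hz. rewrite dsg_eq by exact Hz. assert (H1 := on_den z Hz). assert (H3 := on_kern z mu Hz).
  apply Cmult_neq_0; [apply Cmult_neq_0; [rewrite <- RtoC_opp; apply RtoC_neq_0; lra|exact H3]|].
  apply Cinv_neq_0, Cmult_neq_0; assumption. }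
assert (Dk : D (fun z => 2 * z / (z * z - mu * mu) + (- (2 * alpha)) * (z / den alpha z))%C)
  by (apply Dc_plus; [apply D_k2|apply Dc_mult; [apply Dc_const|apply D_zd]]).
destruct (exp_log_deriv K adm_simple (fun z => / den alpha z - / den alpha mu)%C dden (D_dsg _) D_dden) with (r := r) as [H _]; try assumption.
{ intros z Hz. apply pder_dinv, Hz. }
assert (H' : L (fun z => Cexp (r * (/ den alpha z - / den alpha mu)) * (2 * z / (z * z - mu * mu) + (- (2 * alpha)) * (z / den alpha z)))%C
   = (- (2 * PI * Ci))%C).
{ transitivity (L (fun z => 2 * z / (z * z - mu * mu) + (- (2 * alpha)) * (z / den alpha z))%C).
  - assert (Dl : D (fun z => dden z / (/ den alpha z - / den alpha mu))%C).
    { apply Dc_div; [apply D_dden|apply D_dsg|]. intros q. apply Hnz, Kc_on. }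
    assert (E1 : L (fun z => dden z / (/ den alpha z - / den alpha mu))%C =
      L (fun z => 2 * z / (z * z - mu * mu) + (- (2 * alpha)) * (z / den alpha z))%C).
    { apply (blf_ext HL); [exact Dl|]. intros z Hz. apply dsg_log, Hz. }
    rewrite <- E1. unfold L. rewrite <- H. symmetry. apply (blf_ext HL).
    + apply Dc_mult; [apply Dc_Cexp, Dc_mult; [apply Dc_const|apply D_dsg]|exact Dl].
    + intros z Hz. rewrite <- dsg_log by exact Hz. reflexivity.
  - unfold L. rewrite (blf_plus _ _ _ _ HL _ _ (D_k2 mu) (blf_scal_D _ _ _ _ HL (- (2 * alpha))%C _ D_zd)).
    rewrite (blf_scal _ _ _ _ HL _ _ D_zd). fold L. rewrite L_kern0, L_z_den. field. cnz. }
assert (De : D (fun z => Cexp (r * (/ den alpha z - / den alpha mu)) * (2 * z / (z * z - mu * mu) + (- (2 * alpha)) * (z / den alpha z)))%C).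
{ apply Dc_mult; [apply Dc_Cexp, Dc_mult; [apply Dc_const|apply D_dsg]|exact Dk]. }
replace (- (2 * PI * Ci) * Cexp (r * / den alpha mu))%C with (Cexp (r * / den alpha mu) * - (2 * PI * Ci))%C by ring.
rewrite <- H'. unfold L. rewrite <- (blf_scal _ _ _ _ HL _ _ De).
apply (blf_ext HL); [apply Dc_mult; [apply D_exps|exact Dk]|]. intros z Hz.
rewrite Cmult_assoc, <- Cexp_add. do 2 f_equal. ring.
Qed.

Lemma Cexp_omega : forall (t : R) z, den alpha z <> 0%C ->
  Cexp (- (omega alpha beta z * t))%C = (Cexp (- (b * t))%R * Cexp ((b * t)%R * / den alpha z))%C.
Proof.
intros t z Hz. rewrite omega_den by (try assumption; lra). rewrite <- Cexp_add. f_equal. unfold b.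
rewrite RtoC_opp, RtoC_mult, RtoC_div by lra. field. cnz.
Qed.

Lemma D_expom : forall t : R, D (fun z => Cexp (- (omega alpha beta z * t)))%C.
Proof. intros t. apply Dc_Cexp, Dc_opp, Dc_mult; [apply D_omega|apply Dc_const]. Qed.

Lemma bt_pos : forall t, 0 <= t -> 0 <= b * t.
Proof. intros t Ht. apply Rmult_le_pos; [|exact Ht]. unfold b. apply Rdiv_le_0_compat; lra. Qed.

(** The integrand is [e^{-bt}] times a combination of those of [L_exps_log] and [L_exps_zd], because
    [2z / (z^2 - mu^2) = (2z / (z^2 - mu^2) - 2 alpha z / den) + 2 alpha z / den]. *)
Lemma L_multiplier : forall t (mu : R), 0 <= t ->
  L (fun z => Cexp (- (omega alpha beta z * t)) * kern z mu)%C =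
  (2 * PI * (Cexp (- (omega alpha beta mu * t)) - Cexp (- (b * t))%R))%C.
Proof.
intros t mu Ht. destruct (BLF_contour K adm_simple) as (Lam & HL). assert (Hbt := bt_pos t Ht).
rewrite (Cexp_omega t mu (den_real alpha mu Ha)).
set (e := Cexp (- (b * t))%R).
assert (Dz : D (fun z => Cexp ((b * t)%R * / den alpha z) * (z / den alpha z))%C) by (apply Dc_mult; [apply D_exps|apply D_zd]).
assert (Dl : D (fun z => Cexp ((b * t)%R * / den alpha z) * (2 * z / (z * z - mu * mu) + (- (2 * alpha)) * (z / den alpha z)))%C).
{ apply Dc_mult; [apply D_exps|]. apply Dc_plus; [apply D_k2|apply Dc_mult; [apply Dc_const|apply D_zd]]. }
transitivity (L (fun z => (Ci * e) * (Cexp ((b * t)%R * / den alpha z) * (2 * z / (z * z - mu * mu) + (- (2 * alpha)) * (z / den alpha z)))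
  + (Ci * e * (2 * alpha)) * (Cexp ((b * t)%R * / den alpha z) * (z / den alpha z)))%C).
- apply (blf_ext HL); [apply Dc_mult; [apply D_expom|apply D_kern]|]. intros z Hz.
  rewrite (Cexp_omega t z (on_den z Hz)). fold e. unfold kern.
  assert (H1 := on_den z Hz). assert (H3 := on_kern z mu Hz). field. split; assumption.
- unfold L. rewrite (blf_plus _ _ _ _ HL _ _ (blf_scal_D _ _ _ _ HL _ _ Dl) (blf_scal_D _ _ _ _ HL _ _ Dz)).
  rewrite (blf_scal _ _ _ _ HL _ _ Dl), (blf_scal _ _ _ _ HL _ _ Dz).
  fold L. rewrite L_exps_log, L_exps_zd by assumption.
  transitivity ((Ci * Ci) * e * (2 * PI - 2 * PI * Cexp ((b * t)%R * / den alpha mu)))%C.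
  + field. cnz.
  + rewrite Ci2. ring.
Qed.

(** No constant survives here: dividing by [den] makes the multiplier vanish at infinity. *)
Lemma L_multiplier_den : forall t (mu : R), 0 <= t ->
  L (fun z => Cexp (- (omega alpha beta z * t)) / den alpha z * kern z mu)%C =
  (2 * PI * (Cexp (- (omega alpha beta mu * t)) / den alpha mu))%C.
Proof.
intros t mu Ht. destruct (BLF_contour K adm_simple) as (Lam & HL). assert (Hbt := bt_pos t Ht).
assert (H2 := den_real alpha mu Ha).
rewrite (Cexp_omega t mu H2).
set (e := Cexp (- (b * t))%R).
assert (Dl : D (fun z => Cexp ((b * t)%R * / den alpha z) * (2 * z / (z * z - mu * mu) + (- (2 * alpha)) * (z / den alpha z)))%C).
{ apply Dc_mult; [apply D_exps|]. apply Dc_plus; [apply D_k2|apply Dc_mult; [apply Dc_const|apply D_zd]]. }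
transitivity (L (fun z => (Ci * e / den alpha mu) * (Cexp ((b * t)%R * / den alpha z) * (2 * z / (z * z - mu * mu) + (- (2 * alpha)) * (z / den alpha z))))%C).
- apply (blf_ext HL); [apply Dc_mult; [apply Dc_div; [apply D_expom|apply D_den|intros r; apply on_den, Kc_on]|apply D_kern]|]. intros z Hz.
  rewrite (Cexp_omega t z (on_den z Hz)). fold e. unfold kern.
  assert (H1 := on_den z Hz). assert (H3 := on_kern z mu Hz).
  replace (2 * z / (z * z - mu * mu) + (- (2 * alpha)) * (z / den alpha z))%C
    with (2 * z * (den alpha z - alpha * (z * z - mu * mu)) / ((z * z - mu * mu) * den alpha z))%C by (field; split; assumption).
  replace (den alpha z - alpha * (z * z - mu * mu))%C with (den alpha mu) by (unfold den; ring).
  field. repeat split; assumption.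
- unfold L. rewrite (blf_scal _ _ _ _ HL) by exact Dl. fold L. rewrite L_exps_log by assumption.
  transitivity (- (Ci * Ci) * e * (2 * PI * Cexp ((b * t)%R * / den alpha mu)) / den alpha mu)%C.
  + field. exact H2.
  + rewrite Ci2. field. exact H2.
Qed.

(** Up to a constant factor the integrand is the derivative of [e^{bt / den}]. *)
Lemma L_z_den2 : forall t, 0 <= t ->
  L (fun z => z / (den alpha z * den alpha z) * Cexp (- (omega alpha beta z * t)))%C = 0%C.
Proof.
intros t Ht. destruct (BLF_contour K adm_simple) as (Lam & HL). assert (Hbt := bt_pos t Ht).
transitivity (L (fun z => (- Cexp (- (b * t))%R / (2 * alpha)) * (Cexp ((b * t)%R * / den alpha z) * dden z))%C).
- apply (blf_ext HL).
  + apply Dc_mult; [apply Dc_div; [apply D_id|apply Dc_mult; apply D_den|]|apply D_expom].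
    intros r. apply Cmult_neq_0; apply on_den, Kc_on.
  + intros z Hz. assert (H1 := on_den z Hz). rewrite (Cexp_omega t z H1). unfold dden. field.
    split; [exact H1|apply RtoC_neq_0; lra].
- unfold L. rewrite (blf_scal _ _ _ _ HL) by (apply Dc_mult; [apply D_exps|apply D_dden]).
  fold L. rewrite L_exps_zdd by assumption. ring.
Qed.
End Adm.

(** * Fourier inversion on the half line *)

(** One order more than [dec], so that [y g(y)] is still integrable: this makes the transform Lipschitz. *)
Definition dec3 (Cst : R) (h : R -> C) : Prop := forall y, 0 <= y -> Cmod (h y) <= Cst / (1 + y) ^ 3.

Lemma Cmod_Cexp_Im : forall (mu s : R), Cmod (Cexp (Ci * mu * s)) = 1.
Proof.
intros mu s. rewrite Cmod_Cexp. replace (Re (Ci * mu * s)) with 0 by (simpl; ring). apply exp_0.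
Qed.

Lemma has_deriv_wave : forall (s mu : R), has_deriv (fun mu : R => Cexp (Ci * mu * s)) mu (Ci * s * Cexp (Ci * mu * s))%C.
Proof.
intros s mu. eapply has_deriv_eq.
- apply has_deriv_Cexp, has_deriv_mult; [apply has_deriv_scal, has_deriv_id|apply has_deriv_const].
- cbv beta. ring.
Qed.

Lemma wave_lip : forall (s mu mu' : R), Cmod (Cexp (Ci * mu * s) - Cexp (Ci * mu' * s))%C <= Rabs s * Rabs (mu - mu').
Proof.
intros s mu mu'. apply (deriv_lip_abs (fun mu : R => Cexp (Ci * mu * s)) (fun mu : R => Ci * s * Cexp (Ci * mu * s))%C).
- intros r _. apply has_deriv_wave.
- intros r _. rewrite !Cmod_mult, Cmod_Ci, Cmod_R, Cmod_Cexp_Im. lra.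
Qed.

Lemma wave_lip_s : forall (mu s s' : R), Cmod (Cexp (Ci * mu * s) - Cexp (Ci * mu * s'))%C <= Rabs mu * Rabs (s - s').
Proof.
intros mu s s'. replace (Ci * mu * s)%C with (Ci * s * mu)%C by ring. replace (Ci * mu * s')%C with (Ci * s' * mu)%C by ring. apply wave_lip.
Qed.

Lemma cont_wave : forall (s mu : R), cont (fun mu : R => Cexp (Ci * mu * s)) mu.
Proof. intros. eapply has_deriv_cont, has_deriv_wave. Qed.

Lemma dec3_dec : forall c h, dec3 c h -> dec c h.
Proof.
intros c h H y Hy. eapply Rle_trans; [apply H, Hy|].
assert (Hc : 0 <= c).
{ specialize (H 0 (Rle_refl 0)). generalize (Cmod_ge_0 (h 0)). replace (c / (1 + 0) ^ 3) with c in H by field. lra. }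
apply Rmult_le_compat_l; [exact Hc|]. apply Rinv_le_contravar; [apply pow_lt; lra|].
simpl. assert (0 <= y * (1 + y) * (1 + y)) by (repeat apply Rmult_le_pos; lra). lra.
Qed.

Lemma hat_dec : forall c g (mu : R), dec c g -> dec c (fun x : R => Cexp (- (Ci * mu * x)) * g x)%C.
Proof.
intros c g mu H y Hy. rewrite Cmod_mult.
replace (- (Ci * mu * y))%C with (Ci * (- mu)%R * y)%C by (rewrite RtoC_opp; ring).
rewrite Cmod_Cexp_Im, Rmult_1_l. apply H, Hy.
Qed.

Lemma hat_Dh : forall g (mu : R), Dh g -> Dh (fun x : R => Cexp (- (Ci * mu * x)) * g x)%C.
Proof.
intros g mu H. apply Dc_mult; [|exact H].
apply (Dc_of_cont (fun x : R => Cexp (- (Ci * mu * x)))); [apply Rmax0_lip|].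
intros r. apply cont_Cexp, cont_opp, cont_mult; [apply cont_const|]. apply cont_RtoC, continuous_id.
Qed.

(** The factor [1 + y] is moved into the weight, so that the remaining integrand
    [e^{i mu (x - y)} / (1 + y)] is Lipschitz in [mu] uniformly in [y]. *)
Lemma BLF_hat : forall c g, Dh g -> dec3 c g ->
  BLF (fun y => 0 <= y) (fun h => Dh h /\ bddh h) (fun h => CRInt_halfline (fun y => ((1 + y)%R * g y) * h y)%C) c.
Proof.
intros c g Hg Hd. apply BLF_half.
- apply Dc_mult; [|exact Hg]. apply (Dc_of_cont (fun y => RtoC (1 + y))); [apply Rmax0_lip|].
  intros r. apply cont_RtoC. apply (continuous_plus (V := R_NormedModule)); [apply continuous_const|apply continuous_id].
- intros y Hy. rewrite Cmod_mult, Cmod_R, Rabs_pos_eq by lra.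
  eapply Rle_trans; [apply Rmult_le_compat_l; [lra|apply Hd, Hy]|]. right. field. lra.
Qed.

Lemma hat_arg_D : forall x (m : C) (mu : R), Dh (fun y => Cexp (Ci * mu * (x - y)%R) * m / (1 + y)%R)%C /\
  bddh (fun y => Cexp (Ci * mu * (x - y)%R) * m / (1 + y)%R)%C.
Proof.
intros x m mu. split.
- intros r. assert (Hp : 0 <= Rmax 0 r) by apply Rmax_l.
  apply cont_div.
  + apply cont_mult; [|apply cont_const]. apply (cont_comp_lip (fun y => Cexp (Ci * mu * (x - y)%R))%C (Rmax 0)); [apply Rmax0_lip|].
    apply cont_Cexp, cont_mult; [apply cont_const|]. apply cont_RtoC.
    apply (continuous_minus (V := R_NormedModule)); [apply continuous_const|apply continuous_id].
  + apply (cont_comp_lip (fun y => RtoC (1 + y)) (Rmax 0)); [apply Rmax0_lip|]. apply cont_RtoC.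
    apply (continuous_plus (V := R_NormedModule)); [apply continuous_const|apply continuous_id].
  + apply RtoC_neq_0. lra.
- exists (Cmod m). intros y Hy. unfold Cdiv. rewrite !Cmod_mult, Cmod_Cexp_Im, Cmod_inv, Cmod_R, Rabs_pos_eq by (try (apply RtoC_neq_0); lra).
  rewrite Rmult_1_l. rewrite <- (Rmult_1_r (Cmod m)) at 2. apply Rmult_le_compat_l; [apply Cmod_ge_0|].
  rewrite <- Rinv_1. apply Rinv_le_contravar; lra.
Qed.

Lemma hat_as_L : forall c g x (m : C) (mu : R), Dh g -> dec3 c g ->
  CRInt_halfline (fun y => ((1 + y)%R * g y) * (Cexp (Ci * mu * (x - y)%R) * m / (1 + y)%R))%C =
  (Cexp (Ci * mu * x) * hat g mu * m)%C.
Proof.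
intros c g x m mu Hg Hd. unfold hat.
replace (Cexp (Ci * mu * x) * CRInt_halfline (fun x0 : R => Cexp (- (Ci * mu * x0)) * g x0) * m)%C
  with ((Cexp (Ci * mu * x) * m) * CRInt_halfline (fun x0 : R => Cexp (- (Ci * mu * x0)) * g x0))%C by ring.
rewrite <- (half_scal c) by (try apply hat_Dh; try apply hat_dec; try apply dec3_dec; assumption).
apply (half_ext (Cmod (Cexp (Ci * mu * x) * m) * c)).
- apply Dc_mult; [apply Dc_const|apply hat_Dh, Hg].
- intros y Hy. rewrite Cmod_mult. unfold Rdiv. rewrite Rmult_assoc. apply Rmult_le_compat_l; [apply Cmod_ge_0|].
  apply (hat_dec c g mu (dec3_dec _ _ Hd)), Hy.
- intros y Hy. replace (Cexp (Ci * mu * (x - y)%R)) with (Cexp (Ci * mu * x) * Cexp (- (Ci * mu * y)))%C.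
  + field. apply RtoC_neq_0. lra.
  + rewrite <- Cexp_add. f_equal. rewrite RtoC_minus. ring.
Qed.

Lemma hat_arg_lip : forall x M Lm (m : R -> C) A B, 0 <= M -> 0 <= Lm ->
  (forall mu, A <= mu <= B -> Cmod (m mu) <= M) ->
  (forall mu mu', A <= mu <= B -> A <= mu' <= B -> Cmod (m mu - m mu')%C <= Lm * Rabs (mu - mu')) ->
  forall y, 0 <= y -> forall mu mu', A <= mu <= B -> A <= mu' <= B ->
   Cmod (Cexp (Ci * mu * (x - y)%R) * m mu / (1 + y)%R - Cexp (Ci * mu' * (x - y)%R) * m mu' / (1 + y)%R)%C
     <= ((Rabs x + 1) * M + Lm) * Rabs (mu - mu').
Proof.
intros x M Lm m A B HM HLm Hm Hl y Hy mu mu' Hmu Hmu'.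
assert (Hn : RtoC (1 + y) <> 0%C) by (apply RtoC_neq_0; lra).
replace (Cexp (Ci * mu * (x - y)%R) * m mu / (1 + y)%R - Cexp (Ci * mu' * (x - y)%R) * m mu' / (1 + y)%R)%C
 with (((Cexp (Ci * mu * (x - y)%R) - Cexp (Ci * mu' * (x - y)%R)) * m mu + Cexp (Ci * mu' * (x - y)%R) * (m mu - m mu')) / (1 + y)%R)%C
 by (field; exact Hn).
rewrite Cmod_div, Cmod_R, Rabs_pos_eq by (try exact Hn; lra).
apply Rmult_le_reg_r with (1 + y); [lra|]. unfold Rdiv. rewrite Rmult_assoc, Rinv_l, Rmult_1_r by lra.
eapply Rle_trans; [apply Cmod_triangle|]. rewrite !Cmod_mult, Cmod_Cexp_Im, Rmult_1_l.
assert (H1 := wave_lip (x - y) mu mu'). assert (H2 := Hm mu Hmu). assert (H3 := Hl mu mu' Hmu Hmu').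
set (dm := Rabs (mu - mu')) in *. assert (0 <= dm) by apply Rabs_pos.
assert (Hxy : Rabs (x - y) <= (Rabs x + 1) * (1 + y)).
{ eapply Rle_trans; [apply Rabs_triang|]. rewrite Rabs_Ropp, (Rabs_pos_eq y) by lra. assert (0 <= Rabs x) by apply Rabs_pos. nra. }
apply Rle_trans with ((Rabs x + 1) * (1 + y) * dm * M + Lm * dm).
- apply Rplus_le_compat; [|exact H3]. apply Rmult_le_compat; try apply Cmod_ge_0; [|exact H2].
  eapply Rle_trans; [exact H1|]. apply Rmult_le_compat_r; assumption.
- assert (0 <= Lm * dm * y) by (repeat apply Rmult_le_pos; lra). lra.
Qed.

Lemma hat_bound : forall c g (mu : R), Dh g -> dec3 c g -> Cmod (hat g mu) <= c.
Proof. intros c g mu Hg Hd. apply half_bound; [apply hat_Dh, Hg|apply hat_dec, dec3_dec, Hd]. Qed.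

Lemma hat_lip : forall c g (mu mu' : R), Dh g -> dec3 c g -> Cmod (hat g mu - hat g mu')%C <= c * Rabs (mu - mu').
Proof.
intros c g mu mu' Hg Hd. assert (HL := BLF_hat c g Hg Hd).
replace (hat g mu - hat g mu')%C with (Cexp (Ci * mu * 0%R) * hat g mu * 1 - Cexp (Ci * mu' * 0%R) * hat g mu' * 1)%C.
- rewrite <- !(hat_as_L c) by assumption.
  eapply Rle_trans; [apply (blf_minus_bound HL) with (M := Rabs (mu - mu'))|lra].
  + apply hat_arg_D.
  + apply hat_arg_D.
  + intros y Hy. assert (H := hat_arg_lip 0 1 0 (fun _ => 1%C) (Rmin mu mu') (Rmax mu mu') Rle_0_1 (Rle_refl 0)).
    eapply Rle_trans; [apply H|].
    * intros _ _. rewrite Cmod_1. lra.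
    * intros m m' _ _. replace (1 - 1)%C with (RtoC 0) by ring. rewrite Cmod_0. generalize (Rabs_pos (m - m')). lra.
    * exact Hy.
    * split; [apply Rmin_l|apply Rmax_l].
    * split; [apply Rmin_r|apply Rmax_r].
    * rewrite Rabs_R0. lra.
- replace (Ci * mu * 0%R)%C with (RtoC 0) by ring. replace (Ci * mu' * 0%R)%C with (RtoC 0) by ring. rewrite Cexp_0. ring.
Qed.

Lemma hat_fubini : forall c g (x M Lm : R) (m : R -> C) A B, Dh g -> dec3 c g -> A <= B -> 0 <= M -> 0 <= Lm ->
  (forall mu, A <= mu <= B -> Cmod (m mu) <= M) ->
  (forall mu mu', A <= mu <= B -> A <= mu' <= B -> Cmod (m mu - m mu')%C <= Lm * Rabs (mu - mu')) ->
  CRInt (fun mu : R => Cexp (Ci * mu * x) * hat g mu * m mu)%C A B =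
  CRInt_halfline (fun y => g y * CRInt (fun mu : R => Cexp (Ci * mu * (x - y)%R) * m mu) A B)%C.
Proof.
intros c g x M Lm m A B Hg Hd HAB HM HLm Hm Hl. assert (HL := BLF_hat c g Hg Hd).
destruct (blf_int HL (fun y mu => Cexp (Ci * mu * (x - y)%R) * m mu / (1 + y)%R)%C ((Rabs x + 1) * M + Lm) A B HAB) as [D1 E1].
- intros y Hy mu mu' Hmu Hmu'. apply (hat_arg_lip x M Lm m A B); assumption.
- intros mu Hmu. apply hat_arg_D.
- cbv beta in E1.
  transitivity (CRInt (fun y => CRInt_halfline (fun s => ((1 + s)%R * g s) * (Cexp (Ci * y * (x - s)%R) * m y / (1 + s)%R))%C) A B).
  + apply CRInt_ext; [exact HAB|]. intros mu _. symmetry. apply (hat_as_L c); assumption.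
  + rewrite <- E1. destruct D1 as [D1 [Mb Hb]]. symmetry.
    apply (half_ext (c * Mb)).
    * apply Dc_mult; [|exact D1]. apply Dc_mult; [|exact Hg]. apply (Dc_of_cont (fun y => RtoC (1 + y))); [apply Rmax0_lip|].
      intros r. apply cont_RtoC. apply (continuous_plus (V := R_NormedModule)); [apply continuous_const|apply continuous_id].
    * apply (dec_mult c Mb (fun y => (1 + y)%R * g y)%C); [|exact Hb].
      intros y Hy. rewrite Cmod_mult, Cmod_R, Rabs_pos_eq by lra.
      eapply Rle_trans; [apply Rmult_le_compat_l; [lra|apply Hd, Hy]|]. right. field. lra.
    * intros y Hy. assert (Hn : RtoC (1 + y) <> 0%C) by (apply RtoC_neq_0; lra).
      rewrite (CRInt_ext (fun mu => Cexp (Ci * mu * (x - y)%R) * m mu / (1 + y)%R)%C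
         (fun mu => / (1 + y)%R * (Cexp (Ci * mu * (x - y)%R) * m mu))%C) by (try exact HAB; intros; field; exact Hn).
      rewrite CRInt_scal.
      -- field. exact Hn.
      -- apply exC_Dc; [exact HAB|]. apply Dc_mult.
         ++ apply (Dc_of_cont (fun mu : R => Cexp (Ci * mu * (x - y)%R))); [apply clamp_lip|]. intros; apply cont_wave.
         ++ apply Dc_clamp_lip with Lm; assumption.
Qed.

(** The Dirichlet kernel of the interval from [A] to [B], whose end points go to infinity independently. *)
Definition dker (A B s : R) : C := CRInt (fun mu : R => Cexp (Ci * mu * s)) A B.

Lemma dker_mul : forall A B s : R, A <= B -> (Ci * s * dker A B s)%C = (Cexp (Ci * B * s) - Cexp (Ci * A * s))%C.
Proof.
intros A B s HAB. unfold dker. rewrite <- CRInt_scal by (apply exC_cont; intros; apply cont_wave).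
apply CRInt_unique. apply (CRInt_FTC (fun mu : R => Cexp (Ci * mu * s))); [exact HAB| |].
- intros; apply has_deriv_wave.
- intros; apply cont_mult; [apply cont_const|apply cont_wave].
Qed.

Lemma dker_opp : forall A B s : R, A <= B -> dker A B s = dker (- B) (- A) (- s).
Proof.
intros A B s HAB. unfold dker.
assert (H := CRInt_comp_opp (fun mu : R => Cexp (Ci * mu * s)) (- - A) (- - B) (fun z => cont_wave s z)).
rewrite !Ropp_involutive in H. rewrite H.
apply CRInt_ext; [lra|]. intros mu _. f_equal. rewrite !RtoC_opp. ring.
Qed.

Lemma dker_cont : forall A B s : R, A <= B -> cont (fun s => dker A B s) s.
Proof.
intros A B s HAB. apply cont_lip with (Rmax (Rabs A) (Rabs B) * (B - A)). intros y. unfold dker.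
rewrite <- CRInt_minus by (apply exC_cont; intros; apply cont_wave).
replace (Rmax (Rabs A) (Rabs B) * (B - A) * Rabs (y - s)) with (Rmax (Rabs A) (Rabs B) * Rabs (y - s) * (B - A)) by ring.
apply CRInt_bound; [exact HAB| |].
- apply exC_cont. intros z. apply cont_minus; apply cont_wave.
- intros mu Hmu. eapply Rle_trans; [apply wave_lip_s|]. apply Rmult_le_compat_r; [apply Rabs_pos|].
  revert Hmu. unfold Rmax. destruct Rle_dec; unfold Rabs in *; repeat destruct Rcase_abs; lra.
Qed.

Lemma dker_bound : forall A B s : R, A <= B -> Cmod (dker A B s) <= B - A.
Proof.
intros A B s HAB. unfold dker. replace (B - A) with (1 * (B - A)) by ring. apply CRInt_bound; [exact HAB| |].
- apply exC_cont; intros; apply cont_wave.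
- intros; rewrite Cmod_Cexp_Im; lra.
Qed.

(** Riemann-Lebesgue with a rate: [G = r k] cancels the denominator of the kernel, and one integration by parts gains a factor
    of the size of [1/|A| + 1/B]. *)
Lemma riemann_lebesgue : forall (G k k' : R -> C) (V a b A B : R), 0 <= V -> 0 <= a -> a <= b -> A < 0 -> 0 < B ->
  (forall r, cont G r) ->
  (forall r, a < r < b -> G r = (r * k r)%C /\ has_deriv k r (k' r) /\ Cmod (k r) <= V /\ Cmod (k' r) <= V / (1 + r) ^ 2) ->
  Cmod (CRInt (fun r => G r * dker A B (- r))%C a b) <= 3 * V * (/ - A + / B).
Proof.
intros G k k' V a b A B HV Ha Hab HA HB HG Hk.
assert (HAB : A <= B) by lra. assert (HA' : 0 < / - A) by (apply Rinv_0_lt_compat; lra). assert (HB' : 0 < / B) by (apply Rinv_0_lt_compat; lra).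
set (kap := / - A + / B).
set (H := fun r => (G r * dker A B (- r))%C).
assert (HH : forall r, cont H r).
{ intros r. apply cont_mult; [apply HG|]. apply (cont_comp_lip (fun s => dker A B s) (fun r => - r)).
  - intros u v. replace (- u - - v) with (- (u - v)) by ring. rewrite Rabs_Ropp. lra.
  - apply dker_cont, HAB. }
destruct (bounded_seg H a b Hab HH) as (MH & HMH & HHb).
apply le_of_eps. intros eps He.
destruct (Req_dec a b) as [Eab|Nab].
{ subst b. rewrite CRInt_point, Cmod_0. assert (0 <= V * kap) by (apply Rmult_le_pos; unfold kap; lra). unfold kap in *; lra. }
assert (Hlt : a < b) by lra.
(* The hypotheses on [k] hold in the open interval, so a margin [e] is cut off at both ends. *)
set (e := Rmin ((b - a) / 3) (eps / (2 * (MH + 1)))).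
assert (He0 : 0 < e) by (apply Rmin_glb_lt; [lra|apply Rdiv_lt_0_compat; lra]).
assert (He1 : e <= (b - a) / 3) by apply Rmin_l. assert (He2 : e <= eps / (2 * (MH + 1))) by apply Rmin_r.
assert (Hme : MH * e <= eps / 2).
{ apply Rle_trans with ((MH + 1) * (eps / (2 * (MH + 1)))); [|right; field; lra].
  apply Rle_trans with ((MH + 1) * e); [nra|apply Rmult_le_compat_l; lra]. }
set (a' := a + e). set (b' := b - e).
rewrite (CRInt_Chasles H a a' b) by (apply exC_cont, HH). rewrite (CRInt_Chasles H a' b' b) by (apply exC_cont, HH).
assert (E1 : Cmod (CRInt H a a') <= MH * (a' - a)).
{ apply CRInt_bound; [unfold a'; lra|apply exC_cont, HH|]. intros; apply HHb. unfold a' in *; lra. }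
assert (E2 : Cmod (CRInt H b' b) <= MH * (b - b')).
{ apply CRInt_bound; [unfold b'; lra|apply exC_cont, HH|]. intros; apply HHb. unfold b' in *; lra. }
assert (Hc1 : forall r, a' <= r <= b' -> a < r < b) by (unfold a', b'; intros; lra).
(* A primitive of [i] times the numerator of the kernel, of the size of the required rate. *)
pose (w := fun r : R => (- (/ B)%R * Cexp (Ci * B * (- r)%R) + (/ A)%R * Cexp (Ci * A * (- r)%R))%C).
assert (HwD : forall r, has_deriv w r (Ci * (Cexp (Ci * B * (- r)%R) - Cexp (Ci * A * (- r)%R)))%C).
{ intros r. assert (Hz : forall q : R, has_deriv (fun r => Cexp (Ci * q * (- r)%R)) r (- (Ci * q) * Cexp (Ci * q * (- r)%R))%C).
  { intros q. eapply has_deriv_eq; [apply has_deriv_Cexp, has_deriv_scal, (has_deriv_RtoC (fun r => - r) r (-1))|].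
    - auto_derive; [exact I|ring].
    - cbv beta. ring. }
  eapply has_deriv_eq; [apply has_deriv_plus; apply has_deriv_scal, Hz|].
  rewrite !RtoC_inv by lra. field. split; apply RtoC_neq_0; lra. }
assert (Hwb : forall r, Cmod (w r) <= kap).
{ intros r. unfold w. eapply Rle_trans; [apply Cmod_triangle|]. rewrite !Cmod_mult, Cmod_opp, !Cmod_R, !Cmod_Cexp_Im.
  rewrite (Rabs_pos_eq (/ B)) by lra. rewrite Rabs_left by (apply Rinv_lt_0_compat; lra). unfold kap.
  replace (/ - A) with (- / A) by (field; lra). lra. }
assert (HHk : forall r, a' <= r <= b' -> H r = (k r * (Ci * (Cexp (Ci * B * (- r)%R) - Cexp (Ci * A * (- r)%R))))%C).
{ intros r Hr. unfold H. destruct (Hk r (Hc1 r Hr)) as (-> & _). rewrite <- dker_mul by exact HAB.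
  transitivity (- (Ci * Ci) * (r * k r * dker A B (- r)))%C; [rewrite Ci2; ring|rewrite RtoC_opp; ring]. }
(* Integration by parts, in the form of a derivative that is dominated by an integrable function. *)
assert (Hdom : Cmod ((CRInt H a' b' - k b' * w b') - (CRInt H a' a' - k a' * w a'))%C <=
   - (V * kap / (1 + b')) - - (V * kap / (1 + a'))).
{ apply (deriv_dom (fun r => CRInt H a' r - k r * w r)%C (fun r => - (k' r * w r))%C
   (fun r => - (V * kap / (1 + r))) (fun r => V * kap / (1 + r) ^ 2)).
  - unfold a', b'; lra.
  - intros r Hr. destruct (Hk r (Hc1 r Hr)) as (_ & Dk & _). eapply has_deriv_eq.
    + apply has_deriv_minus; [apply CRInt_deriv, HH|apply has_deriv_mult; [exact Dk|apply HwD]].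
    + cbv beta. rewrite (HHk r Hr). ring.
  - intros r Hr. assert (0 < r) by (specialize (Hc1 r Hr); lra). auto_derive; [lra|field; lra].
  - intros r Hr. assert (0 < r) by (specialize (Hc1 r Hr); lra). destruct (Hk r (Hc1 r Hr)) as (_ & _ & _ & Bk').
    rewrite Cmod_opp, Cmod_mult. replace (V * kap / (1 + r) ^ 2) with (V / (1 + r) ^ 2 * kap) by (field; lra).
    apply Rmult_le_compat; try apply Cmod_ge_0; [exact Bk'|apply Hwb]. }
assert (Hkap : 0 < kap) by (unfold kap; lra).
assert (Hvk : 0 <= V * kap) by (apply Rmult_le_pos; lra).
assert (Hends : forall r, a' <= r <= b' -> Cmod (k r * w r)%C <= V * kap).
{ intros r Hr. destruct (Hk r (Hc1 r Hr)) as (_ & _ & Bk & _). rewrite Cmod_mult. apply Rmult_le_compat; try apply Cmod_ge_0; auto. }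
assert (Ha'b' : a' <= b') by (unfold a', b'; lra).
assert (K1 := Hends a' ltac:(lra)). assert (K2 := Hends b' ltac:(lra)).
assert (E3 : Cmod (CRInt H a' b') <= 3 * (V * kap)).
{ rewrite CRInt_point in Hdom.
  replace (CRInt H a' b') with ((CRInt H a' b' - k b' * w b' - (0 - k a' * w a')) + k b' * w b' + - (k a' * w a'))%C by ring.
  eapply Rle_trans; [apply Cmod_triangle|]. rewrite Cmod_opp.
  eapply Rle_trans; [apply Rplus_le_compat_r, Cmod_triangle|].
  assert (0 <= V * kap / (1 + b')) by (apply Rdiv_le_0_compat; unfold b', a' in *; lra).
  assert (V * kap / (1 + a') <= V * kap).
  { rewrite <- (Rmult_1_r (V * kap)) at 2. apply Rmult_le_compat_l; [lra|]. rewrite <- Rinv_1. apply Rinv_le_contravar; unfold a'; lra. }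
  lra. }
eapply Rle_trans; [apply Cmod_triangle|]. eapply Rle_trans; [apply Rplus_le_compat_l, Cmod_triangle|].
replace (a' - a) with e in E1 by (unfold a'; ring). replace (b - b') with e in E2 by (unfold b'; ring). lra.
Qed.

(** The hypotheses under which inversion is proved with a rate.  They hold both for Schwartz data and for the comparison functions
    [e^{ay}]. *)
Record nice (g g1 : R -> C) (c : R) : Prop := {
  nice_Dh : Dh g;
  nice_deriv : forall y, 0 < y -> has_deriv g y (g1 y);
  nice_dec : dec3 c g;
  nice_dec1 : dec3 c g1;
  nice_tay : forall y y', 0 <= y -> 0 <= y' -> Cmod (g y' - g y - (y' - y)%R * g1 y)%C <= c * (y' - y) ^ 2 }.

Lemma dec3_pos : forall c h, dec3 c h -> 0 <= c.
Proof. intros c h H. apply (dec_pos c h), dec3_dec, H. Qed.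

Lemma dec3_le : forall c h y, dec3 c h -> 0 <= y -> Cmod (h y) <= c.
Proof.
intros c h y H Hy. eapply Rle_trans; [apply H, Hy|]. rewrite <- (Rmult_1_r c) at 2. assert (Hc := dec3_pos _ _ H).
apply Rmult_le_compat_l; [exact Hc|]. rewrite <- Rinv_1. apply Rinv_le_contravar; [lra|]. apply pow_R1_Rle; lra.
Qed.

Lemma dec3_le1 : forall c h y, dec3 c h -> 0 <= y -> Cmod (h y) <= c / (1 + y).
Proof.
intros c h y H Hy. eapply Rle_trans; [apply H, Hy|]. assert (Hc := dec3_pos _ _ H).
apply Rmult_le_compat_l; [exact Hc|]. apply Rinv_le_contravar; [lra|].
rewrite <- (pow_1 (1 + y)) at 1. apply Rle_pow; [lra|lia].
Qed.

Lemma exp_dec3 : forall dl y, 0 < dl -> 0 <= y -> exp (- (dl * y)) <= (Rmax 1 (3 / dl)) ^ 3 / (1 + y) ^ 3.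
Proof.
intros dl y Hd Hy. set (k := Rmax 1 (3 / dl)).
assert (Hk1 : 1 <= k) by apply Rmax_l. assert (Hk2 : 3 / dl <= k) by apply Rmax_r.
assert (He : 1 + y <= k * exp (dl * y / 3)).
{ assert (H := exp_ineq1_le (dl * y / 3)).
  assert (Hkd : 1 <= k * (dl / 3)).
  { replace 1 with (3 / dl * (dl / 3)) by (field; lra). apply Rmult_le_compat_r; lra. }
  apply Rle_trans with (k * (1 + dl * y / 3)); [|apply Rmult_le_compat_l; lra].
  replace (k * (1 + dl * y / 3)) with (k + (k * (dl / 3)) * y) by field. nra. }
assert (Hs : (1 + y) ^ 3 <= k ^ 3 * exp (dl * y)).
{ replace (exp (dl * y)) with (exp (dl * y / 3) ^ 3).
  - rewrite <- Rpow_mult_distr. apply pow_incr. lra.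
  - simpl. rewrite Rmult_1_r, <- !exp_plus. f_equal. field. }
rewrite exp_Ropp. assert (0 < exp (dl * y)) by apply exp_pos. assert (0 < (1 + y) ^ 3) by (apply pow_lt; lra).
apply Rmult_le_reg_r with (exp (dl * y) * (1 + y) ^ 3); [apply Rmult_lt_0_compat; assumption|].
replace (/ exp (dl * y) * (exp (dl * y) * (1 + y) ^ 3)) with ((1 + y) ^ 3) by (field; lra).
replace (k ^ 3 / (1 + y) ^ 3 * (exp (dl * y) * (1 + y) ^ 3)) with (k ^ 3 * exp (dl * y)) by (field; lra).
exact Hs.
Qed.

Lemma nice_exp : forall (a : C), Re a < 0 -> exists c, nice (fun y : R => Cexp (a * y)) (fun y : R => a * Cexp (a * y))%C c.
Proof.
intros a Ha. set (k := (Rmax 1 (3 / - Re a)) ^ 3).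
assert (Hk : 1 <= k) by (apply pow_R1_Rle, Rmax_l).
assert (Hm := Cmod_ge_0 a).
assert (Hmod : forall y : R, Cmod (Cexp (a * y)) = exp (- (- Re a * y))).
{ intros y. rewrite Cmod_Cexp. f_equal. simpl. unfold Re. ring. }
assert (Hdec : forall y, 0 <= y -> Cmod (Cexp (a * y)) <= k / (1 + y) ^ 3).
{ intros y Hy. rewrite Hmod. apply exp_dec3; lra. }
exists ((1 + Cmod a) ^ 2 * k). constructor.
- apply Dh_exp.
- intros y _. apply has_deriv_Cexp_lin.
- intros y Hy. eapply Rle_trans; [apply Hdec, Hy|]. unfold Rdiv. rewrite Rmult_assoc.
  assert (0 <= k * / (1 + y) ^ 3) by (apply Rdiv_le_0_compat; [lra|apply pow_lt; lra]). nra.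
- intros y Hy. rewrite Cmod_mult.
  apply Rle_trans with (Cmod a * (k / (1 + y) ^ 3)); [apply Rmult_le_compat_l; auto|]. unfold Rdiv. rewrite (Rmult_assoc _ k).
  assert (0 <= k * / (1 + y) ^ 3) by (apply Rdiv_le_0_compat; [lra|apply pow_lt; lra]). apply Rmult_le_compat_r; [assumption|nra].
- intros y y' Hy Hy'. apply Rle_trans with (Cmod a * Cmod a * (y' - y) ^ 2).
  + destruct (tay_of_deriv2 (S := unit) plain halfR (fun _ y => Cexp (a * y)) (fun _ y => a * Cexp (a * y))%C (fun _ y => a * (a * Cexp (a * y)))%C interval0_nonneg) as (M & _ & _).
    * intros _ r _ _. apply has_deriv_Cexp_lin.
    * intros _ r _ _. apply has_deriv_scal, has_deriv_Cexp_lin.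
    * exists (Cmod a * Cmod a). split; [apply Rmult_le_pos; assumption|]. intros _ r _ Hr. rewrite !Cmod_mult, Hmod.
      assert (exp (- (- Re a * r)) <= 1) by (apply exp_le_1; nra). assert (0 < exp (- (- Re a * r))) by apply exp_pos. nra.
    * apply taylor_of_lip with (p := fun y : R => Cexp (a * y)) (p1 := fun y : R => (a * Cexp (a * y))%C).
      -- apply Rmult_le_pos; assumption.
      -- intros r _. apply has_deriv_Cexp_lin.
      -- intros r Hr. apply (deriv_lip_abs (fun y : R => a * Cexp (a * y))%C (fun y : R => a * (a * Cexp (a * y)))%C).
         ++ intros q _. apply has_deriv_scal, has_deriv_Cexp_lin.
         ++ intros q Hq. assert (0 <= q) by (apply (interval0_between halfR y y' q interval0_nonneg Hy Hy'); revert Hr Hq; unfold Rmin, Rmax; repeat destruct Rle_dec; lra).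
            rewrite !Cmod_mult, Hmod. assert (exp (- (- Re a * q)) <= 1) by (apply exp_le_1; nra). assert (0 < exp (- (- Re a * q))) by apply exp_pos.
            assert (0 <= Cmod a * Cmod a) by (apply Rmult_le_pos; assumption). nra.
  + apply Rmult_le_compat_r; [apply pow2_ge_0|]. nra.
Qed.

Lemma half_le : forall c h M, Dh h -> dec c h -> (forall N, 0 <= N -> Cmod (CRInt h 0 N) <= M) -> Cmod (CRInt_halfline h) <= M.
Proof.
intros c h M Hh Hd H. apply le_of_eps. intros eps He. destruct (nat_large c eps He) as (N & HN & HNe).
assert (HNR : 0 < INR N) by (apply lt_0_INR, HN). assert (Hc := dec_pos _ _ Hd).
replace (CRInt_halfline h) with (CRInt h 0 (INR N) + (CRInt_halfline h - CRInt h 0 (INR N)))%C by ring.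
eapply Rle_trans; [apply Cmod_triangle|]. apply Rplus_le_compat; [apply H; lra|].
eapply Rle_trans; [apply (half_ex c); auto; lra|]. eapply Rle_trans; [|exact HNe].
apply Rmult_le_compat_l; [exact Hc|]. apply Rinv_le_contravar; lra.
Qed.

Lemma hat_dker : forall c g (x A B : R), Dh g -> dec3 c g -> A <= B ->
  CRInt (fun mu : R => Cexp (Ci * mu * x) * hat g mu)%C A B = CRInt_halfline (fun y => g y * dker A B (x - y))%C.
Proof.
intros c g x A B Hg Hd HAB.
transitivity (CRInt (fun mu : R => Cexp (Ci * mu * x) * hat g mu * 1)%C A B).
- apply CRInt_ext; [exact HAB|]. intros; ring.
- rewrite (hat_fubini c g x 1 0 (fun _ => 1%C)); try assumption; try lra.
  + f_equal. apply functional_extensionality. intros y. f_equal. unfold dker. apply CRInt_ext; [exact HAB|]. intros; ring.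
  + intros; rewrite Cmod_1; lra.
  + intros mu mu' _ _. replace (1 - 1)%C with (RtoC 0) by ring. rewrite Cmod_0. lra.
Qed.

Lemma Dh_dker : forall A B x sg, A <= B -> (sg = 1 \/ sg = -1) -> Dh (fun y => dker A B (x + sg * y)).
Proof.
intros A B x sg HAB Hs. apply (Dc_of_cont (fun y => dker A B (x + sg * y))); [apply Rmax0_lip|].
intros r. apply (cont_comp_lip (fun s => dker A B s) (fun y => x + sg * y)); [|apply dker_cont, HAB].
intros u v. replace (x + sg * u - (x + sg * v)) with (sg * (u - v)) by ring. rewrite Rabs_mult.
replace (Rabs sg) with 1; [lra|]. destruct Hs as [->| ->]; unfold Rabs; destruct Rcase_abs; lra.
Qed.

Lemma dec_dker : forall c g A B x, dec c g -> A <= B -> dec (c * (B - A)) (fun y => g y * dker A B (x y))%C.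
Proof.
intros c g A B x Hd HAB. apply (dec_mult c (B - A) g (fun y => dker A B (x y))); [exact Hd|].
intros; apply dker_bound, HAB.
Qed.

Lemma has_deriv_aff : forall g l x sg r, has_deriv g (x + sg * r) l -> has_deriv (fun r => g (x + sg * r)%R) r (sg * l)%C.
Proof.
intros g l x sg r H. unfold has_deriv. rewrite <- scal_C.
apply (is_derive_comp (V := C_R_NormedModule) g (fun r => x + sg * r) r l sg); [exact H|]. auto_derive; [exact I|ring].
Qed.

(** Subtracting [phi(0) e^{-r}] makes the numerator vanish at the pole of the kernel; the Taylor expansion at [0] then bounds the
    quotient and its derivative. *)
Lemma half_inversion : forall (phi phi1 : R -> C) (M M' b A B : R), 0 <= M -> 0 <= M' -> 0 <= b -> A < 0 -> 0 < B ->
  (forall r, cont phi r) ->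
  Cmod (phi 0) <= M' ->
  (forall r, 0 < r < b -> has_deriv phi r (phi1 r) /\ Cmod (phi1 r) <= M' / (1 + r) /\ Cmod (phi r) <= M' /\
     Cmod (phi r - phi 0)%C <= M * r /\ Cmod (r * phi1 r - phi r + phi 0)%C <= M * r ^ 2) ->
  Cmod (CRInt (fun r => (phi r - phi 0 * Cexp (- (1) * r)) * dker A B (- r))%C 0 b) <= 3 * (4 * (M + M') + 12 * M') * (/ - A + / B).
Proof.
intros phi phi1 M M' b A B HM HM' Hb HA HB Hc H0 Hr.
pose (Phi := fun r : R => (phi r - phi 0 * Cexp (- (1) * r))%C).
pose (Phi1 := fun r : R => (phi1 r + phi 0 * Cexp (- (1) * r))%C).
assert (Hexp : forall r : R, Cexp (- (1) * r) = RtoC (exp (- r))).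
{ intros r. rewrite <- Cexp_R. f_equal. rewrite RtoC_opp. ring. }
apply (riemann_lebesgue Phi (fun r => Phi r / r)%C (fun r => (r * Phi1 r - Phi r) / (r * r))%C); try assumption; try lra.
- intros r. apply cont_minus; [apply Hc|]. apply cont_mult; [apply cont_const|apply cont_Cexp_lin].
- intros r Hrb. destruct (Hr r Hrb) as (Hd & B1 & B2 & B3 & B4). assert (Hr0 : 0 < r) by lra.
  assert (Hn : RtoC r <> 0%C) by (apply RtoC_neq_0; lra).
  assert (Hp : Cmod (phi 0) * exp (- r) <= M' * exp (- r)) by (apply Rmult_le_compat_r; [left; apply exp_pos|exact H0]).
  assert (He := exp_pos (- r)). assert (He1 : exp (- r) <= 1) by (apply exp_le_1; lra).
  assert (He2 : 1 - r <= exp (- r)) by (generalize (exp_ineq1_le (- r)); lra).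
  assert (He3 : (1 + r) * exp (- r) <= 1).
  { rewrite exp_Ropp. apply Rmult_le_reg_r with (exp r); [apply exp_pos|]. rewrite Rmult_assoc, Rinv_l by (apply Rgt_not_eq, exp_pos).
    generalize (exp_ineq1_le r). lra. }
  assert (He4 : exp (- r) <= / (1 + r)).
  { apply Rmult_le_reg_l with (1 + r); [lra|]. rewrite Rinv_r by lra. exact He3. }
  assert (C1 : Cmod (Phi r) <= (M + M') * r).
  { unfold Phi. rewrite Hexp. replace (phi r - phi 0 * RtoC (exp (- r)))%C with ((phi r - phi 0) + phi 0 * (1 - exp (- r))%R)%C by (rewrite RtoC_minus; ring).
    eapply Rle_trans; [apply Cmod_triangle|]. rewrite Cmod_mult, Cmod_R, Rabs_pos_eq by lra. rewrite Rmult_plus_distr_r.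
    apply Rplus_le_compat; [exact B3|]. apply Rmult_le_compat; try lra. apply Cmod_ge_0. }
  assert (C2 : Cmod (Phi r) <= 2 * M').
  { unfold Phi. rewrite Hexp. eapply Rle_trans; [apply Cmod_triangle|]. rewrite Cmod_opp, Cmod_mult, Cmod_R, Rabs_pos_eq by lra. nra. }
  assert (C3 : Cmod (Phi1 r) <= 2 * M' / (1 + r)).
  { unfold Phi1. rewrite Hexp. eapply Rle_trans; [apply Cmod_triangle|]. rewrite Cmod_mult, Cmod_R, Rabs_pos_eq by lra.
    assert (M' * exp (- r) <= M' * / (1 + r)) by (apply Rmult_le_compat_l; lra). unfold Rdiv in *. lra. }
  assert (C4 : Cmod (r * Phi1 r - Phi r)%C <= (M + M') * r ^ 2).
  { unfold Phi, Phi1. rewrite Hexp.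
    replace (r * (phi1 r + phi 0 * RtoC (exp (- r))) - (phi r - phi 0 * RtoC (exp (- r))))%C with
      ((r * phi1 r - phi r + phi 0) + - (phi 0 * (1 - (1 + r) * exp (- r))%R))%C by (rewrite RtoC_minus, RtoC_mult, RtoC_plus; ring).
    eapply Rle_trans; [apply Cmod_triangle|]. rewrite Cmod_opp, Cmod_mult, Cmod_R, Rabs_pos_eq by lra. rewrite (Rmult_plus_distr_r M M').
    apply Rplus_le_compat; [exact B4|]. apply Rmult_le_compat; try lra; [apply Cmod_ge_0|]. nra. }
  split; [|split; [|split]].
  + field. exact Hn.
  + eapply has_deriv_eq.
    * apply has_deriv_mult; [|apply has_deriv_inv; [apply has_deriv_id|exact Hn]].
      apply has_deriv_minus; [exact Hd|apply has_deriv_scal, has_deriv_Cexp_lin].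
    * cbv beta. unfold Phi, Phi1. field. exact Hn.
  + rewrite Cmod_div, Cmod_R, Rabs_pos_eq by (try exact Hn; lra). apply Rmult_le_reg_r with r; [exact Hr0|].
    unfold Rdiv. rewrite Rmult_assoc, Rinv_l, Rmult_1_r by lra. nra.
  + rewrite Cmod_div, Cmod_mult, Cmod_R, Rabs_pos_eq by (try (apply Cmult_neq_0; exact Hn); lra).
    apply Rmult_le_reg_r with (r * r * (1 + r) ^ 2); [apply Rmult_lt_0_compat; [nra|apply pow_lt; lra]|].
    replace (Cmod (r * Phi1 r - Phi r) / (r * r) * (r * r * (1 + r) ^ 2)) with (Cmod (r * Phi1 r - Phi r) * (1 + r) ^ 2) by (field; lra).
    replace ((4 * (M + M') + 12 * M') / (1 + r) ^ 2 * (r * r * (1 + r) ^ 2)) with ((4 * (M + M') + 12 * M') * (r * r)) by (field; lra).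
    (* The Taylor bound is used near the pole, the decay of [phi1] far from it. *)
    destruct (Rle_dec r 1) as [Hr1|Hr1].
    * assert ((1 + r) ^ 2 <= 4) by (simpl; nra). assert (0 <= (1 + r) ^ 2) by (apply pow2_ge_0).
      apply Rle_trans with (((M + M') * r ^ 2) * 4).
      -- apply Rmult_le_compat; try assumption. apply Cmod_ge_0.
      -- simpl. assert (0 <= M' * (r * r)) by (apply Rmult_le_pos; [lra|nra]). lra.
    * assert (C5 : Cmod (r * Phi1 r - Phi r)%C <= r * (2 * M' / (1 + r)) + 2 * M').
      { eapply Rle_trans; [apply Cmod_triangle|]. rewrite Cmod_opp, Cmod_mult, Cmod_R, Rabs_pos_eq by lra.
        apply Rplus_le_compat; [apply Rmult_le_compat_l; lra|exact C2]. }
      apply Rle_trans with ((r * (2 * M' / (1 + r)) + 2 * M') * (1 + r) ^ 2).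
      -- apply Rmult_le_compat_r; [apply pow2_ge_0|exact C5].
      -- replace ((r * (2 * M' / (1 + r)) + 2 * M') * (1 + r) ^ 2) with (2 * M' * ((1 + r) * (2 * r + 1))) by (field; lra).
         assert ((1 + r) * (2 * r + 1) <= 6 * (r * r)) by nra.
         assert (2 * M' * ((1 + r) * (2 * r + 1)) <= 2 * M' * (6 * (r * r))) by (apply Rmult_le_compat_l; lra).
         assert (0 <= (M + M') * (r * r)) by (apply Rmult_le_pos; [lra|nra]). lra.
Qed.

(** On [(z,N)] the variable [r] stays away from the pole of the kernel, so that the quotient [g(r - z) / r] inherits the decay of
    [g] and [g1]. *)
Lemma tail_inversion : forall g g1 c z, nice g g1 c -> 0 < z -> exists V, forall N A B, z <= N -> A < 0 -> 0 < B ->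
  Cmod (CRInt (fun r => g (Rmax 0 (r - z)) * dker A B (- r))%C z N) <= V * (/ - A + / B).
Proof.
intros g g1 c z Hn Hz. assert (Hc := dec3_pos _ _ (nice_dec _ _ _ Hn)).
set (V := (c / z + c / z ^ 2) * (1 + z) ^ 2).
assert (Hcz : 0 <= c / z) by (apply Rdiv_le_0_compat; lra).
assert (Hcz2 : 0 <= c / z ^ 2) by (apply Rdiv_le_0_compat; [lra|apply pow_lt; lra]).
exists (3 * V). intros N A B HN HA HB.
apply (riemann_lebesgue _ (fun r => g (r - z)%R / r)%C (fun r => g1 (r - z)%R / r - g (r - z)%R / (r * r))%C); try assumption; try lra.
- unfold V. apply Rmult_le_pos; [lra|apply pow2_ge_0].
- intros r. apply (cont_comp_lip (fun r => g (Rmax 0 r)) (fun r => r - z)); [|apply (nice_Dh _ _ _ Hn)].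
  intros u v. replace (u - z - (v - z)) with (u - v) by ring. lra.
- intros r Hr. assert (Hrn : RtoC r <> 0%C) by (apply RtoC_neq_0; lra).
  assert (Hz2 : 1 <= (1 + z) ^ 2) by (apply pow_R1_Rle; lra).
  split; [|split; [|split]].
  + rewrite Rmax_right by lra. field. exact Hrn.
  + eapply has_deriv_eq.
    * apply has_deriv_mult; [|apply has_deriv_inv; [apply has_deriv_id|exact Hrn]].
      apply (has_deriv_ext (fun r => g (- z + 1 * r)%R)); [intros y; f_equal; ring|].
      apply has_deriv_aff, (nice_deriv _ _ _ Hn). lra.
    * cbv beta. replace (- z + 1 * r) with (r - z) by ring. field. exact Hrn.
  + rewrite Cmod_div, Cmod_R, Rabs_pos_eq by (try exact Hrn; lra).
    apply Rle_trans with (c / z).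
    * apply Rmult_le_compat; [apply Cmod_ge_0|left; apply Rinv_0_lt_compat; lra|apply (dec3_le c); [apply (nice_dec _ _ _ Hn)|lra]|].
      apply Rinv_le_contravar; lra.
    * unfold V. nra.
  + assert (B1 : Cmod (g1 (r - z)) <= c / (1 + (r - z)) ^ 3) by (apply (nice_dec1 _ _ _ Hn); lra).
    assert (B0 : Cmod (g (r - z)) <= c / (1 + (r - z)) ^ 3) by (apply (nice_dec _ _ _ Hn); lra).
    set (y := r - z) in *. assert (Hy : 0 < y) by (unfold y; lra).
    assert (Hq : c / (1 + y) ^ 3 <= c * (1 + z) ^ 2 / (1 + r) ^ 2).
    { unfold Rdiv. rewrite Rmult_assoc. apply Rmult_le_compat_l; [exact Hc|].
      assert (Hle : (1 + r) ^ 2 <= (1 + z) ^ 2 * (1 + y) ^ 3).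
      { apply Rle_trans with (((1 + z) * (1 + y)) ^ 2).
        - apply pow_incr. unfold y in *. split; [lra|]. nra.
        - rewrite Rpow_mult_distr. apply Rmult_le_compat_l; [apply pow2_ge_0|]. apply Rle_pow; [lra|lia]. }
      assert (0 < (1 + r) ^ 2) by (apply pow_lt; lra). assert (0 < (1 + y) ^ 3) by (apply pow_lt; lra).
      apply Rmult_le_reg_r with ((1 + y) ^ 3 * (1 + r) ^ 2); [apply Rmult_lt_0_compat; assumption|].
      replace (/ (1 + y) ^ 3 * ((1 + y) ^ 3 * (1 + r) ^ 2)) with ((1 + r) ^ 2) by (field; lra).
      replace ((1 + z) ^ 2 * / (1 + r) ^ 2 * ((1 + y) ^ 3 * (1 + r) ^ 2)) with ((1 + z) ^ 2 * (1 + y) ^ 3) by (field; lra). exact Hle. }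
    unfold Cminus. eapply Rle_trans; [apply Cmod_triangle|].
    rewrite Cmod_opp, !Cmod_div, Cmod_mult, Cmod_R, Rabs_pos_eq by (try (apply Cmult_neq_0); try exact Hrn; lra).
    replace (V / (1 + r) ^ 2) with (c * (1 + z) ^ 2 / (1 + r) ^ 2 * / z + c * (1 + z) ^ 2 / (1 + r) ^ 2 * / (z * z)) by (unfold V; field; lra).
    apply Rplus_le_compat; apply Rmult_le_compat; try apply Cmod_ge_0; try lra.
    * left; apply Rinv_0_lt_compat; lra.
    * apply Rinv_le_contravar; lra.
    * left; apply Rinv_0_lt_compat; nra.
    * apply Rinv_le_contravar; nra.
Qed.

(** At negative abscissas the function extended by zero vanishes. *)
Lemma inversion_neg : forall g g1 c z, nice g g1 c -> 0 < z -> exists V, forall A B, A < 0 -> 0 < B ->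
  Cmod (CRInt (fun mu : R => Cexp (Ci * mu * (- z)%R) * hat g mu)%C A B) <= V * (/ - A + / B).
Proof.
intros g g1 c z Hn Hz. destruct (tail_inversion g g1 c z Hn Hz) as (V & HV). exists V. intros A B HA HB.
assert (HAB : A <= B) by lra. assert (Hd := dec3_dec _ _ (nice_dec _ _ _ Hn)).
rewrite (hat_dker c) by (try apply Hn; exact HAB).
apply (half_le (c * (B - A))).
- apply Dc_mult; [apply Hn|]. intros r.
  apply (cont_ext (fun r => dker A B (- z + -1 * Rmax 0 r))); [intros; f_equal; ring|]. apply (Dh_dker A B (- z) (-1) HAB). right; reflexivity.
- apply (dec_dker c g A B (fun y => - z - y)); assumption.
- intros N HN. specialize (HV (N + z) A B ltac:(lra) HA HB).
  eapply Rle_trans; [|exact HV]. right. f_equal.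
  assert (E := CRInt_shift (fun r => g (Rmax 0 (r - z)) * dker A B (- r))%C 0 N z).
  rewrite Rplus_0_l in E. rewrite E.
  + apply CRInt_ext; [lra|]. intros y Hy. replace (y + z - z) with y by ring. rewrite Rmax_right by lra. do 2 f_equal. ring.
  + intros r. apply cont_mult.
    * apply (cont_comp_lip (fun r => g (Rmax 0 r)) (fun r => r - z)); [|apply (nice_Dh _ _ _ Hn)].
      intros u v. replace (u - z - (v - z)) with (u - v) by ring. lra.
    * apply (cont_comp_lip (fun s => dker A B s) (fun r => - r)); [|apply dker_cont, HAB].
      intros u v. replace (- u - - v) with (- (u - v)) by ring. rewrite Rabs_Ropp. lra.
Qed.

Lemma hat_exp : forall (a : C) (mu : R), Re a < 0 -> hat (fun y : R => Cexp (a * y)) mu = (/ (Ci * mu - a))%C.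
Proof.
intros a mu Ha. destruct (nice_exp a Ha) as (c & Hn).
assert (Hw : (a - Ci * mu)%C <> 0%C).
{ intros E. assert (E' : Re (a - Ci * mu) = 0) by (rewrite E; reflexivity). simpl in E'. unfold Re in *. lra. }
assert (Hw' : (Ci * mu - a)%C <> 0%C).
{ intros E. apply Hw. replace (a - Ci * mu)%C with (- (Ci * mu - a))%C by ring. rewrite E. ring. }
unfold hat. apply (half_unique c).
- apply hat_Dh, Hn.
- apply hat_dec, dec3_dec, Hn.
- exists (c * Cmod (/ (a - Ci * mu))). intros N HN.
  rewrite (CRInt_ext _ (fun y : R => Cexp ((a - Ci * mu) * y))) by (try exact HN; intros; rewrite <- Cexp_add; f_equal; ring).
  rewrite (CRInt_unique _ _ _ (/ (a - Ci * mu) * Cexp ((a - Ci * mu) * N) - / (a - Ci * mu) * Cexp ((a - Ci * mu) * 0%R))%C).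
  + replace ((a - Ci * mu) * 0%R)%C with (RtoC 0) by ring. rewrite Cexp_0.
    replace (/ (a - Ci * mu) * Cexp ((a - Ci * mu) * N) - / (a - Ci * mu) * 1 - / (Ci * mu - a))%C
      with (Cexp (a * N) * Cexp (Ci * (- mu)%R * N) * / (a - Ci * mu))%C.
    * rewrite !Cmod_mult, Cmod_Cexp_Im, Rmult_1_r. replace (c * Cmod (/ (a - Ci * mu)) / (1 + N)) with (c / (1 + N) * Cmod (/ (a - Ci * mu))) by (field; lra).
      apply Rmult_le_compat_r; [apply Cmod_ge_0|]. apply (dec3_le1 c (fun y : R => Cexp (a * y))); [apply Hn|exact HN].
    * rewrite <- Cexp_add. replace (a * N + Ci * (- mu)%R * N)%C with ((a - Ci * mu) * N)%C by (rewrite RtoC_opp; ring). field. split; assumption.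
  + apply (CRInt_FTC (fun y : R => / (a - Ci * mu) * Cexp ((a - Ci * mu) * y))%C); [exact HN| |].
    * intros y _. eapply has_deriv_eq; [apply has_deriv_scal, has_deriv_Cexp_lin|]. field. exact Hw.
    * intros y _. apply cont_Cexp_lin.
Qed.

Lemma is_derive_atan_sq : forall r, is_derive atan r (/ (1 + r ^ 2)).
Proof. intros r. rewrite <- Rsqr_pow2. apply is_derive_atan. Qed.

Lemma Cmod_sum6 : forall a b c d e f : C,
  Cmod (a + b + c + d + e + f)%C <= Cmod a + Cmod b + Cmod c + Cmod d + Cmod e + Cmod f.
Proof.
intros. do 5 (eapply Rle_trans; [apply Cmod_triangle|apply Rplus_le_compat_r]). lra.
Qed.

Lemma atan_le : forall y, 0 <= y -> atan y <= y.
Proof.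
intros y Hy.
assert (H := deriv_lip (fun r => RtoC (atan r)) (fun r => RtoC (/ (1 + r ^ 2))) 1 0 y Hy).
assert (K : Cmod (RtoC (atan y) - RtoC (atan 0))%C <= 1 * (y - 0)).
{ apply H.
  - intros r _. apply has_deriv_RtoC. apply is_derive_atan_sq.
  - intros r _. rewrite Cmod_R. assert (0 <= r ^ 2) by apply pow2_ge_0. rewrite Rabs_pos_eq by (left; apply Rinv_0_lt_compat; lra).
    rewrite <- Rinv_1. apply Rinv_le_contravar; lra. }
rewrite atan_0, <- RtoC_minus, Cmod_R in K. generalize (Rle_abs (atan y - 0)). lra.
Qed.

Lemma atan_line : forall A B, A < 0 -> 0 < B -> Rabs (2 * (atan B - atan A) - 2 * PI) <= 2 * (/ - A + / B).
Proof.
intros A B HA HB.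
assert (H1 : atan (/ B) = PI / 2 - atan B) by (apply atan_inv; lra).
assert (H2 : atan (/ - A) = PI / 2 - atan (- A)) by (apply atan_inv; lra). rewrite atan_opp in H2.
assert (0 < / B) by (apply Rinv_0_lt_compat; lra). assert (0 < / - A) by (apply Rinv_0_lt_compat; lra).
assert (L1 := atan_le (/ B) ltac:(lra)). assert (L2 := atan_le (/ - A) ltac:(lra)).
assert (P1 := atan_increasing 0 (/ B) ltac:(lra)). assert (P2 := atan_increasing 0 (/ - A) ltac:(lra)). rewrite atan_0 in *.
apply Rabs_le. lra.
Qed.

Lemma CRInt_reflect : forall (h : R -> C) x, (forall z, cont h z) -> CRInt h 0 x = CRInt (fun r => h (x - r)) 0 x.
Proof.
intros h x Hh. rewrite (CRInt_comp_opp h 0 x Hh).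
assert (E := CRInt_shift (fun r => h (- r)) 0 x (- x)).
replace (0 + - x) with (- x) in E by ring. replace (x + - x) with (- 0) in E by ring. rewrite E.
- f_equal. apply functional_extensionality. intros r. f_equal. ring.
- intros r. apply (cont_comp_lip h (fun r => - r)); [|apply Hh].
  intros u v. replace (- u - - v) with (- (u - v)) by ring. rewrite Rabs_Ropp. lra.
Qed.

(** Jordan's inversion theorem, with a rate and with independent end points.  The two sides of [x] are compared with
    [g x . e^{-|y-x|}], whose transform can be integrated explicitly; each single side would leave a divergent imaginary part
    when [A] and [B] are not opposite. *)
Lemma inversion : forall g g1 c x, nice g g1 c -> 0 < x -> exists V, forall A B, A < 0 -> 0 < B ->
  Cmod (CRInt (fun mu : R => Cexp (Ci * mu * x) * hat g mu)%C A B - 2 * PI * g x)%C <= V * (/ - A + / B).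
Proof.
intros g g1 c x Hn Hx. assert (Hc := dec3_pos _ _ (nice_dec _ _ _ Hn)).
pose (ex := fun y : R => Cexp (- (1) * y)).
assert (Hre : Re (- (1))%C < 0) by (simpl; lra).
destruct (nice_exp _ Hre) as (ce & Hne). fold ex in Hne.
assert (Hce := dec3_pos _ _ (nice_dec _ _ _ Hne)).
destruct (tail_inversion ex _ ce x Hne Hx) as (Vt & HVt).
set (M' := c * (1 + x)). assert (HM' : 0 <= M') by (unfold M'; apply Rmult_le_pos; lra). assert (HcM : c <= M') by (unfold M'; nra).
set (V0 := 3 * (4 * (c + M') + 12 * M')).
exists (2 * V0 + c * Vt + 2 * c). intros A B HA HB. assert (HAB : A <= B) by lra.
set (kap := / - A + / B).
assert (Hgb : forall y, 0 <= y -> Cmod (g y) <= c) by (intros y Hy; apply (dec3_le c); [apply Hn|exact Hy]).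
assert (Hg1b : forall y, 0 <= y -> Cmod (g1 y) <= c) by (intros y Hy; apply (dec3_le c); [apply Hn|exact Hy]).
assert (Hgl : forall y y', 0 < y -> y <= y' -> Cmod (g y' - g y)%C <= c * (y' - y)).
{ intros y y' Hy Hyy. apply (deriv_lip g g1); [exact Hyy| |].
  - intros r Hr. apply Hn. lra.
  - intros r Hr. apply Hg1b. lra. }
assert (Hshift : forall sg, (sg = 1 \/ sg = -1) -> forall r, cont (fun r => g (Rmax 0 (x + sg * r))) r).
{ intros sg Hsg r. apply (cont_comp_lip (fun r => g (Rmax 0 r)) (fun r => x + sg * r)); [|apply (nice_Dh _ _ _ Hn)].
  intros u v. replace (x + sg * u - (x + sg * v)) with (sg * (u - v)) by ring. rewrite Rabs_mult.
  replace (Rabs sg) with 1; [lra|]. destruct Hsg as [->| ->]; unfold Rabs; destruct Rcase_abs; lra. }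
assert (Hdk : forall A B, A <= B -> forall r, cont (fun r => dker A B (- r)) r).
{ intros A' B' HAB' r. apply (cont_comp_lip (fun s => dker A' B' s) (fun r => - r)); [|apply dker_cont, HAB'].
  intros u v. replace (- u - - v) with (- (u - v)) by ring. rewrite Rabs_Ropp. lra. }
assert (Hex : forall r, cont ex r) by (intros; apply cont_Cexp_lin).
(* The substitutions [y = x + r] and [y = x - r]; the second one exchanges the end points of the kernel. *)
assert (HR : forall N, 0 <= N -> Cmod (CRInt (fun r => (g (Rmax 0 (x + 1 * r)) - g (Rmax 0 (x + 1 * 0)) * ex r) * dker A B (- r))%C 0 N) <= V0 * kap).
{ intros N HN. apply (half_inversion (fun r => g (Rmax 0 (x + 1 * r))) (fun r => g1 (x + r)%R)); try assumption.
  - apply Hshift; left; reflexivity.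
  - eapply Rle_trans; [apply Hgb, Rmax_l|exact HcM].
  - intros r Hr. replace (x + 1 * 0) with x by ring. rewrite !Rmax_right by lra. replace (x + 1 * r) with (x + r) by ring.
    split; [|split; [|split; [|split]]].
    + apply (has_deriv_ext_loc (fun r => g (x + 1 * r)%R)).
      * exists (mkposreal r (proj1 Hr)). intros y Hy. change (Rabs (y - r) < r) in Hy. apply Rabs_def2 in Hy. rewrite Rmax_right by lra. reflexivity.
      * eapply has_deriv_eq; [apply has_deriv_aff, Hn; lra|]. replace (x + 1 * r) with (x + r) by ring. ring.
    + eapply Rle_trans; [apply (dec3_le1 c); [apply Hn|lra]|].
      apply Rmult_le_compat; try lra; [left; apply Rinv_0_lt_compat; lra|apply Rinv_le_contravar; lra].
    + eapply Rle_trans; [apply Hgb; lra|exact HcM].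
    + replace (c * r) with (c * (x + r - x)) by ring. apply Hgl; lra.
    + replace (r * g1 (x + r)%R - g (x + r)%R + g x)%C with (g x - g (x + r)%R - (x - (x + r))%R * g1 (x + r)%R)%C by (replace (x - (x + r)) with (- r) by ring; rewrite RtoC_opp; ring).
      replace (r ^ 2) with ((x - (x + r)) ^ 2) by ring. apply (nice_tay _ _ _ Hn); lra. }
assert (HLf : Cmod (CRInt (fun r => (g (Rmax 0 (x + -1 * r)) - g (Rmax 0 (x + -1 * 0)) * ex r) * dker (- B) (- A) (- r))%C 0 x) <= V0 * kap).
{ unfold kap. replace (/ - A + / B) with (/ - - B + / - A) by (rewrite Ropp_involutive; ring).
  apply (half_inversion (fun r => g (Rmax 0 (x + -1 * r))) (fun r => - g1 (x - r)%R)%C); try assumption; try lra.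
  - apply Hshift; right; reflexivity.
  - eapply Rle_trans; [apply Hgb, Rmax_l|exact HcM].
  - intros r Hr. replace (x + -1 * 0) with x by ring. rewrite !Rmax_right by lra. replace (x + -1 * r) with (x - r) by ring.
    split; [|split; [|split; [|split]]].
    + apply (has_deriv_ext_loc (fun r => g (x + -1 * r)%R)).
      * assert (Hm : 0 < x - r) by lra. exists (mkposreal _ Hm). intros y Hy. change (Rabs (y - r) < x - r) in Hy. apply Rabs_def2 in Hy. rewrite Rmax_right by lra. reflexivity.
      * eapply has_deriv_eq; [apply has_deriv_aff, Hn; lra|]. replace (x + -1 * r) with (x - r) by ring. ring.
    + rewrite Cmod_opp. eapply Rle_trans; [apply Hg1b; lra|]. unfold M'.
      apply Rmult_le_reg_r with (1 + r); [lra|]. replace (c * (1 + x) / (1 + r) * (1 + r)) with (c * (1 + x)) by (field; lra). apply Rmult_le_compat_l; lra.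
    + eapply Rle_trans; [apply Hgb; lra|exact HcM].
    + rewrite Cmod_minus_sym. replace (c * r) with (c * (x - (x - r))) by ring. apply Hgl; lra.
    + replace (r * - g1 (x - r)%R - g (x - r)%R + g x)%C with (g x - g (x - r)%R - (x - (x - r))%R * g1 (x - r)%R)%C by (replace (x - (x - r)) with r by ring; ring).
      replace (r ^ 2) with ((x - (x - r)) ^ 2) by ring. apply (nice_tay _ _ _ Hn); lra. }
replace (x + -1 * 0) with x in HLf by ring. rewrite (Rmax_right 0 x) in HLf by lra.
replace (x + 1 * 0) with x in HR by ring. rewrite (Rmax_right 0 x) in HR by lra.
(* Half-transforms of the comparison function: neither is close to [PI], but their sum is [2 (atan B - atan A)]. *)
set (tR := CRInt_halfline (fun y => ex y * dker A B (0 - y))%C).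
set (tL := CRInt_halfline (fun y => ex y * dker (- B) (- A) (0 - y))%C).
assert (HtD : forall A B, A <= B -> Dh (fun y => ex y * dker A B (0 - y))%C).
{ intros A' B' HAB'. apply Dc_mult; [apply Hne|]. intros r.
  apply (cont_ext (fun r => dker A' B' (0 + -1 * Rmax 0 r))); [intros; f_equal; ring|]. apply (Dh_dker A' B' 0 (-1) HAB'). right; reflexivity. }
assert (Htd : forall A B, A <= B -> dec (ce * (B - A)) (fun y => ex y * dker A B (0 - y))%C).
{ intros A' B' HAB'. apply (dec_dker ce ex A' B' (fun y => 0 - y)); [apply dec3_dec, Hne|exact HAB']. }
assert (HBA : - B <= - A) by lra.
assert (Ht : (tR + tL)%C = RtoC (2 * (atan B - atan A))).
{ unfold tR, tL. rewrite <- !(hat_dker ce) by (try apply Hne; lra).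
  assert (He : forall mu : R, hat ex mu = (/ (Ci * mu + 1))%C).
  { intros mu. unfold ex. rewrite (hat_exp (- (1))%C mu Hre). f_equal. ring. }
  assert (Hnz : forall mu : R, (Ci * mu + 1)%C <> 0%C).
  { intros mu E. assert (E' : Re (Ci * mu + 1) = 0) by (rewrite E; reflexivity). simpl in E'. lra. }
  assert (Hcq : forall z, cont (fun mu : R => / (Ci * mu + 1))%C z).
  { intros z. apply cont_inv; [|apply Hnz]. apply cont_plus; [|apply cont_const]. apply cont_mult; [apply cont_const|]. apply cont_RtoC, continuous_id. }
  assert (H0 : forall A B, A <= B -> CRInt (fun mu : R => Cexp (Ci * mu * 0%R) * hat ex mu)%C A B = CRInt (fun mu : R => / (Ci * mu + 1))%C A B).
  { intros A' B' HAB'. apply CRInt_ext; [exact HAB'|]. intros mu _. rewrite He. replace (Ci * mu * 0%R)%C with (RtoC 0) by ring. rewrite Cexp_0. ring. }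
  rewrite !H0 by lra. rewrite (CRInt_comp_opp _ (- B) (- A) Hcq), !Ropp_involutive.
  assert (Hcq' : forall z, cont (fun mu : R => / (Ci * (- mu)%R + 1))%C z).
  { intros z. apply cont_inv; [|apply Hnz]. apply cont_plus; [|apply cont_const]. apply cont_mult; [apply cont_const|]. apply cont_RtoC.
    apply (continuous_opp (V := R_NormedModule)), continuous_id. }
  rewrite <- CRInt_plus by (apply exC_cont; assumption).
  replace (RtoC (2 * (atan B - atan A))) with (RtoC (2 * atan B) - RtoC (2 * atan A))%C by (rewrite <- RtoC_minus; f_equal; ring).
  apply CRInt_unique, (CRInt_FTC (fun mu => RtoC (2 * atan mu))); [exact HAB| |].
  - intros mu _. eapply has_deriv_eq.
    + apply (has_deriv_RtoC (fun mu => 2 * atan mu) mu (2 * (/ (1 + mu ^ 2)))). apply (is_derive_scal atan mu 2). apply is_derive_atan_sq.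
    + assert (N1 := Hnz mu). assert (N2 := Hnz (- mu)). rewrite RtoC_opp in *.
      assert (Hp : (RtoC (1 + mu ^ 2)) <> 0%C) by (apply RtoC_neq_0; generalize (pow2_ge_0 mu); lra).
      assert (Hf : RtoC (1 + mu ^ 2) = ((Ci * mu + 1) * (Ci * - mu + 1))%C).
      { transitivity (1 - Ci * Ci * (mu * mu))%C; [rewrite Ci2; rewrite RtoC_plus; simpl; rewrite !RtoC_mult; ring|ring]. }
      rewrite RtoC_mult, RtoC_inv by (generalize (pow2_ge_0 mu); lra). rewrite Hf. field. split; assumption.
  - intros mu _. apply cont_plus; auto. }
assert (Hmain : Cmod (CRInt (fun mu : R => Cexp (Ci * mu * x) * hat g mu)%C A B - g x * (tR + tL))%C <= 2 * V0 * kap + c * (Vt * kap)).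
{ rewrite (hat_dker c) by (try apply Hn; exact HAB).
  apply le_of_eps. intros eps He.
  set (h := fun y => (g y * dker A B (x - y))%C).
  assert (Hh : Dh h).
  { apply Dc_mult; [apply Hn|]. intros r.
    apply (cont_ext (fun r => dker A B (x + -1 * Rmax 0 r))); [intros; f_equal; ring|]. apply (Dh_dker A B x (-1) HAB). right; reflexivity. }
  assert (Hhd : dec (c * (B - A)) h) by (apply (dec_dker c g A B (fun y => x - y)); [apply dec3_dec, Hn|exact HAB]).
  destruct (nat_large ((B - A) * (c + 2 * (c * ce))) eps He) as (n & Hn0 & Hne').
  set (N := INR n) in *. assert (HN : 0 < N) by (apply lt_0_INR, Hn0).
  assert (E1 := half_ex _ h Hh Hhd (x + N) ltac:(lra)).
  assert (E2 := half_ex _ _ (HtD A B HAB) (Htd A B HAB) N ltac:(lra)). fold tR in E2.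
  assert (E3 := half_ex _ _ (HtD (-B) (-A) HBA) (Htd (-B) (-A) HBA) (x + N) ltac:(lra)). fold tL in E3.
  specialize (HR N ltac:(lra)). specialize (HVt (x + N) (- B) (- A) ltac:(lra) ltac:(lra) ltac:(lra)).
  replace (/ - - B + / - A) with kap in HVt by (unfold kap; rewrite Ropp_involutive; ring).
  (* The left half of the comparison function extends beyond [x], where the datum stops: this is the term [r3]. *)
  assert (Hc1 : forall r, cont (fun r => g (Rmax 0 (x + 1 * r)) * dker A B (- r))%C r) by (intros; apply cont_mult; [apply Hshift; left; reflexivity|apply Hdk; lra]).
  assert (Hc2 : forall r, cont (fun r => g (Rmax 0 (x + -1 * r)) * dker (- B) (- A) (- r))%C r) by (intros; apply cont_mult; [apply Hshift; right; reflexivity|apply Hdk; lra]).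
  assert (Hc3 : forall A B, A <= B -> forall r, cont (fun r => ex r * dker A B (- r))%C r) by (intros; apply cont_mult; [apply Hex|apply Hdk; assumption]).
  assert (S1 : CRInt h 0 x = CRInt (fun r => g (Rmax 0 (x + -1 * r)) * dker (- B) (- A) (- r))%C 0 x).
  { rewrite (CRInt_ext h (fun y => h (Rmax 0 y))) by (try lra; intros; rewrite Rmax_right by lra; reflexivity).
    rewrite (CRInt_reflect (fun y => h (Rmax 0 y)) x) by exact Hh.
    apply CRInt_ext; [lra|]. intros r Hr. unfold h. rewrite !Rmax_right by lra. rewrite <- dker_opp by exact HAB.
    f_equal; f_equal; ring. }
  assert (S2 : CRInt h x (x + N) = CRInt (fun r => g (Rmax 0 (x + 1 * r)) * dker A B (- r))%C 0 N).
  { rewrite (CRInt_ext h (fun y => h (Rmax 0 y))) by (try lra; intros; rewrite Rmax_right by lra; reflexivity).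
    assert (E := CRInt_shift (fun y => h (Rmax 0 y)) 0 N x Hh). rewrite Rplus_0_l in E. rewrite (Rplus_comm x N), E.
    apply CRInt_ext; [lra|]. intros r Hr. unfold h. rewrite !Rmax_right by lra. f_equal; f_equal; ring. }
  assert (S0 : CRInt h 0 (x + N) = (CRInt h 0 x + CRInt h x (x + N))%C) by (apply CRInt_Chasles; apply exC_half; auto; lra).
  assert (S3 : CRInt (fun r => (g (Rmax 0 (x + 1 * r)) - g x * ex r) * dker A B (- r))%C 0 N =
    (CRInt h x (x + N) - g x * CRInt (fun y => ex y * dker A B (0 - y))%C 0 N)%C).
  { rewrite S2. rewrite (CRInt_ext (fun y => ex y * dker A B (0 - y))%C (fun r => ex r * dker A B (- r))%C) by (try lra; intros; f_equal; f_equal; ring).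
    rewrite <- CRInt_scal by (apply exC_cont, Hc3, HAB).
    assert (Hc4 : forall z, cont (fun r => g x * (ex r * dker A B (- r)))%C z) by (intros z; apply cont_mult; [apply cont_const|apply Hc3, HAB]).
    rewrite <- (CRInt_minus (fun r : R => g (Rmax 0 (x + 1 * r)) * dker A B (- r))%C (fun r : R => g x * (ex r * dker A B (- r)))%C 0 N (exC_cont _ 0 N Hc1) (exC_cont _ 0 N Hc4)).
    apply CRInt_ext; [lra|]. intros; ring. }
  assert (S4 : CRInt (fun r => (g (Rmax 0 (x + -1 * r)) - g x * ex r) * dker (- B) (- A) (- r))%C 0 x =
    (CRInt h 0 x - g x * CRInt (fun r => ex r * dker (- B) (- A) (- r))%C 0 x)%C).
  { rewrite S1. rewrite <- CRInt_scal by (apply exC_cont, Hc3; lra).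
    assert (Hc4 : forall z, cont (fun r => g x * (ex r * dker (- B) (- A) (- r)))%C z) by (intros z; apply cont_mult; [apply cont_const|apply Hc3; lra]).
    rewrite <- (CRInt_minus (fun r : R => g (Rmax 0 (x + -1 * r)) * dker (- B) (- A) (- r))%C (fun r : R => g x * (ex r * dker (- B) (- A) (- r)))%C 0 x (exC_cont _ 0 x Hc2) (exC_cont _ 0 x Hc4)).
    apply CRInt_ext; [lra|]. intros; ring. }
  assert (S5 : CRInt (fun y => ex y * dker (- B) (- A) (0 - y))%C 0 (x + N) =
    (CRInt (fun r => ex r * dker (- B) (- A) (- r))%C 0 x + ex x * CRInt (fun r => ex (Rmax 0 (r - x)) * dker (- B) (- A) (- r))%C x (x + N))%C).
  { rewrite (CRInt_ext (fun y => ex y * dker (- B) (- A) (0 - y))%C (fun r => ex r * dker (- B) (- A) (- r))%C) by (try lra; intros; f_equal; f_equal; ring).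
    rewrite (CRInt_Chasles _ 0 x (x + N)) by (apply exC_cont, Hc3; lra). f_equal.
    rewrite <- CRInt_scal.
    - apply CRInt_ext; [lra|]. intros r Hr. rewrite Rmax_right by lra. unfold ex. rewrite Cmult_assoc, <- Cexp_add. do 2 f_equal. rewrite RtoC_minus. ring.
    - apply exC_cont. intros r. apply cont_mult; [|apply Hdk; lra]. apply (cont_comp_lip (fun r => ex (Rmax 0 r)) (fun r => r - x)); [|apply (nice_Dh _ _ _ Hne)].
      intros u v. replace (u - x - (v - x)) with (u - v) by ring. lra. }
  assert (Hexx : Cmod (ex x) <= 1).
  { unfold ex. rewrite Cmod_Cexp. apply exp_le_1. simpl. lra. }
  set (r1 := CRInt (fun r => (g (Rmax 0 (x + 1 * r)) - g x * ex r) * dker A B (- r))%C 0 N) in *.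
  set (r2 := CRInt (fun r => (g (Rmax 0 (x + -1 * r)) - g x * ex r) * dker (- B) (- A) (- r))%C 0 x) in *.
  set (r3 := CRInt (fun r => ex (Rmax 0 (r - x)) * dker (- B) (- A) (- r))%C x (x + N)) in *.
  set (J := CRInt_halfline h) in *.
  set (iR := CRInt (fun y => ex y * dker A B (0 - y))%C 0 N) in *.
  set (iL := CRInt (fun y => ex y * dker (- B) (- A) (0 - y))%C 0 (x + N)) in *.
  set (iL0 := CRInt (fun r => ex r * dker (- B) (- A) (- r))%C 0 x) in *.
  assert (Hid : (J - g x * (tR + tL))%C = ((J - CRInt h 0 (x + N)) + - (g x * (tR - iR)) + - (g x * (tL - iL)) + r1 + r2 + - (g x * (ex x * r3)))%C).
  { rewrite S3, S4, S0. replace iL0 with (iL - ex x * r3)%C by (rewrite S5; ring). ring. }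
  change (CRInt_halfline (fun y : R => (g y * dker A B (x - y))%C)) with J. rewrite Hid.
  assert (Hgx := Hgb x ltac:(lra)). assert (Hgx0 := Cmod_ge_0 (g x)).
  eapply Rle_trans; [apply Cmod_sum6|]. rewrite !Cmod_opp, !Cmod_mult.
  assert (HbA : 0 <= B - A) by lra.
  assert (HN' : forall k u, 0 <= k -> 0 <= u -> k * (B - A) / (1 + (u + N)) <= k * (B - A) / N).
  { intros k u Hk Hu. apply Rmult_le_compat_l; [apply Rmult_le_pos; assumption|]. apply Rinv_le_contravar; lra. }
  assert (B1 := HN' c x Hc ltac:(lra)). assert (B2 := HN' ce 0 Hce ltac:(lra)). assert (B3 := HN' ce x Hce ltac:(lra)).
  replace (1 + (0 + N)) with (1 + N) in B2 by ring.
  replace (- A - - B) with (B - A) in E3 by ring.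
  assert (B2' : Cmod (g x) * Cmod (tR - iR)%C <= c * (ce * (B - A) / N)) by (apply Rmult_le_compat; try apply Cmod_ge_0; lra).
  assert (B3' : Cmod (g x) * Cmod (tL - iL)%C <= c * (ce * (B - A) / N)) by (apply Rmult_le_compat; try apply Cmod_ge_0; lra).
  assert (B4 : Cmod (g x) * (Cmod (ex x) * Cmod r3) <= c * (Vt * kap)).
  { apply Rmult_le_compat; try apply Cmod_ge_0; [apply Rmult_le_pos; apply Cmod_ge_0|exact Hgx|].
    apply Rle_trans with (1 * Cmod r3); [apply Rmult_le_compat_r; [apply Cmod_ge_0|exact Hexx]|]. lra. }
  replace ((B - A) * (c + 2 * (c * ce)) / N) with (c * (B - A) / N + 2 * (c * (ce * (B - A) / N))) in Hne' by (field; lra).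
  lra. }
replace (CRInt (fun mu : R => Cexp (Ci * mu * x) * hat g mu)%C A B - 2 * PI * g x)%C with
  ((CRInt (fun mu : R => Cexp (Ci * mu * x) * hat g mu)%C A B - g x * (tR + tL)) + g x * (2 * (atan B - atan A) - 2 * PI)%R)%C
  by (rewrite Ht, (RtoC_minus _ (2 * PI)), (RtoC_mult 2 PI); ring).
eapply Rle_trans; [apply Cmod_triangle|]. rewrite Cmod_mult, Cmod_R.
assert (Hat := atan_line A B HA HB). fold kap in Hat.
assert (Cmod (g x) * Rabs (2 * (atan B - atan A) - 2 * PI) <= c * (2 * kap)).
{ apply Rmult_le_compat; [apply Cmod_ge_0|apply Rabs_pos|apply Hgb; lra|exact Hat]. }
lra.
Qed.

(** ** The resolvent kernel on the line *)

Definition kker (lam : C) (A B s : R) : C := CRInt (fun mu : R => Cexp (Ci * mu * s) * kern lam mu)%C A B.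

Section Kernel.
Variables (lam : C) (R0 : R).
Hypothesis Hlam : 0 < Im lam.
Hypothesis HR0 : Cmod lam <= R0.

Lemma upper_neq : forall mu : R, (lam * lam - mu * mu)%C <> 0%C.
Proof.
intros mu. replace (lam * lam - mu * mu)%C with ((lam - mu) * (lam - (- mu)%R))%C by (rewrite RtoC_opp; ring).
apply Cmult_neq_0; intros E; apply (f_equal Im) in E; simpl in E; unfold Im in *; lra.
Qed.

Lemma cont_kern : forall mu : R, cont (fun mu : R => kern lam mu) mu.
Proof.
intros mu. apply cont_div; [apply cont_const| |apply upper_neq].
apply cont_minus; [apply cont_const|]. apply cont_mult; apply cont_RtoC, continuous_id.
Qed.

Lemma cont_kker_arg : forall s mu : R, cont (fun mu : R => Cexp (Ci * mu * s) * kern lam mu)%C mu.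
Proof. intros. apply cont_mult; [apply cont_wave|apply cont_kern]. Qed.

Lemma kern_even : forall mu : R, kern lam (- mu)%R = kern lam mu.
Proof. intros mu. unfold kern. rewrite RtoC_opp. do 2 f_equal. ring. Qed.

Lemma kker_even : forall A B s : R, A <= B -> kker lam A B s = kker lam (- B) (- A) (- s).
Proof.
intros A B s HAB. unfold kker.
rewrite (CRInt_comp_opp _ A B (cont_kker_arg s)). apply CRInt_ext; [lra|]. intros mu _. rewrite kern_even. do 2 f_equal.
rewrite !RtoC_opp. ring.
Qed.

(** The transforms of [e^{i lam y}] on the two half lines add up to the one of [e^{i lam |y|}]. *)
Lemma kern_hat : forall mu : R, kern lam mu = (hat (fun y : R => Cexp (Ci * lam * y)) mu + hat (fun y : R => Cexp (Ci * lam * y)) (- mu)%R)%C.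
Proof.
intros mu. assert (Hre : Re (Ci * lam) < 0) by (simpl; unfold Im in Hlam; lra).
rewrite (hat_exp _ mu Hre). assert (E := hat_exp _ (- mu) Hre). rewrite E. clear E. rewrite RtoC_opp.
assert (H := upper_neq mu). unfold kern.
assert (N1 : (mu - lam)%C <> 0%C) by (intros E; apply (f_equal Im) in E; simpl in E; unfold Im in *; lra).
assert (N2 : (- mu - lam)%C <> 0%C) by (intros E; apply (f_equal Im) in E; simpl in E; unfold Im in *; lra).
assert (Hi := Ci_neq_0).
replace (lam * lam - mu * mu)%C with ((mu - lam) * (- mu - lam))%C by ring.
replace (Ci * mu - Ci * lam)%C with (Ci * (mu - lam))%C by ring. replace (Ci * - mu - Ci * lam)%C with (Ci * (- mu - lam))%C by ring.
replace (2 * Ci * lam)%C with (2 * lam * (Ci * Ci) / Ci)%C by (field; exact Hi). rewrite Ci2. field. repeat split; assumption.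
Qed.

Lemma kker_pos : forall s, 0 < s -> exists V, forall A B, A < 0 -> 0 < B ->
  Cmod (kker lam A B s - 2 * PI * Cexp (Ci * lam * s))%C <= V * (/ - A + / B).
Proof.
intros s Hs. assert (Hre : Re (Ci * lam) < 0) by (simpl; unfold Im in Hlam; lra).
set (ex := fun y : R => Cexp (Ci * lam * y)).
destruct (nice_exp _ Hre) as (c & Hn). fold ex in Hn.
destruct (inversion ex _ c s Hn Hs) as (V1 & H1). destruct (inversion_neg ex _ c s Hn Hs) as (V2 & H2).
exists (V1 + V2). intros A B HA HB. specialize (H1 A B HA HB). specialize (H2 (- B) (- A) ltac:(lra) ltac:(lra)).
assert (Hc : forall s z : R, cont (fun mu : R => Cexp (Ci * mu * s) * hat ex mu)%C z).
{ intros q z. apply cont_mult; [apply cont_wave|]. apply cont_lip with c. intros y. apply hat_lip; apply Hn. }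
assert (Hc' : forall z, cont (fun mu : R => Cexp (Ci * mu * s) * hat ex (- mu)%R)%C z).
{ intros z. apply cont_mult; [apply cont_wave|]. apply cont_lip with c. intros y.
  eapply Rle_trans; [apply (hat_lip c); apply Hn|]. replace (- y - - z) with (- (y - z)) by ring. rewrite Rabs_Ropp. lra. }
assert (E : kker lam A B s = (CRInt (fun mu : R => Cexp (Ci * mu * s) * hat ex mu)%C A B + CRInt (fun mu : R => Cexp (Ci * mu * (- s)%R) * hat ex mu)%C (- B) (- A))%C).
{ rewrite (CRInt_comp_opp _ (- B) (- A) (Hc (- s))), !Ropp_involutive.
  transitivity (CRInt (fun mu : R => Cexp (Ci * mu * s) * hat ex mu + Cexp (Ci * mu * s) * hat ex (- mu)%R)%C A B).
  - apply CRInt_ext; [lra|]. intros mu _. rewrite kern_hat. fold ex. ring.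
  - rewrite (CRInt_plus _ _ A B (exC_cont _ A B (Hc s)) (exC_cont _ A B Hc')). f_equal.
    apply CRInt_ext; [lra|]. intros mu _. do 2 f_equal. rewrite !RtoC_opp. ring. }
rewrite E. replace (/ - - B + / - A) with (/ - A + / B) in H2 by (rewrite Ropp_involutive; ring).
match goal with |- Cmod (?a + ?b - ?c)%C <= _ => replace (a + b - c)%C with ((a - c) + b)%C by ring end.
eapply Rle_trans; [apply Cmod_triangle|]. rewrite Rmult_plus_distr_r. unfold ex in *. lra.
Qed.

Lemma kker_abs : forall s, s <> 0 -> exists V, forall A B, A < 0 -> 0 < B ->
  Cmod (kker lam A B s - 2 * PI * Cexp (Ci * lam * Rabs s))%C <= V * (/ - A + / B).
Proof.
intros s Hs. destruct (Rle_dec 0 s) as [H|H].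
- rewrite Rabs_pos_eq by exact H. apply kker_pos. lra.
- rewrite Rabs_left by lra. destruct (kker_pos (- s)) as (V & HV); [lra|]. exists V. intros A B HA HB.
  rewrite kker_even by lra. specialize (HV (- B) (- A) ltac:(lra) ltac:(lra)).
  replace (/ - - B + / - A) with (/ - A + / B) in HV by (rewrite Ropp_involutive; ring). exact HV.
Qed.

Lemma kern_decay : forall mu : R, 2 * R0 + 1 <= Rabs mu -> Cmod (kern lam mu) <= 4 * R0 / mu ^ 2.
Proof.
intros mu Hmu. assert (H := upper_neq mu). assert (Hl := Cmod_ge_0 lam).
unfold kern. rewrite Cmod_div, !Cmod_mult, Cmod_Ci, Cmod_R, (Rabs_pos_eq 2) by (try exact H; lra).
assert (Hm2 : mu ^ 2 / 2 <= Cmod (lam * lam - mu * mu)).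
{ assert (T := Cmod_triangle (mu * mu - lam * lam)%C (lam * lam)%C). replace (mu * mu - lam * lam + lam * lam)%C with (mu * mu)%C in T by ring.
  rewrite Cmod_minus_sym, !Cmod_mult, Cmod_R in T. rewrite <- (pow2_abs mu).
  assert (Cmod lam * Cmod lam <= R0 * R0) by (apply Rmult_le_compat; lra). rewrite Cmod_minus_sym in T.
  rewrite Cmod_minus_sym. assert (2 * (R0 * R0) <= Rabs mu ^ 2) by (simpl; nra). simpl in *. lra. }
assert (Hmp : 0 < mu ^ 2) by (rewrite <- pow2_abs; apply pow_lt; lra).
assert (Hmu0 : mu <> 0) by (intros ->; rewrite Rabs_R0 in Hmu; lra).
apply Rmult_le_reg_r with (Cmod (lam * lam - mu * mu) * mu ^ 2); [apply Rmult_lt_0_compat; lra|].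
replace (2 * 1 * Cmod lam / Cmod (lam * lam - mu * mu) * (Cmod (lam * lam - mu * mu) * mu ^ 2)) with (2 * Cmod lam * mu ^ 2) by (field; repeat split; first [assumption|lra]).
replace (4 * R0 / mu ^ 2 * (Cmod (lam * lam - mu * mu) * mu ^ 2)) with (4 * R0 * Cmod (lam * lam - mu * mu)) by (field; repeat split; first [assumption|lra]).
apply Rle_trans with (2 * R0 * mu ^ 2); [apply Rmult_le_compat_r; lra|].
replace (2 * R0 * mu ^ 2) with (4 * R0 * (mu ^ 2 / 2)) by field. apply Rmult_le_compat_l; lra.
Qed.

Lemma kker_tail_pos : forall B B' s : R, 2 * R0 + 1 <= B -> B <= B' -> Cmod (kker lam B B' s) <= 4 * R0 * / B.
Proof.
intros B B' s HB HBB. assert (0 <= R0) by (generalize (Cmod_ge_0 lam); lra).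
eapply Rle_trans; [apply (CRInt_dom _ (fun r => - (4 * R0 * / r)) (fun r => 4 * R0 / r ^ 2)); [exact HBB|intros; apply cont_kker_arg| |]|].
- intros r Hr. auto_derive; [lra|field; lra].
- intros r Hr. rewrite Cmod_mult, Cmod_Cexp_Im, Rmult_1_l. apply kern_decay. rewrite Rabs_pos_eq; lra.
- cbv beta. assert (0 < / B') by (apply Rinv_0_lt_compat; lra). nra.
Qed.

Lemma kker_tail_neg : forall A' A s : R, A <= - (2 * R0 + 1) -> A' <= A -> Cmod (kker lam A' A s) <= 4 * R0 * / - A.
Proof. intros A' A s HA HAA. rewrite kker_even by exact HAA. apply kker_tail_pos; lra. Qed.

Lemma kker_lip : forall A B : R, A <= B -> exists M, 0 <= M /\ forall s s' : R, Cmod (kker lam A B s - kker lam A B s')%C <= M * Rabs (s - s').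
Proof.
intros A B HAB. destruct (bounded_seg (fun mu : R => kern lam mu) A B HAB cont_kern) as (Mk & HMk & Hk).
set (MA := Rmax (Rabs A) (Rabs B)). assert (HMA : 0 <= MA) by (unfold MA; eapply Rle_trans; [apply Rabs_pos|apply Rmax_l]).
exists (MA * Mk * (B - A)). split; [repeat apply Rmult_le_pos; lra|]. intros s s'. unfold kker.
rewrite <- (CRInt_minus _ _ A B (exC_cont _ A B (cont_kker_arg s)) (exC_cont _ A B (cont_kker_arg s'))).
replace (MA * Mk * (B - A) * Rabs (s - s')) with (MA * Rabs (s - s') * Mk * (B - A)) by ring.
apply CRInt_bound; [exact HAB| |].
- apply exC_cont. intros z. apply cont_minus; apply cont_kker_arg.
- intros mu Hmu. replace (Cexp (Ci * mu * s) * kern lam mu - Cexp (Ci * mu * s') * kern lam mu)%C with ((Cexp (Ci * mu * s) - Cexp (Ci * mu * s')) * kern lam mu)%C by ring.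
  rewrite Cmod_mult. apply Rmult_le_compat; try apply Cmod_ge_0; [|apply Hk, Hmu].
  eapply Rle_trans; [apply wave_lip_s|]. apply Rmult_le_compat_r; [apply Rabs_pos|].
  unfold MA. revert Hmu. unfold Rmax. destruct Rle_dec; unfold Rabs in *; repeat destruct Rcase_abs; lra.
Qed.

Lemma expabs_lip : forall u v : R, 0 <= u -> 0 <= v -> Cmod (Cexp (Ci * lam * u) - Cexp (Ci * lam * v))%C <= R0 * Rabs (u - v).
Proof.
intros u v Hu Hv. apply (deriv_lip_abs (fun s : R => Cexp (Ci * lam * s)) (fun s : R => Ci * lam * Cexp (Ci * lam * s))%C).
- intros r _. apply has_deriv_Cexp_lin.
- intros r Hr. assert (0 <= r) by (revert Hr; unfold Rmin, Rmax; destruct Rle_dec; lra).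
  rewrite !Cmod_mult, Cmod_Ci, Cmod_Cexp, Rmult_1_l. rewrite <- (Rmult_1_r R0).
  apply Rmult_le_compat; [apply Cmod_ge_0|left; apply exp_pos|exact HR0|]. apply exp_le_1. simpl. unfold Im in Hlam. nra.
Qed.

(** The rate is uniform in [s], although each single limit above came with a constant that blows up at [s = 0]: absolute
    convergence controls the tails, and [s = 0] follows by continuity. *)
Lemma kker_unif : forall A B s : R, A <= - (2 * R0 + 1) -> 2 * R0 + 1 <= B ->
  Cmod (kker lam A B s - 2 * PI * Cexp (Ci * lam * Rabs s))%C <= 4 * R0 * (/ - A + / B).
Proof.
assert (HR : 0 <= R0) by (generalize (Cmod_ge_0 lam); lra).
assert (Hnz : forall A B s : R, A <= - (2 * R0 + 1) -> 2 * R0 + 1 <= B -> s <> 0 ->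
  Cmod (kker lam A B s - 2 * PI * Cexp (Ci * lam * Rabs s))%C <= 4 * R0 * (/ - A + / B)).
{ intros A B s HA HB Hs. destruct (kker_abs s Hs) as (V & HV). apply le_of_eps. intros eps He.
  destruct (nat_large (2 * V) eps He) as (n & Hn & Hne). assert (HnR : 0 < INR n) by (apply lt_0_INR, Hn).
  (* The limit is known for the interval from [- N] to [N]; what lies outside of [A] and [B] is a tail. *)
  set (N := Rmax (INR n) (Rmax (- A) B)). assert (HN1 : INR n <= N) by apply Rmax_l.
  assert (HN2 : - A <= N) by (eapply Rle_trans; [apply Rmax_l|apply Rmax_r]). assert (HN3 : B <= N) by (eapply Rle_trans; [apply Rmax_r|apply Rmax_r]).
  specialize (HV (- N) N ltac:(lra) ltac:(lra)). rewrite Ropp_involutive in HV.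
  assert (E : kker lam (- N) N s = (kker lam (- N) A s + kker lam A B s + kker lam B N s)%C).
  { unfold kker. rewrite (CRInt_Chasles _ (- N) A N) by (apply exC_cont, cont_kker_arg).
    rewrite (CRInt_Chasles _ A B N) by (apply exC_cont, cont_kker_arg). ring. }
  assert (T1 := kker_tail_neg (- N) A s HA ltac:(lra)). assert (T2 := kker_tail_pos B N s HB HN3).
  replace (kker lam A B s - 2 * PI * Cexp (Ci * lam * Rabs s))%C with
    ((kker lam (- N) N s - 2 * PI * Cexp (Ci * lam * Rabs s)) + - (kker lam (- N) A s) + - kker lam B N s)%C by (rewrite E; ring).
  eapply Rle_trans; [apply Cmod_triangle|]. eapply Rle_trans; [apply Rplus_le_compat_r, Cmod_triangle|]. rewrite !Cmod_opp.
  assert (HVe : V * (/ N + / N) <= eps).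
  { destruct (Rle_dec 0 V) as [H0|H0].
    - eapply Rle_trans; [|exact Hne]. replace (V * (/ N + / N)) with (2 * V * / N) by ring. apply Rmult_le_compat_l; [lra|]. apply Rinv_le_contravar; lra.
    - assert (0 < / N) by (apply Rinv_0_lt_compat; lra). nra. }
  lra. }
intros A B s HA HB. destruct (Req_dec s 0) as [->|Hs]; [|apply Hnz; assumption].
destruct (kker_lip A B ltac:(lra)) as (M & HM & HL). apply le_of_eps. intros eps He.
assert (HPI := PI_RGT_0).
set (q := eps / (M + 2 * PI * R0 + 1)). assert (Hden : 0 < M + 2 * PI * R0 + 1) by (assert (0 <= PI * R0) by (apply Rmult_le_pos; lra); lra).
assert (Hq : 0 < q) by (unfold q; apply Rdiv_lt_0_compat; [exact He|exact Hden]).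
assert (H1 := Hnz A B q HA HB (Rgt_not_eq _ _ Hq)). assert (H2 := HL 0 q). assert (H3 := expabs_lip q 0 ltac:(lra) ltac:(lra)).
rewrite Rabs_R0. rewrite (Rabs_pos_eq q) in H1 by lra.
rewrite Rminus_0_l, Rabs_Ropp, (Rabs_pos_eq q) in H2 by lra. rewrite Rminus_0_r, (Rabs_pos_eq q) in H3 by lra.
replace (kker lam A B 0 - 2 * PI * Cexp (Ci * lam * 0%R))%C with
  ((kker lam A B q - 2 * PI * Cexp (Ci * lam * q)) + (kker lam A B 0 - kker lam A B q) + 2 * PI * (Cexp (Ci * lam * q) - Cexp (Ci * lam * 0%R)))%C by ring.
eapply Rle_trans; [apply Cmod_triangle|]. eapply Rle_trans; [apply Rplus_le_compat_r, Cmod_triangle|].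
rewrite !Cmod_mult, !Cmod_R, (Rabs_pos_eq 2), (Rabs_pos_eq PI) by lra.
assert (2 * PI * Cmod (Cexp (Ci * lam * q) - Cexp (Ci * lam * 0%R)) <= 2 * PI * (R0 * q)) by (apply Rmult_le_compat_l; lra).
assert (Eq : (M + 2 * PI * R0 + 1) * q = eps) by (unfold q; field; lra). lra.
Qed.
End Kernel.

(** ** From the line to the contour *)

(** The whole-line resolvent applied to [g] extended by zero. *)
Definition resol (g : R -> C) (x : R) (lam : C) : C := CRInt_halfline (fun y => g y * Cexp (Ci * lam * Rabs (x - y)))%C.

Section Line.
Variable K : R -> C.
Hypothesis HKs : simple_closed_curve K.
Hypothesis HKpos : forall z, on_curve K z -> 0 < Im z.

Let L := contour_int K.
Let D := Dc (Kc K).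

(** By Fubini, first along the contour and then on the half line, the left integral is the contour integral of [w] times the
    convolution of [g] with the truncated kernel [kker], and [kker_unif] applies.  The constant depends on the contour only, which
    later allows an integration in time. *)
Lemma line_to_contour : exists Cst N1, 0 < N1 /\ 0 <= Cst /\ forall g c w Mw x, Dh g -> dec3 c g -> D w -> 0 <= Mw ->
  (forall z, on_curve K z -> Cmod (w z) <= Mw) ->
  D (fun z => w z * resol g x z)%C /\
  forall A B, A <= - N1 -> N1 <= B ->
   Cmod (CRInt (fun mu : R => Cexp (Ci * mu * x) * hat g mu * L (fun z => w z * kern z mu)) A B
      - 2 * PI * L (fun z => w z * resol g x z))%C <= Cst * c * Mw * (/ - A + / B).
Proof.
destruct (BLF_contour K HKs) as (Lam & HL). assert (HLam := blf_pos _ _ _ _ HL).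
destruct (Dc_coef K _ (Dc_id K HKs)) as (R0 & HR0 & HR).
assert (Hdl : exists dl, 0 < dl /\ forall z, on_curve K z -> dl <= Im z).
{ destruct (continuity_ab_min (fun r => Im (Kc K r)) 0 1) as (m & Hm & Hm01); [lra| |].
  - intros q _. apply continuity_pt_filterlim. apply (proj1 (cont_pair _ _) (Kc_cont K HKs q)).
  - exists (Im (Kc K m)). split; [apply HKpos, Kc_on|].
    intros w Hw. destruct (on_Kc K w Hw) as (r & Hr & <-). apply Hm, Hr. }
destruct Hdl as (dl & Hdl & HIm).
exists (Lam * (4 * R0)), (2 * R0 + 1). split; [lra|split; [apply Rmult_le_pos; lra|]].
intros g c w Mw x Hg Hd Hw HMw Hwb. assert (Hc := dec3_pos _ _ Hd).
assert (HPI := PI_RGT_0).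
assert (Hfac : forall z (mu : R), on_curve K z -> dl ^ 2 <= Cmod (z * z - mu * mu)).
{ intros z mu Hz. replace (z * z - mu * mu)%C with ((z - mu) * (z - (- mu)%R))%C by (rewrite RtoC_opp; ring).
  rewrite Cmod_mult. assert (Hi := HIm z Hz).
  assert (Hb : forall q : R, dl <= Cmod (z - q)%C).
  { intros q. eapply Rle_trans; [exact Hi|]. eapply Rle_trans; [apply Rle_abs|]. replace (Im z) with (Im (z - q)%C) by (simpl; unfold Im; ring). apply im_le_Cmod. }
  replace (dl ^ 2) with (dl * dl) by ring. apply Rmult_le_compat; try lra; apply Hb. }
assert (Hdl2 : 0 < dl ^ 2) by (apply pow_lt, Hdl).
assert (Hnz : forall z (mu : R), on_curve K z -> (z * z - mu * mu)%C <> 0%C) by (intros z mu Hz; apply upper_neq, HKpos, Hz).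
set (M := 2 * R0 / dl ^ 2). assert (HM : 0 <= M) by (apply Rdiv_le_0_compat; lra).
assert (Hkb : forall z (mu : R), on_curve K z -> Cmod (kern z mu) <= M).
{ intros z mu Hz. unfold kern. rewrite Cmod_div, !Cmod_mult, Cmod_Ci, Cmod_R, (Rabs_pos_eq 2), Rmult_1_r by (try apply Hnz, Hz; lra).
  unfold M. apply Rmult_le_compat; [apply Rmult_le_pos; [lra|apply Cmod_ge_0]|left; apply Rinv_0_lt_compat, Cmod_gt_0, Hnz, Hz| |].
  - apply Rmult_le_compat_l; [lra|apply HR, Hz].
  - apply Rinv_le_contravar; [exact Hdl2|apply Hfac, Hz]. }
assert (Hkl : forall A B z (mu mu' : R), on_curve K z -> A <= mu <= B -> A <= mu' <= B ->
   Cmod (kern z mu - kern z mu')%C <= (M / dl ^ 2 * (2 * Rmax (Rabs A) (Rabs B))) * Rabs (mu - mu')).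
{ intros A B z mu mu' Hz Hmu Hmu'. set (MA := Rmax (Rabs A) (Rabs B)).
  assert (Hb : forall q, A <= q <= B -> Rabs q <= MA).
  { intros q Hq. unfold MA. revert Hq. unfold Rmax. destruct Rle_dec; unfold Rabs in *; repeat destruct Rcase_abs; lra. }
  replace (kern z mu - kern z mu')%C with (kern z mu * ((mu + mu')%R * (mu - mu')%R) / (z * z - mu' * mu'))%C.
  - rewrite Cmod_div, !Cmod_mult, !Cmod_R by (apply Hnz, Hz). assert (Hs : Rabs (mu + mu') <= 2 * MA).
    { eapply Rle_trans; [apply Rabs_triang|]. generalize (Hb mu Hmu) (Hb mu' Hmu'). lra. }
    replace (M / dl ^ 2 * (2 * MA) * Rabs (mu - mu')) with (M * (2 * MA * Rabs (mu - mu')) * / dl ^ 2) by (field; lra).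
    apply Rmult_le_compat.
    + repeat apply Rmult_le_pos; try apply Rabs_pos; apply Cmod_ge_0.
    + left; apply Rinv_0_lt_compat, Cmod_gt_0, Hnz, Hz.
    + apply Rmult_le_compat; [apply Cmod_ge_0|apply Rmult_le_pos; apply Rabs_pos|apply Hkb, Hz|]. apply Rmult_le_compat_r; [apply Rabs_pos|exact Hs].
    + apply Rinv_le_contravar; [exact Hdl2|apply Hfac, Hz].
  - unfold kern. rewrite RtoC_plus, RtoC_minus. assert (N1 := Hnz z mu Hz). assert (N2 := Hnz z mu' Hz). field. split; assumption. }
assert (DK : forall mu : R, D (fun z => kern z mu)).
{ intros mu. apply Dc_div; [apply Dc_mult; [apply Dc_const|apply Dc_id, HKs]|apply Dc_minus; [apply Dc_mult; apply Dc_id, HKs|apply Dc_const]|].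
  intros r. apply Hnz, Kc_on. }
assert (HLg := BLF_half g c Hg (dec3_dec _ _ Hd)).
assert (DA : forall z A B, on_curve K z -> A <= B -> Dh (fun y => kker z A B (x - y)) /\ bddh (fun y => kker z A B (x - y))).
{ intros z A B Hz HAB. destruct (kker_lip z (HKpos z Hz) A B HAB) as (Mk & HMk & Hl). split.
  - intros r. apply (cont_comp_lip (fun y => kker z A B (x - y)) (Rmax 0)); [apply Rmax0_lip|]. apply cont_lip with Mk. intros y.
    eapply Rle_trans; [apply Hl|]. replace (x - y - (x - Rmax 0 r)) with (- (y - Rmax 0 r)) by ring. rewrite Rabs_Ropp. lra.
  - exists (M * (B - A)). intros y _. apply CRInt_bound; [exact HAB|apply exC_cont, cont_kker_arg, HKpos, Hz|].
    intros mu _. rewrite Cmod_mult, Cmod_Cexp_Im, Rmult_1_l. apply Hkb, Hz. }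
assert (DE0 : forall z, on_curve K z -> Dh (fun y => Cexp (Ci * z * Rabs (x - y))) /\ forall y, 0 <= y -> Cmod (Cexp (Ci * z * Rabs (x - y))) <= 1).
{ intros z Hz. assert (Hl := expabs_lip z R0 (HKpos z Hz) (HR z Hz)). split.
  - intros r. apply (cont_comp_lip (fun y => Cexp (Ci * z * Rabs (x - y))) (Rmax 0)); [apply Rmax0_lip|].
    apply cont_lip with R0. intros y. eapply Rle_trans; [apply Hl; apply Rabs_pos|]. apply Rmult_le_compat_l; [exact HR0|].
    eapply Rle_trans; [apply Rabs_triang_inv2|]. replace (x - y - (x - Rmax 0 r)) with (- (y - Rmax 0 r)) by ring. rewrite Rabs_Ropp. lra.
  - intros y _. rewrite Cmod_Cexp. apply exp_le_1.
    assert (0 <= Rabs (x - y)) by apply Rabs_pos. assert (Hi := HKpos z Hz). simpl. unfold Im in Hi. nra. }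
assert (DE : forall z, on_curve K z -> Dh (fun y => 2 * PI * Cexp (Ci * z * Rabs (x - y)))%C /\ bddh (fun y => 2 * PI * Cexp (Ci * z * Rabs (x - y)))%C).
{ intros z Hz. destruct (DE0 z Hz) as [D1 B1]. split; [apply Dc_mult; [apply Dc_const|exact D1]|].
  exists (Cmod (2 * PI) * 1). intros y Hy. rewrite Cmod_mult. apply Rmult_le_compat_l; [apply Cmod_ge_0|apply B1, Hy]. }
assert (HF : forall A B, A <= B ->
   D (fun z => w z * CRInt_halfline (fun y => g y * kker z A B (x - y)))%C /\
   CRInt (fun mu : R => Cexp (Ci * mu * x) * hat g mu * L (fun z => w z * kern z mu))%C A B =
   L (fun z => w z * CRInt_halfline (fun y => g y * kker z A B (x - y)))%C).
{ intros A B HAB.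
  pose (G := fun (z : C) (mu : R) => (w z * (Cexp (Ci * mu * x) * hat g mu * kern z mu))%C).
  set (Lm := M / dl ^ 2 * (2 * Rmax (Rabs A) (Rabs B))).
  assert (HLm : 0 <= Lm).
  { assert (H1 : 0 <= M / dl ^ 2) by (apply Rdiv_le_0_compat; [exact HM|exact Hdl2]).
    assert (H2 : 0 <= Rmax (Rabs A) (Rabs B)) by (eapply Rle_trans; [apply (Rabs_pos A)|apply Rmax_l]).
    unfold Lm. apply Rmult_le_pos; [exact H1|]. lra. }
  assert (Hin : forall z, on_curve K z -> forall y y' : R, A <= y <= B -> A <= y' <= B ->
     Cmod (Cexp (Ci * y * x) * hat g y * kern z y - Cexp (Ci * y' * x) * hat g y' * kern z y')%C <= ((Rabs x + 1) * c * M + c * Lm) * Rabs (y - y')).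
  { intros z Hz y y' Hy Hy'.
    replace (Cexp (Ci * y * x) * hat g y * kern z y - Cexp (Ci * y' * x) * hat g y' * kern z y')%C with
     (((Cexp (Ci * y * x) - Cexp (Ci * y' * x)) * hat g y + Cexp (Ci * y' * x) * (hat g y - hat g y')) * kern z y + Cexp (Ci * y' * x) * hat g y' * (kern z y - kern z y'))%C by ring.
    assert (Hdy := Rabs_pos (y - y')).
    assert (B1 : Cmod ((Cexp (Ci * y * x) - Cexp (Ci * y' * x)) * hat g y + Cexp (Ci * y' * x) * (hat g y - hat g y'))%C <= (Rabs x + 1) * c * Rabs (y - y')).
    { eapply Rle_trans; [apply Cmod_triangle|]. rewrite !Cmod_mult, Cmod_Cexp_Im, Rmult_1_l.
      assert (Cmod (Cexp (Ci * y * x) - Cexp (Ci * y' * x)) * Cmod (hat g y) <= Rabs x * Rabs (y - y') * c).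
      { apply Rmult_le_compat; try apply Cmod_ge_0; [apply wave_lip|apply hat_bound; assumption]. }
      assert (Cmod (hat g y - hat g y')%C <= c * Rabs (y - y')) by (apply hat_lip; assumption). lra. }
    eapply Rle_trans; [apply Cmod_triangle|]. rewrite (Cmod_mult _ (kern z y)), (Cmod_mult _ (kern z y - kern z y')%C), Cmod_mult, Cmod_Cexp_Im, Rmult_1_l.
    rewrite Rmult_plus_distr_r. apply Rplus_le_compat.
    - replace ((Rabs x + 1) * c * M * Rabs (y - y')) with ((Rabs x + 1) * c * Rabs (y - y') * M) by ring.
      apply Rmult_le_compat; try apply Cmod_ge_0; [exact B1|apply Hkb, Hz].
    - rewrite Rmult_assoc. apply Rmult_le_compat; try apply Cmod_ge_0; [apply hat_bound; assumption|apply Hkl; assumption]. }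
  destruct (blf_int HL G (Mw * ((Rabs x + 1) * c * M + c * Lm)) A B HAB) as [D1 E1].
  - intros z Hz y y' Hy Hy'. unfold G.
    match goal with |- Cmod (?a * ?b - ?a * ?b')%C <= _ => replace (a * b - a * b')%C with (a * (b - b'))%C by ring end.
    rewrite Cmod_mult, Rmult_assoc. apply Rmult_le_compat; try apply Cmod_ge_0; [apply Hwb, Hz|apply Hin; assumption].
  - intros mu _. apply Dc_mult; [exact Hw|]. apply Dc_mult; [apply Dc_const|apply DK].
  - assert (EG : forall z, on_curve K z -> CRInt (G z) A B = (w z * CRInt_halfline (fun y => g y * kker z A B (x - y)))%C).
    { intros z Hz. unfold G.
      rewrite (CRInt_scal (w z) (fun mu : R => Cexp (Ci * mu * x) * hat g mu * kern z mu)%C).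
      - f_equal. apply (hat_fubini c g x M Lm (fun mu : R => kern z mu)); try assumption.
        + intros; apply Hkb, Hz.
        + intros; apply Hkl; assumption.
      - apply exC_Dc; [exact HAB|]. apply Dc_clamp_lip with ((Rabs x + 1) * c * M + c * Lm); [exact HAB|]. intros; apply Hin; assumption. }
    split.
    + apply (blf_D_ext HL _ _ D1). exact EG.
    + transitivity (L (fun z => CRInt (G z) A B)); [|apply (blf_ext HL _ _ D1); exact EG].
      unfold L. rewrite E1. apply CRInt_ext; [exact HAB|]. intros mu _. unfold G.
      rewrite <- (blf_scal _ _ _ _ HL (Cexp (Ci * mu * x) * hat g mu)%C (fun z => w z * kern z mu)%C) by (apply Dc_mult; [exact Hw|apply DK]).
      f_equal. apply functional_extensionality. intros z. ring. }
assert (Hcl : forall A B z, A <= - (2 * R0 + 1) -> 2 * R0 + 1 <= B -> on_curve K z ->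
   Cmod (w z * CRInt_halfline (fun y => g y * kker z A B (x - y)) - 2 * PI * (w z * resol g x z))%C <= Mw * (c * (4 * R0 * (/ - A + / B)))).
{ intros A B z HA HB Hz.
  assert (E : (2 * PI * (w z * resol g x z))%C = (w z * CRInt_halfline (fun y => g y * (2 * PI * Cexp (Ci * z * Rabs (x - y)))))%C).
  { destruct (DE0 z Hz) as [D1 B1].
    transitivity (w z * (2 * PI * resol g x z))%C; [ring|]. f_equal. unfold resol.
    rewrite <- (half_scal (c * 1) (2 * PI)%C).
    - f_equal. apply functional_extensionality. intros y. ring.
    - apply Dc_mult; [exact Hg|exact D1].
    - apply (dec_mult c 1 g); [apply dec3_dec, Hd|exact B1]. }
  rewrite E.
  match goal with |- Cmod (?a * ?b - ?a * ?b')%C <= _ => replace (a * b - a * b')%C with (a * (b - b'))%C by ring end.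
  rewrite Cmod_mult. apply Rmult_le_compat; try apply Cmod_ge_0; [apply Hwb, Hz|].
  apply (blf_minus_bound HLg (fun y => kker z A B (x - y)) (fun y => 2 * PI * Cexp (Ci * z * Rabs (x - y)))%C).
  - apply DA; [exact Hz|lra].
  - apply DE, Hz.
  - intros y _. apply kker_unif; [apply HKpos, Hz|apply HR, Hz|exact HA|exact HB]. }
assert (H2PI : (2 * PI)%C <> 0%C) by (apply Cmult_neq_0; apply RtoC_neq_0; lra).
(* The resolvent inherits admissibility as a uniform limit of truncated integrals. *)
assert (DF2 : D (fun z => 2 * PI * (w z * resol g x z))%C).
{ apply (blf_lim _ _ _ _ HL). intros eps He.
  destruct (nat_large (2 * (Mw * (c * (4 * R0)))) eps He) as (n & Hn & Hne). assert (HnR : 0 < INR n) by (apply lt_0_INR, Hn).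
  set (N := Rmax (INR n) (2 * R0 + 1)). assert (HN1 : INR n <= N) by apply Rmax_l. assert (HN2 : 2 * R0 + 1 <= N) by apply Rmax_r.
  exists (fun z => w z * CRInt_halfline (fun y => g y * kker z (- N) N (x - y)))%C. split; [apply HF; lra|].
  intros z Hz. rewrite Cmod_minus_sym. eapply Rle_trans; [apply Hcl; [lra|lra|exact Hz]|].
  eapply Rle_trans; [|exact Hne]. rewrite Ropp_involutive.
  replace (Mw * (c * (4 * R0 * (/ N + / N)))) with (2 * (Mw * (c * (4 * R0))) * / N) by ring.
  apply Rmult_le_compat_l; [repeat apply Rmult_le_pos; lra|]. apply Rinv_le_contravar; lra. }
assert (DF : D (fun z => w z * resol g x z)%C).
{ apply (blf_D_ext HL (fun z => / (2 * PI) * (2 * PI * (w z * resol g x z)))%C).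
  - apply (blf_scal_D _ _ _ _ HL), DF2.
  - intros z _. field. apply RtoC_neq_0; lra. }
split; [exact DF|]. intros A B HA HB.
assert (HAB : A <= B) by lra. destruct (HF A B HAB) as [D1 E1]. rewrite E1.
unfold L. rewrite <- (blf_scal _ _ _ _ HL (2 * PI)%C _ DF).
replace (Lam * (4 * R0) * c * Mw * (/ - A + / B)) with (Lam * (Mw * (c * (4 * R0 * (/ - A + / B))))) by ring.
apply (blf_minus_bound HL); [exact D1|exact DF2|]. intros z Hz. apply Hcl; assumption.
Qed.
End Line.

(** * The half-line resolvent *)

Lemma cube_dec : forall (h : R -> C) M0 M3, (forall y, 0 <= y -> Cmod (h y) <= M0) -> (forall y, 0 <= y -> y ^ 3 * Cmod (h y) <= M3) ->
  dec3 (4 * (M0 + M3)) h.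
Proof.
intros h M0 M3 H0 H3 y Hy. specialize (H0 y Hy). specialize (H3 y Hy). assert (Hp := Cmod_ge_0 (h y)).
assert (Hq : 0 < (1 + y) ^ 3) by (apply pow_lt; lra).
apply Rmult_le_reg_r with ((1 + y) ^ 3); [exact Hq|].
replace (4 * (M0 + M3) / (1 + y) ^ 3 * (1 + y) ^ 3) with (4 * (M0 + M3)) by (field; lra).
assert (Hc : (1 + y) ^ 3 <= 4 * (1 + y ^ 3)).
{ assert (0 <= 3 * ((1 - y) ^ 2 * (1 + y))) by (apply Rmult_le_pos; [lra|apply Rmult_le_pos; [apply pow2_ge_0|lra]]). simpl in *. lra. }
apply Rle_trans with (Cmod (h y) * (4 * (1 + y ^ 3))); [apply Rmult_le_compat_l; assumption|]. lra.
Qed.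

Lemma Schwartz_nice : forall g dg, Schwartz_halfline g dg -> exists c, nice (dg 0%nat) (dg 1%nat) c.
Proof.
intros g dg H. destruct (Schwartz_jets g dg H 0%nat) as (_ & M & HM & T). destruct H as ((_ & Hc & Hd) & B).
assert (Hdec : forall n, exists c, dec3 c (dg n)).
{ intros n. destruct (B n 0%nat) as (M0 & B0). destruct (B n 3%nat) as (M3 & B3). exists (4 * (M0 + M3)). apply cube_dec; [|exact B3].
  intros y Hy. specialize (B0 y Hy). simpl in B0. lra. }
destruct (Hdec 0%nat) as (c0 & D0). destruct (Hdec 1%nat) as (c1 & D1).
assert (P0 := dec3_pos _ _ D0). assert (P1 := dec3_pos _ _ D1).
assert (Hup : forall c h k, dec3 c h -> c <= k -> dec3 k h).
{ intros c h k Hh Hk y Hy. eapply Rle_trans; [apply Hh, Hy|]. apply Rmult_le_compat_r; [|exact Hk]. left. apply Rinv_0_lt_compat, pow_lt. lra. }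
exists (c0 + c1 + M). constructor.
- apply Dh_on, Hc.
- intros y Hy. apply Hd, Hy.
- apply (Hup c0); [exact D0|lra].
- apply (Hup c1); [exact D1|lra].
- intros y y' Hy Hy'. eapply Rle_trans; [apply (T tt y y' Logic.I Hy Hy')|]. apply Rmult_le_compat_r; [apply pow2_ge_0|lra].
Qed.

(** The integral is split at [y = x], where [|x - y|] changes branch. *)
Lemma resol_split : forall g c z x, Dh g -> dec3 c g -> 0 < Im z -> 0 <= x ->
  resol g x z = (duh (Ci * z) g x + CRInt_halfline (fun y => Cexp (Ci * z * y) * g (x + y)%R))%C.
Proof.
intros g c z x Hg Hd Hz Hx. assert (Hc := dec3_pos _ _ Hd).
assert (He1 : forall y, Cmod (Cexp (Ci * z * Rabs (x - y))) <= 1).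
{ intros y. rewrite Cmod_Cexp. apply exp_le_1. assert (0 <= Rabs (x - y)) by apply Rabs_pos. simpl. unfold Im in Hz. nra. }
assert (He2 : forall y, 0 <= y -> Cmod (Cexp (Ci * z * y)) <= 1).
{ intros y Hy. rewrite Cmod_Cexp. apply exp_le_1. simpl. unfold Im in Hz. nra. }
assert (Hgx : Dh (fun y => g (x + y)%R)).
{ intros r. apply (cont_ext (fun r => g (Rmax 0 (x + Rmax 0 r)))).
  - intros y. rewrite (Rmax_right 0 (x + _)); [reflexivity|]. generalize (Rmax_l 0 y). lra.
  - apply (cont_comp_lip (fun r => g (Rmax 0 r)) (fun r => x + Rmax 0 r)); [|apply Hg].
    intros u v. replace (x + Rmax 0 u - (x + Rmax 0 v)) with (Rmax 0 u - Rmax 0 v) by ring. apply Rmax0_lip. }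
assert (Hgd : dec c (fun y => g (x + y)%R)).
{ intros y Hy. eapply Rle_trans; [apply (dec3_dec _ _ Hd); lra|]. apply Rmult_le_compat_l; [exact Hc|].
  apply Rinv_le_contravar; [apply pow_lt; lra|]. apply pow_incr. lra. }
assert (Hq : dec (c * 1) (fun y => Cexp (Ci * z * y) * g (x + y)%R)%C).
{ intros y Hy. rewrite Cmult_comm. apply (dec_mult c 1 (fun y => g (x + y)%R) (fun y => Cexp (Ci * z * y))); assumption. }
assert (HqD : Dh (fun y => Cexp (Ci * z * y) * g (x + y)%R)%C) by (apply Dc_mult; [apply Dh_exp|exact Hgx]).
assert (Hk : Dh (fun y => Cexp (Ci * z * Rabs (x - y)))).
{ intros r. apply (cont_comp_lip (fun y => Cexp (Ci * z * Rabs (x - y))) (Rmax 0)); [apply Rmax0_lip|].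
  apply cont_Cexp, cont_mult; [apply cont_const|]. apply cont_RtoC. apply (continuous_comp _ Rabs); [|apply continuous_Rabs].
  apply (continuous_minus (V := R_NormedModule)); [apply continuous_const|apply continuous_id]. }
unfold resol. apply (half_unique (c * 1)).
- apply Dc_mult; assumption.
- apply (dec_mult c 1 g); [apply dec3_dec, Hd|]. intros; apply He1.
- exists ((c * 1) * (1 + x) + Cmod (duh (Ci * z) g x + CRInt_halfline (fun y => Cexp (Ci * z * y) * g (x + y)%R)
     - CRInt_halfline (fun y => g y * Cexp (Ci * z * Rabs (x - y))))%C * (1 + x) + (c * 1) * (1 + x)).
  intros N HN. destruct (Rle_dec x N) as [HxN|HxN].
  + rewrite (CRInt_Chasles _ 0 x N) by (apply exC_half; [lra|lra|apply Dc_mult; assumption]).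
    replace (CRInt (fun y => g y * Cexp (Ci * z * Rabs (x - y)))%C 0 x) with (duh (Ci * z) g x).
    2: { unfold duh. apply CRInt_ext; [exact Hx|]. intros y Hy. rewrite Rabs_pos_eq by lra. ring. }
    replace (CRInt (fun y => g y * Cexp (Ci * z * Rabs (x - y)))%C x N) with (CRInt (fun y => Cexp (Ci * z * y) * g (x + y)%R)%C 0 (N - x)).
    2: { rewrite (CRInt_ext _ (fun y => (fun y => g y * Cexp (Ci * z * Rabs (x - y)))%C (Rmax 0 y)) x N) by (try lra; intros; rewrite Rmax_right by lra; reflexivity).
         assert (E := CRInt_shift (fun y => (fun y => g y * Cexp (Ci * z * Rabs (x - y)))%C (Rmax 0 y)) 0 (N - x) x (Dc_mult _ _ _ Hg Hk)).
         replace (0 + x) with x in E by ring. replace (N - x + x) with N in E by ring. rewrite E.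
         apply CRInt_ext; [lra|]. intros y Hy. rewrite !Rmax_right by lra. replace (x - (y + x)) with (- y) by ring.
         rewrite Rabs_Ropp, Rabs_pos_eq by lra. rewrite (Rplus_comm y x). ring. }
    match goal with |- Cmod (?a + ?p - (?a + ?q))%C <= _ => replace (a + p - (a + q))%C with (- (q - p))%C by ring end.
    rewrite Cmod_opp. eapply Rle_trans; [apply (half_ex (c * 1)); auto; lra|].
    apply Rmult_le_reg_r with ((1 + N) * (1 + (N - x))); [apply Rmult_lt_0_compat; lra|].
    replace (c * 1 / (1 + (N - x)) * ((1 + N) * (1 + (N - x)))) with (c * 1 * (1 + N)) by (field; lra).
    match goal with |- _ <= (?a + ?b + ?d) / _ * _ => replace ((a + b + d) / (1 + N) * ((1 + N) * (1 + (N - x)))) with ((a + b + d) * (1 + (N - x))) by (field; lra) end.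
    assert (0 <= Cmod (duh (Ci * z) g x + CRInt_halfline (fun y => Cexp (Ci * z * y) * g (x + y)%R)
     - CRInt_halfline (fun y => g y * Cexp (Ci * z * Rabs (x - y))))%C * (1 + x)) by (apply Rmult_le_pos; [apply Cmod_ge_0|lra]).
    apply Rle_trans with (c * 1 * (1 + x) * (1 + (N - x))).
    * rewrite (Rmult_assoc (c * 1)). apply Rmult_le_compat_l; [lra|]. assert (0 <= x * (N - x)) by (apply Rmult_le_pos; lra). lra.
    * apply Rmult_le_compat_r; [lra|]. assert (0 <= c * 1 * (1 + x)) by (apply Rmult_le_pos; lra). lra.
  + assert (B1 := half_ex (c * 1) (fun y => g y * Cexp (Ci * z * Rabs (x - y)))%C (Dc_mult _ _ _ Hg Hk)
       (dec_mult c 1 g _ (dec3_dec _ _ Hd) (fun y _ => He1 y)) N HN).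
    set (X := CRInt_halfline (fun y => g y * Cexp (Ci * z * Rabs (x - y)))%C) in *.
    set (Y := (duh (Ci * z) g x + CRInt_halfline (fun y => Cexp (Ci * z * y) * g (x + y)%R))%C) in *.
    set (F := CRInt (fun y => g y * Cexp (Ci * z * Rabs (x - y)))%C 0 N) in *.
    replace (F - Y)%C with (- (X - F) + - (Y - X))%C by ring.
    eapply Rle_trans; [apply Cmod_triangle|]. rewrite !Cmod_opp.
    assert (Hpos := Cmod_ge_0 (Y - X)%C).
    apply Rmult_le_reg_r with (1 + N); [lra|].
    match goal with |- _ <= ?a / (1 + N) * (1 + N) => replace (a / (1 + N) * (1 + N)) with a by (field; lra) end.
    assert (Cmod (X - F)%C * (1 + N) <= c * 1).
    { apply Rmult_le_compat_r with (r := 1 + N) in B1; [|lra]. replace (c * 1 / (1 + N) * (1 + N)) with (c * 1) in B1 by (field; lra). exact B1. }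
    assert (Cmod (Y - X)%C * (1 + N) <= Cmod (Y - X)%C * (1 + x)) by (apply Rmult_le_compat_l; lra).
    assert (0 <= c * 1 * x) by (apply Rmult_le_pos; lra). lra.
Qed.

(** Integration by parts in the outer part of the resolvent. *)
Lemma lap_parts_pos : forall (g g1 : R -> C) M (a : C) dl x, 0 < dl -> Re a <= - dl -> 0 < x ->
  (forall y, 0 < y -> has_deriv g y (g1 y)) -> Dh (fun y => g (x + y)%R) -> Dh (fun y => g1 (x + y)%R) ->
  (forall y, 0 <= y -> Cmod (g y) <= M) -> (forall y, 0 <= y -> Cmod (g1 y) <= M) ->
  CRInt_halfline (fun y => Cexp (a * y) * g1 (x + y)%R)%C = (- a * CRInt_halfline (fun y => Cexp (a * y) * g (x + y)%R) - g x)%C.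
Proof.
intros g g1 M a dl x Hdl Ha Hx Hd Hg Hg1 HM HM1.
pose (k := (Rmax 1 (2 / dl)) ^ 2). assert (Hexp := dec_exp a dl Hdl Ha). fold k in Hexp.
assert (Hk0 : 0 <= k) by (apply (dec_pos _ _ Hexp)).
assert (HM0 : 0 <= M) by (eapply Rle_trans; [apply Cmod_ge_0|apply (HM 0); lra]).
assert (D0 : Dh (fun y => Cexp (a * y) * g (x + y)%R)%C) by (apply Dc_mult; [apply Dh_exp|exact Hg]).
assert (D1 : Dh (fun y => Cexp (a * y) * g1 (x + y)%R)%C) by (apply Dc_mult; [apply Dh_exp|exact Hg1]).
assert (E0 : dec (k * M) (fun y => Cexp (a * y) * g (x + y)%R)%C) by (apply (dec_mult k M (fun y : R => Cexp (a * y))); [exact Hexp|intros; apply HM; lra]).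
assert (E1 : dec (k * M) (fun y => Cexp (a * y) * g1 (x + y)%R)%C) by (apply (dec_mult k M (fun y : R => Cexp (a * y))); [exact Hexp|intros; apply HM1; lra]).
apply (half_unique (k * M)); [exact D1|exact E1|].
exists (Cmod a * (k * M) + k * M). intros N HN.
assert (B := half_ex _ _ D0 E0 N HN).
assert (FT : CRInt (fun y => a * (Cexp (a * y) * g (x + y)%R) + Cexp (a * y) * g1 (x + y)%R)%C 0 N = (Cexp (a * N) * g (x + N)%R - g x)%C).
{ replace (g x) with (Cexp (a * 0%R) * g (x + 0)%R)%C by (replace (a * 0%R)%C with (RtoC 0) by ring; rewrite Cexp_0, Rplus_0_r; ring).
  rewrite (CRInt_ext _ (fun y => a * (Cexp (a * Rmax 0 y) * g (x + Rmax 0 y)%R) + Cexp (a * Rmax 0 y) * g1 (x + Rmax 0 y)%R)%C) by (try exact HN; intros; rewrite !Rmax_right by lra; reflexivity).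
  apply CRInt_unique, (CRInt_FTC (fun y => Cexp (a * y) * g (x + y)%R)%C); [exact HN| |].
  - intros y Hy. rewrite Rmax_right by lra. eapply has_deriv_eq.
    + apply has_deriv_mult; [apply has_deriv_Cexp_lin|]. apply (has_deriv_ext (fun y => g (x + 1 * y)%R)); [intros; f_equal; ring|].
      apply has_deriv_aff, Hd. lra.
    + cbv beta. replace (x + 1 * y) with (x + y) by ring. ring.
  - intros y _. apply cont_plus; [apply cont_mult; [apply cont_const|apply D0]|apply D1]. }
assert (X0 := exC_half _ 0 N (Rle_refl 0) HN D0). assert (X1 := exC_half _ 0 N (Rle_refl 0) HN D1).
rewrite (CRInt_plus _ _ 0 N (exC_scal a _ 0 N X0) X1), (CRInt_scal a _ 0 N X0) in FT.
set (i0 := CRInt (fun y => Cexp (a * y) * g (x + y)%R)%C 0 N) in *. set (i1 := CRInt (fun y => Cexp (a * y) * g1 (x + y)%R)%C 0 N) in *.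
set (h0 := CRInt_halfline (fun y => Cexp (a * y) * g (x + y)%R)%C) in *.
assert (Hi : i1 = (Cexp (a * N) * g (x + N)%R - g x - a * i0)%C) by (rewrite <- FT; ring).
replace (i1 - (- a * h0 - g x))%C with (a * (h0 - i0) + Cexp (a * N) * g (x + N)%R)%C by (rewrite Hi; ring).
eapply Rle_trans; [apply Cmod_triangle|]. rewrite !Cmod_mult.
replace ((Cmod a * (k * M) + k * M) / (1 + N)) with (Cmod a * (k * M / (1 + N)) + k / (1 + N) * M) by (field; lra).
apply Rplus_le_compat; [apply Rmult_le_compat_l; [apply Cmod_ge_0|exact B]|].
apply Rmult_le_compat; try apply Cmod_ge_0; [|apply HM; lra].
eapply Rle_trans; [apply Hexp, HN|]. apply Rmult_le_compat_l; [exact Hk0|]. apply Rinv_le_contravar; [lra|].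
rewrite <- (pow_1 (1 + N)) at 1. apply Rle_pow; [lra|lia].
Qed.

Section Resolvent.
Variables (alpha : R) (gamma0 gamma1 : C) (K : R -> C).
Hypothesis Hg : (gamma0 * sqrt alpha)%C <> gamma1.
Hypothesis HK : admissible_contour alpha gamma0 gamma1 K.

Let L := contour_int K.
Let D := Dc (Kc K).
Let P := on_curve K.
Let HKs := adm_simple _ _ _ _ HK.

Definition iz (z : C) : C := (Ci * z)%C.

Lemma Re_iz : forall z, Re (iz z) = - Im z.
Proof. intros z. unfold iz. simpl. unfold Im. ring. Qed.

Lemma coef_iz : coef P iz.
Proof. apply (Dc_coef K). apply Dc_mult; [apply Dc_const|apply Dc_id, HKs]. Qed.

(** The resolvent of [G] minus its reflection at the wall, both written so that the jets in [x] are explicit: the first two terms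
    are the two halves of [resol_split], the last one is [refl] times the value of the resolvent at [x = 0] times [e^{izx}]. *)
Definition robin_jet (G : nat -> nat -> C -> R -> R -> C) (n m : nat) (z : C) (x t : R) : C :=
  (duhx iz G n m z x t + lap iz G n m z x t +
    - refl gamma0 gamma1 z * (lap iz G 0 m z 0 t * (iz z ^ n * Cexp (iz z * x))))%C.

Lemma coef_pow : forall k n, coef P k -> coef P (fun z => k z ^ n)%C.
Proof.
intros k n (M & HM & H). exists (M ^ n). split; [apply pow_le, HM|]. intros z Hz. rewrite Cmod_pow. apply pow_incr. split; [apply Cmod_ge_0|apply H, Hz].
Qed.

Lemma wave_jets : forall n, bdd P halfR (fun z x => iz z ^ n * Cexp (iz z * x))%C /\
  tay P halfR (fun z x => iz z ^ n * Cexp (iz z * x))%C (fun z x => iz z ^ (S n) * Cexp (iz z * x))%C.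
Proof.
assert (Hd : forall n z (y : R), has_deriv (fun x : R => iz z ^ n * Cexp (iz z * x))%C y (iz z ^ (S n) * Cexp (iz z * y))%C).
{ intros n z y. eapply has_deriv_eq; [apply has_deriv_scal, has_deriv_Cexp_lin|]. simpl. ring. }
assert (Hbd : forall n, bdd P halfR (fun z x => iz z ^ n * Cexp (iz z * x))%C).
{ intros n. apply (bdd_scal P halfR (fun z => iz z ^ n)%C (fun z x => Cexp (iz z * x))); [apply coef_pow, coef_iz|].
  exists 1. split; [lra|]. intros z y Hz Hy. rewrite Cmod_Cexp. apply exp_le_1.
  assert (Hi := on_Im_pos _ _ _ _ HK z Hz). assert (Hr := Re_iz z).
  replace (Re (iz z * y)) with (Re (iz z) * y) by (destruct (iz z); simpl; ring). rewrite Hr. nra. }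
intros n. split; [apply Hbd|].
apply (tay_of_deriv2 _ _ _ _ (fun z x => iz z ^ (S (S n)) * Cexp (iz z * x))%C interval0_nonneg); [intros; apply Hd|intros; apply Hd|apply Hbd].
Qed.

Lemma iz_decay : exists dl, 0 < dl /\ forall z, P z -> Re (iz z) <= - dl.
Proof.
destruct (curve_Im _ _ _ _ HK) as (dl & Hdl & H). exists dl. split; [exact Hdl|]. intros z Hz. rewrite Re_iz. specialize (H z Hz). lra.
Qed.

Lemma tame_at0 : forall G, tame P G -> forall T, 0 < T -> forall m,
  bdd P (segR T) (fun z t => G 0%nat m z 0 t) /\ tay P (segR T) (fun z t => G 0%nat m z 0 t) (fun z t => G 0%nat (S m) z 0 t).
Proof.
intros G HG T HT m. split.
- destruct (tame_bt G HG T HT 0 m) as (M & HM & B). exists M. split; [exact HM|]. intros z t Hz Ht. apply (B (z, 0) t); [split; simpl; [exact Hz|lra]|exact Ht].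
- destruct (HG T HT 0%nat m) as (_ & _ & (M & HM & B)). exists M. split; [exact HM|]. intros z t t' Hz Ht Ht'. apply (B (z, 0)); [split; simpl; [exact Hz|lra]| |]; assumption.
Qed.

Lemma coef_refl : coef P (fun z => - refl gamma0 gamma1 z)%C.
Proof. apply coef_opp, (Dc_coef K), (D_refl alpha gamma0 gamma1 K); assumption. Qed.

Lemma tame_robin_jet : forall G, tame P G -> tame P (robin_jet G).
Proof.
intros G HG. destruct iz_decay as (dl & Hdl & Hre).
assert (HP : tame P (duhx iz G)) by (apply (tame_duhx iz G dl Hdl coef_iz Hre HG)).
assert (HQ : tame P (lap iz G)) by (apply (tame_lap iz G dl Hdl Hre HG)).
apply (tame_plus (fun n m z x t => duhx iz G n m z x t + lap iz G n m z x t)%C); [apply tame_plus; assumption|].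
apply (tame_scal (fun z => - refl gamma0 gamma1 z)%C); [apply coef_refl|].
apply (tame_sep (fun n z x => iz z ^ n * Cexp (iz z * x))%C (fun m z t => lap iz G 0 m z 0 t)); [apply wave_jets|].
intros T HT m. apply tame_at0; assumption.
Qed.

(** At [x = 0] the inner part vanishes, and the outer part satisfies [p_x = - i z p - G] with a compensating [+ G] from the
    inner one; the remaining factor [gamma0 - i gamma1 z] is cancelled by the reflected wave. *)
Lemma robin_jet_robin : forall G, tame P G -> (forall m z x t, P z -> 0 < x -> 0 <= t -> has_deriv (fun y => G 0%nat m z y t) x (G 1%nat m z x t)) ->
  forall m z t, P z -> 0 <= t ->
  (gamma0 * robin_jet G 0 m z 0 t + gamma1 * robin_jet G 1 m z 0 t)%C = 0%C.
Proof.
intros G HG Hd m z t Hz Ht. destruct iz_decay as (dl & Hdl & Hre).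
assert (HT : 0 < t + 1) by lra.
assert (HQ : tame P (lap iz G)) by (apply (tame_lap iz G dl Hdl Hre HG)).
assert (Hpar : parT P (t + 1) (z, t)) by (split; simpl; [exact Hz|lra]).
assert (HQ1 : lap iz G 1 m z 0 t = (- iz z * lap iz G 0 m z 0 t - G 0%nat m z 0 t)%C).
{ destruct (tame_lipx _ HQ (t + 1) HT 1 m) as (M1 & HM1 & B1). destruct (tame_lipx _ HQ (t + 1) HT 0 m) as (M2 & HM2 & B2).
  destruct (tame_lipx _ HG (t + 1) HT 0 m) as (M3 & HM3 & B3).
  destruct (HG (t + 1) HT 0%nat m) as ((M4 & HM4 & B4) & _). destruct (HG (t + 1) HT 1%nat m) as ((M5 & HM5 & B5) & _).
  assert (Hx : forall x, 0 < x -> lap iz G 1 m z x t = (- iz z * lap iz G 0 m z x t - G 0%nat m z x t)%C).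
  { intros x Hx. unfold lap. apply (lap_parts_pos (fun y => G 0%nat m z y t) (fun y => G 1%nat m z y t) (M4 + M5) (iz z) dl); try assumption.
    - apply Hre, Hz.
    - intros; apply Hd; assumption.
    - apply (tame_Dh G HG); [exact Hz|lra|exact Ht].
    - apply (tame_Dh G HG); [exact Hz|lra|exact Ht].
    - intros y Hy. specialize (B4 (z, t) y Hpar Hy). simpl in B4. lra.
    - intros y Hy. specialize (B5 (z, t) y Hpar Hy). simpl in B5. lra. }
  apply Ceq_of_eps. intros eps He. set (S0 := M1 + Cmod (iz z) * M2 + M3 + 1).
  assert (Hiz := Cmod_ge_0 (iz z)). assert (HS : 0 < S0) by (unfold S0; assert (0 <= Cmod (iz z) * M2) by (apply Rmult_le_pos; lra); lra).
  set (x := eps / S0). assert (Hxp : 0 < x) by (apply Rdiv_lt_0_compat; lra).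
  assert (C1 := B1 (z, t) 0 x Hpar ltac:(lra) ltac:(lra)). assert (C2 := B2 (z, t) 0 x Hpar ltac:(lra) ltac:(lra)). assert (C3 := B3 (z, t) 0 x Hpar ltac:(lra) ltac:(lra)).
  cbn [fst snd] in *. rewrite Rminus_0_l, Rabs_Ropp, Rabs_pos_eq in C1, C2, C3 by lra.
  replace (lap iz G 1 m z 0 t - (- iz z * lap iz G 0 m z 0 t - G 0%nat m z 0 t))%C with
    ((lap iz G 1 m z 0 t - lap iz G 1 m z x t) + iz z * (lap iz G 0 m z 0 t - lap iz G 0 m z x t) + (G 0%nat m z 0 t - G 0%nat m z x t))%C
    by (rewrite (Hx x Hxp); ring).
  eapply Rle_trans; [apply Cmod_triangle|]. eapply Rle_trans; [apply Rplus_le_compat_r, Cmod_triangle|]. rewrite Cmod_mult.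
  assert (Cmod (iz z) * Cmod (lap iz G 0 m z 0 t - lap iz G 0 m z x t)%C <= Cmod (iz z) * (M2 * x)) by (apply Rmult_le_compat_l; assumption).
  assert (Ex : S0 * x = eps) by (unfold x; field; lra). unfold S0 in Ex. lra. }
assert (Hz1 : (gamma0 + Ci * gamma1 * z)%C <> 0%C) by (apply (on_robin alpha gamma0 gamma1 K); assumption).
unfold robin_jet. rewrite HQ1. cbn [duhx]. unfold duh at 1 2. rewrite !CRInt_point.
replace (iz z * 0%R)%C with (RtoC 0) by ring. rewrite Cexp_0. cbn [Cpow]. unfold refl, iz. field. exact Hz1.
Qed.

(** ** Admissibility along the contour *)

Lemma D_resol : forall g c w x, Dh g -> dec3 c g -> D w -> D (fun z => w z * resol g x z)%C.
Proof.
intros g c w x Hgd Hd Hw. destruct (line_to_contour K HKs (on_Im_pos _ _ _ _ HK)) as (Cst & N1 & _ & _ & H).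
destruct (Dc_coef K w Hw) as (Mw & HMw & Bw). apply (H g c w Mw x); assumption.
Qed.

Lemma resol_0 : forall g c z, Dh g -> dec3 c g -> P z -> resol g 0 z = CRInt_halfline (fun y => Cexp (Ci * z * y) * g (0 + y)%R)%C.
Proof.
intros g c z Hgd Hd Hz. rewrite (resol_split g c) by (try assumption; try lra; apply (on_Im_pos _ _ _ _ HK z Hz)).
unfold duh. rewrite CRInt_point. ring.
Qed.

(** By Fubini the vanishing for each shift [s = rho y] carries over to the superposition on [(0,N)], and the tail is small. *)
Lemma L_superpose : forall (g : R -> C) c M1 (h : C -> C) (rho : R -> R), Dh g -> dec3 c g ->
  (forall y y', 0 <= y -> 0 <= y' -> Cmod (g y - g y')%C <= M1 * Rabs (y - y')) -> D h ->
  (forall y, 0 <= rho y) -> (forall y y', Rabs (rho y - rho y') <= Rabs (y - y')) ->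
  (forall s : R, 0 <= s -> L (fun z => h z * Cexp (Ci * z * s))%C = 0%C) ->
  D (fun z => h z * CRInt_halfline (fun y => g y * Cexp (Ci * z * rho y)))%C ->
  L (fun z => h z * CRInt_halfline (fun y => g y * Cexp (Ci * z * rho y)))%C = 0%C.
Proof.
intros g c M1 h rho Hgd Hd Hl Hh Hr0 Hr1 HL0 HD0.
destruct (BLF_contour K HKs) as (Lam & HL). assert (HLam := blf_pos _ _ _ _ HL).
destruct (Dc_coef K h Hh) as (Mh & HMh & Bh). destruct (Dc_coef K _ (Dc_id K HKs)) as (R0 & HR0 & HR).
assert (Hc := dec3_pos _ _ Hd).
assert (HM1 : 0 <= M1).
{ specialize (Hl 0 1 ltac:(lra) ltac:(lra)). rewrite Rminus_0_l, Rabs_Ropp, Rabs_R1 in Hl. generalize (Cmod_ge_0 (g 0 - g 1)%C). lra. }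
assert (He : forall z y, P z -> Cmod (Cexp (Ci * z * rho y)) <= 1).
{ intros z y Hz. rewrite Cmod_Cexp. apply exp_le_1. assert (Hi := on_Im_pos _ _ _ _ HK z Hz). specialize (Hr0 y). simpl. unfold Im in Hi. nra. }
assert (Hel : forall z y y', P z -> Cmod (Cexp (Ci * z * rho y) - Cexp (Ci * z * rho y'))%C <= R0 * Rabs (y - y')).
{ intros z y y' Hz. eapply Rle_trans; [apply (expabs_lip z R0 (on_Im_pos _ _ _ _ HK z Hz) (HR z Hz)); apply Hr0|]. apply Rmult_le_compat_l; [exact HR0|apply Hr1]. }
assert (HeD : forall z, P z -> Dh (fun y => Cexp (Ci * z * rho y))).
{ intros z Hz. apply Dc_lip with R0; [apply Rmax0_lip|]. intros; apply Hel, Hz. }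
assert (HFN : forall N, 0 <= N -> D (fun z => CRInt (fun y => h z * (g y * Cexp (Ci * z * rho y)))%C 0 N) /\
   L (fun z => CRInt (fun y => h z * (g y * Cexp (Ci * z * rho y)))%C 0 N) = 0%C).
{ intros N HN.
  destruct (blf_int HL (fun z y => h z * (g y * Cexp (Ci * z * rho y)))%C (Mh * (M1 + c * R0)) 0 N HN) as [D1 E1].
  - intros z Hz y y' Hy Hy'.
    replace (h z * (g y * Cexp (Ci * z * rho y)) - h z * (g y' * Cexp (Ci * z * rho y')))%C with
      (h z * ((g y - g y') * Cexp (Ci * z * rho y) + g y' * (Cexp (Ci * z * rho y) - Cexp (Ci * z * rho y'))))%C by ring.
    rewrite Cmod_mult, Rmult_assoc. apply Rmult_le_compat; try apply Cmod_ge_0; [apply Bh, Hz|].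
    eapply Rle_trans; [apply Cmod_triangle|]. rewrite !Cmod_mult, Rmult_plus_distr_r. apply Rplus_le_compat.
    + rewrite <- (Rmult_1_r (M1 * _)). apply Rmult_le_compat; try apply Cmod_ge_0; [apply Hl; lra|apply He, Hz].
    + rewrite Rmult_assoc. apply Rmult_le_compat; try apply Cmod_ge_0; [apply (dec3_le c); [exact Hd|lra]|apply Hel, Hz].
  - intros y Hy. apply Dc_mult; [exact Hh|]. apply Dc_mult; [apply Dc_const|]. apply Dc_Cexp, Dc_mult; [apply Dc_mult; [apply Dc_const|apply Dc_id, HKs]|apply Dc_const].
  - split; [exact D1|]. unfold L. rewrite E1. rewrite (CRInt_ext _ (fun _ => 0%C)); [rewrite CRInt_const; ring|exact HN|].
    intros y Hy. transitivity (L (fun z => g y * (h z * Cexp (Ci * z * rho y)))%C).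
    + unfold L. f_equal. apply functional_extensionality. intros z. ring.
    + unfold L. rewrite (blf_scal _ _ _ _ HL).
      * fold L. rewrite HL0 by apply Hr0. ring.
      * apply Dc_mult; [exact Hh|]. apply Dc_Cexp, Dc_mult; [apply Dc_mult; [apply Dc_const|apply Dc_id, HKs]|apply Dc_const]. }
apply Ceq_of_eps. intros eps Heps. destruct (nat_large (Lam * (Mh * (c * 1))) eps Heps) as (n & Hn & Hne).
assert (HnR : 0 < INR n) by (apply lt_0_INR, Hn). destruct (HFN (INR n) ltac:(lra)) as [DN EN].
rewrite <- EN. eapply Rle_trans; [apply (blf_minus_bound HL) with (M := Mh * (c * 1 / INR n)); [exact HD0|exact DN|]|].
- intros z Hz. rewrite CRInt_scal by (apply exC_half; [lra|lra|apply Dc_mult; [exact Hgd|apply HeD, Hz]]).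
  match goal with |- Cmod (?a * ?b - ?a * ?b')%C <= _ => replace (a * b - a * b')%C with (a * (b - b'))%C by ring end.
  rewrite Cmod_mult. apply Rmult_le_compat; try apply Cmod_ge_0; [apply Bh, Hz|].
  eapply Rle_trans; [apply (half_ex (c * 1))|].
  + apply Dc_mult; [exact Hgd|apply HeD, Hz].
  + apply (dec_mult c 1 g); [apply dec3_dec, Hd|]. intros; apply He, Hz.
  + lra.
  + apply Rmult_le_compat_l; [lra|]. apply Rinv_le_contravar; lra.
- eapply Rle_trans; [|exact Hne]. right. field. lra.
Qed.
End Resolvent.

(** * The solution as a contour integral *)

Lemma blf_param_cont : forall {S} {P : S -> Prop} {D L Lam} (HL : BLF P D L Lam) (g : S -> R -> C) M a b, a <= b ->
  (forall s, P s -> forall y y', a <= y <= b -> a <= y' <= b -> Cmod (g s y - g s y')%C <= M * Rabs (y - y')) ->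
  (forall y, a <= y <= b -> D (fun s => g s y)) -> Dc (clamp a b) (fun y => L (fun s => g s y)).
Proof.
intros S P D L Lam HL g M a b Hab Hg HD. apply Dc_clamp_lip with (Lam * M); [exact Hab|]. intros y y' Hy Hy'.
rewrite Rmult_assoc. apply (blf_minus_bound HL); [apply HD, Hy|apply HD, Hy'|]. intros s Hs. apply Hg; assumption.
Qed.

Lemma time_jets : forall {S} (P : S -> Prop) (k : S -> C), coef P k -> forall T, 0 < T -> forall m,
  bdd P (segR T) (fun s t => k s ^ m * Cexp (k s * t))%C /\
  tay P (segR T) (fun s t => k s ^ m * Cexp (k s * t))%C (fun s t => k s ^ (Datatypes.S m) * Cexp (k s * t))%C.
Proof.
intros S P k (A & HA & Hk) T HT.
assert (Hd : forall m s (y : R), has_deriv (fun t : R => k s ^ m * Cexp (k s * t))%C y (k s ^ (Datatypes.S m) * Cexp (k s * y))%C).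
{ intros m s y. eapply has_deriv_eq; [apply has_deriv_scal, has_deriv_Cexp_lin|]. simpl. ring. }
assert (Hb : forall m, bdd P (segR T) (fun s t => k s ^ m * Cexp (k s * t))%C).
{ intros m. exists (A ^ m * exp (A * T)). split; [apply Rmult_le_pos; [apply pow_le, HA|left; apply exp_pos]|].
  intros s y Hs Hy. rewrite Cmod_mult, Cmod_pow, Cmod_Cexp. apply Rmult_le_compat.
  - apply pow_le, Cmod_ge_0.
  - left; apply exp_pos.
  - apply pow_incr. split; [apply Cmod_ge_0|apply Hk, Hs].
  - apply exp_le. eapply Rle_trans; [apply Rle_abs|]. eapply Rle_trans; [apply re_le_Cmod|].
    rewrite Cmod_mult, Cmod_R, Rabs_pos_eq by lra. apply Rmult_le_compat; try lra; [apply Cmod_ge_0|apply Hk, Hs]. }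
intros m. split; [apply Hb|].
apply (tay_of_deriv2 _ _ _ _ (fun s t => k s ^ (Datatypes.S (Datatypes.S m)) * Cexp (k s * t))%C); [apply interval0_seg; lra|intros; apply Hd|intros; apply Hd|apply Hb].
Qed.

Lemma exp_coef : forall {S} (P : S -> Prop) (k : S -> C), coef P k -> forall t, 0 <= t ->
  exists M, 0 <= M /\ (forall s r, P s -> 0 <= r <= t -> Cmod (Cexp (k s * (t - r)%R)) <= M) /\
  (forall s r r', P s -> 0 <= r <= t -> 0 <= r' <= t -> Cmod (Cexp (k s * (t - r)%R) - Cexp (k s * (t - r')%R))%C <= M * Rabs (r - r')).
Proof.
intros S P k Hk t Ht. destruct (time_jets P k Hk (t + 1) ltac:(lra) 0%nat) as (B0 & T0). destruct (time_jets P k Hk (t + 1) ltac:(lra) 1%nat) as (B1 & _).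
destruct (tay_lip P (segR (t + 1)) _ _ B0 B1 T0) as (M1 & HM1 & L1). destruct B0 as (M0 & HM0 & B0).
exists (M0 + M1). split; [lra|]. split.
- intros s r Hs Hr. specialize (B0 s (t - r) Hs ltac:(lra)). simpl in B0. rewrite Cmult_1_l in B0. lra.
- intros s r r' Hs Hr Hr'. specialize (L1 s (t - r) (t - r') Hs ltac:(lra) ltac:(lra)). simpl in L1. rewrite !Cmult_1_l in L1.
  replace (t - r - (t - r')) with (- (r - r')) in L1 by ring. rewrite Rabs_Ropp in L1. assert (0 <= Rabs (r - r')) by apply Rabs_pos. nra.
Qed.

Lemma duh_lin : forall a g h (k : C) y, 0 <= y -> Dc (clamp 0 y) g -> Dc (clamp 0 y) h ->
  duh a (fun r => k * g r + h r)%C y = (k * duh a g y + duh a h y)%C.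
Proof.
intros a g h k y Hy Hg Hh. assert (HB := BLF_duh_seg a y (Cmod a) y ltac:(lra) (Rle_refl _)).
rewrite (blf_plus _ _ _ _ HB (fun r => k * g r)%C h (blf_scal_D _ _ _ _ HB k g Hg) Hh), (blf_scal _ _ _ _ HB k g Hg). reflexivity.
Qed.

Lemma duh_scal : forall a g (k : C) y, 0 <= y -> Dc (clamp 0 y) g -> duh a (fun r => k * g r)%C y = (k * duh a g y)%C.
Proof.
intros a g k y Hy Hg. assert (HB := BLF_duh_seg a y (Cmod a) y ltac:(lra) (Rle_refl _)). apply (blf_scal _ _ _ _ HB k g Hg).
Qed.

Lemma duh_ext : forall a g h y, 0 <= y -> (forall r, 0 < r < y -> g r = h r) -> duh a g y = duh a h y.
Proof. intros a g h y Hy H. unfold duh. apply CRInt_ext; [exact Hy|]. intros r Hr. rewrite H by exact Hr. reflexivity. Qed.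

Lemma exp_integral_duh : forall w h t, 0 <= t -> Dc (clamp 0 t) h ->
  (Cexp (- (w * t)) * CRInt (fun tau : R => Cexp (w * tau) * h tau) 0 t)%C = duh (- w) h t.
Proof.
intros w h t Ht Hh. rewrite <- CRInt_scal.
- unfold duh. apply CRInt_ext; [exact Ht|]. intros r _. rewrite Cmult_assoc, <- Cexp_add. do 2 f_equal. rewrite RtoC_minus. ring.
- apply exC_Dc; [exact Ht|]. apply Dc_mult; [|exact Hh]. apply (Dc_of_cont (fun r : R => Cexp (w * r))); [apply clamp_lip|]. intros; apply cont_Cexp_lin.
Qed.

Section Sol.
Variables (alpha beta : R) (gamma0 gamma1 : C) (u0 : R -> C) (du0 : nat -> R -> C)
  (zeta : R -> C) (dzeta : nat -> R -> C) (f : R -> R -> C) (df : nat -> nat -> R -> R -> C) (K : R -> C).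
Hypothesis Ha : 0 < alpha.
Hypothesis Hb : 0 < beta.
Hypothesis Hg : (gamma0 * sqrt alpha)%C <> gamma1.
Hypothesis Hu : Schwartz_halfline u0 du0.
Hypothesis Hz : derivs1 pos nonneg zeta dzeta.
Hypothesis Hf : derivs2 open_quadrant closed_quadrant f df.
Hypothesis Hfb : forall T : R, 0 < T -> forall n m l : nat, exists M : R,
     forall x t, 0 < x -> 0 <= t <= T -> x ^ l * Cmod (df n m x t) <= M.
Hypothesis HK : admissible_contour alpha gamma0 gamma1 K.

Let L := contour_int K.
Let D := Dc (Kc K).
Let P := on_curve K.
Let HKs := adm_simple _ _ _ _ HK.
Let b : R := beta / alpha.

(** The successive [t]-derivatives of the constant [1]. *)
Definition one_jet (m : nat) : C := match m with O => 1%C | _ => 0%C end.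
Definition init_jet (n m : nat) (_ : C) (x _ : R) : C := (one_jet m * du0 n x)%C.
Definition force_jet (n m : nat) (_ : C) (x t : R) : C := df n m x t.
(** Amplitude of the wave [e^{izx}] sent by a unit boundary datum. *)
Definition wall_coef (z : C) : C := (- (Ci / PI) * (z / (den alpha z * (gamma0 + Ci * gamma1 * z))))%C.
Definition rate (z : C) : C := (- omega alpha beta z)%C.
(** The inhomogeneous term of the density: the response to the forcing and to the boundary datum at time [t]. *)
Definition source (n m : nat) (z : C) (x t : R) : C :=
  (/ (2 * PI) * / den alpha z * robin_jet gamma0 gamma1 force_jet n m z x t
   + wall_coef z * (dzeta m t * (iz z ^ n * Cexp (iz z * x))))%C.
(** The evolution of the initial datum. *)
Definition free_wave (n m : nat) (z : C) (x t : R) : C :=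
  (/ (2 * PI) * ((rate z ^ m * Cexp (rate z * t)) * robin_jet gamma0 gamma1 init_jet n 0 z x 0))%C.
(** The function of [z] which is integrated over the contour; it solves [p_t = - omega p + source]. *)
Definition density (n m : nat) (z : C) (x t : R) : C := (free_wave n m z x t + duht rate source n m z x t)%C.
(** The jet of the solution, defined up to the boundary.  The argument of type [unit] indexes a [tame] family with a
    single member. *)
Definition sol_jet (n m : nat) (_ : unit) (x t : R) : C :=
  ((RtoC (- b) ^ m * Cexp (RtoC (- b) * t)) * du0 n x + L (fun z => density n m z x t))%C.

Lemma tame_init_jet : tame P init_jet.
Proof.
apply (tame_sep (fun n _ x => du0 n x) (fun m _ _ => one_jet m)).
- intros n. destruct (Schwartz_jets u0 du0 Hu n) as (B & T). split.
  + exact (bdd_sub plain P (fun _ => tt) _ _ (fun _ _ => Logic.I) B).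
  + exact (tay_sub plain P (fun _ => tt) _ _ _ (fun _ _ => Logic.I) T).
- intros T HT m. split.
  + exists 1. split; [lra|]. intros _ _ _ _. destruct m; simpl; [rewrite Cmod_1|rewrite Cmod_0]; lra.
  + exists 0. split; [lra|]. intros _ y y' _ _ _. replace (one_jet (S m)) with (RtoC 0) by reflexivity.
    replace (one_jet m - one_jet m - (y' - y)%R * 0)%C with (RtoC 0) by ring. rewrite Cmod_0. lra.
Qed.

Lemma tame_force_jet : tame P force_jet.
Proof. exact (tame_sub plain P (fun _ => tt) _ (fun _ _ => Logic.I) (tame_derivs2_data f df Hf Hfb)). Qed.

Lemma coef_rate : coef P rate.
Proof. apply coef_opp, (Dc_coef K), (D_omega alpha beta gamma0 gamma1 K); assumption. Qed.

Lemma D_wall_coef : D wall_coef.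
Proof.
apply Dc_mult; [apply Dc_const|]. apply Dc_div; [apply Dc_id, HKs| |].
- apply Dc_mult; [apply (D_den alpha gamma0 gamma1 K); assumption|]. apply Dc_plus; [apply Dc_const|apply Dc_mult; [apply Dc_const|apply Dc_id, HKs]].
- intros r. apply Cmult_neq_0; [apply (on_den alpha gamma0 gamma1 K)|apply (on_robin alpha gamma0 gamma1 K)]; try assumption; apply Kc_on.
Qed.

Lemma D_pden : D (fun z => / (2 * PI) * / den alpha z)%C.
Proof. apply Dc_mult; [apply Dc_const|apply (D_dinv alpha gamma0 gamma1 K); assumption]. Qed.

Lemma zeta_jets : forall T, 0 < T -> forall m, bdd P (segR T) (fun _ => dzeta m) /\ tay P (segR T) (fun _ => dzeta m) (fun _ => dzeta (S m)).
Proof.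
intros T HT m. destruct (derivs1_jets_seg zeta dzeta Hz T HT m) as (B & T1). split.
- exact (bdd_sub plain P (fun _ => tt) _ _ (fun _ _ => Logic.I) B).
- exact (tay_sub plain P (fun _ => tt) _ _ _ (fun _ _ => Logic.I) T1).
Qed.

Lemma tame_zwave : tame P (fun n m z x t => dzeta m t * (iz z ^ n * Cexp (iz z * x)))%C.
Proof.
apply (tame_sep (fun n z x => iz z ^ n * Cexp (iz z * x))%C (fun m _ t => dzeta m t)).
- apply (wave_jets alpha gamma0 gamma1 K HK).
- apply zeta_jets.
Qed.

Lemma tame_source : tame P source.
Proof.
apply (tame_plus (fun n m z x t => / (2 * PI) * / den alpha z * robin_jet gamma0 gamma1 force_jet n m z x t)%C).
- apply (tame_scal (fun z => / (2 * PI) * / den alpha z)%C); [apply (Dc_coef K), D_pden|].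
  apply (tame_robin_jet alpha gamma0 gamma1 K Hg HK force_jet tame_force_jet).
- apply (tame_scal wall_coef); [apply (Dc_coef K), D_wall_coef|apply tame_zwave].
Qed.

Lemma tame_free_wave : tame P free_wave.
Proof.
apply (tame_scal (fun _ => / (2 * PI))%C); [apply coef_const|].
assert (HB := tame_robin_jet alpha gamma0 gamma1 K Hg HK init_jet tame_init_jet).
apply (tame_sep (fun n z x => robin_jet gamma0 gamma1 init_jet n 0 z x 0) (fun m z t => rate z ^ m * Cexp (rate z * t))%C).
- intros n. destruct (HB 1 Rlt_0_1 n 0%nat) as (B & T & _).
  assert (Hm : forall z, P z -> parT P 1 (z, 0)) by (intros z Hz0; split; simpl; [exact Hz0|lra]).
  split.
  + exact (bdd_sub (parT P 1) P (fun z => (z, 0)) _ _ Hm B).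
  + exact (tay_sub (parT P 1) P (fun z => (z, 0)) _ _ _ Hm T).
- apply time_jets, coef_rate.
Qed.

Lemma tame_density : tame P density.
Proof. apply tame_plus; [apply tame_free_wave|]. apply tame_duht; [apply coef_rate|apply tame_source]. Qed.

(** ** Decay of the data *)

Lemma u_nice : exists c, nice (du0 0%nat) (du0 1%nat) c.
Proof. apply (Schwartz_nice u0 du0 Hu). Qed.

Lemma f_dec : forall T, 0 < T -> exists c, 0 <= c /\ forall t, 0 <= t <= T -> dec3 c (fun y => df 0%nat 0%nat y t).
Proof.
intros T HT. destruct (Hfb T HT 0%nat 0%nat 3%nat) as (M3 & B3).
destruct (tame_force_jet T HT 0%nat 0%nat) as ((M0 & HM0 & B0) & _).
destruct (curve_Im alpha gamma0 gamma1 K HK) as (_ & _ & _).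
assert (Hz0 : P (Kc K 0)) by apply Kc_on.
exists (4 * (M0 + Rabs M3)). split; [generalize (Rabs_pos M3); lra|]. intros t Ht. apply cube_dec.
- intros y Hy. apply (B0 (Kc K 0, t) y); [split; assumption|exact Hy].
- intros y [Hy|<-].
  + eapply Rle_trans; [apply B3; assumption|apply Rle_abs].
  + rewrite pow_i by lia. rewrite Rmult_0_l. apply Rabs_pos.
Qed.

Lemma f_Dh : forall t, 0 <= t -> Dh (fun y => df 0%nat 0%nat y t).
Proof.
intros t Ht. assert (Hz0 : P (Kc K 0)) by apply Kc_on.
intros r. apply (cont_ext (fun r => force_jet 0 0 (Kc K 0) (0 + Rmax 0 r)%R t)); [intros y; rewrite Rplus_0_l; reflexivity|].
apply (tame_Dh force_jet tame_force_jet 0 0 (Kc K 0) 0 t Hz0 (Rle_refl 0) Ht).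
Qed.

(** The bounds on [df] are only given for [x > 0], hence the interior estimate and the passage to the boundary along the diagonal. *)
Lemma f_dec_lip : forall T, 0 < T -> exists c, 0 <= c /\ forall t t', 0 <= t <= T -> 0 <= t' <= T ->
  dec3 (c * Rabs (t - t')) (fun y => df 0%nat 0%nat y t - df 0%nat 0%nat y t')%C.
Proof.
intros T HT. destruct (Hfb (T + 1) ltac:(lra) 0%nat 1%nat 3%nat) as (M3 & B3).
destruct (tame_lipt force_jet tame_force_jet T HT 0 0) as (M0 & HM0 & B0).
assert (Hz0 : P (Kc K 0)) by apply Kc_on. destruct Hf as (_ & Hc & Hd).
exists (4 * (M0 + Rabs M3)). split; [generalize (Rabs_pos M3); lra|]. intros t t' Ht Ht'.
replace (4 * (M0 + Rabs M3) * Rabs (t - t')) with (4 * (M0 * Rabs (t - t') + Rabs M3 * Rabs (t - t'))) by ring.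
apply cube_dec.
- intros y Hy. apply (B0 (Kc K 0, y)); [split; assumption|assumption|assumption].
- intros y Hy.
  replace (y ^ 3 * Cmod (df 0%nat 0%nat y t - df 0%nat 0%nat y t')%C) with (Cmod (RtoC (y ^ 3) * (df 0%nat 0%nat y t + - (1) * df 0%nat 0%nat y t'))%C).
  2: { rewrite Cmod_mult, Cmod_R, Rabs_pos_eq by (apply pow_le, Hy). do 2 f_equal. ring. }
  apply (rlim_bound _ _ _ (rlim_scal (RtoC (y ^ 3)) _ _ (rlim_plus _ _ _ _ (rlim_on2 _ y t (Hc 0%nat 0%nat) Hy (proj1 Ht))
     (rlim_scal (- (1))%C _ _ (rlim_on2 _ y t' (Hc 0%nat 0%nat) Hy (proj1 Ht')))))).
  intros e He. rewrite Cmod_mult, Cmod_R, Rabs_pos_eq by (apply pow_le, Hy).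
  replace (df 0%nat 0%nat (y + e) (t + e) + - (1) * df 0%nat 0%nat (y + e) (t' + e))%C with (df 0%nat 0%nat (y + e) (t + e) - df 0%nat 0%nat (y + e) (t' + e))%C by ring.
  assert (Hw : 0 < (y + e) ^ 3) by (apply pow_lt; lra).
  assert (Hwle : y ^ 3 <= (y + e) ^ 3) by (apply pow_incr; lra).
  apply Rle_trans with ((y + e) ^ 3 * (Rabs M3 / (y + e) ^ 3 * Rabs ((t + e) - (t' + e)))).
  + apply Rmult_le_compat; [apply pow_le, Hy|apply Cmod_ge_0|exact Hwle|].
    apply (deriv_lip_abs (fun s => df 0%nat 0%nat (y + e) s) (fun s => df 0%nat 1%nat (y + e) s)).
    * intros r Hr. apply Hd. split; simpl; [lra|]. revert Hr. unfold Rmin. destruct Rle_dec; lra.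
    * intros r Hr. apply Rmult_le_reg_l with ((y + e) ^ 3); [exact Hw|]. replace ((y + e) ^ 3 * (Rabs M3 / (y + e) ^ 3)) with (Rabs M3) by (field; lra).
      eapply Rle_trans; [apply B3; [lra|]|apply Rle_abs]. revert Hr. unfold Rmin, Rmax. repeat destruct Rle_dec; lra.
  + right. replace (t + e - (t' + e)) with (t - t') by ring. field. lra.
Qed.

(** ** Fubini for the Duhamel integral along the contour *)

Lemma duh_fubini : forall (F : C -> R -> C) t, 0 <= t -> bdd P (segR t) F -> lip P (segR t) F -> (forall r, 0 <= r <= t -> D (fun z => F z r)) ->
  D (fun z => duh (rate z) (F z) t) /\
  L (fun z => duh (rate z) (F z) t) = CRInt (fun r => L (fun z => Cexp (rate z * (t - r)%R) * F z r)%C) 0 t /\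
  Dc (clamp 0 t) (fun r => L (fun z => Cexp (rate z * (t - r)%R) * F z r)%C).
Proof.
intros F t Ht (MF & HMF & BF) (LF & HLF & HF) HD.
destruct (BLF_contour K HKs) as (Lam & HL). destruct (exp_coef P rate coef_rate t Ht) as (Me & HMe & Be & Le).
assert (Hlip : forall z, P z -> forall y y', 0 <= y <= t -> 0 <= y' <= t ->
   Cmod (Cexp (rate z * (t - y)%R) * F z y - Cexp (rate z * (t - y')%R) * F z y')%C <= (Me * MF + Me * LF) * Rabs (y - y')).
{ intros z Hz0 y y' Hy Hy'.
  replace (Cexp (rate z * (t - y)%R) * F z y - Cexp (rate z * (t - y')%R) * F z y')%C with
   ((Cexp (rate z * (t - y)%R) - Cexp (rate z * (t - y')%R)) * F z y + Cexp (rate z * (t - y')%R) * (F z y - F z y'))%C by ring.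
  eapply Rle_trans; [apply Cmod_triangle|]. rewrite !Cmod_mult, Rmult_plus_distr_r. apply Rplus_le_compat.
  - replace (Me * MF * Rabs (y - y')) with (Me * Rabs (y - y') * MF) by ring. apply Rmult_le_compat; try apply Cmod_ge_0; [apply Le; assumption|apply BF; assumption].
  - rewrite Rmult_assoc. apply Rmult_le_compat; try apply Cmod_ge_0; [apply Be; assumption|apply HF; assumption]. }
assert (HDr : forall y, 0 <= y <= t -> D (fun z => Cexp (rate z * (t - y)%R) * F z y)%C).
{ intros y Hy. apply Dc_mult; [|apply HD, Hy]. apply Dc_Cexp, Dc_mult; [|apply Dc_const].
  apply Dc_opp, (D_omega alpha beta gamma0 gamma1 K); assumption. }
destruct (blf_int HL (fun z r => Cexp (rate z * (t - r)%R) * F z r)%C (Me * MF + Me * LF) 0 t Ht Hlip HDr) as [D1 E1].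
split; [exact D1|split; [exact E1|]].
apply (blf_param_cont HL (fun z r => Cexp (rate z * (t - r)%R) * F z r)%C (Me * MF + Me * LF) 0 t Ht Hlip HDr).
Qed.

(** ** The resolvents of the data *)

Definition u_init := du0 0%nat.
Definition f_at (t y : R) := df 0%nat 0%nat y t.

Lemma robin_jet_resol : forall G (g : R -> C) c z x t, Dh g -> dec3 c g -> (forall y, G 0%nat 0%nat z y t = g y) -> P z -> 0 <= x ->
  robin_jet gamma0 gamma1 G 0 0 z x t = (resol g x z + - refl gamma0 gamma1 z * (resol g 0 z * Cexp (Ci * z * x)))%C.
Proof.
intros G g c z x t Hgd Hd HG Hz0 Hx.
rewrite (resol_0 alpha gamma0 gamma1 K HK g c z Hgd Hd Hz0).
rewrite (resol_split g c z x Hgd Hd (on_Im_pos _ _ _ _ HK z Hz0) Hx).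
unfold robin_jet, lap, duhx, iz. cbn [Cpow].
replace (fun y : R => G 0%nat 0%nat z y t) with g by (apply functional_extensionality; intros; symmetry; apply HG).
replace (fun y : R => (Cexp (Ci * z * y) * G 0%nat 0%nat z (x + y)%R t)%C) with (fun y : R => (Cexp (Ci * z * y) * g (x + y)%R)%C)
  by (apply functional_extensionality; intros; rewrite HG; reflexivity).
replace (fun y : R => (Cexp (Ci * z * y) * G 0%nat 0%nat z (0 + y)%R t)%C) with (fun y : R => (Cexp (Ci * z * y) * g (0 + y)%R)%C)
  by (apply functional_extensionality; intros; rewrite HG; reflexivity).
ring.
Qed.

Lemma D_wave : forall x : R, D (fun z => Cexp (Ci * z * x)).
Proof. intros x. apply Dc_Cexp, Dc_mult; [apply Dc_mult; [apply Dc_const|apply Dc_id, HKs]|apply Dc_const]. Qed.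

Lemma D_resol1 : forall g c x, Dh g -> dec3 c g -> D (fun z => resol g x z).
Proof.
intros g c x Hgd Hd. destruct (BLF_contour K HKs) as (Lam & HL).
apply (blf_D_ext HL (fun z => 1 * resol g x z)%C).
- apply (D_resol alpha gamma0 gamma1 K HK g c (fun _ => 1%C)); [exact Hgd|exact Hd|apply Dc_const].
- intros; ring.
Qed.

Lemma D_reflection : D (refl gamma0 gamma1).
Proof. apply (D_refl alpha gamma0 gamma1 K); assumption. Qed.

(** The resolvent of the forcing is a sum of two tame families. *)
Lemma fres_time : forall x t, 0 <= x -> 0 <= t -> bdd P (segR t) (fun z r => resol (f_at r) x z) /\ lip P (segR t) (fun z r => resol (f_at r) x z).
Proof.
intros x t Hx Ht. destruct (f_dec (t + 1) ltac:(lra)) as (c & Hc & Hd).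
destruct (iz_decay alpha gamma0 gamma1 K HK) as (dl & Hdl & Hre).
assert (HP : tame P (duhx iz force_jet)) by (apply (tame_duhx iz force_jet dl Hdl (coef_iz alpha gamma0 gamma1 K HK) Hre tame_force_jet)).
assert (HQ : tame P (lap iz force_jet)) by (apply (tame_lap iz force_jet dl Hdl Hre tame_force_jet)).
assert (HS := tame_plus _ _ HP HQ).
assert (E : forall z r, P z -> 0 <= r <= t -> (duhx iz force_jet 0 0 z x r + lap iz force_jet 0 0 z x r)%C = resol (f_at r) x z).
{ intros z r Hz0 Hr. symmetry. rewrite (resol_split (f_at r) c z x); [reflexivity| | | |exact Hx].
  - apply f_Dh; lra.
  - apply Hd; lra.
  - apply (on_Im_pos _ _ _ _ HK z Hz0). }
destruct (tame_bt _ HS (t + 1) ltac:(lra) 0 0) as (M & HM & B). destruct (tame_lipt _ HS (t + 1) ltac:(lra) 0 0) as (M' & HM' & B').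
split.
- exists M. split; [exact HM|]. intros z r Hz0 Hr. rewrite <- E by assumption. apply (B (z, x)); [split; assumption|lra].
- exists M'. split; [exact HM'|]. intros z r r' Hz0 Hr Hr'. rewrite <- !E by assumption. apply (B' (z, x)); [split; assumption|lra|lra].
Qed.

Lemma D_source : forall x t, 0 <= x -> 0 <= t -> D (fun z => source 0 0 z x t).
Proof.
intros x t Hx Ht. destruct (BLF_contour K HKs) as (Lam & HL). destruct (f_dec (t + 1) ltac:(lra)) as (c & Hc & Hd).
assert (Hdt : dec3 c (f_at t)) by (apply Hd; lra). assert (HDh : Dh (f_at t)) by (apply f_Dh, Ht).
apply Dc_plus.
- apply Dc_mult; [apply D_pden|].
  apply (blf_D_ext HL (fun z => resol (f_at t) x z + - refl gamma0 gamma1 z * (resol (f_at t) 0 z * Cexp (Ci * z * x)))%C).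
  + apply Dc_plus; [apply (D_resol1 _ c); assumption|]. apply Dc_mult; [apply Dc_opp, D_reflection|]. apply Dc_mult; [apply (D_resol1 _ c); assumption|apply D_wave].
  + intros z Hz0. symmetry. apply (robin_jet_resol force_jet (f_at t) c); try assumption. reflexivity.
- change (D (fun z => wall_coef z * (dzeta 0%nat t * (1 * Cexp (Ci * z * x))))%C).
  apply Dc_mult; [exact D_wall_coef|]. apply Dc_mult; [apply Dc_const|]. apply Dc_mult; [apply Dc_const|exact (D_wave x)].
Qed.

Lemma source_time : forall x t, 0 <= x -> 0 <= t -> bdd P (segR t) (fun z r => source 0 0 z x r) /\ lip P (segR t) (fun z r => source 0 0 z x r).
Proof.
intros x t Hx Ht. destruct (tame_bt source tame_source (t + 1) ltac:(lra) 0 0) as (M & HM & B). destruct (tame_lipt source tame_source (t + 1) ltac:(lra) 0 0) as (M' & HM' & B').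
split.
- exists M. split; [exact HM|]. intros z r Hz0 Hr. apply (B (z, x)); [split; assumption|lra].
- exists M'. split; [exact HM'|]. intros z r r' Hz0 Hr Hr'. apply (B' (z, x)); [split; assumption|lra|lra].
Qed.

Lemma u_Dh : Dh u_init.
Proof. destruct u_nice as (c & Hn). apply Hn. Qed.

Lemma u_dec : exists c, dec3 c u_init.
Proof. destruct u_nice as (c & Hn). exists c. apply Hn. Qed.

Lemma init_robin_resol : forall z x, P z -> 0 <= x ->
  robin_jet gamma0 gamma1 init_jet 0 0 z x 0 = (resol u_init x z + - refl gamma0 gamma1 z * (resol u_init 0 z * Cexp (Ci * z * x)))%C.
Proof.
intros z x Hz0 Hx. destruct u_dec as (c & Hd). apply (robin_jet_resol init_jet u_init c); [apply u_Dh|exact Hd| |exact Hz0|exact Hx].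
intros y. unfold init_jet, one_jet, u_init. ring.
Qed.

Lemma D_init_robin : forall x, 0 <= x -> D (fun z => robin_jet gamma0 gamma1 init_jet 0 0 z x 0).
Proof.
intros x Hx. destruct (BLF_contour K HKs) as (Lam & HL). destruct u_dec as (c & Hd).
apply (blf_D_ext HL (fun z => resol u_init x z + - refl gamma0 gamma1 z * (resol u_init 0 z * Cexp (Ci * z * x)))%C).
- apply Dc_plus; [apply (D_resol1 _ c); [apply u_Dh|exact Hd]|]. apply Dc_mult; [apply Dc_opp, D_reflection|]. apply Dc_mult; [apply (D_resol1 _ c); [apply u_Dh|exact Hd]|apply D_wave].
- intros z Hz0. symmetry. apply init_robin_resol; assumption.
Qed.

Lemma D_expt : forall t : R, D (fun z => Cexp (rate z * t)).
Proof. intros t. apply Dc_Cexp, Dc_mult; [|apply Dc_const]. apply Dc_opp, (D_omega alpha beta gamma0 gamma1 K); assumption. Qed.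

Lemma D_density0 : forall x t, 0 <= x -> 0 <= t -> D (fun z => density 0 0 z x t).
Proof.
intros x t Hx Ht. apply Dc_plus.
- change (D (fun z => / (2 * PI) * ((1 * Cexp (rate z * t)) * robin_jet gamma0 gamma1 init_jet 0 0 z x 0))%C).
  apply Dc_mult; [apply Dc_const|]. apply Dc_mult; [|exact (D_init_robin x Hx)]. apply Dc_mult; [apply Dc_const|exact (D_expt t)].
- destruct (source_time x t Hx Ht) as (B & Lp). apply (duh_fubini (fun z r => source 0 0 z x r) t Ht B Lp).
  intros r Hr. apply D_source; lra.
Qed.

Lemma D_density : forall n m x t, 0 <= x -> 0 <= t -> D (fun z => density n m z x t).
Proof.
destruct (BLF_contour K HKs) as (Lam & HL). apply (tame_blf_D D L Lam HL density tame_density D_density0).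
Qed.

Lemma tame_sol_jet : tame plain sol_jet.
Proof.
destruct (BLF_contour K HKs) as (Lam & HL). apply tame_plus.
- apply (tame_sep (fun n _ x => du0 n x) (fun m _ t => RtoC (- b) ^ m * Cexp (RtoC (- b) * t))%C).
  + apply (Schwartz_jets u0 du0 Hu).
  + apply (time_jets plain (fun _ => RtoC (- b))). apply coef_const.
- apply (tame_blf D L Lam HL density tame_density D_density0).
Qed.

(** ** The representation formula *)

Lemma hat_ext : forall (g h : R -> C) c (lam : C), Dh g -> dec3 c g -> Im lam <= 0 -> (forall y, 0 < y -> h y = g y) -> hat h lam = hat g lam.
Proof.
intros g h c lam Hgd Hd Hl He. unfold hat. apply (half_ext (c * 1)).
- apply Dc_mult; [|exact Hgd]. apply (Dc_of_cont (fun y : R => Cexp (- (Ci * lam * y)))); [apply Rmax0_lip|]. intros r.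
  apply (cont_ext (fun y : R => Cexp (- (Ci * lam) * y))); [intros; f_equal; ring|]. apply cont_Cexp_lin.
- intros y Hy. rewrite Cmult_comm. apply (dec_mult c 1 g (fun y => Cexp (- (Ci * lam * y)))); [apply dec3_dec, Hd| |exact Hy].
  intros v Hv. rewrite Cmod_Cexp. apply exp_le_1. simpl. unfold Im in Hl. nra.
- intros y Hy. rewrite He by exact Hy. reflexivity.
Qed.

Lemma hat_resol : forall (g : R -> C) c z, Dh g -> dec3 c g -> P z -> hat g (- z) = resol g 0 z.
Proof.
intros g c z Hgd Hd Hz0. rewrite (resol_0 alpha gamma0 gamma1 K HK g c z Hgd Hd Hz0). unfold hat. f_equal. apply functional_extensionality.
intros y. rewrite Rplus_0_l. do 2 f_equal. ring.
Qed.

Lemma hat_minus : forall (g h : R -> C) c (mu : R), Dh g -> Dh h -> dec3 c g -> dec3 c h ->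
  (hat g mu - hat h mu)%C = hat (fun y => g y - h y)%C mu.
Proof.
intros g h c mu Hgd Hhd Hd Hd'.
assert (HE : Dh (fun y : R => Cexp (- (Ci * mu * y)))).
{ apply (Dc_of_cont (fun y : R => Cexp (- (Ci * mu * y)))); [apply Rmax0_lip|]. intros r.
  apply (cont_ext (fun y : R => Cexp (- (Ci * mu) * y))); [intros; f_equal; ring|]. apply cont_Cexp_lin. }
assert (Hdd : forall k, dec3 c k -> dec (c * 1) (fun y : R => Cexp (- (Ci * mu * y)) * k y)%C).
{ intros k Hk y Hy. rewrite Cmult_comm. apply (dec_mult c 1 k (fun y => Cexp (- (Ci * mu * y)))); [apply dec3_dec, Hk| |exact Hy].
  intros v Hv. rewrite Cmod_Cexp. apply exp_le_1. simpl. lra. }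
assert (X1 := Dc_mult _ _ _ HE Hgd). assert (X2 := Dc_mult _ _ _ HE Hhd).
unfold hat. transitivity (CRInt_halfline (fun y : R => Cexp (- (Ci * mu * y)) * g y) + CRInt_halfline (fun y : R => - (1) * (Cexp (- (Ci * mu * y)) * h y)))%C.
- rewrite (half_scal (c * 1)) by (try exact X2; apply Hdd, Hd'). ring.
- rewrite <- (half_plus (c * 1) (Cmod (- (1)) * (c * 1))).
  + f_equal. apply functional_extensionality. intros y. ring.
  + exact X1.
  + apply Dc_mult; [apply Dc_const|exact X2].
  + apply Hdd, Hd.
  + intros y Hy. rewrite Cmod_mult. unfold Rdiv. rewrite Rmult_assoc. apply Rmult_le_compat_l; [apply Cmod_ge_0|]. apply (Hdd h Hd' y Hy).
Qed.

Lemma omega_even : forall z, omega alpha beta (- z) = omega alpha beta z.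
Proof. intros z. unfold omega. replace (- z * - z)%C with (z * z)%C by ring. reflexivity. Qed.

Lemma den_R : forall mu : R, den alpha mu = RtoC (1 + alpha * (mu * mu)).
Proof. intros mu. unfold den. rewrite RtoC_plus, !RtoC_mult. reflexivity. Qed.

Lemma den_R_ge : forall mu : R, 1 <= 1 + alpha * (mu * mu).
Proof. intros mu. assert (0 <= alpha * (mu * mu)) by (apply Rmult_le_pos; [lra|apply Rle_0_sqr]). lra. Qed.

Lemma coef_rate_R : coef (fun _ : R => True) (fun mu : R => rate mu).
Proof.
exists (b + b). assert (Hbp : 0 < b) by (apply Rdiv_lt_0_compat; assumption). split; [lra|]. intros mu _.
assert (Hge := den_R_ge mu). unfold rate. rewrite omega_den by (try lra; apply den_real, Ha). rewrite den_R.
assert (E : (- (beta / alpha - beta / alpha / (1 + alpha * (mu * mu))%R))%C = RtoC (- (b - b / (1 + alpha * (mu * mu))))).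
{ unfold b. rewrite RtoC_opp, RtoC_minus, !RtoC_div by lra. reflexivity. }
rewrite E, Cmod_R.
assert (0 <= b / (1 + alpha * (mu * mu)) <= b).
{ split; [apply Rlt_le, Rdiv_lt_0_compat; lra|]. apply Rmult_le_reg_r with (1 + alpha * (mu * mu)); [lra|].
  replace (b / (1 + alpha * (mu * mu)) * (1 + alpha * (mu * mu))) with b by (field; lra). nra. }
apply Rabs_le. lra.
Qed.

Lemma coef_dinv_R : forall mu : R, Cmod (/ den alpha mu)%C <= 1.
Proof.
intros mu. assert (Hge := den_R_ge mu). rewrite den_R, <- RtoC_inv by lra. rewrite Cmod_R, Rabs_pos_eq by (left; apply Rinv_0_lt_compat; lra).
rewrite <- Rinv_1 at 2. apply Rinv_le_contravar; lra.
Qed.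

Lemma D_line_exp : forall (r A B : R), Dc (clamp A B) (fun mu : R => Cexp (rate mu * r)).
Proof.
intros r A B. apply Dc_Cexp, Dc_mult; [|apply Dc_const]. unfold rate, omega.
assert (Hi : Dc (clamp A B) (fun mu : R => RtoC mu)).
{ apply Dc_lip with 1; [apply clamp_lip|]. intros. rewrite <- RtoC_minus, Cmod_R. lra. }
apply Dc_opp, Dc_div.
- apply Dc_mult; [apply Dc_const|]. apply Dc_mult; exact Hi.
- apply Dc_plus; [apply Dc_const|]. apply Dc_mult; [apply Dc_const|]. apply Dc_mult; exact Hi.
- intros s. apply (den_real alpha _ Ha).
Qed.

Lemma D_line_dinv : forall (A B : R), Dc (clamp A B) (fun mu : R => / den alpha mu)%C.
Proof.
intros A B. assert (Hi : Dc (clamp A B) (fun mu : R => RtoC mu)).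
{ apply Dc_lip with 1; [apply clamp_lip|]. intros. rewrite <- RtoC_minus, Cmod_R. lra. }
apply Dc_inv.
- apply Dc_plus; [apply Dc_const|]. apply Dc_mult; [apply Dc_const|]. apply Dc_mult; exact Hi.
- intros s. apply (den_real alpha _ Ha).
Qed.

Lemma D_line_hat : forall (g : R -> C) c (x A B : R), Dh g -> dec3 c g -> Dc (clamp A B) (fun mu : R => Cexp (Ci * mu * x) * hat g mu)%C.
Proof.
intros g c x A B Hgd Hd. apply Dc_mult.
- apply (Dc_of_cont (fun mu : R => Cexp (Ci * mu * x))); [apply clamp_lip|]. intros; apply cont_wave.
- apply Dc_lip with c; [apply clamp_lip|]. intros. apply hat_lip; assumption.
Qed.

Lemma inv_sum_small : forall V eps : R, 0 <= V -> 0 < eps -> forall N1, exists N0, 0 < N0 /\ N1 <= N0 /\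
  forall A B, A <= - N0 -> N0 <= B -> V * (/ - A + / B) < eps.
Proof.
intros V eps HV He N1. set (N0 := Rmax N1 (2 * (V + 1) / eps)).
assert (Hq : 0 < 2 * (V + 1) / eps) by (apply Rdiv_lt_0_compat; lra).
assert (H2 := Rmax_r N1 (2 * (V + 1) / eps)). fold N0 in H2. exists N0. split; [lra|]. split; [apply Rmax_l|].
intros A B HA HB. apply Rle_lt_trans with (V * (2 * / N0)).
- apply Rmult_le_compat_l; [exact HV|]. assert (/ - A <= / N0) by (apply Rinv_le_contravar; lra). assert (/ B <= / N0) by (apply Rinv_le_contravar; lra). lra.
- apply Rmult_lt_reg_r with N0; [lra|]. replace (V * (2 * / N0) * N0) with (2 * V) by (field; lra).
  apply Rlt_le_trans with (eps * (2 * (V + 1) / eps)); [|apply Rmult_le_compat_l; lra].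
  replace (eps * (2 * (V + 1) / eps)) with (2 * (V + 1)) by (field; lra). lra.
Qed.

Lemma inv_sum_pos : forall A B : R, A < 0 -> 0 < B -> 0 <= / - A + / B.
Proof. intros A B HA HB. assert (0 < / - A) by (apply Rinv_0_lt_compat; lra). assert (0 < / B) by (apply Rinv_0_lt_compat; lra). lra. Qed.

(** On the real axis [e^{-omega t}] is split into [e^{-bt}], treated by [inversion], and a contour integral of [kern], treated by
    [line_to_contour]. *)
Lemma line_initial : forall x t : R, 0 < x -> 0 <= t ->
  CRInt_line (fun mu : R => hat u0 mu * Cexp (Ci * mu * x - omega alpha beta mu * t))%C =
  (2 * PI * (Cexp (RtoC (- b) * t) * u_init x) + L (fun z => Cexp (rate z * t) * resol u_init x z))%C.
Proof.
intros x t Hx Ht. destruct u_nice as (c & Hn). assert (Hgd := nice_Dh _ _ _ Hn). assert (Hd := nice_dec _ _ _ Hn). fold u_init in Hgd, Hd.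
destruct (inversion _ _ c x Hn Hx) as (V & HV). fold u_init in HV.
destruct (line_to_contour K HKs (on_Im_pos _ _ _ _ HK)) as (Cst & N1 & HN1 & HCst & HL).
destruct (Dc_coef K _ (D_expt t)) as (Mw & HMw & Bw).
destruct (HL u_init c (fun z => Cexp (rate z * t)) Mw x Hgd Hd (D_expt t) HMw Bw) as (_ & HLC). clear HL.
assert (Hc := dec3_pos _ _ Hd).
set (e := Cexp (RtoC (- b) * t)).
assert (He : Cmod e <= 1).
{ unfold e. rewrite Cmod_Cexp. apply exp_le_1. assert (Hbp : 0 < b) by (apply Rdiv_lt_0_compat; assumption). simpl. nra. }
assert (EH : forall mu : R, (hat u0 mu * Cexp (Ci * mu * x - omega alpha beta mu * t))%C =
   (e * (Cexp (Ci * mu * x) * hat u_init mu) + / (2 * PI) * (Cexp (Ci * mu * x) * hat u_init mu * L (fun z => Cexp (rate z * t) * kern z mu)))%C).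
{ intros mu. rewrite (hat_ext u_init u0 c mu Hgd Hd); [|simpl; lra|].
  2: { intros y Hy. destruct Hu as ((E0 & _) & _). symmetry. apply E0. unfold nonneg. lra. }
  replace (L (fun z => Cexp (rate z * t) * kern z mu)%C) with (2 * PI * (Cexp (- (omega alpha beta mu * t)) - e))%C.
  - unfold Cminus at 1. rewrite Cexp_add. field. apply RtoC_neq_0, PI_neq0.
  - symmetry. replace e with (Cexp (- (beta / alpha * t))%R).
    + rewrite <- (L_multiplier alpha beta gamma0 gamma1 K Ha Hb HK t mu Ht). unfold L. f_equal. apply functional_extensionality. intros z.
      do 2 f_equal. unfold rate. ring.
    + unfold e, b. f_equal. rewrite <- RtoC_mult. f_equal. ring. }
assert (HG1 : forall A B : R, A <= B -> exC (fun mu : R => Cexp (Ci * mu * x) * hat u_init mu)%C A B).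
{ intros A B HAB. apply exC_Dc; [exact HAB|]. apply (D_line_hat u_init c); assumption. }
assert (HG2 : forall A B : R, A <= B -> exC (fun mu : R => Cexp (Ci * mu * x) * hat u_init mu * L (fun z => Cexp (rate z * t) * kern z mu))%C A B).
{ intros A B HAB. apply exC_Dc; [exact HAB|]. apply Dc_mult; [apply (D_line_hat u_init c); assumption|].
  assert (X : Dc (clamp A B) (fun mu : R => 2 * PI * (Cexp (rate mu * t) - e))%C).
  { apply Dc_mult; [apply Dc_const|]. apply Dc_minus; [apply D_line_exp|apply Dc_const]. }
  replace (fun mu : R => L (fun z => Cexp (rate z * t) * kern z mu)%C) with (fun mu : R => 2 * PI * (Cexp (rate mu * t) - e))%C; [exact X|].
  apply functional_extensionality. intros mu. symmetry. replace e with (Cexp (- (beta / alpha * t))%R).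
    + replace (rate mu * t)%C with (- (omega alpha beta mu * t))%C by (unfold rate; ring).
      rewrite <- (L_multiplier alpha beta gamma0 gamma1 K Ha Hb HK t mu Ht). unfold L. f_equal. apply functional_extensionality. intros z.
      do 2 f_equal. unfold rate. ring.
    + unfold e, b. f_equal. rewrite <- RtoC_mult. f_equal. ring. }
replace (fun mu : R => hat u0 mu * Cexp (Ci * mu * x - omega alpha beta mu * t))%C with
  (fun mu : R => e * (Cexp (Ci * mu * x) * hat u_init mu) + / (2 * PI) * (Cexp (Ci * mu * x) * hat u_init mu * L (fun z => Cexp (rate z * t) * kern z mu)))%C
  by (apply functional_extensionality; intros; symmetry; apply EH).
assert (Hpi : 0 < 2 * PI) by (generalize PI_RGT_0; lra).
apply CRInt_line_intro.
- intros A B HAB. apply exC_plus; apply exC_scal; [apply HG1|apply HG2]; exact HAB.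
- intros eps Heps. destruct (inv_sum_small (Rabs V + Cst * c * Mw) eps) with (N1 := N1) as (N0 & HN0 & HN01 & Hsm).
  + assert (0 <= Cst * c * Mw) by (repeat apply Rmult_le_pos; assumption). generalize (Rabs_pos V). lra.
  + exact Heps.
  + exists N0. split; [exact HN0|]. intros A B HA HB. eapply Rle_lt_trans; [|apply (Hsm A B HA HB)].
    assert (X1 := HG1 A B ltac:(lra)). assert (X2 := HG2 A B ltac:(lra)).
    rewrite (CRInt_plus _ _ A B (exC_scal _ _ A B X1) (exC_scal _ _ A B X2)), (CRInt_scal _ _ A B X1), (CRInt_scal _ _ A B X2).
    assert (B1 := HV A B ltac:(lra) ltac:(lra)). assert (B2 := HLC A B ltac:(lra) ltac:(lra)).
    assert (Hs := inv_sum_pos A B ltac:(lra) ltac:(lra)).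
    set (i1 := CRInt (fun mu : R => Cexp (Ci * mu * x) * hat u_init mu)%C A B) in *.
    set (i2 := CRInt (fun mu : R => Cexp (Ci * mu * x) * hat u_init mu * L (fun z => Cexp (rate z * t) * kern z mu))%C A B) in *.
    change (contour_int K) with L in B2. fold i2 in B2. set (l := L (fun z => Cexp (rate z * t) * resol u_init x z)%C) in *.
    replace (e * i1 + / (2 * PI) * i2 - (2 * PI * (e * u_init x) + l))%C with (e * (i1 - 2 * PI * u_init x) + / (2 * PI) * (i2 - 2 * PI * l))%C
      by (field; apply RtoC_neq_0, PI_neq0).
    eapply Rle_trans; [apply Cmod_triangle|]. rewrite !Cmod_mult, Rmult_plus_distr_r. apply Rplus_le_compat.
    * apply Rle_trans with (1 * (V * (/ - A + / B))); [apply Rmult_le_compat; try apply Cmod_ge_0; assumption|].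
      rewrite Rmult_1_l. apply Rmult_le_compat_r; [exact Hs|apply Rle_abs].
    * apply Rle_trans with (1 * (Cst * c * Mw * (/ - A + / B))); [|lra]. apply Rmult_le_compat; try apply Cmod_ge_0; [|exact B2].
      rewrite <- RtoC_mult, <- RtoC_inv by lra. rewrite Cmod_R, Rabs_pos_eq by (left; apply Rinv_0_lt_compat; exact Hpi).
      rewrite <- Rinv_1. apply Rinv_le_contravar; [lra|]. generalize PI2_3_2. lra.
Qed.

Lemma hat_time : forall T, 0 < T -> exists c, 0 <= c /\ (forall r, 0 <= r <= T -> dec3 c (f_at r)) /\
  (forall r (mu : R), 0 <= r <= T -> Cmod (hat (f_at r) mu) <= c) /\
  (forall r r' (mu : R), 0 <= r <= T -> 0 <= r' <= T -> Cmod (hat (f_at r) mu - hat (f_at r') mu)%C <= c * Rabs (r - r')).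
Proof.
intros T HT. destruct (f_dec T HT) as (c1 & Hc1 & H1). destruct (f_dec_lip T HT) as (c2 & Hc2 & H2).
assert (Hw : forall r, 0 <= r <= T -> dec3 (c1 + c2) (f_at r)).
{ intros r Hr y Hy. eapply Rle_trans; [apply (H1 r Hr y Hy)|]. apply Rmult_le_compat_r; [|lra]. left. apply Rinv_0_lt_compat, pow_lt. lra. }
exists (c1 + c2). split; [lra|]. split; [exact Hw|]. split.
- intros r mu Hr. apply hat_bound; [apply f_Dh, Hr|apply Hw, Hr].
- intros r r' mu Hr Hr'. rewrite (hat_minus (f_at r) (f_at r') (c1 + c2)); [|apply f_Dh; lra|apply f_Dh; lra|apply Hw; lra|apply Hw; lra].
  apply Rle_trans with (c2 * Rabs (r - r')).
  + apply hat_bound; [|apply H2; assumption]. apply Dc_minus; apply f_Dh; lra.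
  + apply Rmult_le_compat_r; [apply Rabs_pos|lra].
Qed.

Lemma hat_f : forall r (lam : C), 0 <= r -> Im lam <= 0 -> hat (fun y => f y r) lam = hat (f_at r) lam.
Proof.
intros r lam Hr Hl. destruct (f_dec (r + 1) ltac:(lra)) as (c & Hc & Hd). apply (hat_ext (f_at r) (fun y => f y r) c).
- apply f_Dh, Hr.
- apply Hd. lra.
- exact Hl.
- intros y Hy. destruct Hf as (E0 & _). symmetry. apply E0. split; simpl; lra.
Qed.

(** At each time the line integral is moved to the contour, with a truncation error that is uniform in time; the order of the
    integrations in [mu], in time and along the contour is then exchanged twice. *)
Lemma line_forcing : forall x t : R, 0 < x -> 0 <= t ->
  CRInt_line (fun mu : R => Cexp (Ci * mu * x - omega alpha beta mu * t) / den alpha mu * Fhat alpha beta f mu t)%C =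
  L (fun z => duh (rate z) (fun r => / den alpha z * resol (f_at r) x z)%C t).
Proof.
intros x t Hx Ht. destruct (hat_time (t + 1) ltac:(lra)) as (c & Hc & Hd & Hhb & Hhl).
destruct (line_to_contour K HKs (on_Im_pos _ _ _ _ HK)) as (Cst & N1 & HN1 & HCst & HL).
assert (Ddi := D_dinv alpha gamma0 gamma1 K Ha HK).
destruct (Dc_coef K _ Ddi) as (Mi & HMi & Bi).
destruct (exp_coef P rate coef_rate t Ht) as (Me & HMe & Be & _).
destruct (exp_coef (fun _ : R => True) (fun mu : R => rate mu) coef_rate_R t Ht) as (Mr & HMr & Br & Lr).
set (k := fun mu : R => (Cexp (Ci * mu * x) * / den alpha mu)%C).
set (G := fun (mu r : R) => (Cexp (rate mu * (t - r)%R) * (k mu * hat (f_at r) mu))%C).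
assert (Hk : forall mu, Cmod (k mu) <= 1).
{ intros mu. unfold k. rewrite Cmod_mult, <- (Rmult_1_r 1). apply Rmult_le_compat; try apply Cmod_ge_0; [|apply coef_dinv_R].
  rewrite Cmod_Cexp. apply exp_le_1. simpl. lra. }
assert (HhD : forall mu : R, Dc (clamp 0 t) (fun r => hat (f_at r) mu)).
{ intros mu. apply Dc_clamp_lip with c; [exact Ht|]. intros; apply Hhl; lra. }
assert (EH : forall mu : R, (Cexp (Ci * mu * x - omega alpha beta mu * t) / den alpha mu * Fhat alpha beta f mu t)%C = CRInt (G mu) 0 t).
{ intros mu. transitivity (k mu * duh (rate mu) (fun r => hat (f_at r) mu) t)%C.
  - unfold rate. rewrite <- exp_integral_duh by (try exact Ht; apply HhD).
    replace (Fhat alpha beta f mu t) with (CRInt (fun tau : R => Cexp (omega alpha beta mu * tau) * hat (f_at tau) mu)%C 0 t).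
    + unfold k, Cminus. rewrite Cexp_add. unfold Cdiv. ring.
    + unfold Fhat. apply CRInt_ext; [exact Ht|]. intros r Hr. rewrite (hat_f r mu) by (simpl; lra). reflexivity.
  - symmetry. apply (duh_scal (rate mu) (fun r => hat (f_at r) mu) (k mu) t Ht (HhD mu)). }
assert (HGl : forall mu (y y' : R), 0 <= y <= t -> 0 <= y' <= t -> Cmod (G mu y - G mu y')%C <= (Mr * c + Mr * c) * Rabs (y - y')).
{ intros mu y y' Hy Hy'. unfold G.
  replace (Cexp (rate mu * (t - y)%R) * (k mu * hat (f_at y) mu) - Cexp (rate mu * (t - y')%R) * (k mu * hat (f_at y') mu))%C with
   (k mu * ((Cexp (rate mu * (t - y)%R) - Cexp (rate mu * (t - y')%R)) * hat (f_at y) mu + Cexp (rate mu * (t - y')%R) * (hat (f_at y) mu - hat (f_at y') mu)))%C by ring.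
  rewrite Cmod_mult, <- (Rmult_1_l ((Mr * c + Mr * c) * _)). apply Rmult_le_compat; try apply Cmod_ge_0; [apply Hk|].
  eapply Rle_trans; [apply Cmod_triangle|]. rewrite !Cmod_mult, Rmult_plus_distr_r. apply Rplus_le_compat.
  - replace (Mr * c * Rabs (y - y')) with (Mr * Rabs (y - y') * c) by ring. apply Rmult_le_compat; try apply Cmod_ge_0; [apply (Lr mu y y' Logic.I Hy Hy')|apply Hhb; lra].
  - rewrite Rmult_assoc. apply Rmult_le_compat; try apply Cmod_ge_0; [apply (Br mu y' Logic.I Hy')|apply Hhl; lra]. }
assert (HGD : forall (A B : R) r, 0 <= r <= t -> Dc (clamp A B) (fun mu => G mu r)).
{ intros A B r Hr. replace (fun mu => G mu r) with (fun mu : R => Cexp (rate mu * (t - r)%R) * (/ den alpha mu * (Cexp (Ci * mu * x) * hat (f_at r) mu)))%C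
    by (apply functional_extensionality; intros mu; unfold G, k; ring).
  apply Dc_mult; [apply D_line_exp|]. apply Dc_mult; [apply D_line_dinv|]. apply (D_line_hat (f_at r) c); [apply f_Dh; lra|apply Hd; lra]. }
set (FR := fun (z : C) (r : R) => (/ den alpha z * resol (f_at r) x z)%C).
destruct (fres_time x t ltac:(lra) Ht) as (FB & (ML & HML & FL)).
destruct (duh_fubini FR t Ht) as (_ & EF & DF).
{ apply bdd_scal; [exists Mi; split; [exact HMi|exact Bi]|exact FB]. }
{ exists (Mi * ML). split; [apply Rmult_le_pos; assumption|]. intros z y y' Hz0 Hy Hy'. unfold FR.
  replace (/ den alpha z * resol (f_at y) x z - / den alpha z * resol (f_at y') x z)%C with (/ den alpha z * (resol (f_at y) x z - resol (f_at y') x z))%C by ring.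
  rewrite Cmod_mult, Rmult_assoc. apply Rmult_le_compat; try apply Cmod_ge_0; [apply Bi, Hz0|apply FL; assumption]. }
{ intros r Hr. apply Dc_mult; [exact Ddi|]. apply (D_resol1 (f_at r) c); [apply f_Dh; lra|apply Hd; lra]. }
fold L in EF, DF.
assert (Hpt : forall A B r : R, A <= - N1 -> N1 <= B -> 0 <= r <= t ->
  Cmod (CRInt (fun mu => G mu r) A B - L (fun z => Cexp (rate z * (t - r)%R) * FR z r))%C <= Cst * c * (Me * Mi) * (/ - A + / B)).
{ intros A B r HA HB Hr.
  destruct (HL (f_at r) c (fun z => Cexp (rate z * (t - r)%R) * / den alpha z)%C (Me * Mi) x) as (HD1 & HB1).
  - apply f_Dh; lra.
  - apply Hd; lra.
  - apply Dc_mult; [exact (D_expt (t - r))|exact Ddi].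
  - apply Rmult_le_pos; assumption.
  - intros z Hz0. rewrite Cmod_mult. apply Rmult_le_compat; try apply Cmod_ge_0; [apply Be; assumption|apply Bi, Hz0].
  - specialize (HB1 A B HA HB). fold L in HB1.
    assert (E1 : CRInt (fun mu : R => Cexp (Ci * mu * x) * hat (f_at r) mu * L (fun z => Cexp (rate z * (t - r)%R) * / den alpha z * kern z mu))%C A B
       = (2 * PI * CRInt (fun mu => G mu r) A B)%C).
    { rewrite <- CRInt_scal by (apply exC_Dc; [lra|apply HGD, Hr]). f_equal. apply functional_extensionality. intros mu.
      replace (L (fun z => Cexp (rate z * (t - r)%R) * / den alpha z * kern z mu)%C) with (2 * PI * (Cexp (- (omega alpha beta mu * (t - r)%R)) / den alpha mu))%C.
      - unfold G, k, rate, Cdiv. replace (- omega alpha beta mu * (t - r)%R)%C with (- (omega alpha beta mu * (t - r)%R))%C by ring. ring.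
      - rewrite <- (L_multiplier_den alpha beta gamma0 gamma1 K Ha Hb HK (t - r) mu) by lra. unfold L. f_equal. apply functional_extensionality. intros z.
        unfold rate, Cdiv. replace (- omega alpha beta z * (t - r)%R)%C with (- (omega alpha beta z * (t - r)%R))%C by ring. reflexivity. }
    rewrite E1 in HB1.
    replace (fun z => Cexp (rate z * (t - r)%R) * / den alpha z * resol (f_at r) x z)%C with (fun z => Cexp (rate z * (t - r)%R) * FR z r)%C in HB1
      by (apply functional_extensionality; intros z; unfold FR; ring).
    set (i1 := CRInt (fun mu => G mu r) A B) in *. set (l := L (fun z => Cexp (rate z * (t - r)%R) * FR z r)%C) in *.
    replace (2 * PI * i1 - 2 * PI * l)%C with (RtoC (2 * PI) * (i1 - l))%C in HB1 by (rewrite RtoC_mult; ring).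
    assert (Hpi : 1 <= 2 * PI) by (generalize PI2_3_2; lra).
    rewrite Cmod_mult, Cmod_R, Rabs_pos_eq in HB1 by lra. eapply Rle_trans; [|exact HB1]. assert (Hp := Cmod_ge_0 (i1 - l)%C). nra. }
replace (fun mu : R => Cexp (Ci * mu * x - omega alpha beta mu * t) / den alpha mu * Fhat alpha beta f mu t)%C with (fun mu : R => CRInt (G mu) 0 t)
  by (apply functional_extensionality; intros; symmetry; apply EH).
change (L (fun z => duh (rate z) (fun r => / den alpha z * resol (f_at r) x z)%C t)) with (L (fun z => duh (rate z) (FR z) t)). rewrite EF.
assert (Hint : forall A B : R, A <= B -> Dc (clamp A B) (fun mu => CRInt (G mu) 0 t) /\
   CRInt (fun mu => CRInt (G mu) 0 t) A B = CRInt (fun r => CRInt (fun mu => G mu r) A B) 0 t /\ Dc (clamp 0 t) (fun r => CRInt (fun mu => G mu r) A B)).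
{ intros A B HAB. assert (HBL := BLF_RInt A B HAB).
  destruct (blf_int HBL G (Mr * c + Mr * c) 0 t Ht (fun mu _ => HGl mu) (HGD A B)) as [D1 E1]. split; [exact D1|split; [exact E1|]].
  exact (blf_param_cont HBL G (Mr * c + Mr * c) 0 t Ht (fun mu _ => HGl mu) (HGD A B)). }
apply CRInt_line_intro.
- intros A B HAB. apply exC_Dc; [exact HAB|]. apply (Hint A B HAB).
- intros eps Heps. destruct (inv_sum_small (t * (Cst * c * (Me * Mi))) eps) with (N1 := N1) as (N0 & HN0 & HN01 & Hsm).
  + repeat apply Rmult_le_pos; assumption.
  + exact Heps.
  + exists N0. split; [exact HN0|]. intros A B HA HB. destruct (Hint A B ltac:(lra)) as (_ & E1 & D1). rewrite E1.
    eapply Rle_lt_trans; [|apply (Hsm A B HA HB)].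
    replace (t * (Cst * c * (Me * Mi)) * (/ - A + / B)) with ((t - 0) * (Cst * c * (Me * Mi) * (/ - A + / B))) by ring.
    apply (blf_minus_bound (BLF_RInt 0 t Ht)); [exact D1|exact DF|]. intros r Hr. apply Hpt; [lra|lra|exact Hr].
Qed.

Lemma zeta_D : forall t, 0 <= t -> Dc (clamp 0 t) (dzeta 0%nat).
Proof.
intros t Ht. destruct (zeta_jets (t + 1) ltac:(lra) 0%nat) as (B0 & T0). destruct (zeta_jets (t + 1) ltac:(lra) 1%nat) as (B1 & _).
destruct (tay_lip P (segR (t + 1)) _ _ B0 B1 T0) as (M & HM & HL). assert (Hz0 : P (Kc K 0)) by apply Kc_on.
apply Dc_clamp_lip with M; [exact Ht|]. intros y y' Hy Hy'. apply (HL (Kc K 0)); [exact Hz0|lra|lra].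
Qed.

Lemma fres_D : forall x t z, 0 <= x -> 0 <= t -> P z -> Dc (clamp 0 t) (fun r => resol (f_at r) x z).
Proof.
intros x t z Hx Ht Hz0. destruct (fres_time x t Hx Ht) as (_ & (M & HM & HL)).
apply Dc_clamp_lip with M; [exact Ht|]. intros; apply HL; assumption.
Qed.

Lemma duh_source : forall x t z, 0 <= x -> 0 <= t -> P z ->
  duh (rate z) (fun r => source 0 0 z x r) t =
  (/ (2 * PI) * (/ den alpha z * duh (rate z) (fun r => resol (f_at r) x z) t)
   + (- / (2 * PI) * (refl gamma0 gamma1 z * Cexp (Ci * z * x) * (/ den alpha z * duh (rate z) (fun r => resol (f_at r) 0 z) t))
      + wall_coef z * Cexp (Ci * z * x) * duh (rate z) (dzeta 0%nat) t))%C.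
Proof.
intros x t z Hx Ht Hz0.
assert (X1 := fres_D x t z Hx Ht Hz0). assert (X2 := fres_D 0 t z (Rle_refl 0) Ht Hz0). assert (X3 := zeta_D t Ht).
transitivity (duh (rate z) (fun r => / (2 * PI) * / den alpha z * resol (f_at r) x z +
   ((- / (2 * PI) * (refl gamma0 gamma1 z * Cexp (Ci * z * x)) * / den alpha z) * resol (f_at r) 0 z + wall_coef z * Cexp (Ci * z * x) * dzeta 0%nat r))%C t).
- apply duh_ext; [exact Ht|]. intros r Hr. unfold source.
  destruct (f_dec (r + 1) ltac:(lra)) as (c & Hc & Hd).
  rewrite (robin_jet_resol force_jet (f_at r) c z x r); [|apply f_Dh; lra|apply Hd; lra|reflexivity|exact Hz0|exact Hx].
  unfold iz. cbn [Cpow]. ring.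
- rewrite (duh_lin (rate z) (fun r => resol (f_at r) x z)); [|exact Ht|exact X1|].
  + rewrite (duh_lin (rate z) (fun r => resol (f_at r) 0 z)); [|exact Ht|exact X2|].
    * rewrite (duh_scal (rate z) (dzeta 0%nat)); [ring|exact Ht|exact X3].
    * apply Dc_mult; [apply Dc_const|exact X3].
  + apply Dc_plus; [apply Dc_mult; [apply Dc_const|exact X2]|apply Dc_mult; [apply Dc_const|exact X3]].
Qed.

Lemma Fhat_resol : forall z t, 0 <= t -> P z ->
  (Cexp (- (omega alpha beta z * t)) * Fhat alpha beta f (- z) t)%C = duh (rate z) (fun r => resol (f_at r) 0 z) t.
Proof.
intros z t Ht Hz0. unfold rate. rewrite <- (exp_integral_duh (omega alpha beta z) (fun r => resol (f_at r) 0 z) t Ht (fres_D 0 t z (Rle_refl 0) Ht Hz0)).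
apply (f_equal (Cmult (Cexp (- (omega alpha beta z * t))))). unfold Fhat.
apply CRInt_ext; [exact Ht|]. intros r Hr. rewrite omega_even. apply (f_equal (Cmult (Cexp (omega alpha beta z * r)))).
assert (Hi := on_Im_pos _ _ _ _ HK z Hz0). destruct (f_dec (r + 1) ltac:(lra)) as (c & Hc & Hd).
rewrite (hat_f r (- z)) by (try lra; simpl; unfold Im in Hi; lra). apply (hat_resol (f_at r) c); [apply f_Dh; lra|apply Hd; lra|exact Hz0].
Qed.

Lemma zeta_duh : forall z t, 0 <= t -> (Cexp (- (omega alpha beta z * t)) * zeta_tilde alpha beta zeta z t)%C = duh (rate z) (dzeta 0%nat) t.
Proof.
intros z t Ht. unfold rate. rewrite <- (exp_integral_duh (omega alpha beta z) (dzeta 0%nat) t Ht (zeta_D t Ht)).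
apply (f_equal (Cmult (Cexp (- (omega alpha beta z * t))))). unfold zeta_tilde.
apply CRInt_ext; [exact Ht|]. intros r Hr. destruct Hz as (E0 & _). rewrite E0 by (unfold nonneg; lra). reflexivity.
Qed.

Lemma D_zeta_duh : forall t, 0 <= t -> D (fun z => duh (rate z) (dzeta 0%nat) t).
Proof.
intros t Ht. destruct (zeta_jets (t + 1) ltac:(lra) 0%nat) as (B0 & T0). destruct (zeta_jets (t + 1) ltac:(lra) 1%nat) as (B1 & _).
destruct (tay_lip P (segR (t + 1)) _ _ B0 B1 T0) as (M & HM & HLp). destruct B0 as (M0 & HM0 & B0).
apply (duh_fubini (fun _ => dzeta 0%nat) t Ht).
- exists M0. split; [exact HM0|]. intros z y Hz0 Hy. apply (B0 z); [exact Hz0|lra].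
- exists M. split; [exact HM|]. intros z y y' Hz0 Hy Hy'. apply (HLp z); [exact Hz0|lra|lra].
- intros r _. apply Dc_const.
Qed.

Lemma D_fres_duh : forall x t, 0 <= x -> 0 <= t -> D (fun z => duh (rate z) (fun r => resol (f_at r) x z) t).
Proof.
intros x t Hx Ht. destruct (fres_time x t Hx Ht) as (FB & FL). destruct (f_dec (t + 1) ltac:(lra)) as (c & Hc & Hd).
apply (duh_fubini (fun z r => resol (f_at r) x z) t Ht FB FL). intros r Hr. apply (D_resol1 (f_at r) c); [apply f_Dh; lra|apply Hd; lra].
Qed.

(** Term by term: the two line integrals are known, and the three contour integrals are rewritten pointwise, using that [omega] is
    even and that [hat g (- z)] is the resolvent of [g] at the wall. *)
Lemma sol_is_jet : forall x t : R, 0 < x -> 0 <= t -> sol alpha beta gamma0 gamma1 u0 zeta f K x t = sol_jet 0 0 tt x t.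
Proof.
intros x t Hx Ht. destruct (BLF_contour K HKs) as (Lam & HL). fold L in HL. fold P in HL. change (Dc (Kc K)) with D in HL.
destruct u_dec as (c & Hd). assert (Hgd := u_Dh).
assert (Ddi := D_dinv alpha gamma0 gamma1 K Ha HK). fold D in Ddi.
set (A1 := fun z => (Cexp (rate z * t) * resol u_init x z)%C).
set (A2 := fun z => (refl gamma0 gamma1 z * (resol u_init 0 z * Cexp (Ci * z * x)) * Cexp (rate z * t))%C).
set (A3 := fun z => (wall_coef z * Cexp (Ci * z * x) * duh (rate z) (dzeta 0%nat) t)%C).
set (A4 := fun z => (/ den alpha z * duh (rate z) (fun r => resol (f_at r) x z) t)%C).
set (A5 := fun z => (refl gamma0 gamma1 z * Cexp (Ci * z * x) * (/ den alpha z * duh (rate z) (fun r => resol (f_at r) 0 z) t))%C).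
assert (D1 : D A1) by (apply Dc_mult; [exact (D_expt t)|exact (D_resol1 u_init c x Hgd Hd)]).
assert (D2 : D A2).
{ apply Dc_mult; [|exact (D_expt t)]. apply Dc_mult; [exact D_reflection|]. apply Dc_mult; [exact (D_resol1 u_init c 0 Hgd Hd)|exact (D_wave x)]. }
assert (D3 : D A3).
{ apply Dc_mult; [|exact (D_zeta_duh t Ht)]. apply Dc_mult; [exact D_wall_coef|exact (D_wave x)]. }
assert (D4 : D A4) by (apply Dc_mult; [exact Ddi|exact (D_fres_duh x t ltac:(lra) Ht)]).
assert (D5 : D A5).
{ apply Dc_mult; [apply Dc_mult; [exact D_reflection|exact (D_wave x)]|]. apply Dc_mult; [exact Ddi|exact (D_fres_duh 0 t (Rle_refl 0) Ht)]. }
set (h := (/ (2 * PI))%C).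
assert (EL : L (fun z => density 0 0 z x t) = (h * L A1 + (- h * L A2 + (L A3 + (h * L A4 + - h * L A5))))%C).
{ assert (S1 := Dc_mult _ _ _ (Dc_const (Kc K) h) D1). assert (S2 := Dc_mult _ _ _ (Dc_const (Kc K) (- h)%C) D2).
  assert (S4 := Dc_mult _ _ _ (Dc_const (Kc K) h) D4). assert (S5 := Dc_mult _ _ _ (Dc_const (Kc K) (- h)%C) D5).
  assert (S45 := Dc_plus _ _ _ S4 S5). assert (S35 := Dc_plus _ _ _ D3 S45). assert (S25 := Dc_plus _ _ _ S2 S35).
  transitivity (L (fun z => h * A1 z + (- h * A2 z + (A3 z + (h * A4 z + - h * A5 z))))%C).
  - apply (blf_ext HL); [exact (D_density0 x t ltac:(lra) Ht)|]. intros z Hz0. unfold density. cbn [duht].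
    rewrite (duh_source x t z) by (try exact Hz0; lra). unfold free_wave. rewrite (init_robin_resol z x Hz0) by lra.
    fold h. unfold A1, A2, A3, A4, A5. cbn [Cpow]. ring.
  - rewrite (blf_plus _ _ _ _ HL _ _ S1 S25), (blf_plus _ _ _ _ HL _ _ S2 S35), (blf_plus _ _ _ _ HL _ _ D3 S45), (blf_plus _ _ _ _ HL _ _ S4 S5).
    rewrite (blf_scal _ _ _ _ HL h A1 D1), (blf_scal _ _ _ _ HL (- h)%C A2 D2), (blf_scal _ _ _ _ HL h A4 D4), (blf_scal _ _ _ _ HL (- h)%C A5 D5). reflexivity. }
assert (Eexp : forall z, Cexp (Ci * z * x - omega alpha beta z * t) = (Cexp (Ci * z * x) * Cexp (- (omega alpha beta z * t)))%C).
{ intros z. unfold Cminus. apply Cexp_add. }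
assert (Eom : forall z, Cexp (- (omega alpha beta z * t)) = Cexp (rate z * t)).
{ intros z. f_equal. unfold rate. ring. }
assert (E1 := line_initial x t Hx Ht). fold A1 in E1.
assert (E4 : CRInt_line (fun mu : R => Cexp (Ci * mu * x - omega alpha beta mu * t) / den alpha mu * Fhat alpha beta f mu t)%C = L A4).
{ rewrite (line_forcing x t Hx Ht). symmetry. apply (blf_ext HL _ _ D4). intros z Hz0. symmetry. apply (duh_scal (rate z) (fun r => resol (f_at r) x z)); [exact Ht|].
  apply fres_D; [lra|exact Ht|exact Hz0]. }
assert (E2 : contour_int K (fun z => hat u0 (- z) * refl gamma0 gamma1 z * Cexp (Ci * z * x - omega alpha beta z * t))%C = L A2).
{ symmetry. apply (blf_ext HL _ _ D2). intros z Hz0. assert (Hi := on_Im_pos _ _ _ _ HK z Hz0).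
  rewrite (hat_ext u_init u0 c (- z) Hgd Hd), (hat_resol u_init c z Hgd Hd Hz0), Eexp, Eom.
  - unfold A2. ring.
  - simpl. unfold Im in Hi. lra.
  - intros y Hy. destruct Hu as ((E0 & _) & _). symmetry. apply E0. unfold nonneg. lra. }
assert (E3 : (- (Ci / PI) * contour_int K (fun z => Cexp (Ci * z * x - omega alpha beta z * t) / (den alpha z * (Ci * gamma1 * z + gamma0)) * z * zeta_tilde alpha beta zeta z t))%C = L A3).
{ symmetry. set (B3 := fun z => (z / (den alpha z * (gamma0 + Ci * gamma1 * z)) * (Cexp (Ci * z * x) * duh (rate z) (dzeta 0%nat) t))%C).
  assert (DB3 : D B3).
  { apply Dc_mult; [|apply Dc_mult; [exact (D_wave x)|exact (D_zeta_duh t Ht)]]. apply Dc_div; [apply Dc_id, HKs| |].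
    - apply Dc_mult; [apply (D_den alpha gamma0 gamma1 K); assumption|]. apply Dc_plus; [apply Dc_const|apply Dc_mult; [apply Dc_const|apply Dc_id, HKs]].
    - intros r. apply Cmult_neq_0; [apply (on_den alpha gamma0 gamma1 K)|apply (on_robin alpha gamma0 gamma1 K)]; try assumption; apply Kc_on. }
  transitivity (L (fun z => - (Ci / PI) * B3 z)%C).
  - apply (blf_ext HL _ _ D3). intros z _. unfold A3, B3, wall_coef. ring.
  - rewrite (blf_scal _ _ _ _ HL _ _ DB3). f_equal. apply (blf_ext HL _ _ DB3). intros z Hz0. unfold B3. rewrite <- (zeta_duh z t Ht), Eexp.
    rewrite (Cplus_comm (Ci * gamma1 * z)). unfold Cdiv. ring. }
assert (E5 : contour_int K (fun z => Cexp (Ci * z * x - omega alpha beta z * t) / den alpha z * refl gamma0 gamma1 z * Fhat alpha beta f (- z) t)%C = L A5).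
{ symmetry. apply (blf_ext HL _ _ D5). intros z Hz0. unfold A5. rewrite <- (Fhat_resol z t Ht Hz0), Eexp. unfold Cdiv. ring. }
transitivity (h * CRInt_line (fun mu : R => hat u0 mu * Cexp (Ci * mu * x - omega alpha beta mu * t))
  - h * contour_int K (fun z => hat u0 (- z) * refl gamma0 gamma1 z * Cexp (Ci * z * x - omega alpha beta z * t))
  - Ci / PI * contour_int K (fun z => Cexp (Ci * z * x - omega alpha beta z * t) / (den alpha z * (Ci * gamma1 * z + gamma0)) * z * zeta_tilde alpha beta zeta z t)
  + h * CRInt_line (fun mu : R => Cexp (Ci * mu * x - omega alpha beta mu * t) / den alpha mu * Fhat alpha beta f mu t)
  - h * contour_int K (fun z => Cexp (Ci * z * x - omega alpha beta z * t) / den alpha z * refl gamma0 gamma1 z * Fhat alpha beta f (- z) t))%C.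
{ reflexivity. }
rewrite E1, E2, E4, E5. unfold sol_jet. rewrite EL, <- E3. unfold u_init, h. cbn [Cpow]. field. apply RtoC_neq_0, PI_neq0.
Qed.

(** ** Initial and boundary values *)

Lemma u_init_lip : exists M, forall y y', 0 <= y -> 0 <= y' -> Cmod (u_init y - u_init y')%C <= M * Rabs (y - y').
Proof.
destruct (Schwartz_jets u0 du0 Hu 0%nat) as (B0 & T0). destruct (Schwartz_jets u0 du0 Hu 1%nat) as (B1 & _).
destruct (tay_lip plain (fun y => 0 <= y) _ _ B0 B1 T0) as (M & HM & HL). exists M. intros y y' Hy Hy'. apply (HL tt y y' Logic.I Hy Hy').
Qed.

(** The resolvent superposes the waves [e^{iz|x-y|}], and its reflection the waves [e^{iz(x+y)}] times the reflection coefficient. *)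
Lemma L_init_robin : forall x, 0 <= x -> L (fun z => robin_jet gamma0 gamma1 init_jet 0 0 z x 0) = 0%C.
Proof.
intros x Hx. destruct (BLF_contour K HKs) as (Lam & HL). fold L in HL. fold P in HL. change (Dc (Kc K)) with D in HL.
destruct u_dec as (c & Hd). assert (Hgd := u_Dh). destruct u_init_lip as (M1 & HM1).
assert (Hri : forall w y y', Rabs (w + Rabs (0 - y) - (w + Rabs (0 - y'))) <= Rabs (y - y')).
{ intros w y y'. replace (w + Rabs (0 - y) - (w + Rabs (0 - y'))) with (Rabs y - Rabs y').
  - apply Rabs_triang_inv2.
  - rewrite !Rminus_0_l, !Rabs_Ropp. ring. }
assert (DA := D_resol1 u_init c x Hgd Hd).
assert (DB := Dc_mult _ _ _ D_reflection (Dc_mult _ _ _ (D_resol1 u_init c 0 Hgd Hd) (D_wave x))).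
assert (DA' := Dc_mult _ _ _ (Dc_const (Kc K) 1%C) DA).
assert (EA : L (fun z => 1 * resol u_init x z)%C = 0%C).
{ apply (L_superpose alpha gamma0 gamma1 K HK u_init c M1 (fun _ => 1%C) (fun y => Rabs (x - y)) Hgd Hd HM1 (Dc_const _ _)).
  - intros; apply Rabs_pos.
  - intros y y'. rewrite (Rabs_minus_sym y y'). replace (y' - y) with ((x - y) - (x - y')) by ring. apply Rabs_triang_inv2.
  - intros s Hs. rewrite <- (L_exp alpha gamma0 gamma1 K HK s Hs). unfold L. f_equal. apply functional_extensionality. intros z. ring.
  - exact DA'. }
assert (EW : forall z, P z -> (resol u_init 0 z * Cexp (Ci * z * x))%C = CRInt_halfline (fun y => u_init y * Cexp (Ci * z * (x + Rabs (0 - y))%R))%C).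
{ intros z Hz0. assert (Hi := on_Im_pos _ _ _ _ HK z Hz0). rewrite Cmult_comm. unfold resol. rewrite <- (half_scal (c * 1)).
  - f_equal. apply functional_extensionality. intros y. rewrite RtoC_plus, Cmult_plus_distr_l, Cexp_add. ring.
  - apply Dc_mult; [exact Hgd|]. destruct (Dc_coef K _ (Dc_id K HKs)) as (R0 & HR0 & HR).
    apply Dc_lip with R0; [apply Rmax0_lip|]. intros r r'. eapply Rle_trans; [apply (expabs_lip z R0 Hi (HR z Hz0)); apply Rabs_pos|].
    apply Rmult_le_compat_l; [exact HR0|]. specialize (Hri 0 (Rmax 0 r) (Rmax 0 r')). rewrite !Rplus_0_l in Hri. exact Hri.
  - apply (dec_mult c 1 u_init); [apply dec3_dec, Hd|]. intros y Hy. rewrite Cmod_Cexp. apply exp_le_1.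
    assert (Hp := Rabs_pos (0 - y)). simpl. unfold Im in Hi. nra. }
assert (EB : L (fun z => refl gamma0 gamma1 z * (resol u_init 0 z * Cexp (Ci * z * x)))%C = 0%C).
{ assert (Ex : forall z, P z -> (refl gamma0 gamma1 z * (resol u_init 0 z * Cexp (Ci * z * x)))%C =
    (refl gamma0 gamma1 z * CRInt_halfline (fun y => u_init y * Cexp (Ci * z * (x + Rabs (0 - y))%R)))%C).
  { intros z Hz0. rewrite (EW z Hz0). reflexivity. }
  rewrite (blf_ext HL _ _ DB Ex).
  apply (L_superpose alpha gamma0 gamma1 K HK u_init c M1 (refl gamma0 gamma1) (fun y => x + Rabs (0 - y)) Hgd Hd HM1 D_reflection).
  - intros y. generalize (Rabs_pos (0 - y)). lra.
  - apply Hri.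
  - intros s Hs. apply (L_refl_exp alpha gamma0 gamma1 K Hg HK s Hs).
  - apply (blf_D_ext HL _ _ DB Ex). }
transitivity (L (fun z => 1 * resol u_init x z + - (1) * (refl gamma0 gamma1 z * (resol u_init 0 z * Cexp (Ci * z * x))))%C).
- apply (blf_ext HL); [exact (D_init_robin x Hx)|]. intros z Hz0. rewrite (init_robin_resol z x Hz0 Hx). ring.
- rewrite (blf_plus _ _ _ _ HL _ _ DA' (blf_scal_D _ _ _ _ HL (- (1))%C _ DB)), (blf_scal _ _ _ _ HL _ _ DB), EA, EB. ring.
Qed.

Lemma sol_jet_initial : forall x, 0 <= x -> sol_jet 0 0 tt x 0 = u_init x.
Proof.
intros x Hx. destruct (BLF_contour K HKs) as (Lam & HL). fold L in HL. fold P in HL. change (Dc (Kc K)) with D in HL.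
unfold sol_jet. replace (L (fun z => density 0 0 z x 0)) with (RtoC 0).
- replace (RtoC (- b) * 0%R)%C with (RtoC 0) by ring. rewrite Cexp_0. unfold u_init. cbn [Cpow]. ring.
- symmetry. transitivity (L (fun z => / (2 * PI) * robin_jet gamma0 gamma1 init_jet 0 0 z x 0)%C).
  + apply (blf_ext HL); [exact (D_density0 x 0 Hx (Rle_refl 0))|]. intros z _. unfold density, free_wave. cbn [duht]. unfold duh. rewrite CRInt_point.
    replace (rate z * 0%R)%C with (RtoC 0) by ring. rewrite Cexp_0. cbn [Cpow]. ring.
  + rewrite (blf_scal _ _ _ _ HL _ _ (D_init_robin x Hx)), (L_init_robin x Hx). ring.
Qed.

Lemma du0_deriv : forall n (x : R), 0 < x -> has_deriv (du0 n) x (du0 (S n) x).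
Proof. intros n x Hx. destruct Hu as ((_ & _ & Hd) & _). apply Hd, Hx. Qed.

Lemma sol_jet_initial_jets : forall n x, 0 < x -> sol_jet n 0 tt x 0 = du0 n x.
Proof.
apply (jets_unique (fun n x => sol_jet n 0 tt x 0) du0).
- intros n x Hx. apply (tame_has_deriv_x sol_jet tame_sol_jet); [exact Hx|lra].
- apply du0_deriv.
- intros x Hx. apply sol_jet_initial. lra.
Qed.

(** Only the boundary datum survives the Robin operator at the wall. *)
Lemma source_robin : forall z t, P z -> 0 <= t ->
  (gamma0 * source 0 0 z 0 t + gamma1 * source 1 0 z 0 t)%C = (- (Ci / PI) * (z / den alpha z) * dzeta 0%nat t)%C.
Proof.
intros z t Hz0 Ht.
assert (HB := robin_jet_robin alpha gamma0 gamma1 K Hg HK force_jet tame_force_jet (fun m _ x r _ Hx Hr => tame_has_deriv_x _ (tame_derivs2_data f df Hf Hfb) 0 m x r Hx Hr) 0%nat z t Hz0 Ht).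
assert (H1 := on_den alpha gamma0 gamma1 K Ha HK z Hz0). assert (H2 := on_robin alpha gamma0 gamma1 K Hg HK z Hz0).
unfold source. replace (iz z * 0%R)%C with (RtoC 0) by ring. rewrite Cexp_0. cbn [Cpow]. unfold wall_coef, iz.
transitivity (/ (2 * PI) * / den alpha z * (gamma0 * robin_jet gamma0 gamma1 force_jet 0 0 z 0 t + gamma1 * robin_jet gamma0 gamma1 force_jet 1 0 z 0 t)
  + - (Ci / PI) * (z / (den alpha z * (gamma0 + Ci * gamma1 * z))) * dzeta 0%nat t * (gamma0 + Ci * gamma1 * z))%C.
- ring.
- rewrite HB. field. repeat split; cnz.
Qed.

Lemma free_wave_robin : forall z t, P z -> 0 <= t -> (gamma0 * free_wave 0 0 z 0 t + gamma1 * free_wave 1 0 z 0 t)%C = 0%C.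
Proof.
intros z t Hz0 Ht.
assert (HB := robin_jet_robin alpha gamma0 gamma1 K Hg HK init_jet tame_init_jet).
assert (Hd : forall m z x t, P z -> 0 < x -> 0 <= t -> has_deriv (fun y => init_jet 0 m z y t) x (init_jet 1 m z x t)).
{ intros m z1 x r _ Hx _. apply has_deriv_scal, du0_deriv, Hx. }
specialize (HB Hd 0%nat z 0 Hz0 (Rle_refl 0)). unfold free_wave.
transitivity (/ (2 * PI) * (rate z ^ 0 * Cexp (rate z * t)) * (gamma0 * robin_jet gamma0 gamma1 init_jet 0 0 z 0 0 + gamma1 * robin_jet gamma0 gamma1 init_jet 1 0 z 0 0))%C.
- ring.
- rewrite HB. ring.
Qed.

Lemma source_wall_D : forall n z t, P z -> 0 <= t -> Dc (clamp 0 t) (fun r => source n 0 z 0 r).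
Proof.
intros n z t Hz0 Ht. destruct (tame_lipt source tame_source (t + 1) ltac:(lra) n 0) as (M & HM & B).
apply Dc_clamp_lip with M; [exact Ht|]. intros y y' Hy Hy'. apply (B (z, 0)); [split; simpl; [exact Hz0|lra]|lra|lra].
Qed.

Lemma density_robin : forall z t, P z -> 0 <= t ->
  (gamma0 * density 0 0 z 0 t + gamma1 * density 1 0 z 0 t)%C = (- (Ci / PI) * (z / den alpha z) * duh (rate z) (dzeta 0%nat) t)%C.
Proof.
intros z t Hz0 Ht. unfold density. cbn [duht].
assert (X0 := source_wall_D 0 z t Hz0 Ht). assert (X1 := source_wall_D 1 z t Hz0 Ht).
transitivity ((gamma0 * free_wave 0 0 z 0 t + gamma1 * free_wave 1 0 z 0 t) + (gamma0 * duh (rate z) (fun r => source 0 0 z 0 r) t + gamma1 * duh (rate z) (fun r => source 1 0 z 0 r) t))%C; [ring|].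
rewrite (free_wave_robin z t Hz0 Ht), Cplus_0_l. rewrite <- (duh_scal (rate z) _ _ t Ht (zeta_D t Ht)), <- (duh_scal (rate z) _ gamma1 t Ht X1).
rewrite <- (duh_lin (rate z) _ _ gamma0 t Ht X0 (Dc_mult _ _ _ (Dc_const _ gamma1) X1)).
apply duh_ext; [exact Ht|]. intros r Hr. apply source_robin; [exact Hz0|lra].
Qed.

Lemma density_S : forall n z x t, density n 1 z x t = (rate z * density n 0 z x t + source n 0 z x t)%C.
Proof. intros n z x t. unfold density, free_wave. cbn [duht Cpow]. ring. Qed.

Lemma D_kern0 : D (fun z => z / den alpha z)%C.
Proof.
apply Dc_div; [apply Dc_id, HKs|apply (D_den alpha gamma0 gamma1 K); assumption|]. intros r. apply (on_den alpha gamma0 gamma1 K); try assumption. apply Kc_on.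
Qed.

(** The past of the boundary datum does not contribute, by [L_z_den2] under the time integral. *)
Lemma L_wall_memory : forall t, 0 <= t -> D (fun z => z / (den alpha z * den alpha z) * duh (rate z) (dzeta 0%nat) t)%C /\
  L (fun z => z / (den alpha z * den alpha z) * duh (rate z) (dzeta 0%nat) t)%C = 0%C.
Proof.
intros t Ht. destruct (BLF_contour K HKs) as (Lam & HL). fold L in HL. fold P in HL. change (Dc (Kc K)) with D in HL.
destruct (zeta_jets (t + 1) ltac:(lra) 0%nat) as (B0 & T0). destruct (zeta_jets (t + 1) ltac:(lra) 1%nat) as (B1 & _).
destruct (tay_lip P (segR (t + 1)) _ _ B0 B1 T0) as (M & HM & HLp). destruct B0 as (M0 & HM0 & B0).
assert (Dk : D (fun z => z / (den alpha z * den alpha z))%C).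
{ assert (Dd := D_den alpha gamma0 gamma1 K HK). apply Dc_div; [apply Dc_id, HKs|apply Dc_mult; exact Dd|].
  intros r. assert (H1 := on_den alpha gamma0 gamma1 K Ha HK _ (Kc_on K r)). apply Cmult_neq_0; exact H1. }
destruct (Dc_coef K _ Dk) as (Mk & HMk & Bk).
destruct (duh_fubini (fun z r => z / (den alpha z * den alpha z) * dzeta 0%nat r)%C t Ht) as (D1 & E1 & _).
- exists (Mk * M0). split; [apply Rmult_le_pos; assumption|]. intros z y Hz0 Hy. rewrite Cmod_mult. apply Rmult_le_compat; try apply Cmod_ge_0; [apply Bk, Hz0|].
  apply (B0 z); [exact Hz0|lra].
- exists (Mk * M). split; [apply Rmult_le_pos; assumption|]. intros z y y' Hz0 Hy Hy'.
  replace (z / (den alpha z * den alpha z) * dzeta 0%nat y - z / (den alpha z * den alpha z) * dzeta 0%nat y')%C with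
    (z / (den alpha z * den alpha z) * (dzeta 0%nat y - dzeta 0%nat y'))%C by ring.
  rewrite Cmod_mult, Rmult_assoc. apply Rmult_le_compat; try apply Cmod_ge_0; [apply Bk, Hz0|]. apply (HLp z); [exact Hz0|lra|lra].
- intros r _. apply Dc_mult; [exact Dk|apply Dc_const].
- assert (Ex : forall z, P z -> duh (rate z) (fun r => z / (den alpha z * den alpha z) * dzeta 0%nat r)%C t = (z / (den alpha z * den alpha z) * duh (rate z) (dzeta 0%nat) t)%C).
  { intros z _. apply duh_scal; [exact Ht|apply zeta_D, Ht]. }
  split; [exact (blf_D_ext HL _ _ D1 Ex)|]. rewrite <- (blf_ext HL _ _ D1 Ex). rewrite E1.
  rewrite (CRInt_ext _ (fun _ => 0%C)); [rewrite CRInt_const; ring|exact Ht|]. intros r Hr.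
  transitivity (L (fun z => dzeta 0%nat r * (z / (den alpha z * den alpha z) * Cexp (- (omega alpha beta z * (t - r)%R))))%C).
  + unfold L. f_equal. apply functional_extensionality. intros z. replace (rate z * (t - r)%R)%C with (- (omega alpha beta z * (t - r)%R))%C by (unfold rate; ring). ring.
  + assert (DE : D (fun z => z / (den alpha z * den alpha z) * Cexp (- (omega alpha beta z * (t - r)%R)))%C).
    { apply Dc_mult; [exact Dk|]. apply Dc_Cexp, Dc_opp, Dc_mult; [apply (D_omega alpha beta gamma0 gamma1 K); assumption|apply Dc_const]. }
    rewrite (blf_scal _ _ _ _ HL _ _ DE). unfold L. rewrite (L_z_den2 alpha beta gamma0 gamma1 K Ha Hb HK (t - r)) by lra. ring.
Qed.

(** The left side of the boundary condition, with [m] derivatives in time. *)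
Definition wall_op (m : nat) (t : R) : C :=
  (gamma0 * (alpha * sol_jet 0 (S m) tt 0 t + beta * sol_jet 0 m tt 0 t) + gamma1 * (alpha * sol_jet 1 (S m) tt 0 t + beta * sol_jet 1 m tt 0 t))%C.

(** Since [alpha (- b) + beta = 0], the term [e^{-bt} u0] drops out.  On the density, [alpha d/dt + beta] is multiplication by
    [alpha (- omega) + beta = beta / den] plus [alpha] times the source. *)
Lemma wall_0 : forall t, 0 <= t -> wall_op 0 t = dzeta 0%nat t.
Proof.
intros t Ht. destruct (BLF_contour K HKs) as (Lam & HL). fold L in HL. fold P in HL. change (Dc (Kc K)) with D in HL.
assert (Df : forall n m, D (fun z => density n m z 0 t)) by (intros n m; exact (D_density n m 0 t (Rle_refl 0) Ht)).
destruct (L_wall_memory t Ht) as (DM & EM).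
assert (EL : (gamma0 * (alpha * L (fun z => density 0 1 z 0 t) + beta * L (fun z => density 0 0 z 0 t))
   + gamma1 * (alpha * L (fun z => density 1 1 z 0 t) + beta * L (fun z => density 1 0 z 0 t)))%C = dzeta 0%nat t).
{ assert (DS : forall (k l : C) g h, D g -> D h -> D (fun z => k * g z + l * h z)%C).
  { intros k l g h H1 H2. apply (blf_plus_D _ _ _ _ HL); apply (blf_scal_D _ _ _ _ HL); assumption. }
  assert (ES : forall (k l : C) g h, D g -> D h -> L (fun z => k * g z + l * h z)%C = (k * L g + l * L h)%C).
  { intros k l g h H1 H2. rewrite (blf_plus _ _ _ _ HL _ _ (blf_scal_D _ _ _ _ HL k g H1) (blf_scal_D _ _ _ _ HL l h H2)), (blf_scal _ _ _ _ HL k g H1), (blf_scal _ _ _ _ HL l h H2). reflexivity. }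
  rewrite <- (ES alpha beta _ _ (Df 0%nat 1%nat) (Df 0%nat 0%nat)), <- (ES alpha beta _ _ (Df 1%nat 1%nat) (Df 1%nat 0%nat)).
  rewrite <- (ES gamma0 gamma1 _ _ (DS alpha beta _ _ (Df 0%nat 1%nat) (Df 0%nat 0%nat)) (DS alpha beta _ _ (Df 1%nat 1%nat) (Df 1%nat 0%nat))).
  transitivity (L (fun z => (- (Ci / PI) * beta) * (z / (den alpha z * den alpha z) * duh (rate z) (dzeta 0%nat) t) + (- (Ci / PI) * alpha * dzeta 0%nat t) * (z / den alpha z))%C).
  - apply (blf_ext HL).
    + exact (DS gamma0 gamma1 _ _ (DS alpha beta _ _ (Df 0%nat 1%nat) (Df 0%nat 0%nat)) (DS alpha beta _ _ (Df 1%nat 1%nat) (Df 1%nat 0%nat))).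
    + intros z Hz0. rewrite !density_S.
      assert (H1 := on_den alpha gamma0 gamma1 K Ha HK z Hz0).
      transitivity ((alpha * rate z + beta) * (gamma0 * density 0 0 z 0 t + gamma1 * density 1 0 z 0 t) + alpha * (gamma0 * source 0 0 z 0 t + gamma1 * source 1 0 z 0 t))%C; [ring|].
      rewrite (density_robin z t Hz0 Ht), (source_robin z t Hz0 Ht). unfold rate. rewrite omega_den by (try lra; exact H1). field. repeat split; cnz.
  - rewrite (ES _ _ _ _ DM D_kern0), EM. unfold L. rewrite (L_z_den alpha gamma0 gamma1 K Ha HK).
    transitivity (- (Ci * Ci) * dzeta 0%nat t)%C; [field; repeat split; cnz|]. rewrite Ci2. ring. }
unfold wall_op, sol_jet. rewrite <- EL at 1. cbn [Cpow]. unfold b. rewrite RtoC_opp, RtoC_div by lra. field. repeat split; cnz.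
Qed.

Lemma dzeta_deriv : forall m (t : R), 0 < t -> has_deriv (dzeta m) t (dzeta (S m) t).
Proof. intros m t Ht. destruct Hz as (_ & _ & Hd). apply Hd, Ht. Qed.

Lemma wall_jets : forall m t, 0 < t -> wall_op m t = dzeta m t.
Proof.
apply (jets_unique wall_op dzeta).
- intros m t Ht. assert (H := fun n m => tame_has_deriv_t sol_jet tame_sol_jet n m 0 t (Rle_refl 0) Ht).
  unfold wall_op. apply has_deriv_plus; apply has_deriv_scal; apply has_deriv_plus; apply has_deriv_scal; apply H.
- apply dzeta_deriv.
- intros t Ht. apply wall_0. lra.
Qed.

Lemma wall_limit : forall m T, 0 < T ->
  unif_lim_0plus (fun x t => gamma0 * (alpha * sol_jet 0 (S m) tt x t + beta * sol_jet 0 m tt x t) + gamma1 * (alpha * sol_jet 1 (S m) tt x t + beta * sol_jet 1 m tt x t))%C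
    (fun t => 0 < t <= T) (dzeta m).
Proof.
intros m T HT.
destruct (tame_lipx sol_jet tame_sol_jet T HT 0 (S m)) as (M1 & HM1 & B1). destruct (tame_lipx sol_jet tame_sol_jet T HT 0 m) as (M2 & HM2 & B2).
destruct (tame_lipx sol_jet tame_sol_jet T HT 1 (S m)) as (M3 & HM3 & B3). destruct (tame_lipx sol_jet tame_sol_jet T HT 1 m) as (M4 & HM4 & B4).
assert (G0 := Cmod_ge_0 gamma0). assert (G1 := Cmod_ge_0 gamma1).
apply unif_lim_lip with (Cmod gamma0 * (alpha * M1 + beta * M2) + Cmod gamma1 * (alpha * M3 + beta * M4)).
- assert (0 <= alpha * M1 + beta * M2) by nra. assert (0 <= alpha * M3 + beta * M4) by nra. nra.
- intros x t Hx Ht. rewrite <- (wall_jets m t) by lra. unfold wall_op.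
  assert (Hp : parT plain T (tt, t)) by (split; simpl; [exact Logic.I|lra]).
  specialize (B1 (tt, t) x 0 Hp ltac:(lra) ltac:(lra)). specialize (B2 (tt, t) x 0 Hp ltac:(lra) ltac:(lra)).
  specialize (B3 (tt, t) x 0 Hp ltac:(lra) ltac:(lra)). specialize (B4 (tt, t) x 0 Hp ltac:(lra) ltac:(lra)).
  cbn [fst snd] in B1, B2, B3, B4. rewrite Rminus_0_r, Rabs_pos_eq in B1, B2, B3, B4 by lra.
  set (d1 := (sol_jet 0 (S m) tt x t - sol_jet 0 (S m) tt 0 t)%C) in *. set (d2 := (sol_jet 0 m tt x t - sol_jet 0 m tt 0 t)%C) in *.
  set (d3 := (sol_jet 1 (S m) tt x t - sol_jet 1 (S m) tt 0 t)%C) in *. set (d4 := (sol_jet 1 m tt x t - sol_jet 1 m tt 0 t)%C) in *.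
  match goal with |- Cmod ?X <= _ => replace X with (gamma0 * (alpha * d1 + beta * d2) + gamma1 * (alpha * d3 + beta * d4))%C by (unfold d1, d2, d3, d4; ring) end.
  assert (Hab : forall (p q : C) Mp Mq, Cmod p <= Mp * x -> Cmod q <= Mq * x -> Cmod (alpha * p + beta * q)%C <= (alpha * Mp + beta * Mq) * x).
  { intros p q Mp Mq Hp' Hq. eapply Rle_trans; [apply Cmod_triangle|]. rewrite !Cmod_mult, !Cmod_R, !Rabs_pos_eq by lra. nra. }
  eapply Rle_trans; [apply Cmod_triangle|]. rewrite !Cmod_mult, Rmult_plus_distr_r, !Rmult_assoc. apply Rplus_le_compat; apply Rmult_le_compat_l; try assumption; apply Hab; assumption.
Qed.
End Sol.

Theorem theorem2 :
  forall (alpha beta : R) (gamma0 gamma1 : C)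
    (u0 : R -> C) (du0 : nat -> R -> C)
    (zeta : R -> C) (dzeta : nat -> R -> C)
    (f : R -> R -> C) (df : nat -> nat -> R -> R -> C)
    (K : R -> C),
  0 < alpha -> 0 < beta ->
  (gamma0 * sqrt alpha)%C <> gamma1 ->
  Schwartz_halfline u0 du0 ->
  derivs1 pos nonneg zeta dzeta ->
  derivs2 open_quadrant closed_quadrant f df ->
  (forall T : R, 0 < T -> forall n m l : nat, exists M : R,
     forall x t, 0 < x -> 0 <= t <= T -> x ^ l * Cmod (df n m x t) <= M) ->
  admissible_contour alpha gamma0 gamma1 K ->
  exists du : nat -> nat -> R -> R -> C,
    derivs2 open_quadrant open_quadrant
      (sol alpha beta gamma0 gamma1 u0 zeta f K) du /\
    (forall n m : nat, exists U : R -> C,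
       unif_lim_0plus (fun t x => du n m x t) pos U /\ smooth_on_pos U) /\
    (forall n m : nat, exists H : R -> C,
       (forall T : R, 0 < T ->
          unif_lim_0plus (fun x t => du n m x t) (fun t => 0 < t <= T) H) /\
       smooth_on_pos H) /\
    (forall n : nat, unif_lim_0plus (fun t x => du n 0%nat x t) pos (du0 n)) /\
    (forall (m : nat) (T : R), 0 < T ->
       unif_lim_0plus
         (fun x t =>
            (gamma0 * (alpha * du 0%nat (S m) x t + beta * du 0%nat m x t)
             + gamma1 * (alpha * du 1%nat (S m) x t + beta * du 1%nat m x t))%C)
         (fun t => 0 < t <= T) (dzeta m)).
Proof.
intros alpha beta gamma0 gamma1 u0 du0 zeta dzeta f df K Ha Hb Hg Hu Hz Hf Hfb HK.
assert (HT := tame_sol_jet alpha beta gamma0 gamma1 u0 du0 zeta dzeta f df K Ha Hg Hu Hz Hf Hfb HK).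
set (G := sol_jet alpha beta gamma0 gamma1 du0 dzeta df K) in HT.
exists (fun n m x t => G n m tt x t). split; [|split; [|split; [|split]]].
- apply (tame_derivs2 G HT). intros x t Hx Ht. symmetry. apply sol_is_jet; try assumption. lra.
- intros n m. exists (fun x => G n m tt x 0). split; [exact (tame_lim_t G HT n m)|exact (tame_smooth_x G HT n m)].
- intros n m. exists (fun t => G n m tt 0 t). split; [exact (tame_lim_x G HT n m)|exact (tame_smooth_t G HT n m)].
- intros n eps. destruct (tame_lim_t G HT n 0 eps) as (d & Hd). exists d. intros s Hs1 Hs2 x Hx.
  rewrite <- (sol_jet_initial_jets alpha beta gamma0 gamma1 u0 du0 zeta dzeta f df K Ha Hg Hu Hz Hf Hfb HK n x Hx).
  apply (Hd s Hs1 Hs2 x Hx).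
- intros m T HT0. apply (wall_limit alpha beta gamma0 gamma1 u0 du0 zeta dzeta f df K Ha Hb Hg Hu Hz Hf Hfb HK m T HT0).
Qed.
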